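(* Let $(M,\phi_\alpha,\xi_\alpha,\eta_\alpha,g)$, $\alpha\in\{1,2,3\}$, be a $3$-quasi-Sasakian manifold of dimension $4n+3$ and rank $4l+3$, with $[\xi_\alpha,\xi_\beta]=c\,\xi_\gamma$ for every even permutation $(\alpha,\beta,\gamma)$ of $\{1,2,3\}$. Then the following statements are equivalent: (i) each structure tensor $\phi_\alpha$ is projectable with respect to the foliation $\mathcal{V}$; (ii) for all $\alpha\in\{1,2,3\}$, $d\eta_\alpha=0$ on $\mathcal{H}$; (iii) the horizontal subbundle $\mathcal{H}$ is integrable; (iv) $M$ is locally a Riemannian product of a hyper-K\''ahler manifold and the $3$-dimensional sphere of constant curvature $\frac{c^2}{4}$; (v) $M$ is a $3$-quasi-Sasakian manifold of rank $3$. Furthermore, if one of these conditions holds, then the Ricci tensor of $M$ is given by $$\mathrm{Ric}=\frac{c^2}{2}\left(\eta_1\otimes\eta_1+\eta_2\otimes\eta_2+\eta_3\otimes\eta_3\right),$$ hence $M$ is $\eta$-Einstein.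
   Context: Conventions: for a $1$-form $\eta$, $2d\eta(X,Y)=X(\eta(Y))-Y(\eta(X))-\eta([X,Y])$. An almost contact metric structure $(\phi,\xi,\eta,g)$ consists of a $(1,1)$-tensor $\phi$, a vector field $\xi$, a $1$-form $\eta$ and a Riemannian metric $g$ with $\phi^2=-I+\eta\otimes\xi$, $\eta(\xi)=1$, $g(\phi X,\phi Y)=g(X,Y)-\eta(X)\eta(Y)$. Its fundamental $2$-form is $\Phi(X,Y)=g(X,\phi Y)$. It is normal if $[\phi,\phi]+2d\eta\otimes\xi=0$ ($[\phi,\phi]$ the Nijenhuis torsion), and quasi-Sasakian if it is normal and $d\Phi=0$. A quasi-Sasakian structure has rank $2p+1$ if $\eta\wedge(d\eta)^p\neq0$ and $(d\eta)^{p+1}=0$ on $M$; only structures of constant rank are considered. A $3$-quasi-Sasakian manifold is a $(4n+3)$-dimensional manifold with three quasi-Sasakian structures $(\phi_\alpha,\xi_\alpha,\eta_\alpha,g)$, $\alpha=1,2,3$, with the same metric $g$, such that for every even permutation $(\alpha,\beta,\gamma)$ of $\{1,2,3\}$: $\phi_\gamma=\phi_\alpha\phi_\beta-\eta_\beta\otimes\xi_\alpha=-\phi_\beta\phi_\alpha+\eta_\alpha\otimes\xi_\beta$, $\xi_\gamma=\phi_\alpha\xi_\beta=-\phi_\beta\xi_\alpha$, $\eta_\gamma=\eta_\alpha\circ\phi_\beta=-\eta_\beta\circ\phi_\alpha$. It is known that there is $c\in\mathbb{R}$ with $[\xi_\alpha,\xi_\beta]=c\,\xi_\gamma$ for every even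 permutation, and that $\eta_1,\eta_2,\eta_3$ have the same rank, called the rank of $M$; it is $4l+1$ if $c=0$ and $4l+3$ if $c\ne0$, for some $0\le l\le n$. $\mathcal{V}=\langle\xi_1,\xi_2,\xi_3\rangle$ is the vertical distribution, which is integrable and defines a Riemannian, totally geodesic foliation, and $\mathcal{H}=\bigcap_{\alpha=1}^3\ker\eta_\alpha=\mathcal{V}^\perp$ is the horizontal distribution; each $\xi_\beta$ satisfies $[\xi_\beta,\Gamma(\mathcal{H})]\subset\Gamma(\mathcal{H})$. The tensor $\phi_\alpha$ is projectable with respect to $\mathcal{V}$ if its restriction to $\mathcal{H}$ descends to the local leaf spaces of $\mathcal{V}$, i.e. $(\mathcal{L}_{\xi_\beta}\phi_\alpha)X=0$ for all $X\in\Gamma(\mathcal{H})$ and $\beta\in\{1,2,3\}$. $M$ is $\eta$-Einstein if $\mathrm{Ric}=a\,g+b\sum_{\alpha=1}^3\eta_\alpha\otimes\eta_\alpha$ for some functions $a,b$. *)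

(* Defs.v *)
From HB Require Import structures.
From mathcomp Require Import all_boot all_order all_algebra all_fingroup.
From mathcomp Require Import all_classical all_reals topology normedtype derive.

Set Implicit Arguments.
Unset Strict Implicit.
Unset Printing Implicit Defensive.

Import Order.TTheory GRing.Theory Num.Theory.
Import numFieldNormedType.Exports.

Local Open Scope classical_set_scope.
Local Open Scope ring_scope.

(** * Smooth maps between normed spaces *)

Section smooth_normed.
Context {R : realType} {V W : normedModType R}.

(* For finite-dimensional V and open U, this is the usual C^k: all iterated
   directional derivatives up to order k exist and are continuous on U. *)
Fixpoint Ck (k : nat) (U : set V) (f : V -> W) : Prop :=
  (forall x, U x -> {for x, continuous f}) /\
  match k with
  | 0 => True
  | k'.+1 => forall v : V,
      (forall x, U x -> derivable f x v) /\ Ck k' U (fun x => 'D_v f x)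
  end.

Definition smooth_on (U : set V) (f : V -> W) : Prop := forall k, Ck k U f.

End smooth_normed.

(** * Smooth manifolds *)

(* A homeomorphism from the open set [chart_dom] onto an open subset of R^m.
   Values of [chart_fun] outside [chart_dom], and of [chart_inv] outside the
   image of [chart_dom], are irrelevant. *)
Record chart (R : realType) (T : topologicalType) (m : nat) := Chart {
  chart_dom : set T;
  chart_fun :> T -> 'cV[R]_m;
  chart_inv : 'cV[R]_m -> T;
  chart_dom_open : open chart_dom;
  chart_img_open : open (chart_fun @` chart_dom);
  chart_funK : forall x, chart_dom x -> chart_inv (chart_fun x) = x;
  chart_fun_continuous : forall x, chart_dom x -> {for x, continuous chart_fun};
  chart_inv_continuous : forall y, (chart_fun @` chart_dom) y ->
    {for y, continuous chart_inv} }.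

Record manifold (R : realType) (m : nat) := Manifold {
  points :> topologicalType;
  atlas : set (chart R points m);
  manifold_hausdorff : hausdorff_space points;
  manifold_second_countable : @second_countable points;
  atlas_cover : forall p : points, exists c, atlas c /\ chart_dom c p;
  atlas_compatible : forall c d, atlas c -> atlas d ->
    smooth_on (c @` (chart_dom c `&` chart_dom d)) (d \o chart_inv c) }.

Definition chart_at (R : realType) (m : nat) (M : manifold R m) (p : M) :
  chart R M m := sval (cid (atlas_cover p)).

(* The tangent space at p is R^m, a vector being identified with its components
   in the chart [chart_at p]; hence vector fields, endomorphism fields, 1-forms
   and metrics are families of columns, square matrices, rows and Gram
   matrices. All operations below refer to these components. *)
Definition vfield (R : realType) (m : nat) (M : manifold R m) :=
  M -> 'cV[R]_m.
Definition endofield (R : realType) (m : nat) (M : manifold R m) :=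
  M -> 'M[R]_m.
Definition oneform (R : realType) (m : nat) (M : manifold R m) :=
  M -> 'rV[R]_m.
Definition metric (R : realType) (m : nat) (M : manifold R m) :=
  M -> 'M[R]_m.

Section calculus.
Context {R : realType} {m : nat} {M : manifold R m}.
Implicit Types (X Y Z : vfield M) (p q : M) (f : M -> R^o).

Definition smooth_fun {W : normedModType R} (U : set M) (f : M -> W) : Prop :=
  forall c, atlas c ->
    smooth_on (c @` (chart_dom c `&` U)) (f \o chart_inv c).

Definition dfun {W : normedModType R} (f : M -> W) p (v : 'cV[R]_m) : W :=
  'd (f \o chart_inv (chart_at p)) (chart_at p p) v.

Definition smooth_map {k : nat} {N : manifold R k} (U : set M) (F : M -> N) :
  Prop :=
  (forall p, U p -> {for p, continuous F}) /\
  forall d : chart R N k, atlas d ->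
    smooth_fun (U `&` F @^-1` chart_dom d) (d \o F).

Definition tangent_map {k : nat} {N : manifold R k} (F : M -> N) p
  (v : 'cV[R]_m) : 'cV[R]_k := dfun (chart_at (F p) \o F) p v.

(* components of X in the chart c, at points of [chart_dom c] *)
Definition components (c : chart R M m) X : M -> 'cV[R]_m :=
  fun q => dfun c q (X q).

(* the i-th coordinate vector field of c, at points of [chart_dom c] *)
Definition coord_field (c : chart R M m) (i : 'I_m) : vfield M :=
  fun q => 'd (chart_at q \o chart_inv c) (c q) (delta_mx i 0 : 'cV[R]_m).

Definition smooth_vfield X : Prop :=
  forall c, atlas c -> smooth_fun (chart_dom c) (components c X).

Definition deriv X f : M -> R^o := fun p => dfun f p (X p).

Definition bracket X Y : vfield M := fun p =>
  let c := chart_at p in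
  dfun (components c Y) p (X p) - dfun (components c X) p (Y p).

Definition app1 (eta : oneform M) X : M -> R^o :=
  fun p => (eta p *m X p) 0 0.
Definition appE (phi : endofield M) X : vfield M := fun p => phi p *m X p.
Definition inner (g : metric M) X Y : M -> R^o :=
  fun p => ((X p)^T *m g p *m Y p) 0 0.

Definition smooth_oneform (eta : oneform M) : Prop :=
  forall X, smooth_vfield X -> smooth_fun setT (app1 eta X).

Definition smooth_endofield (phi : endofield M) : Prop :=
  forall X, smooth_vfield X -> smooth_vfield (appE phi X).

Record riemannian (g : metric M) : Prop := Riemannian {
  metric_smooth : forall X Y, smooth_vfield X -> smooth_vfield Y ->
    smooth_fun setT (inner g X Y);
  metric_sym : forall p, (g p)^T = g p;
  metric_pos : forall p (v : 'cV[R]_m), v != 0 -> 0 < (v^T *m g p *m v) 0 0 }.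

(** ** Differential forms *)

Definition form (k : nat) := ('I_k -> vfield M) -> M -> R.

(* The normalisation 1/(k+l)! is the one that matches the factors 1/2 and 1/3
   in the exterior derivatives [d1] and [d2]. *)
Definition wedge k l (a : form k) (b : form l) : form (k + l)%N := fun Xs p =>
  ((k + l)`!%:R)^-1 *
  \sum_(s : 'S_(k + l)) (-1) ^+ s *
    (a (fun i => Xs (s (lshift l i))) p * b (fun j => Xs (s (rshift k j))) p).

Unset Implicit Arguments.
Fixpoint wedge_pow (a : form 2) (p : nat) : form (p * 2)%N :=
  match p with
  | 0 => fun _ _ => 1
  | p'.+1 => wedge a (wedge_pow a p')
  end.
Set Implicit Arguments.

Definition d1 (eta : oneform M) X Y : M -> R := fun p =>
  2^-1 * (deriv X (app1 eta Y) p - deriv Y (app1 eta X) p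
          - app1 eta (bracket X Y) p).

Definition d2 (w : vfield M -> vfield M -> M -> R^o) X Y Z : M -> R := fun p =>
  3^-1 * (deriv X (w Y Z) p + deriv Y (w Z X) p + deriv Z (w X Y) p
          - w (bracket X Y) Z p - w (bracket Y Z) X p - w (bracket Z X) Y p).

Definition form1 (eta : oneform M) : form 1 := fun Xs => app1 eta (Xs ord0).
Definition form_d1 (eta : oneform M) : form 2 :=
  fun Xs => d1 eta (Xs ord0) (Xs ord_max).

(* A k-form nowhere vanishing, resp. identically zero, on M. *)
Definition form_neq0 k (a : form k) : Prop := forall p,
  exists Xs : 'I_k -> vfield M, (forall i, smooth_vfield (Xs i)) /\ a Xs p != 0.
Definition form_eq0 k (a : form k) : Prop :=
  forall Xs : 'I_k -> vfield M, (forall i, smooth_vfield (Xs i)) ->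
  forall p, a Xs p = 0.

(** ** Levi-Civita connection and Ricci tensor *)

(* Koszul formula: this is 2 g(nabla_X Y, Z). *)
Definition koszul (g : metric M) X Y Z : M -> R := fun p =>
  deriv X (inner g Y Z) p + deriv Y (inner g X Z) p - deriv Z (inner g X Y) p
  + inner g (bracket X Y) Z p - inner g (bracket X Z) Y p
  - inner g (bracket Y Z) X p.

(* At p, the coordinate fields of [chart_at p] are the canonical basis, so that
   g(nabla_X Y, d_i) determines nabla_X Y through the inverse Gram matrix. *)
Definition levi_civita (g : metric M) X Y : vfield M := fun p =>
  invmx (g p) *m
    \col_i (2^-1 * koszul g X Y (coord_field (chart_at p) i) p).

Definition curvature (g : metric M) X Y Z : vfield M := fun p =>
  levi_civita g X (levi_civita g Y Z) p
  - levi_civita g Y (levi_civita g X Z) p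
  - levi_civita g (bracket X Y) Z p.

(* Ric(Y, Z) is the trace of X |-> R(X, Y)Z. *)
Definition ricci (g : metric M) Y Z : M -> R := fun p =>
  \sum_i curvature g (coord_field (chart_at p) i) Y Z p i 0.

End calculus.

(** ** Distributions *)

(* Integrability in the sense of integral manifolds: through each point passes
   an immersed k-dimensional submanifold whose tangent spaces are the D p. *)
Definition integrable_distribution {R : realType} {m : nat} {M : manifold R m}
    (k : nat) (D : M -> set 'cV[R]_m) : Prop :=
  forall p, exists (N : manifold R k) (iota : N -> M),
  [/\ smooth_map setT iota, injective iota,
      forall q, injective (tangent_map iota q),
      (exists q, iota q = p) &
      forall q, D (iota q) = [set tangent_map iota q w | w in setT]].

(** ** Nijenhuis torsion *)

Section structures.
Context {R : realType} {m : nat} {M : manifold R m}.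
Implicit Types (X Y Z : vfield M).

Definition nijenhuis (phi : endofield M) X Y : vfield M := fun p =>
  appE phi (appE phi (bracket X Y)) p + bracket (appE phi X) (appE phi Y) p
  - appE phi (bracket (appE phi X) Y) p - appE phi (bracket X (appE phi Y)) p.

Definition fundamental_form (g : metric M) (phi : endofield M) X Y : M -> R^o :=
  inner g X (appE phi Y).

Definition fundamental_form_closed (g : metric M) (phi : endofield M) : Prop :=
  forall X Y Z, smooth_vfield X -> smooth_vfield Y -> smooth_vfield Z ->
  forall p, d2 (fundamental_form g phi) X Y Z p = 0.

(** * Quasi-Sasakian structures *)

Record almost_contact_metric (phi : endofield M) (xi : vfield M)
    (eta : oneform M) (g : metric M) : Prop := AlmostContactMetric {
  acm_phi_smooth : smooth_endofield phi;
  acm_xi_smooth : smooth_vfield xi;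
  acm_eta_smooth : smooth_oneform eta;
  acm_riemannian : riemannian g;
  acm_phi2 : forall p, phi p *m phi p = - 1%:M + xi p *m eta p;
  acm_eta_xi : forall p, eta p *m xi p = 1%:M;
  acm_metric : forall p, (phi p)^T *m g p *m phi p = g p - (eta p)^T *m eta p }.

Definition normal_structure (phi : endofield M) (xi : vfield M)
    (eta : oneform M) : Prop :=
  forall X Y, smooth_vfield X -> smooth_vfield Y ->
  forall p, nijenhuis phi X Y p + (2 * d1 eta X Y p) *: xi p = 0.

Record quasi_Sasakian (phi : endofield M) (xi : vfield M)
    (eta : oneform M) (g : metric M) : Prop := QuasiSasakian {
  qs_acm : almost_contact_metric phi xi eta g;
  qs_normal : normal_structure phi xi eta;
  qs_closed : fundamental_form_closed g phi }.

Definition qs_rank (eta : oneform M) (r : nat) : Prop :=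
  exists p : nat, [/\ r = p.*2.+1,
    form_neq0 (wedge (form1 eta) (wedge_pow (form_d1 eta) p)) &
    form_eq0 (wedge_pow (form_d1 eta) p.+1)].

Definition even_triple (a b c : 'I_3) : Prop :=
  exists2 s : 'S_3, ~~ odd_perm s & [/\ a = s 0, b = s 1 & c = s 2].

End structures.

(** * Three-quasi-Sasakian manifolds *)

Section three_structures.
Context {R : realType} {m : nat} {M : manifold R m}.
Variables (phi : 'I_3 -> endofield M) (xi : 'I_3 -> vfield M)
  (eta : 'I_3 -> oneform M) (g : metric M).

Record three_quasi_Sasakian : Prop := ThreeQuasiSasakian {
  tqs_dim : exists n, m = (4 * n + 3)%N;
  tqs_qs : forall a, quasi_Sasakian (phi a) (xi a) (eta a) g;
  tqs_phi : forall a b c, even_triple a b c -> forall p,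
    phi c p = phi a p *m phi b p - xi a p *m eta b p /\
    phi c p = - (phi b p *m phi a p) + xi b p *m eta a p;
  tqs_xi : forall a b c, even_triple a b c -> forall p,
    xi c p = phi a p *m xi b p /\ xi c p = - (phi b p *m xi a p);
  tqs_eta : forall a b c, even_triple a b c -> forall p,
    eta c p = eta a p *m phi b p /\ eta c p = - (eta b p *m phi a p) }.

Definition three_quasi_Sasakian_of_rank (r : nat) : Prop :=
  three_quasi_Sasakian /\ forall a, qs_rank (eta a) r.

Definition horizontal_space (p : M) : set 'cV[R]_m :=
  [set v | forall a, eta a p *m v = 0].

Definition horizontal_field (X : vfield M) : Prop :=
  smooth_vfield X /\ forall p, horizontal_space p (X p).

(* Lie derivative: (L_xi phi) X = [xi, phi X] - phi [xi, X]. *)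
Definition projectable (a : 'I_3) : Prop :=
  forall (b : 'I_3) (X : vfield M), horizontal_field X -> forall p,
  bracket (xi b) (appE (phi a) X) p - appE (phi a) (bracket (xi b) X) p = 0.

Definition eta_Einstein : Prop :=
  exists a b : M -> R^o, [/\ smooth_fun setT a, smooth_fun setT b &
  forall X Y, smooth_vfield X -> smooth_vfield Y -> forall p,
  ricci g X Y p = a p * inner g X Y p
    + b p * \sum_(i < 3) app1 (eta i) X p * app1 (eta i) Y p].

End three_structures.

(** * Hyper-Kähler manifolds and local Riemannian products *)

(* Three Kähler structures (integrable almost complex structures, Hermitian
   with respect to g, with closed fundamental form) satisfying the quaternionic
   relations. *)
Record hyperKahler {R : realType} {m : nat} {K : manifold R m}
    (g : metric K) (J : 'I_3 -> endofield K) : Prop := HyperKahler {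
  hk_riemannian : riemannian g;
  hk_smooth : forall a, smooth_endofield (J a);
  hk_square : forall a p, J a p *m J a p = - 1%:M;
  hk_hermitian : forall a p, (J a p)^T *m g p *m J a p = g p;
  hk_quaternion : forall a b c, even_triple a b c -> forall p,
    J c p = J a p *m J b p /\ J c p = - (J b p *m J a p);
  hk_integrable : forall a X Y, smooth_vfield X -> smooth_vfield Y ->
    forall p, nijenhuis (J a) X Y p = 0;
  hk_closed : forall a, fundamental_form_closed g (J a) }.

(* The 3-sphere of constant curvature kappa > 0, i.e. of radius
   kappa^(-1/2), with the metric induced by R^4. *)
Definition sphere3 {R : realType} (kappa : R) : set 'cV[R]_4 :=
  [set y | kappa * \sum_i y i 0 ^+ 2 = 1].

(* Every point has a neighbourhood U isometric to a product A x B, with A open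
   in a hyper-Kähler manifold K and B open in the sphere. The isometry (F1, F2)
   is a bijective smooth map whose differentials are linear isometries; its
   second component is viewed as a map into R^4. *)
Definition locally_hyperKahler_times_sphere {R : realType} {m : nat}
    {M : manifold R m} (g : metric M) (k : nat) (kappa : R) : Prop :=
  forall p : M, exists (U : set M) (K : manifold R k) (gK : metric K)
    (J : 'I_3 -> endofield K) (A : set K) (O : set 'cV[R]_4)
    (F1 : M -> K) (F2 : M -> 'cV[R]_4),
  [/\ open U /\ U p, hyperKahler gK J, open A /\ open O,
      [/\ smooth_map U F1, smooth_fun U F2 &
          set_bij U (A `*` (sphere3 kappa `&` O)) (fun q => (F1 q, F2 q))] &
      forall q, U q -> forall u v : 'cV[R]_m,
        (u^T *m g q *m v) 0 0 =
        ((tangent_map F1 q u)^T *m gK (F1 q) *m tangent_map F1 q v) 0 0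
        + ((dfun F2 q u)^T *m dfun F2 q v) 0 0].

(* Main.v *)
(* In a chart all tensors become matrix-valued functions, and everything except
   (iii) and (iv) is a computation there. Let (a, b, e) be an even permutation.
   (i) <=> (ii): L_(xi_a) phi_a = 0, and since d Phi_a = 0 Cartan's formula gives
   g (L_(xi_b) phi_a) = -2 d eta_e.
   (v) => (ii): on H write 2 d eta_a = g A; then A anticommutes with some phi, so
   evaluating d eta_a ^ d eta_a = 0 on (u, A u, phi u, phi A u) yields |A u|^4 = 0.
   (ii) => (v): under (ii), 2 d eta_a = -c (eta_b eta_e - eta_e eta_b), and the rank
   hypothesis forces c <> 0.
   (ii) => (iii): H has a local frame of commuting fields, whose time-one flow from
   a point parametrises the integral leaf. (iii) => (ii): pull eta_a back to a leaf.
   (ii) => (iv): flowing along commuting vertical fields onto a transversal slice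
   gives F1; g - sum eta_a^2 and Phi_a - (2/c) d eta_a are basic, the latter is closed,
   and they induce the hyper-Kähler structure of the slice. F2 solves the integrable
   system dF = (c/2) sum_a eta_a (F q_a) in the quaternions, with q_a = i, j, k.
   (iv) => (ii): the second fundamental form of the isometry (F1, F2) and the
   Ricci-flatness of hyper-Kähler metrics give Ric(v, v) = (c^2/2) |dF2 v|^2, which is
   at most c^2/2 for v = xi_a, whereas Bochner's identity for the Killing field xi_a
   gives c^2/2 plus a positive multiple of |d eta_a restricted to H|^2. Hence (ii),
   and then dF2^T dF2 = sum eta_a^2, which is the formula for the Ricci tensor. *)
From HB Require Import structures.
Require Import Defs.
From mathcomp Require Import all_boot all_order all_algebra all_fingroup.
From mathcomp Require Import all_classical all_reals topology normedtype derive.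
From mathcomp Require Import sequences realfun exp.
From mathcomp Require Import measure lebesgue_measure lebesgue_integral ftc.
From mathcomp Require Import landau ring lra.

Set Implicit Arguments.
Unset Strict Implicit.
Unset Printing Implicit Defensive.

Import Order.TTheory GRing.Theory Num.Theory.
Import numFieldNormedType.Exports.

Local Open Scope classical_set_scope.
Local Open Scope ring_scope.

(** * Differential calculus of smooth maps *)

Section ck_basic.
Context {R : realType} {V W : normedModType R}.
Implicit Types (U : set V) (f g : V -> W).

Lemma Ck_cont k U f x : Ck k U f -> U x -> {for x, continuous f}.
Proof. by case: k => [|k] [cf _] /cf. Qed.

Lemma CkS k U f : Ck k.+1 U f -> Ck k U f.
Proof.
elim: k f => [|k IH] f [cf df]; split=> // v.
by have [dv Cv] := df v; split=> //; exact: IH.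
Qed.

Lemma CkW k k' U f : (k' <= k)%N -> Ck k U f -> Ck k' U f.
Proof.
by move=> /subnKC <-; elim: (k - k')%N => [|j IH]; rewrite ?addn0// addnS => /CkS.
Qed.

Lemma Ck_sub k U U' f : U' `<=` U -> Ck k U f -> Ck k U' f.
Proof.
move=> sU; elim: k f => [|k IH] f [cf df]; first by split=> // x /sU /cf.
split=> [x /sU /cf//|v].
by have [dv Cv] := df v; split=> [x /sU /dv//|]; exact: IH.
Qed.

Lemma Ck_loc k U f :
  (forall x, U x -> exists B, [/\ open B, B x & Ck k B f]) -> Ck k U f.
Proof.
elim: k f => [|k IH] f loc.
  by split=> // x /loc [B [_ Bx [cf _]]]; exact: cf.
split=> [x /loc [B [_ Bx [cf _]]]|v]; first exact: cf.
split=> [x /loc [B [_ Bx [_ /(_ v) [dv _]]]]|]; first exact: dv.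
by apply: IH => x /loc [B [oB Bx [_ /(_ v) [_ ?]]]]; exists B.
Qed.

Lemma Ck_eq k U f g : open U -> (forall x, U x -> f x = g x) ->
  Ck k U f -> Ck k U g.
Proof.
move=> oU; elim: k f g => [|k IH] f g fg [cf df].
  split=> // x Ux; have nfg : {near x, f =1 g}.
    by near=> y; apply: fg; near: y; apply: open_nbhs_nbhs.
  rewrite /prop_for /continuous_at -(fg _ Ux).
  exact: cvg_trans (near_eq_cvg nfg) (cf x Ux).
have nfg x : U x -> {near x, f =1 g}.
  by move=> Ux; near=> y; apply: fg; near: y; apply: open_nbhs_nbhs.
split=> [x Ux|v].
  rewrite /prop_for /continuous_at -(fg _ Ux).
  exact: cvg_trans (near_eq_cvg (nfg x Ux)) (cf x Ux).
have [dv Cv] := df v; split=> [x Ux|].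
  exact: near_eq_derivable (nfg x Ux) (dv x Ux).
apply: IH Cv => x Ux; apply: near_eq_derive; exact: nfg.
Unshelve. all: by end_near. Qed.

Lemma Ck_cst k U (a : W) : Ck k U (fun=> a).
Proof.
elim: k a => [|k IH] a; first by split=> // x _; exact: cvg_cst.
split=> [x _|v]; first exact: cvg_cst.
split=> [x _|]; first exact: derivable_cst.
have -> : 'D_v (fun=> a) = (fun=> 0) :> (V -> W) by apply/funext => x; exact: (derive_cst a).
exact: IH.
Qed.

Lemma CkD k U f g : open U ->
  Ck k U f -> Ck k U g -> Ck k U (fun x => f x + g x).
Proof.
move=> oU; elim: k f g => [|k IH] f g [cf df] [cg dg].
  by split=> // x Ux; exact: cvgD (cf x Ux) (cg x Ux).
split=> [x Ux|v]; first exact: cvgD (cf x Ux) (cg x Ux).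
have [dv Cv] := df v; have [dv' Cv'] := dg v.
split=> [x Ux|]; first exact: derivableD (dv x Ux) (dv' x Ux).
apply: Ck_eq oU _ (IH _ _ Cv Cv') => x Ux.
by rewrite (deriveD (dv x Ux) (dv' x Ux)).
Qed.

Lemma CkZ k U (a : R) f : open U -> Ck k U f -> Ck k U (fun x => a *: f x).
Proof.
move=> oU; elim: k f => [|k IH] f [cf df].
  by split=> // x Ux; apply: cvgZr; exact: cf.
split=> [x Ux|v]; first by apply: cvgZr; exact: cf.
have [dv Cv] := df v; split=> [x Ux|]; first exact: derivableZ (dv x Ux).
apply: Ck_eq oU _ (IH _ Cv) => x Ux.
by rewrite (deriveZ a (dv x Ux)).
Qed.

End ck_basic.

Section ck_real.
Context {R : realType} {V : normedModType R}.
Implicit Types (U : set V) (f g : V -> R^o).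

Lemma CkM k U f g : open U ->
  Ck k U f -> Ck k U g -> Ck k U (fun x => f x * g x : R^o).
Proof.
move=> oU; elim: k f g => [|k IH] f g Hf Hg.
  by split=> // x Ux; apply: cvgM; [exact: (Ck_cont Hf)|exact: (Ck_cont Hg)].
have [cf df] := Hf; have [cg dg] := Hg.
split=> [x Ux|v]; first exact: cvgM (cf x Ux) (cg x Ux).
have [dv Cv] := df v; have [dv' Cv'] := dg v.
split=> [x Ux|]; first exact: derivableM (dv x Ux) (dv' x Ux).
apply: Ck_eq oU _ (CkD oU (IH _ _ (CkS Hf) Cv') (IH _ _ (CkS Hg) Cv)) => x Ux.
by have := (deriveM (dv x Ux) (dv' x Ux)); rewrite /GRing.scale /= => <-.
Qed.

Lemma CkV k U f : open U -> (forall x, U x -> f x != 0) ->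
  Ck k U f -> Ck k U (fun x => (f x)^-1 : R^o).
Proof.
move=> oU f0; elim: k => [|k IH] Hf.
  by split=> // x Ux; apply: cvgV; [exact: f0|exact: (Ck_cont Hf)].
have [cf df] := Hf; have Ci := IH (CkS Hf).
split=> [x Ux|v]; first by apply: cvgV; [exact: f0|exact: cf].
have [dv Cv] := df v.
split=> [x Ux|]; first exact: derivableV (f0 x Ux) (dv x Ux).
apply: Ck_eq oU _ (CkM oU (CkZ (-1) oU (CkM oU Ci Ci)) Cv) => x Ux.
have := (deriveV (f0 x Ux) (dv x Ux)); rewrite /GRing.scale /= => ->.
by rewrite expr2 mulN1r invfM.
Qed.

End ck_real.

Section ck_mx.
Context {R : realType} {V : normedModType R}.
Implicit Types (U : set V).

Lemma continuous_mxP m n (A : V -> 'M[R]_(m, n)) x :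
  {for x, continuous A} <-> forall i j, {for x, continuous (fun y => A y i j : R^o)}.
Proof.
split=> [cA i j|cA]; first exact: continuous_comp cA (@coord_continuous _ _ _ i j _).
apply/cvgrPdist_le => e e0; near=> y.
rewrite /Num.Def.normr/= mx_normrE (bigmax_le _ (ltW e0))//= => i _.
rewrite !mxE/=.
move: i; near: y; apply: filter_forall => /= i.
exact: ((cvgrPdist_le _ _).1 (cA i.1 i.2)).
Unshelve. all: by end_near. Qed.

Lemma Ck_mx k U m n (A : V -> 'M[R]_(m, n)) : open U ->
  Ck k U A <-> forall i j, Ck k U (fun y => A y i j : R^o).
Proof.
move=> oU; elim: k A => [|k IH] A; split.
- by case=> cA _ i j; split=> // x Ux; have /continuous_mxP := cA x Ux; exact.
- by move=> H; split=> // x Ux; apply/continuous_mxP => i j; have [+ _] := H i j; exact.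
- case=> cA dA i j; split=> [x Ux|v]; first by have /continuous_mxP := cA x Ux; exact.
  have [dv /IH Cv] := dA v; split=> [x Ux|]; first by have /derivable_mxP := dv x Ux; exact.
  by apply: Ck_eq oU _ (Cv i j) => x Ux; rewrite derive_mx ?mxE//; exact: dv.
- move=> H; split=> [x Ux|v].
    by apply/continuous_mxP => i j; have [+ _] := H i j; exact.
  have dA x : U x -> derivable A x v.
    by move=> Ux; apply/derivable_mxP => i j; have [_ /(_ v)[+ _]] := H i j; exact.
  split=> //; apply/IH => i j; have [_ /(_ v)[_ C]] := H i j.
  by apply: Ck_eq oU _ C => x Ux; rewrite derive_mx ?mxE//; exact: dA.
Qed.

Lemma Ck_sum k U (I : Type) (r : seq I) (P : pred I) (F : I -> V -> R^o) : open U ->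
  (forall i, Ck k U (F i)) -> Ck k U (fun x => \sum_(i <- r | P i) F i x : R^o).
Proof.
move=> oU H; elim: r => [|i r IH].
  by rewrite (_ : (fun x => _) = (fun=> 0)); [exact: Ck_cst|apply/funext => x; rewrite big_nil].
case: (boolP (P i)) => Pi.
  rewrite (_ : (fun x => _) = (fun x => F i x + \sum_(j <- r | P j) F j x)).
    exact: CkD oU (H i) IH.
  by apply/funext => x; rewrite big_cons Pi.
rewrite (_ : (fun x => _) = (fun x => \sum_(j <- r | P j) F j x)) //.
by apply/funext => x; rewrite big_cons (negPf Pi).
Qed.

End ck_mx.

Section ck_coord.
Context {R : realType}.

Lemma Ck_coord k m n (U : set 'M[R]_(m, n)) i j :
  Ck k U (fun y : 'M[R]_(m, n) => y i j : R^o).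
Proof.
have df (x : 'M[R]_(m, n)) : differentiable (fun y : 'M[R]_(m, n) => y i j : R^o) x.
  exact: (differentiable_coord x i j).
have c x : {for x, continuous (fun y : 'M[R]_(m, n) => y i j : R^o)}.
  exact: coord_continuous.
case: k => [|k]; split=> // v; split=> [x _|]; first exact: diff_derivable.
rewrite (_ : (fun x => _) = (fun=> v i j : R^o)); first exact: Ck_cst.
apply/funext => x.
have dx : derivable (fun y : 'M[R]_(m, n) => y) x v by exact: derivable_id.
have /matrixP/(_ i j) := derive_mx dx.
by rewrite mxE => <-; rewrite (derive_id x v).
Qed.

Lemma Ck_id k m n (U : set 'M[R]_(m, n)) : open U -> Ck k U id.
Proof. by move=> oU; apply/Ck_mx => // i j; exact: Ck_coord. Qed.

End ck_coord.

Section lines.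
Context {R : realType} {V W : normedModType R}.
Implicit Types (f : V -> W).

Lemma is_derive_line f x v (r : R) : derivable f (x + r *: v) v ->
  is_derive r (1:R) (fun s : R => f (x + s *: v)) ('D_v f (x + r *: v)).
Proof.
have E : (fun h : R => h^-1 *: (f (x + (h *: (1 : R) + r) *: v) - f (x + r *: v))) =
         (fun h : R => h^-1 *: (f (h *: v + (x + r *: v)) - f (x + r *: v))).
  apply/funext => h; congr (_ *: (f _ - _)).
  by rewrite scalerDl scaler1 addrCA.
move=> d; apply: DeriveDef.
  by rewrite /derivable /= E.
by rewrite /derive /= E.
Qed.

Lemma derive_dirZ f x v (a : R) : derivable f x v ->
  derivable f x (a *: v) /\ 'D_(a *: v) f x = a *: 'D_v f x.
Proof.
have [->|a0] := eqVneq a 0.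
  by rewrite !scale0r derive0; split=> //; exact: derivable0.
move=> d.
suff H : h^-1 *: (f (h *: (a *: v) + x) - f x) @[h --> (0:R)^'] --> a *: 'D_v f x.
  by split; [apply/cvg_ex; exists (a *: 'D_v f x)|exact: cvg_lim H].
have := d => /cvg_ex[l /= dl].
have -> : 'D_v f x = l by exact: cvg_lim dl.
have ac : a * h @[h --> (0:R)^'] --> (0:R)^'.
  move=> A /= [e e0 eA]; change (\forall h \near (0 : R)^', A (a * h)); near=> h.
  apply: eA; last by rewrite mulf_neq0//; near: h; exact: nbhs_dnbhs_neq.
  rewrite /= sub0r normrN normrM -ltr_pdivlMl ?normr_gt0//.
  by near: h; apply: dnbhs0_lt; rewrite mulr_gt0// invr_gt0 normr_gt0.
have -> : (fun h : R => h^-1 *: (f (h *: (a *: v) + x) - f x)) =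
   (fun h : R => a *: ((a * h)^-1 *: (f ((a * h) *: v + x) - f x))).
  apply/funext => h; rewrite !scalerA [h * a]mulrC.
  by rewrite invfM mulrA divff// mul1r.
apply: cvgZr.
exact: (cvg_comp _ (fun k : R => k^-1 *: (f (k *: v + x) - f x)) ac dl).
Unshelve. all: by end_near. Qed.

End lines.

Section mvt_line.
Context {R : realType} {V : normedModType R}.
Implicit Types (f : V -> R^o).

Lemma MVT_line f x v : (forall r : R, 0 <= r <= 1 -> derivable f (x + r *: v) v) ->
  exists2 r : R, 0 <= r <= 1 & f (x + v) - f x = 'D_v f (x + r *: v).
Proof.
move=> d.
have dl (r : R) : 0 <= r <= 1 ->
   is_derive r (1:R) (fun s : R => f (x + s *: v)) ('D_v f (x + r *: v)).
  by move=> r01; apply: is_derive_line; exact: d.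
have [||r] := @MVT R (fun s : R => f (x + s *: v)) (fun r => 'D_v f (x + r *: v)) 0 1 ltr01.
- by move=> r /[!in_itv]/= /andP[r0 r1]; apply: dl; rewrite !ltW.
- apply: continuous_in_subspaceT => r /[!inE] /=; rewrite in_itv /= => r01.
  have := dl r r01 => -[/derivable1_diffP dr _].
  exact: differentiable_continuous.
- rewrite in_itv /= => /andP[r0 r1]; rewrite scale1r scale0r addr0 subr0 mulr1 => E.
  by exists r => //; rewrite !ltW.
Qed.

End mvt_line.

Section eps_delta.
Context {R : realType} {V W : normedModType R}.

Lemma nbhs_normP (P : set V) x :
  nbhs x P <-> exists2 r : R, 0 < r & forall y, `|y - x| < r -> P y.
Proof.
split=> [/nbhs_ballP[r r0 Pr]|[r r0 Pr]].
  by exists r => // y yx; apply: Pr; rewrite -ball_normE /= distrC.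
by apply/nbhs_ballP; exists r => // y; rewrite -ball_normE /= distrC; exact: Pr.
Qed.

Lemma open_normP (U : set V) x : open U -> U x ->
  exists2 r : R, 0 < r & forall y, `|y - x| < r -> U y.
Proof. by move=> oU Ux; apply/nbhs_normP; apply: open_nbhs_nbhs. Qed.

Lemma cont_normP (f : V -> W) x : {for x, continuous f} <->
  forall e : R, 0 < e -> exists2 r : R, 0 < r & forall y, `|y - x| < r -> `|f y - f x| <= e.
Proof.
split=> [/cvgrPdist_le H e e0|H].
  have /nbhs_normP[r r0 Hr] := H e e0.
  by exists r => // y /Hr; rewrite distrC.
apply/cvgrPdist_le => e e0; apply/nbhs_normP; have [r r0 Hr] := H e e0.
by exists r => // y /Hr; rewrite distrC.
Qed.

End eps_delta.

Lemma cont_realP (R : realType) (V : normedModType R) (f : V -> R^o) x :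
  {for x, continuous f} -> forall e : R, 0 < e ->
  exists2 r : R, 0 < r & forall y, `|y - x| < r -> `|(f y : R) - (f x : R)| <= e.
Proof. by move=> /cont_normP. Qed.

Lemma cont_neq0 (R : realType) (V : normedModType R) (f : V -> R^o) x :
  {for x, continuous f} -> f x != 0 ->
  exists2 r : R, 0 < r & forall y, `|y - x| < r -> f y != 0.
Proof.
move=> cf f0; have e0 : 0 < `|f x : R| / 2 by rewrite divr_gt0 ?normr_gt0.
have [r r0 Hr] := cont_realP cf e0; exists r => // y /Hr H.
apply/eqP => fy; move: H e0; rewrite fy sub0r normrN.
by move: (`|_|) => a; lra.
Qed.

Lemma open_normball (R : realType) (V : normedModType R) (x : V) (r : R) :
  open [set y : V | `|y - x| < r].
Proof.
rewrite openE => y By; apply/nbhs_normP; exists (r - `|y - x|).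
  by rewrite subr_gt0.
move=> z zy /=; apply: le_lt_trans (ler_distD y z x) _.
by rewrite -ltrBrDr.
Qed.

Lemma mx_norm_leP (R : realType) m n (A : 'M[R]_(m, n)) (e : R) : 0 <= e ->
  (`|A| <= e <-> forall i j, `|A i j| <= e).
Proof.
move=> e0; split=> [Ae i j|H].
  by apply: le_trans Ae; rewrite /Num.norm/= mx_normrE; exact: (le_bigmax _ _ (i, j)).
by rewrite /Num.norm/= mx_normrE bigmax_le.
Qed.

Lemma mx_entry_le (R : realType) m n (A : 'M[R]_(m, n)) i j : `|A i j| <= `|A|.
Proof. exact: (mx_norm_leP A (normr_ge0 A)).1. Qed.

Lemma differentiable_lin (R : realType) (V W : normedModType R) (f : V -> W)
    (L : {linear V -> W}) x : continuous L ->
  (forall e : R, 0 < e -> exists2 r : R, 0 < r &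
     forall h : V, `|h| < r -> `|f (h + x) - f x - L h| <= e * `|h|) ->
  differentiable f x.
Proof.
move=> cL Hf.
have H : f \o shift x = cst (f x) + L +o_ (0 : V) id.
  apply/eqaddoP => e e0; have [r r0 Hr] := Hf e e0.
  apply/nbhs_normP; exists r => // h; rewrite subr0 => /Hr.
  by rewrite !fctE /= opprD addrA.
by apply/diff_locallyP; rewrite (diff_unique cL H).
Qed.

Section c1_diff.
Context {R : realType} {m : nat}.
Implicit Types (f : 'cV[R]_m -> R^o) (U : set 'cV[R]_m).

Definition rowform (A : 'rV[R]_m) (h : 'cV[R]_m) : R^o := (A *m h) 0 0.

Lemma rowform_linear A : linear (rowform A).
Proof. by move=> a u v; rewrite /rowform mulmxDr -scalemxAr !mxE. Qed.

HB.instance Definition _ A :=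
  GRing.isLinear.Build R 'cV[R]_m R^o _ (rowform A) (rowform_linear A).

Lemma rowform_continuous A : continuous (rowform A).
Proof.
move=> x; rewrite /rowform.
have -> : (fun h : 'cV[R]_m => (A *m h) 0 0 : R^o) = (fun h => \sum_i (A 0 i) * (h i 0) : R^o).
  by apply/funext => h; rewrite mxE.
have C := @Ck_sum R _ 0 setT 'I_m (index_enum 'I_m) xpredT
  (fun i (h : 'cV[R]_m) => A 0 i * h i 0 : R^o) openT
  (fun i => CkZ (A 0 i) openT (@Ck_coord R 0 m 1 setT i 0)).
exact: (Ck_cont C).
Qed.

(* The increment is telescoped along the coordinate directions. *)
Lemma C1_differentiable f U x : open U -> Ck 1 U f -> U x -> differentiable f x.
Proof.
move=> oU [cf df] Ux.
pose d i := 'D_(delta_mx i 0 : 'cV[R]_m) f.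
pose A : 'rV[R]_m := \row_i d i x.
apply: (@differentiable_lin _ _ _ f (rowform A)) => [|e e0].
  exact: rowform_continuous.
have e10 : 0 < e / m.+1%:R by rewrite divr_gt0.
have [r r0 Pr] : exists2 r : R, 0 < r & forall y, `|y - x| < r ->
    U y /\ forall i, `|(d i y : R) - (d i x : R)| <= e / m.+1%:R.
  apply/nbhs_normP; apply: filterI; first exact: open_nbhs_nbhs.
  apply: (@filter_forall _ _ (fun i y => `|(d i y : R) - (d i x : R)| <= e / m.+1%:R)
            (nbhs x) (nbhs_filter x)) => i; apply/nbhs_normP.
  have [_ [cd _]] := df (delta_mx i 0 : 'cV[R]_m).
  exact: cont_realP (cd x Ux) _ e10.
exists r => // h hr.
pose p k : 'cV[R]_m := \col_j (if (j < k)%N then h j 0 else 0).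
have entry (g : 'cV[R]_m) : (forall j, `|g j 0| <= `|h j 0|) -> `|g| <= `|h|.
  move=> gh; rewrite /Num.norm/= !mx_normrE.
  apply: bigmax_le => [|[j z] _]; first by rewrite bigmax_idl le_max lexx.
  by rewrite (ord1 z) (le_trans (gh j))//; exact: (le_bigmax _ _ (j, 0)).
have step (k : 'I_m) : `|f (x + p k.+1) - f (x + p k) - d k x * h k 0| <= e / m.+1%:R * `|h|.
  have pE s : p k + s *: (h k 0 *: delta_mx k 0) =
     \col_j (if (j < k)%N then h j 0 else if j == k then s * h k 0 else 0).
    apply/colP => j; rewrite !mxE eqxx andbT.
    by have [->|jk] := eqVneq j k; rewrite ?ltnn ?mulr1 ?mulr0 ?add0r ?addr0.
  have pk1 : p k.+1 = p k + h k 0 *: delta_mx k 0.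
    rewrite -[h k 0 *: _]scale1r pE; apply/colP => j; rewrite !mxE ltnS leq_eqVlt mul1r.
    by rewrite -val_eqE /=; case: eqP => [/val_inj ->|] //=; rewrite ltnn.
  have pb s : 0 <= s <= 1 -> `|p k + s *: (h k 0 *: delta_mx k 0)| <= `|h|.
    case/andP=> s0 s1; rewrite pE; apply: entry => j; rewrite mxE.
    case: ifP => // _; have [->|_] := eqVneq j k; last by rewrite normr0.
    by rewrite normrM ger0_norm// ler_piMl.
  have inU s : 0 <= s <= 1 ->
      U (x + p k + s *: (h k 0 *: delta_mx k 0)) /\
      forall i, `|d i (x + p k + s *: (h k 0 *: delta_mx k 0)) - d i x| <= e / m.+1%:R.
    move=> s01; apply: Pr; rewrite addrC !addrA addNr add0r.
    exact: le_lt_trans (pb _ s01) hr.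
  have dd y : U y -> derivable f y (h k 0 *: delta_mx k 0) /\
      'D_(h k 0 *: delta_mx k 0) f y = h k 0 *: d k y.
    by move=> Uy; apply: derive_dirZ; have [+ _] := df (delta_mx k 0 : 'cV[R]_m); exact.
  have [s s01|s s01] := @MVT_line R _ f (x + p k) (h k 0 *: delta_mx k 0).
    by have [/inU[/dd[]]] := s01.
  rewrite pk1 addrA => ->.
  have [Uy dy] := inU s s01; have [_ ->] := dd _ Uy.
  rewrite /GRing.scale /= [d k x * _]mulrC -mulrBr normrM mulrC ler_pM//.
  by rewrite /Num.norm/= mx_normrE; exact: (le_bigmax _ (fun ij => `|h ij.1 ij.2|) (k, 0)).
have tel : f (h + x) - f x = \sum_(k < m) (f (x + p k.+1) - f (x + p k)).
  rewrite -(big_mkord xpredT (fun k => f (x + p k.+1) - f (x + p k))).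
  rewrite telescope_sumr//.
  have -> : p m = h by apply/colP => j; rewrite mxE ltn_ord.
  have -> : p 0%N = 0 by apply/colP => j; rewrite !mxE.
  by rewrite addr0 [x + h]addrC.
have -> : f (h + x) - f x - rowform A h =
    \sum_(k < m) (f (x + p k.+1) - f (x + p k) - d k x * h k 0).
  rewrite sumrB -tel /rowform mxE.
  by congr (_ - _); apply: eq_bigr => i _; rewrite mxE.
apply: le_trans (ler_norm_sum _ _ _) _.
apply: (@le_trans _ _ (\sum_(k < m) e / m.+1%:R * `|h|)).
  by apply: ler_sum => k _; exact: step.
rewrite sumr_const card_ord -mulrnAl ler_wpM2r// -mulrnAr -{2}[e]mulr1 ler_wpM2l ?ltW//.
by rewrite -[_ *+ m]mulr_natl ltr_pdivrMr ?mul1r ?ltr_nat.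
Qed.

End c1_diff.

Lemma subrACA (V : zmodType) (a b c d : V) : a - b - (c - d) = a - c - (b - d).
Proof. by rewrite !opprB addrACA [RHS]addrACA [- b - c]addrC. Qed.

Lemma dist_half (R : realType) (a b c e : R) :
  `|a - b| <= e / 2 -> `|a - c| <= e / 2 -> `|b - c| <= e.
Proof.
by rewrite !ler_norml => /andP[? ?] /andP[? ?]; apply/andP; split; lra.
Qed.

Section schwarz.
Context {R : realType} {V : normedModType R}.

Lemma schwarz_real (f : V -> R^o) U x (u v : V) : open U -> Ck 2 U f -> U x ->
  'D_v ('D_u f) x = 'D_u ('D_v f) x.
Proof.
move=> oU [cf df] Ux.
have [du [cDu /(_ v)[dvu [cvu _]]]] := df u.
have [dv [cDv /(_ u)[duv [cuv _]]]] := df v.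
apply/eqP; rewrite -subr_eq0 -normr_le0; apply/ler_addgt0Pr => e e0; rewrite add0r.
have e2 : 0 < e / 2 by rewrite divr_gt0.
have [r1 r10 Pr1] := open_normP oU Ux.
have [r2 r20 Pr2] := cont_realP (cvu x Ux) e2.
have [r3 r30 Pr3] := cont_realP (cuv x Ux) e2.
pose r := Num.min r1 (Num.min r2 r3).
have r0 : 0 < r by rewrite !lt_min r10 r20.
have Pr y : `|y - x| < r -> [/\ U y,
   `|('D_v ('D_u f) y : R) - ('D_v ('D_u f) x : R)| <= e / 2 &
   `|('D_u ('D_v f) y : R) - ('D_u ('D_v f) x : R)| <= e / 2].
  rewrite !lt_min => /and3P[y1 y2 y3].
  by split; [exact: Pr1|exact: Pr2|exact: Pr3].
pose s := r / 2 / (1 + `|u| + `|v|).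
have N0 : 0 < 1 + `|u| + `|v| by rewrite -addrA ltr_pwDl// addr_ge0.
have s0 : 0 < s by rewrite !divr_gt0.
have inb a b : 0 <= a <= 1 -> 0 <= b <= 1 ->
    `|x + a *: (s *: u) + b *: (s *: v) - x| < r.
  move=> /andP[a0 a1] /andP[b0 b1].
  have -> : x + a *: (s *: u) + b *: (s *: v) - x = a *: (s *: u) + b *: (s *: v).
    by rewrite addrC !addrA addNr add0r.
  have H : s * (1 + `|u| + `|v|) = r / 2 by rewrite /s divfK// gt_eqF.
  clearbody s.
  apply: le_lt_trans (ler_normD _ _) _; rewrite !normrZ !ger0_norm ?(ltW s0)//.
  have : a * (s * `|u|) <= s * `|u| by rewrite ler_piMl// mulr_ge0// ltW.
  have : b * (s * `|v|) <= s * `|v| by rewrite ler_piMl// mulr_ge0// ltW.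
  by nra.
have i0 : 0 <= (0 : R) <= 1 by rewrite lexx ler01.
have i1 : 0 <= (1 : R) <= 1 by rewrite lexx ler01.
have main (w w' : V) : (forall y, U y -> derivable f y w) ->
    (forall y, U y -> derivable ('D_w f) y w') ->
    (forall a b, 0 <= a <= 1 -> 0 <= b <= 1 -> U (x + a *: (s *: w) + b *: (s *: w'))) ->
    exists a b, [/\ 0 <= a <= 1, 0 <= b <= 1 &
      f (x + s *: w + s *: w') - f (x + s *: w) - (f (x + s *: w') - f x) =
      s * (s * 'D_w' ('D_w f) (x + a *: (s *: w) + b *: (s *: w')))].
  move=> dw dw' iU.
  pose phi y := f (y + s *: w') - f y.
  have sh y : derivable f (y + s *: w') w -> derivable (fun y => f (y + s *: w')) y w /\
     'D_w (fun y => f (y + s *: w')) y = 'D_w f (y + s *: w').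
    have E : (fun h : R => h^-1 *: (f (h *: w + y + s *: w') - f (y + s *: w'))) =
      (fun h : R => h^-1 *: (f (h *: w + (y + s *: w')) - f (y + s *: w'))).
      by apply/funext => h; rewrite addrA.
    by rewrite /derivable /derive /= E.
  have dphi a : 0 <= a <= 1 -> derivable phi (x + a *: (s *: w)) w /\
      'D_w phi (x + a *: (s *: w)) =
      'D_w f (x + a *: (s *: w) + s *: w') - 'D_w f (x + a *: (s *: w)).
    move=> a01.
    have U1 := iU a 1 a01 i1; rewrite scale1r in U1.
    have U0 := iU a 0 a01 i0; rewrite scale0r addr0 in U0.
    have [d1 E1] := sh _ (dw _ U1).
    split; first exact: derivableB d1 (dw _ U0).
    by rewrite (deriveB d1 (dw _ U0)) E1.
  have [a a01|a a01] := @MVT_line R V phi x (s *: w).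
    by have [d _] := dphi a a01; have [] := derive_dirZ s d.
  have [d Ed] := dphi a a01; have [_ ->] := derive_dirZ s d.
  rewrite Ed => E1.
  have [b b01|b b01] := @MVT_line R V ('D_w f) (x + a *: (s *: w)) (s *: w').
    by have [] := derive_dirZ s (dw' _ (iU a b a01 b01)).
  have [_ ->] := derive_dirZ s (dw' _ (iU a b a01 b01)).
  move=> E2; exists a, b; split=> //.
  by move: E1; rewrite E2 /phi.
have [a [b [a01 b01 E1]]] := main u v du dvu (fun a b ha hb => let: And3 h _ _ := Pr _ (inb a b ha hb) in h).
have inb' p q : 0 <= p <= 1 -> 0 <= q <= 1 -> U (x + p *: (s *: v) + q *: (s *: u)).
  by move=> ha hb; have [+ _ _] := Pr _ (inb q p hb ha); rewrite addrAC.
have [a' [b' [a01' b01' E2]]] := main v u dv duv inb'.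
have EE : 'D_v ('D_u f) (x + a *: (s *: u) + b *: (s *: v)) =
          'D_u ('D_v f) (x + a' *: (s *: v) + b' *: (s *: u)).
  apply: (mulfI (lt0r_neq0 s0)); apply: (mulfI (lt0r_neq0 s0)).
  apply: (etrans (esym E1)); apply: (etrans _ E2).
  have -> : x + s *: v + s *: u = x + s *: u + s *: v by rewrite addrAC.
  exact: subrACA.
have [_ B1 _] := Pr _ (inb a b a01 b01).
have [_ _ B2] := Pr _ (inb b' a' b01' a01').
rewrite addrAC -EE in B2.
exact: dist_half B1 B2.
Qed.

End schwarz.

Section derive_comp.
Context {R : realType} {V W : normedModType R}.

Lemma derive_lineE (F : V -> W) x v :
  (derivable F x v <-> derivable (fun s : R => F (x + s *: v)) 0 1) /\
  'D_v F x = 'D_1 (fun s : R => F (x + s *: v)) 0.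
Proof.
have E : (fun h : R => h^-1 *: (F (x + (h *: (1 : R) + 0) *: v) - F (x + (0 : R) *: v))) =
         (fun h : R => h^-1 *: (F (h *: v + x) - F x)).
  by apply/funext => h; rewrite addr0 scaler1 scale0r addr0 [x + _]addrC.
by rewrite /derivable /derive /= E; split.
Qed.

End derive_comp.

Lemma derive_comp_diff {R : realType} {V V' W : normedModType R}
    (f : V -> V') (h : V' -> W) x v :
  derivable f x v -> differentiable h (f x) ->
  derivable (fun y => h (f y)) x v /\
  'D_v (fun y => h (f y)) x = 'D_('D_v f x) h (f x).
Proof.
move=> df dh; have [[df1 _] Ef] := derive_lineE f x v.
have [[_ dg1] Eg] := derive_lineE (fun y => h (f y)) x v.
have /derivable1_diffP dg := df1 df.
have g0 : f (x + (0 : R) *: v) = f x by rewrite scale0r addr0.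
have dh' : differentiable h (f (x + (0 : R) *: v)) by rewrite g0.
have dc : differentiable (h \o (fun s : R => f (x + s *: v))) 0.
  exact: differentiable_comp dg dh'.
split; first by apply: dg1; exact: diff_derivable dc.
rewrite Eg (deriveE _ dc) (diff_comp dg dh') /= g0.
by rewrite Ef (deriveE _ dg) (deriveE _ dh).
Qed.

Section coord_sum.
Context {R : realType} {m : nat} {W : normedModType R}.

Lemma col_sum_delta (w : 'cV[R]_m) : w = \sum_i w i 0 *: (delta_mx i 0 : 'cV[R]_m).
Proof.
apply/colP => j; rewrite summxE (bigD1 j)//= big1 => [|i ij]; rewrite !mxE.
  by rewrite !eqxx mulr1 addr0.
by rewrite eq_sym (negPf ij) mulr0.
Qed.

Lemma derive_coord_sum (h : 'cV[R]_m -> W) y w : differentiable h y ->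
  'D_w h y = \sum_i w i 0 *: 'D_(delta_mx i 0 : 'cV[R]_m) h y.
Proof.
move=> dh; rewrite (deriveE _ dh) {1}(col_sum_delta w) linear_sum.
by apply: eq_bigr => i _; rewrite linearZ (deriveE _ dh).
Qed.

End coord_sum.

Lemma Ck_comp {R : realType} {V : normedModType R} {m : nat} k (U : set V)
    (Om : set 'cV[R]_m) (f : V -> 'cV[R]_m) (h : 'cV[R]_m -> R^o) :
  open U -> open Om -> (forall x, U x -> Om (f x)) ->
  Ck k U f -> Ck k Om h -> Ck k U (fun x => h (f x)).
Proof.
move=> oU oO fO; elim: k h => [|k IH] h Hf Hh.
  split=> // x Ux; apply: (continuous_comp (f := f) (g := h)).
    exact: Ck_cont Hf Ux.
  exact: Ck_cont Hh (fO x Ux).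
have dh x : U x -> differentiable h (f x).
  by move=> Ux; apply: C1_differentiable oO (CkW _ Hh) (fO x Ux).
have [cf df] := Hf; split=> [x Ux|v].
  apply: (continuous_comp (f := f) (g := h)); first exact: cf.
  exact: Ck_cont Hh (fO x Ux).
have [dv Cv] := df v.
have H x : U x -> _ := fun Ux => derive_comp_diff (dv x Ux) (dh x Ux).
split=> [x /H[]//|].
pose G i x := ('D_v f x i 0 : R^o) * 'D_(delta_mx i 0 : 'cV[R]_m) h (f x) : R^o.
apply: (@Ck_eq _ _ _ _ _ (fun x => \sum_i G i x)) => // [x Ux|].
  have [_ ->] := H x Ux; rewrite (derive_coord_sum _ (dh x Ux)).
  by apply: eq_bigr.
apply: Ck_sum => // i; apply: CkM => //; first exact: (Ck_mx _ _ oU).1.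
apply: (IH ('D_(delta_mx i 0 : 'cV[R]_m) h) (CkS Hf)).
by have [_ /(_ (delta_mx i 0 : 'cV[R]_m))[_ ?]] := Hh.
Qed.

Lemma differentiable_mx {R : realType} {V : normedModType R} m n
   (f : V -> 'M[R]_(m, n)) x :
  (forall i j, differentiable (fun y => f y i j : R^o) x) -> differentiable f x.
Proof.
move=> df.
pose L h : 'M[R]_(m, n) := \matrix_(i, j) ('d (fun y => f y i j : R^o) x h : R).
have Ll : linear L by move=> a u v; apply/matrixP => i j; rewrite !mxE linearP.
pose LL := HB.pack_for {linear V -> 'M[R]_(m, n)} L (GRing.isLinear.Build _ _ _ _ L Ll).
apply: (@differentiable_lin _ _ _ f LL) => [y|e e0].
  apply/continuous_mxP => i j.
  have -> : (fun y => LL y i j : R^o) = 'd (fun y => f y i j : R^o) x.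
    by apply/funext => z; rewrite mxE.
  exact: (diff_continuous (df i j)).
suff /nbhs_normP[r r0 Hr] : nbhs (0 : V) (fun h => `|f (h + x) - f x - LL h| <= e * `|h|).
  by exists r => // h hr; apply: Hr; rewrite subr0.
have : forall ij : 'I_m * 'I_n, nbhs (0 : V) (fun h =>
   `|(f (h + x) ij.1 ij.2 - f x ij.1 ij.2 - L h ij.1 ij.2 : R)| <= e * `|h|).
  case=> i j /=; have /diff_locallyP[_ /eqaddoP/(_ e e0)] := df i j.
  by apply: filterS => h; rewrite !fctE /= opprD addrA !mxE.
move=> /(@filter_forall _ _ _ (nbhs (0 : V)) (nbhs_filter 0)).
apply: filterS => h Hh.
apply/mx_norm_leP => [|i j]; first by rewrite mulr_ge0// ltW.
by move: (Hh (i, j)); rewrite !mxE.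
Qed.

Definition sm {R : realType} {V W : normedModType R} (f : V -> W) (x : V) : Prop :=
  exists U, [/\ open U, U x & smooth_on U f].

HB.lock Definition dd {R : realType} {V W : normedModType R} (v : V) (f : V -> W) (x : V) : W :=
  'D_v f x.
Canonical dd_unlockable := Unlockable dd.unlock.

Section sm_general.
Context {R : realType} {V W : normedModType R}.
Implicit Types (f g : V -> W) (x v : V).

Lemma sm_on U f x : open U -> smooth_on U f -> U x -> sm f x.
Proof. by move=> oU sf Ux; exists U. Qed.

Lemma smooth_onP U f : open U -> smooth_on U f <-> (forall x, U x -> sm f x).
Proof.
move=> oU; split=> [sf x Ux|H k]; first exact: sm_on Ux.
by apply: Ck_loc => x /H [B [oB Bx sB]]; exists B.
Qed.

Lemma sm_near f x : sm f x -> \forall y \near x, sm f y.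
Proof.
case=> U [oU Ux sU]; apply: (@filterS _ _ _ U); first by move=> y; exact: sm_on.
exact: open_nbhs_nbhs.
Qed.

Lemma sm_cont f x : sm f x -> {for x, continuous f}.
Proof. by case=> U [_ Ux /(_ 0%N)/Ck_cont]; exact. Qed.

Lemma sm_derivable f x v : sm f x -> derivable f x v.
Proof. by case=> U [_ Ux /(_ 1%N)[_ /(_ v)[+ _]]]; exact. Qed.

Lemma sm_eq f g x : (\forall y \near x, f y = g y) -> sm f x -> sm g x.
Proof.
move=> /nbhs_normP[r r0 fg] [U [oU Ux sU]].
pose B := [set y : V | `|y - x| < r].
have oB : open B by exact: open_normball.
exists (U `&` B); split; [exact: openI|by split=> //; rewrite /B /= subrr normr0|].
move=> k; apply: (@Ck_eq _ _ _ _ _ f); first exact: openI.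
  by move=> y [_ /fg].
by apply: (@Ck_sub _ _ _ _ U) => // y [].
Qed.

Lemma sm_ext f g x : f =1 g -> sm f x -> sm g x.
Proof. by move=> fg; apply: sm_eq; apply: nearW => y; rewrite fg. Qed.

Lemma sm_cst (a : W) x : sm (fun=> a) x.
Proof. by exists setT; split=> //; [exact: openT|move=> k; exact: Ck_cst]. Qed.

Lemma sm2 f g x : sm f x -> sm g x ->
  exists U, [/\ open U, U x, smooth_on U f & smooth_on U g].
Proof.
move=> [U [oU Ux sU]] [U' [oU' Ux' sU']]; exists (U `&` U'); split=> //.
- exact: openI.
- by move=> k; apply: Ck_sub (sU k) => y [].
- by move=> k; apply: Ck_sub (sU' k) => y [].
Qed.

Lemma smD f g x : sm f x -> sm g x -> sm (fun y => f y + g y) x.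
Proof.
by move=> sf sg; have [U [oU Ux sU sU']] := sm2 sf sg; exists U; split=> // k; exact: CkD.
Qed.

Lemma smZ a f x : sm f x -> sm (fun y => a *: f y) x.
Proof. by move=> [U [oU Ux sU]]; exists U; split=> // k; exact: CkZ. Qed.

Lemma smN f x : sm f x -> sm (fun y => - f y) x.
Proof. by move=> /(smZ (-1)); apply: sm_ext => y; rewrite scaleN1r. Qed.

Lemma smB f g x : sm f x -> sm g x -> sm (fun y => f y - g y) x.
Proof. by move=> sf /smN; exact: smD. Qed.

Lemma sm_D f x v : sm f x -> sm (dd v f) x.
Proof. rewrite unlock.
by move=> [U [oU Ux sU]]; exists U; split=> // k; have [_ /(_ v)[]] := sU k.+1.
Qed.

Lemma D_eq f g x v : (\forall y \near x, f y = g y) -> dd v f x = dd v g x.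
Proof. rewrite unlock. exact: near_eq_derive. Qed.

Lemma D_ext f g x v : f =1 g -> dd v f x = dd v g x.
Proof. by move=> fg; apply: D_eq; apply: nearW. Qed.

Lemma DD f g x v : sm f x -> sm g x ->
  dd v (fun y => f y + g y) x = dd v f x + dd v g x.
Proof. rewrite unlock. by move=> sf sg; exact: (deriveD (sm_derivable (v:=v) sf) (sm_derivable (v:=v) sg)). Qed.

Lemma DB f g x v : sm f x -> sm g x ->
  dd v (fun y => f y - g y) x = dd v f x - dd v g x.
Proof. rewrite unlock. by move=> sf sg; exact: (deriveB (sm_derivable (v:=v) sf) (sm_derivable (v:=v) sg)). Qed.

Lemma DN f x v : sm f x -> dd v (fun y => - f y) x = - dd v f x.
Proof. rewrite unlock. by move=> sf; exact: (deriveN (sm_derivable (v:=v) sf)). Qed.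

Lemma DZ a f x v : sm f x -> dd v (fun y => a *: f y) x = a *: dd v f x.
Proof. rewrite unlock. by move=> sf; exact: (deriveZ a (sm_derivable (v:=v) sf)). Qed.

Lemma Dcst (a : W) x v : dd v (fun=> a) x = 0.
Proof. rewrite unlock. exact: derive_cst. Qed.

Lemma Dscale a f x v : sm f x -> dd (a *: v) f x = a *: dd v f x.
Proof. rewrite unlock. by move=> sf; have [] := derive_dirZ a (sm_derivable (v:=v) sf). Qed.

End sm_general.

Section sm_real.
Context {R : realType} {V : normedModType R}.
Implicit Types (f g : V -> R^o) (x v : V).

Lemma smM f g x : sm f x -> sm g x -> sm (fun y => (f y : R) * (g y : R) : R^o) x.
Proof.
by move=> sf sg; have [U [oU Ux sU sU']] := sm2 sf sg; exists U; split=> // k; exact: CkM.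
Qed.

Lemma smV f x : (f x : R) != 0 -> sm f x -> sm (fun y => (f y : R)^-1 : R^o) x.
Proof.
move=> f0 sf; have [U [oU Ux sU]] := sf.
have [r r0 fr] := cont_neq0 (sm_cont sf) f0.
pose B := [set y : V | `|y - x| < r].
have oB : open B by exact: open_normball.
exists (U `&` B); split; [exact: openI|by split=> //; rewrite /B /= subrr normr0|].
move=> k; apply: CkV => [|y [_ /fr]//|]; first exact: openI.
by apply: (@Ck_sub _ _ _ _ U) => // y [].
Qed.

Lemma DM f g x v : sm f x -> sm g x ->
  dd v (fun y => (f y : R) * (g y : R) : R^o) x = (f x : R) * dd v g x + (dd v f x : R) * g x.
Proof. rewrite unlock.
move=> sf sg; have := deriveM (sm_derivable (v:=v) sf) (sm_derivable (v:=v) sg).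
by rewrite /GRing.scale /= => ->; rewrite [_ * 'D_v f x]mulrC.
Qed.

Lemma sm_sum (I : Type) (r : seq I) (P : pred I) (F : I -> V -> R^o) x :
  (forall i, sm (F i) x) -> sm (fun y => \sum_(i <- r | P i) F i y : R^o) x.
Proof.
move=> H; elim: r => [|i r IH].
  by apply: sm_ext (sm_cst 0 x) => y; rewrite big_nil.
case: (boolP (P i)) => Pi; last by apply: sm_ext IH => y; rewrite big_cons (negPf Pi).
by apply: sm_ext (smD (H i) IH) => y; rewrite big_cons Pi.
Qed.

Lemma sm_prod (I : Type) (r : seq I) (P : pred I) (F : I -> V -> R^o) x :
  (forall i, sm (F i) x) -> sm (fun y => \prod_(i <- r | P i) F i y : R^o) x.
Proof.
move=> H; elim: r => [|i r IH].
  by apply: sm_ext (sm_cst (1 : R^o) x) => y; rewrite big_nil.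
case: (boolP (P i)) => Pi; last by apply: sm_ext IH => y; rewrite big_cons (negPf Pi).
by apply: sm_ext (smM (H i) IH) => y; rewrite big_cons Pi.
Qed.

Lemma D_sum (I : Type) (r : seq I) (P : pred I) (F : I -> V -> R^o) x v :
  (forall i, sm (F i) x) ->
  dd v (fun y => \sum_(i <- r | P i) F i y : R^o) x = \sum_(i <- r | P i) dd v (F i) x.
Proof.
move=> H; elim: r => [|i r IH].
  rewrite big_nil -[RHS](Dcst (0 : R^o) x v); apply: D_ext => y; by rewrite big_nil.
rewrite big_cons -IH; case: (boolP (P i)) => Pi.
  rewrite -DD//; last exact: sm_sum.
  by apply: D_ext => y; rewrite big_cons Pi.
by apply: D_ext => y; rewrite big_cons (negPf Pi).
Qed.

End sm_real.

Section sm_mx.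
Context {R : realType} {V : normedModType R}.
Implicit Types (x v : V).

Lemma sm_mxP m n (A : V -> 'M[R]_(m, n)) x :
  sm A x <-> forall i j, sm (fun y => A y i j : R^o) x.
Proof.
split=> [[U [oU Ux sU]] i j|H].
  by exists U; split=> // k; exact: (Ck_mx _ _ oU).1.
have [r r0 Hr] : exists2 r : R, 0 < r & forall y, `|y - x| < r ->
    forall ij : 'I_m * 'I_n, sm (fun y => A y ij.1 ij.2 : R^o) y.
  apply/nbhs_normP; apply: (@filter_forall _ _ _ (nbhs x) (nbhs_filter x)).
  by move=> ij; apply: sm_near.
pose B := [set y : V | `|y - x| < r].
have oB : open B by exact: open_normball.
exists B; split=> //; first by rewrite /B /= subrr normr0.
move=> k; apply/Ck_mx => // i j.
by move: k; apply/(smooth_onP _ oB) => y /Hr /(_ (i, j)).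
Qed.

Lemma D_entry m n (A : V -> 'M[R]_(m, n)) x v i j : sm A x ->
  (dd v A x) i j = dd v (fun y => A y i j : R^o) x.
Proof. rewrite unlock. by move=> sA; rewrite derive_mx ?mxE//; exact: sm_derivable. Qed.

Lemma sm_mulmx m n p (A : V -> 'M[R]_(m, n)) (B : V -> 'M[R]_(n, p)) x :
  sm A x -> sm B x -> sm (fun y => A y *m B y) x.
Proof.
move=> /sm_mxP sA /sm_mxP sB; apply/sm_mxP => i j.
apply: (@sm_ext _ _ _ (fun y => \sum_k (A y i k : R^o) * B y k j)).
  by move=> y; rewrite mxE.
by apply: sm_sum => k; exact: smM.
Qed.

Lemma D_mulmx m n p (A : V -> 'M[R]_(m, n)) (B : V -> 'M[R]_(n, p)) x v :
  sm A x -> sm B x ->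
  dd v (fun y => A y *m B y) x = dd v A x *m B x + A x *m dd v B x.
Proof.
move=> sA sB; apply/matrixP => i j; rewrite D_entry; last exact: sm_mulmx.
transitivity (dd v (fun y => \sum_k (A y i k : R^o) * B y k j : R^o) x).
  by apply: D_ext => y; rewrite mxE.
have sA' k := (sm_mxP A x).1 sA i k; have sB' k := (sm_mxP B x).1 sB k j.
rewrite D_sum => [|k]; last exact: smM.
rewrite !mxE -big_split /=; apply: eq_bigr => k _.
by rewrite DM// !D_entry// addrC.
Qed.

Lemma sm_mulmxl m n p (A : 'M[R]_(m, n)) (B : V -> 'M[R]_(n, p)) x :
  sm B x -> sm (fun y => A *m B y) x.
Proof. by apply: sm_mulmx; exact: sm_cst. Qed.

Lemma sm_mulmxr m n p (A : V -> 'M[R]_(m, n)) (B : 'M[R]_(n, p)) x :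
  sm A x -> sm (fun y => A y *m B) x.
Proof. by move=> sA; apply: sm_mulmx => //; exact: sm_cst. Qed.

Lemma D_mulmxl m n p (A : 'M[R]_(m, n)) (B : V -> 'M[R]_(n, p)) x v :
  sm B x -> dd v (fun y => A *m B y) x = A *m dd v B x.
Proof.
by move=> sB; rewrite (D_mulmx v (sm_cst A x) sB) Dcst mul0mx add0r.
Qed.

Lemma D_mulmxr m n p (A : V -> 'M[R]_(m, n)) (B : 'M[R]_(n, p)) x v :
  sm A x -> dd v (fun y => A y *m B) x = dd v A x *m B.
Proof.
by move=> sA; rewrite (D_mulmx v sA (sm_cst B x)) Dcst mulmx0 addr0.
Qed.

Lemma sm_trmx m n (A : V -> 'M[R]_(m, n)) x : sm A x -> sm (fun y => (A y)^T) x.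
Proof.
by move=> /sm_mxP sA; apply/sm_mxP => i j; apply: sm_ext (sA j i) => y; rewrite mxE.
Qed.

Lemma D_trmx m n (A : V -> 'M[R]_(m, n)) x v : sm A x ->
  dd v (fun y => (A y)^T) x = (dd v A x)^T.
Proof.
move=> sA; apply/matrixP => i j; rewrite mxE !D_entry//; last exact: sm_trmx.
by apply: D_ext => y; rewrite mxE.
Qed.

Lemma sm_scale m n (a : V -> R^o) (A : V -> 'M[R]_(m, n)) x :
  sm a x -> sm A x -> sm (fun y => a y *: A y) x.
Proof.
move=> sa /sm_mxP sA; apply/sm_mxP => i j.
by apply: sm_ext (smM sa (sA i j)) => y; rewrite mxE.
Qed.

Lemma D_scale m n (a : V -> R^o) (A : V -> 'M[R]_(m, n)) x v : sm a x -> sm A x ->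
  dd v (fun y => a y *: A y) x = (dd v a x : R) *: A x + a x *: dd v A x.
Proof.
move=> sa sA; apply/matrixP => i j; rewrite D_entry; last exact: sm_scale.
transitivity (dd v (fun y => a y * (A y i j : R^o) : R^o) x).
  by apply: D_ext => y; rewrite mxE.
have sA' := (sm_mxP A x).1 sA i j.
by rewrite DM// !mxE D_entry// addrC.
Qed.

Lemma sm_det n (A : V -> 'M[R]_n) x : sm A x -> sm (fun y => \det (A y) : R^o) x.
Proof.
move=> /sm_mxP sA; apply: sm_sum => s.
by apply: (smM (sm_cst ((-1) ^+ s : R^o) x)); apply: sm_prod => i; exact: sA.
Qed.

Lemma sm_invmx n (A : V -> 'M[R]_n) x : sm A x -> A x \in unitmx ->
  sm (fun y => invmx (A y)) x.
Proof.
move=> sA uA; have sd := sm_det sA.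
have d0 : \det (A x) != 0 by rewrite -unitfE.
have sadj : sm (fun y => \adj (A y)) x.
  apply/sm_mxP => i j.
  apply: (@sm_ext _ _ _ (fun y => ((-1) ^+ (j + i) : R^o) * \det (row' j (col' i (A y))))).
    by move=> y; rewrite mxE.
  apply: (smM (sm_cst ((-1) ^+ (j + i) : R^o) x)); apply: sm_det.
  by apply/sm_mxP => k l; apply: sm_ext ((sm_mxP A x).1 sA _ _) => y; rewrite !mxE.
apply: (@sm_eq _ _ _ (fun y => (\det (A y))^-1 *: \adj (A y))); last first.
  apply: (@sm_scale n n (fun y => (\det (A y))^-1 : R^o) (fun y => \adj (A y)) x _ sadj).
  exact: (@smV R V (fun y => \det (A y) : R^o) x d0 sd).
have [r r0 Hr] := cont_neq0 (sm_cont sd) d0.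
by apply/nbhs_normP; exists r => // y /Hr H; rewrite /invmx unitmxE unitfE H.
Qed.

End sm_mx.

Section sm_comp.
Context {R : realType} {V : normedModType R} {m : nat}.
Implicit Types (x v : V).

Lemma sm_comp_real (f : V -> 'cV[R]_m) (h : 'cV[R]_m -> R^o) x :
  sm f x -> sm h (f x) -> sm (fun y => h (f y)) x.
Proof.
move=> sf [B [oB Bfx sB]]; have [U [oU Ux sU]] := sf.
have [r r0 Hr] : exists2 r : R, 0 < r & forall y, `|y - x| < r -> U y /\ B (f y).
  apply/nbhs_normP; apply: filterI; first exact: open_nbhs_nbhs.
  apply: (sm_cont sf); exact: open_nbhs_nbhs.
pose D := [set y : V | `|y - x| < r].
have oD : open D by exact: open_normball.
exists D; split=> //; first by rewrite /D /= subrr normr0.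
move=> k; apply: (Ck_comp oD oB) (sB k) => [y /Hr[]//|].
by apply: Ck_sub (sU k) => y /Hr[].
Qed.

Lemma sm_comp p q (f : V -> 'cV[R]_m) (h : 'cV[R]_m -> 'M[R]_(p, q)) x :
  sm f x -> sm h (f x) -> sm (fun y => h (f y)) x.
Proof.
move=> sf /sm_mxP sh; apply/sm_mxP => i j.
exact: (sm_comp_real (h := fun z => h z i j : R^o)).
Qed.

End sm_comp.

Section sm_col.
Context {R : realType} {m : nat}.
Implicit Types (x u v w : 'cV[R]_m).

Lemma sm_id p q (x : 'M[R]_(p, q)) : sm id x.
Proof. by exists setT; split=> //; [exact: openT|move=> k; exact: Ck_id openT]. Qed.

Lemma sm_diff_real (f : 'cV[R]_m -> R^o) x : sm f x -> differentiable f x.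
Proof. by move=> [U [oU Ux sU]]; exact: C1_differentiable oU (sU 1%N) Ux. Qed.

Lemma sm_diff p q (f : 'cV[R]_m -> 'M[R]_(p, q)) x : sm f x -> differentiable f x.
Proof.
by move=> /sm_mxP sf; apply: differentiable_mx => i j; exact: sm_diff_real.
Qed.

Lemma D_comp {V : normedModType R} p q (f : V -> 'cV[R]_m) (h : 'cV[R]_m -> 'M[R]_(p, q)) (x v : V) :
  sm f x -> sm h (f x) ->
  dd v (fun y => h (f y)) x = dd (dd v f x) h (f x).
Proof. rewrite unlock.
by move=> sf /sm_diff sh; have [] := derive_comp_diff (sm_derivable (v:=v) sf) sh.
Qed.

Lemma D_comp_real {V : normedModType R} (f : V -> 'cV[R]_m) (h : 'cV[R]_m -> R^o) (x v : V) :
  sm f x -> sm h (f x) ->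
  dd v (fun y => h (f y)) x = dd (dd v f x) h (f x).
Proof. rewrite unlock.
by move=> sf /sm_diff_real sh; have [] := derive_comp_diff (sm_derivable (v:=v) sf) sh.
Qed.

Lemma D_dirD p q (f : 'cV[R]_m -> 'M[R]_(p, q)) x u v : sm f x ->
  dd (u + v) f x = dd u f x + dd v f x.
Proof. rewrite unlock. by move=> /sm_diff df; rewrite !(deriveE _ df) linearD. Qed.

Lemma D_dirB p q (f : 'cV[R]_m -> 'M[R]_(p, q)) x u v : sm f x ->
  dd (u - v) f x = dd u f x - dd v f x.
Proof. rewrite unlock. by move=> /sm_diff df; rewrite !(deriveE _ df) linearB. Qed.

Lemma D_dirZ p q (f : 'cV[R]_m -> 'M[R]_(p, q)) x (a : R) u : sm f x ->
  dd (a *: u) f x = a *: dd u f x.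
Proof. rewrite unlock. by move=> /sm_diff df; rewrite !(deriveE _ df) linearZ. Qed.

Lemma D_dir_sum p q (f : 'cV[R]_m -> 'M[R]_(p, q)) x (I : finType) (F : I -> 'cV[R]_m) :
  sm f x -> dd (\sum_i F i) f x = \sum_i dd (F i) f x.
Proof. rewrite unlock.
move=> /sm_diff df; rewrite !(deriveE _ df) linear_sum.
by apply: eq_bigr => i _; rewrite (deriveE _ df).
Qed.

Lemma D_swap p q (f : 'cV[R]_m -> 'M[R]_(p, q)) x u v : sm f x ->
  dd u (dd v f) x = dd v (dd u f) x.
Proof.
move=> sf; have [U [oU Ux sU]] := sf.
have H w i j : \forall y \near x, (dd w f y) i j = dd w (fun y => f y i j : R^o) y.
  by apply: filterS (sm_near sf) => y sy; rewrite D_entry.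
apply/matrixP => i j.
rewrite (D_entry u i j (sm_D v sf)) (D_entry v i j (sm_D u sf)).
rewrite (D_eq u (H v i j)) (D_eq v (H u i j)) unlock.
apply: (schwarz_real v u oU _ Ux).
exact: (Ck_mx _ _ oU).1 (sU 2%N) i j.
Qed.

Lemma D_id p q (x v : 'M[R]_(p, q)) : dd v id x = v.
Proof. rewrite unlock. exact: derive_id. Qed.

Definition jac n (f : 'cV[R]_m -> 'cV[R]_n) x : 'M[R]_(n, m) :=
  \matrix_(i, j) (dd (delta_mx j 0 : 'cV[R]_m) f x) i 0.

Lemma D_jac n (f : 'cV[R]_m -> 'cV[R]_n) x v : sm f x -> dd v f x = jac f x *m v.
Proof.
rewrite unlock => /sm_diff df; rewrite (derive_coord_sum _ df); apply/colP => i.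
by rewrite summxE mxE; apply: eq_bigr => j _; rewrite !mxE unlock mulrC.
Qed.

Lemma sm_jac n (f : 'cV[R]_m -> 'cV[R]_n) x : sm f x -> sm (jac f) x.
Proof.
move=> sf; apply/sm_mxP => i j.
have /sm_mxP/(_ i 0) := sm_D (delta_mx j 0 : 'cV[R]_m) sf.
by apply: sm_ext => y; rewrite mxE.
Qed.

Lemma D_jacE n (f : 'cV[R]_m -> 'cV[R]_n) x u v : sm f x ->
  dd u (jac f) x *m v = dd u (dd v f) x.
Proof.
move=> sf; rewrite -(D_mulmxr _ _ (sm_jac sf)).
apply: D_eq; apply: filterS (sm_near sf) => y sy; by rewrite D_jac.
Qed.

Lemma D_jac_sym n (f : 'cV[R]_m -> 'cV[R]_n) x u v : sm f x ->
  dd u (jac f) x *m v = dd v (jac f) x *m u.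
Proof. by move=> sf; rewrite (D_jacE u v sf) (D_jacE v u sf); exact: D_swap. Qed.

End sm_col.

Lemma jac_comp {R : realType} {m n p : nat} (f : 'cV[R]_m -> 'cV[R]_n)
   (h : 'cV[R]_n -> 'cV[R]_p) x : sm f x -> sm h (f x) ->
  jac (fun y => h (f y)) x = jac h (f x) *m jac f x.
Proof.
move=> sf sh; apply/matrixP => i j.
by rewrite !mxE D_comp// D_jac// mxE; apply: eq_bigr => k _; rewrite !mxE.
Qed.

Lemma jac_id {R : realType} {m : nat} (x : 'cV[R]_m) : jac id x = 1%:M.
Proof. by apply/matrixP => i j; rewrite !mxE D_id !mxE eqxx andbT. Qed.

Lemma jac_eq {R : realType} {m n : nat} (f h : 'cV[R]_m -> 'cV[R]_n) x :
  (\forall y \near x, f y = h y) -> jac f x = jac h x.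
Proof. by move=> fh; apply/matrixP => i j; rewrite !mxE (D_eq _ fh). Qed.

Lemma mulmx_ext {R : realType} {m n : nat} (A B : 'M[R]_(n, m)) :
  (forall v : 'cV[R]_m, A *m v = B *m v) -> A = B.
Proof.
move=> H; apply/matrixP => i j.
by have /colP/(_ i) := H (delta_mx j 0); rewrite -!colE !mxE.
Qed.

Lemma jac_uniq {R : realType} {m n : nat} (f : 'cV[R]_m -> 'cV[R]_n) x (A : 'M[R]_(n, m)) :
  sm f x -> (forall v, dd v f x = A *m v) -> jac f x = A.
Proof. by move=> sf H; apply: mulmx_ext => v; rewrite -H D_jac. Qed.

Lemma form_ext {R : realType} {m n : nat} (A B : 'M[R]_(n, m)) :
  (forall (u : 'cV[R]_n) (v : 'cV[R]_m), u^T *m A *m v = u^T *m B *m v) -> A = B.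
Proof.
move=> H; apply: mulmx_ext => v; apply: trmx_inj; apply: mulmx_ext => u.
by apply: trmx_inj; rewrite !trmx_mul !trmxK !mulmxA H.
Qed.

(** * Plateau functions *)

Section flat_bump.
Context {R : realType}.
Implicit Types (x : R).

(* The family is closed under derivation: f_n' = - n f_(n+1) + f_(n+2). *)
Definition flat (n : nat) (x : R) : R :=
  if 0 < x then x^-1 ^+ n * expR (- x^-1) else 0.

Lemma flat_ge0 n x : 0 <= flat n x.
Proof.
rewrite /flat; case: ifP => // x0.
by rewrite mulr_ge0 ?expR_ge0// exprn_ge0// invr_ge0 ltW.
Qed.

Lemma flat_gt0 n x : 0 < x -> 0 < flat n x.
Proof.
by move=> x0; rewrite /flat x0 mulr_gt0 ?expR_gt0// exprn_gt0// invr_gt0.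
Qed.

Lemma flat_bound n x : 0 < x -> flat n x <= (n.+2)`!%:R * x ^+ 2.
Proof.
move=> x0; rewrite /flat x0.
have y0 : 0 < x^-1 by rewrite invr_gt0.
have H := expR_ge1Dxn n.+1 (ltW y0).
have {}H : (x^-1) ^+ n.+2 <= n.+2`!%:R * expR x^-1.
  rewrite mulrC -ler_pdivrMr ?ltr0n ?fact_gt0//.
  by apply: le_trans H; rewrite lerDr.
rewrite expRN ler_pdivrMr ?expR_gt0//.
have -> : (x^-1) ^+ n = x ^+ 2 * (x^-1) ^+ n.+2.
  by rewrite -[n.+2]addn2 exprD [x^-1 ^+ 2]exprVn mulrCA divff ?mulr1// expf_neq0// gt_eqF.
by rewrite [leRHS]mulrAC [leLHS]mulrC ler_wpM2r// exprn_ge0// ltW.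
Qed.

Lemma is_derive_flat n x :
  is_derive x 1 (flat n) (- n%:R * flat n.+1 x + flat n.+2 x).
Proof.
have [x0|x0|<-] := ltgtP 0 x.
- have E : \near x, x^-1 ^+ n * expR (- x^-1) = flat n x.
    near=> y; rewrite /flat ifT//; near: y.
    by apply: lt_nbhsr.
  apply: (near_eq_is_derive E).
  have dV : is_derive x (1 : R) (fun y : R => y^-1) (- (x ^- 2) *: 1).
    by apply: (@is_deriveV R id) => //; rewrite gt_eqF.
  have dE : is_derive x (1 : R) (fun y : R => expR (- y^-1)) (expR (- x^-1) * (- (- (x ^- 2) *: 1))).
    by apply: (is_derive1_comp (f := expR) (g := fun y : R => - y^-1)).
  have dX : is_derive x (1 : R) (fun y : R => y^-1 ^+ n) (- n%:R * x^-1 ^+ n.+1).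
    elim: (n) => [|k IHk].
      by rewrite oppr0 mul0r; apply: (is_derive_cst (1 : R)).
    have -> : (fun y : R => y^-1 ^+ k.+1) = (fun y : R => y^-1) * (fun y : R => y^-1 ^+ k).
      by apply/funext => y; rewrite exprS.
    have [d1 d2] := is_deriveM dV IHk; apply: DeriveDef; first exact: d1.
    rewrite [LHS]d2 /GRing.scale /= mulr1 -exprVn -natr1 !exprS; ring.
  have [d1 d2] := is_deriveM dX dE; apply: DeriveDef; first exact: d1.
  rewrite [LHS]d2 /GRing.scale /= /flat x0 mulr1 opprK -exprVn !exprS; ring.
- have E : \near x, 0 = flat n x.
    near=> y; rewrite /flat ifF//; apply/negbTE; rewrite -leNgt; near: y.
    apply/nbhs_normP; exists (- x) => [|y]; first by rewrite oppr_gt0.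
    by rewrite ltr_norml => /andP[_]; lra.
  apply: (near_eq_is_derive E).
  rewrite /flat ltNge (ltW x0) /= mulr0 addr0.
  exact: is_derive_cst.
- rewrite {2 3}/flat ltxx mulr0 addr0.
  suff H : (fun h : R => h^-1 *: (flat n (h *: 1 + 0) - flat n 0)) @ (0 : R)^' --> (0 : R).
    by apply: DeriveDef; [apply/cvg_ex; exists 0|exact: cvg_lim H].
  apply/cvgrPdist_le => e e0; near=> h.
  have h0 : h != 0 by near: h; exact: nbhs_dnbhs_neq.
  rewrite sub0r normrN /GRing.scale /= mulr1 addr0 {2}/flat ltxx subr0.
  have [hp|hn] := ltP 0 h; last by rewrite /flat ltNge hn mulr0 normr0 ltW.
  rewrite ger0_norm; last by rewrite mulr_ge0 ?flat_ge0// invr_ge0 ltW.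
  apply: (@le_trans _ _ (h^-1 * ((n.+2)`!%:R * h ^+ 2))).
    by rewrite ler_wpM2l ?flat_bound// invr_ge0 ltW.
  rewrite mulrCA expr2 [h^-1 * _]mulrA mulVf// mul1r.
  rewrite -ler_pdivlMl ?ltr0n ?fact_gt0//.
  apply: le_trans (ler_norm _) _; near: h; apply: dnbhs0_le.
  by rewrite mulr_gt0// invr_gt0 ltr0n fact_gt0.
Unshelve. all: by end_near. Qed.

Definition flatc n (y : 'cV[R]_1) : R^o := flat n (y 0 0).

Lemma flatc_D n v y : derivable (flatc n) y v /\
  'D_v (flatc n) y = v 0 0 *: (- n%:R *: flatc n.+1 y + flatc n.+2 y : R^o).
Proof.
  have dc : derivable (fun y : 'cV[R]_1 => y 0 0 : R^o) y v.
    exact/diff_derivable/differentiable_coord.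
  have df : differentiable (flat n : R -> R^o) (y 0 0).
    by apply/derivable1_diffP; have [] := is_derive_flat n (y 0 0).
  have [d1 d2] := derive_comp_diff (h := flat n : R -> R^o) dc df.
  split; first exact: d1.
  rewrite [LHS]d2; have [df1 Ef] := is_derive_flat n (y 0 0).
  have -> : 'D_v (fun y : 'cV[R]_1 => y 0 0 : R^o) y = v 0 0.
    have dx : derivable (fun y : 'cV[R]_1 => y) y v by exact: derivable_id.
    have /matrixP/(_ 0 0) := derive_mx dx.
    by rewrite mxE => <-; rewrite (derive_id y v).
  have -> : v 0 0 = v 0 0 *: (1 : R) by rewrite /GRing.scale /= mulr1.
  by have [_ ->] := derive_dirZ (v 0 0) df1; rewrite Ef /GRing.scale /= mulr1.
Qed.

Lemma flatc_C0 n : Ck 0 setT (flatc n).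
Proof.
have c y : {for y, continuous (flatc n)}.
  apply: (continuous_comp (f := fun y : 'cV[R]_1 => y 0 0) (g := flat n)).
    exact: coord_continuous.
  apply: (@differentiable_continuous _ R R^o); apply/derivable1_diffP.
  by have [] := is_derive_flat n (y 0 0).
by split=> // y _; exact: c.
Qed.

Lemma flatc_Ck k n : Ck k setT (flatc n).
Proof.
elim: k n => [|k IH] n; first exact: flatc_C0.
split=> [y _|v]; first by have [+ _] := flatc_C0 n; exact.
split=> [y _|]; first by have [] := flatc_D n v y.
have -> : 'D_v (flatc n) = (fun y => v 0 0 *: (- n%:R *: flatc n.+1 y + flatc n.+2 y : R^o)).
  by apply/funext => y; have [_] := flatc_D n v y.
apply: CkZ; first exact: openT.
by apply: CkD; [exact: openT|apply: CkZ => //; exact: openT|].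
Qed.

Lemma sm_flat {V : normedModType R} n (f : V -> R^o) (x : V) : sm f x ->
  sm (fun y => flat n (f y) : R^o) x.
Proof.
move=> sf; apply: (@sm_ext _ _ _ (fun y => flatc n (const_mx (f y)))).
  by move=> y; rewrite /flatc mxE.
apply: sm_comp_real.
  by apply/sm_mxP => i j; apply: sm_ext sf => y; rewrite mxE.
by exists setT; split=> //; [exact: openT|move=> k; exact: flatc_Ck].
Qed.

End flat_bump.

Lemma plateau {R : realType} {m : nat} (a : 'cV[R]_m) (rho : R) : 0 < rho ->
  exists chi : 'cV[R]_m -> R^o, [/\ forall x, sm chi x,
    forall x, 0 <= (chi x : R) <= 1,
    forall x, `|x - a| <= rho -> chi x = 1 &
    forall x, chi x != 0 -> `|x - a| < 2 * m.+1%:R * rho].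
Proof.
move=> rho0; pose c := m.+1%:R * rho ^+ 2.
have c0 : 0 < c by rewrite mulr_gt0 ?exprn_gt0.
pose s (x : 'cV[R]_m) : R^o := \sum_i (x i 0 - a i 0) * (x i 0 - a i 0).
have ss x : sm s x.
  apply: sm_sum => i; have h : sm (fun x : 'cV[R]_m => x i 0 - a i 0 : R^o) x.
    apply: (@smB _ _ _ (fun x : 'cV[R]_m => x i 0 : R^o) (fun=> a i 0)); last exact: sm_cst.
    exact: ((sm_mxP id x).1 (sm_id x) i 0).
  exact: (smM h h).
pose A x := flat 0 (2 * c - s x); pose B x := flat 0 (s x - c).
have AB x : 0 < A x + B x.
  have [h|h] := ltP (s x) (2 * c).
    by rewrite ltr_pwDl ?flat_ge0// flat_gt0// subr_gt0.
  by rewrite ltr_pwDr ?flat_ge0// flat_gt0//; lra.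
have sA x : sm (A : _ -> R^o) x.
  by apply: sm_flat; apply: (smB (sm_cst (2 * c : R^o) x) (ss x)).
have sB x : sm (B : _ -> R^o) x.
  by apply: sm_flat; apply: (smB (ss x) (sm_cst (c : R^o) x)).
exists (fun x => A x / (A x + B x)); split => [x|x|x xa|x].
- apply: (smM (sA x)); apply: (@smV _ _ (fun x => A x + B x : R^o)); first by rewrite gt_eqF.
  exact: smD (sA x) (sB x).
- rewrite divr_ge0 ?flat_ge0 ?(ltW (AB x))//= ler_pdivrMr// mul1r lerDl.
  exact: flat_ge0.
- suff : B x = 0; last first.
    rewrite /B /flat ifF//; apply/negbTE; rewrite -leNgt subr_le0.
    apply: (@le_trans _ _ (\sum_(i < m) rho ^+ 2)).
      apply: ler_sum => i _; rewrite -expr2 -real_normK ?num_real//.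
      rewrite ler_pXn2r ?nnegrE// ?(ltW rho0)//.
      by apply: le_trans xa; have := mx_entry_le (x - a) i 0; rewrite !mxE.
    by rewrite sumr_const card_ord -mulr_natl ler_wpM2r ?exprn_ge0 ?(ltW rho0)// ler_nat.
  move=> B0; have := AB x; rewrite B0 addr0 => A0.
  by rewrite divff// gt_eqF.
- move=> An0; have {An0} sc : s x < 2 * c.
    rewrite ltNge; apply: contra An0 => h.
    by rewrite /A /flat ifF ?mul0r ?eqxx//; apply/negbTE; rewrite -leNgt subr_le0.
  have m1 : 1 <= m.+1%:R :> R by rewrite ler1n.
  apply: (@le_lt_trans _ _ (3 / 2 * m.+1%:R * rho)); last first.
    by rewrite ltr_pM2r// ltr_pM2r ?ltr0n//; lra.
  have N0 : 0 <= 3 / 2 * m.+1%:R * rho by rewrite !mulr_ge0// ?invr_ge0// ltW.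
  apply/mx_norm_leP => // i j; rewrite (ord1 j) !mxE.
  rewrite -(@ler_pXn2r _ 2) ?nnegrE// real_normK ?num_real//.
  have : (x i 0 - a i 0) ^+ 2 <= s x.
    rewrite /s (bigD1 i)//= -expr2 lerDl; apply: sumr_ge0 => k _.
    by rewrite -expr2 sqr_ge0.
  move: sc; rewrite /c; move: (s x) ((x i 0 - a i 0) ^+ 2) (m.+1%:R : R) m1 => S D p m1 h1 h2.
  apply: le_trans h2 _; apply: le_trans (ltW h1) _.
  have : 0 <= rho ^+ 2 by rewrite exprn_ge0// ltW.
  rewrite !exprMn; move: (rho ^+ 2) => q q0.
  rewrite mulrA [2 * p * _]mulrC [leRHS]mulrC; apply: ler_wpM2l => //; nra.
Qed.

(** * Ordinary differential equations *)

Section curves.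
Context {R : realType}.

Lemma is_derive_entry m n (z : R -> 'M[R]_(m, n)) (s : R) (w : 'M[R]_(m, n)) :
  is_derive s 1 z w <-> forall i j, is_derive s 1 (fun t => z t i j) (w i j).
Proof.
split=> [[d <-] i j|H].
  have /derivable_mxP/(_ i j) dij := d.
  by apply: DeriveDef; [exact: dij|rewrite (derive_mx d) mxE].
have d : derivable z s 1 by apply/derivable_mxP => i j; have [] := H i j.
apply: DeriveDef => //; rewrite (derive_mx d); apply/matrixP => i j; rewrite mxE.
by have [] := H i j.
Qed.

Lemma is_derive_cont m n (z : R -> 'M[R]_(m, n)) (s : R) w :
  is_derive s 1 z w -> {for s, continuous z}.
Proof. by move=> [/derivable1_diffP d _]; exact: differentiable_continuous. Qed.

Lemma derive_le (f g f' g' : R -> R) (b : R) : f 0 <= g 0 ->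
  (forall s, 0 <= s <= b -> is_derive s 1 f (f' s)) ->
  (forall s, 0 <= s <= b -> is_derive s 1 g (g' s)) ->
  (forall s, 0 <= s <= b -> f' s <= g' s) ->
  forall s, 0 <= s <= b -> f s <= g s.
Proof.
move=> fg0 df dg fg s /andP[s0 sb].
have sub r : 0 <= r <= s -> 0 <= r <= b.
  by move=> /andP[-> /le_trans ->].
have dh r : 0 <= r <= b -> is_derive r 1 (g - f) (g' r - f' r).
  by move=> r01; apply: is_deriveB; [exact: dg|exact: df].
have [||r] := @MVT_segment R (g - f) (fun r => g' r - f' r) 0 s s0.
- by move=> r; rewrite in_itv /= => /andP[r0 rs]; apply: dh; apply: sub; rewrite !ltW.
- apply: continuous_in_subspaceT => r /[!inE] /=; rewrite in_itv /= => /sub /dh.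
  by move=> [/derivable1_diffP d _]; exact: differentiable_continuous.
- rewrite in_itv /= => /sub /fg fgr; rewrite !fctE subr0 => E.
  have : 0 <= (g' r - f' r) * s by rewrite mulr_ge0// subr_ge0.
  by rewrite -E; lra.
Qed.

Lemma curve_le m n (z w : R -> 'M[R]_(m, n)) (h h' : R -> R) (b : R) :
  `|z 0| <= h 0 ->
  (forall s, 0 <= s <= b -> is_derive s 1 z (w s)) ->
  (forall s, 0 <= s <= b -> is_derive s 1 h (h' s)) ->
  (forall s, 0 <= s <= b -> `|w s| <= h' s) ->
  forall s, 0 <= s <= b -> `|z s| <= h s.
Proof.
move=> z0 dz dh wh s sb.
have hge0 : 0 <= h s.
  apply: (@derive_le (cst 0) h (cst 0) h' b) => // [|r rb].
  - exact: le_trans z0.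
  - exact: le_trans (wh r rb).
apply/mx_norm_leP => // i j; rewrite ler_norml; apply/andP; split.
  rewrite lerNl; apply: (@derive_le (- (fun t => z t i j)) h (fun t => - w t i j) h' b) => //.
  - apply: le_trans z0; apply: le_trans (mx_entry_le (z 0) i j).
    by rewrite -normrN ler_norm.
  - by move=> r rb; apply: is_deriveN; have /is_derive_entry := dz r rb; exact.
  - move=> r rb; apply: le_trans (wh r rb); apply: le_trans (mx_entry_le (w r) i j).
    by rewrite -normrN ler_norm.
apply: (@derive_le (fun t => z t i j) h (fun t => w t i j) h' b) => //.
- apply: le_trans z0; apply: le_trans (mx_entry_le (z 0) i j); exact: ler_norm.
- by move=> r rb; have /is_derive_entry := dz r rb; exact.
- move=> r rb; apply: le_trans (wh r rb); apply: le_trans (mx_entry_le (w r) i j).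
  exact: ler_norm.
Qed.

Lemma antiderivative_real (f : R -> R) : continuous f ->
  exists G : R -> R, G 0 = 0 /\ forall s : R, 0 <= s -> is_derive s 1 G (f s).
Proof.
move=> cf; pose mu := @lebesgue_measure R.
pose F (x : R) : R := (\int[mu]_(t in [set` `[-1, x]]) (f t))%R.
exists (fun x => F x - F 0); rewrite subrr; split=> // s s0.
have s1 : s < s + 1 by rewrite ltrDl.
have int : mu.-integrable `[-1, s + 1] (EFin \o f).
  apply: continuous_compact_integrable; first exact: segment_compact.
  exact: continuous_subspaceT.
have a : -1 < s by rewrite (lt_le_trans _ s0)// oppr_lt0.
have [d E] := continuous_FTC1_closed s1 int a (cf s).
have H : is_derive s 1 F (f s).
  by apply: DeriveDef; [exact: d|rewrite -derive1E; exact: E].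
have := is_deriveB H (is_derive_cst (F 0) s 1).
by rewrite subr0.
Qed.

Lemma antiderivative m n (f : R -> 'M[R]_(m, n)) : continuous f ->
  exists G : R -> 'M[R]_(m, n), G 0 = 0 /\ forall s : R, 0 <= s -> is_derive s 1 G (f s).
Proof.
move=> cf.
have H i j : exists G : R -> R, G 0 = 0 /\ forall s : R, 0 <= s -> is_derive s 1 G (f s i j).
  apply: antiderivative_real => s.
  by have /continuous_mxP := cf s; exact.
pose G i j := sval (cid (H i j)).
exists (fun s => \matrix_(i, j) G i j s); split.
  by apply/matrixP => i j; rewrite !mxE; have [] := svalP (cid (H i j)).
move=> s s0; apply/is_derive_entry => i j.
have [_ /(_ s s0)] := svalP (cid (H i j)).
by under [X in _ -> is_derive _ _ X _]eq_fun do rewrite mxE.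
Qed.

Lemma geo_lim (u : nat -> R) (C : R) :
  (forall n, `|u n.+1 - u n| <= C * 2^-1 ^+ n) ->
  exists l, forall n, `|u n - l| <= 2 * C * 2^-1 ^+ n.
Proof.
move=> H; pose a n := u n - 2 * C * 2^-1 ^+ n; pose b n := u n + 2 * C * 2^-1 ^+ n.
have C0 : 0 <= C by have := H 0%N; rewrite expr0 mulr1; apply: le_trans.
have p0 n : 0 <= (2^-1 : R) ^+ n by rewrite exprn_ge0// invr_ge0.
have aS n : a n <= a n.+1.
  have := H n; rewrite ler_norml => /andP[+ _]; have := p0 n; rewrite /a exprS.
  by move: (u n) (u n.+1) (_ ^+ n) => x y z; lra.
have bS n : b n.+1 <= b n.
  have := H n; rewrite ler_norml => /andP[_ +]; have := p0 n; rewrite /b exprS.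
  by move: (u n) (u n.+1) (_ ^+ n) => x y z; lra.
have amono n k : a n <= a (n + k)%N.
  by elim: k => [|k IH]; rewrite ?addn0 ?addnS//; exact: le_trans (aS _).
have bmono n k : b (n + k)%N <= b n.
  by elim: k => [|k IH]; rewrite ?addn0 ?addnS//; exact: le_trans (bS _) _.
have ab n k : a n <= b k.
  apply: le_trans (amono n k) _; apply: le_trans (_ : b (n + k)%N <= _); last first.
    by rewrite addnC bmono.
  have := p0 (n + k)%N; rewrite /a /b; move: (_ ^+ _) (u _) => z x.
  have := C0; nra.
pose S := [set a n | n in setT].
have S0 : S !=set0 by exists (a 0%N); exists 0%N.
have Sub n : ubound S (b n) by move=> _ [k _ <-].
have hS : has_sup S by split=> //; exists (b 0%N).
exists (sup S) => n; rewrite ler_norml.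
have A1 : a n <= sup S by apply: sup_upper_bound => //; exists n.
have A2 : sup S <= b n by apply: ge_sup => //; exact: Sub.
by move: A1 A2; rewrite /a /b => A1 A2; apply/andP; split; lra.
Qed.

Lemma geo_lim_mx m n (u : nat -> 'M[R]_(m, n)) (C : R) :
  (forall k, `|u k.+1 - u k| <= C * 2^-1 ^+ k) ->
  exists l, forall k, `|u k - l| <= 2 * C * 2^-1 ^+ k.
Proof.
move=> H; have C0 : 0 <= C by have := H 0%N; rewrite expr0 mulr1; apply: le_trans.
have K i j : exists l, forall k, `|u k i j - l| <= 2 * C * 2^-1 ^+ k.
  apply: geo_lim => k; apply: le_trans (H k).
  by have := mx_entry_le (u k.+1 - u k) i j; rewrite !mxE.
exists (\matrix_(i, j) sval (cid (K i j))) => k; apply/mx_norm_leP => [|i j].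
  by rewrite !mulr_ge0// exprn_ge0// invr_ge0.
by rewrite !mxE; exact: (svalP (cid (K i j))).
Qed.

Lemma pow_small (C e : R) : 0 < e -> exists n, C * 2^-1 ^+ n < e.
Proof.
move=> e0; exists (Num.truncn (C / e)).+1.
have nC : C / e < (Num.truncn (C / e)).+1%:R by apply: truncnS_gt.
rewrite exprVn ltr_pdivrMr ?exprn_gt0// mulrC -ltr_pdivrMr//.
by apply: lt_le_trans nC _; rewrite -natrX ler_nat ltnW// ltn_expl.
Qed.

Lemma small_pow (x C : R) : 0 <= x -> (forall n, x <= C * 2^-1 ^+ n) -> x = 0.
Proof.
move=> x0 H; apply/eqP; rewrite eq_le x0 andbT leNgt; apply/negP => xp.
have [n] := pow_small C xp.
by rewrite ltNge H.
Qed.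

End curves.

Section picard.
Context {R : realType} {N : nat}.
Implicit Types (F : 'cV[R]_N -> 'cV[R]_N) (x : 'cV[R]_N).

Definition sol F x (z : R -> 'cV[R]_N) :=
  z 0 = x /\ forall s : R, 0 <= s <= 1 -> is_derive s 1 z (F (z s)).

Let pos (s : R) : R := Num.max s 0.

Let pos_ge0 s : 0 <= pos s. Proof. by rewrite le_max lexx orbT. Qed.

Let posE s : 0 <= s -> pos s = s. Proof. by move=> s0; rewrite /pos max_l. Qed.

Let pos_lip s t : `|pos s - pos t| <= `|s - t|.
Proof.
rewrite /pos; have [s0|s0] := leP s 0; have [t0|t0] := leP t 0; rewrite ?subrr ?normr0//.
- rewrite sub0r normrN gtr0_norm// ler0_norm; lra.
- rewrite subr0 gtr0_norm// ger0_norm; lra.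
Qed.

Let pos_cont (z : R -> 'cV[R]_N) : (forall s, 0 <= s -> {for s, continuous z}) ->
  continuous (fun s => z (pos s)).
Proof.
move=> cz s; apply/cont_normP => e e0.
have [r r0 Hr] := (cont_normP z (pos s)).1 (cz _ (pos_ge0 s)) e e0.
by exists r => // t ts; apply: Hr; apply: le_lt_trans ts; exact: pos_lip.
Qed.

Lemma picard F (L : R) x : 0 <= L -> (forall a b, `|F a - F b| <= L * `|a - b|) ->
  exists z, sol F x z.
Proof.
move=> L0 LF.
have cF a : {for a, continuous F}.
  apply/cont_normP => e e0; exists (e / (L + 1)); first by rewrite divr_gt0// ltr_pwDr.
  move=> y ya; apply: le_trans (LF y a) _.
  have L1 : 0 < L + 1 by rewrite ltr_pwDr.
  move: ya; rewrite ltr_pdivlMr// => /ltW; apply: le_trans.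
  by rewrite mulrC ler_wpM2l// lerDl.
have step (z : R -> 'cV[R]_N) : (forall s, 0 <= s -> {for s, continuous z}) ->
    exists w : R -> 'cV[R]_N, w 0 = x /\ forall s : R, 0 <= s -> is_derive s 1 w (F (z s)).
  move=> cz; have cf : continuous (fun s => F (z (pos s))).
    move=> s; apply: (continuous_comp (f := fun s => z (pos s)) (g := F)); last exact: cF.
    exact: pos_cont.
  have [G [G0 dG]] := antiderivative cf.
  exists (fun s => x + G s); split=> [|s s0]; first by rewrite G0 addr0.
  have := is_deriveD (is_derive_cst x s 1) (dG s s0).
  by rewrite add0r posE.
pose good (z : R -> 'cV[R]_N) := forall s, 0 <= s -> {for s, continuous z}.
have goodw w z : (forall s : R, 0 <= s -> is_derive s 1 w (F (z s))) -> good w.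
  by move=> H s /H; exact: is_derive_cont.
have [u [u0 uS]] : exists u : nat -> R -> 'cV[R]_N, u 0%N = (fun=> x) /\
    forall n, good (u n) /\ (u n.+1 0 = x /\
      forall s : R, 0 <= s -> is_derive s 1 (u n.+1) (F (u n s))).
  have g0 : good (fun=> x) by move=> s _; exact: cvg_cst.
  pose T := {z : R -> 'cV[R]_N | good z}.
  pose nxt (z : T) : T := exist _ (sval (cid (step _ (svalP z))))
     (goodw _ _ (svalP (cid (step _ (svalP z)))).2).
  exists (fun n => sval (iter n nxt (exist _ _ g0))); split=> // n.
  split; first exact: svalP.
  exact: (svalP (cid (step _ (svalP (iter n nxt (exist _ _ g0)))))).
pose K := 2 * L + 1; pose C := `|F x|.
have K1 : 1 <= K by rewrite /K lerDr mulr_ge0.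
have C0 : 0 <= C by exact: normr_ge0.
have dexp (c s : R) : is_derive s 1 (fun t : R => c * expR (K * t)) (c * K * expR (K * s)).
  have d1 : is_derive s (1 : R) (fun t : R => K * t) (K * 1).
    by apply: is_deriveZ.
  have d2 := is_derive1_comp (f := expR) (is_derive_expR (K * s)) d1.
  have d3 := is_deriveZ c d2.
  by rewrite -[c * K * _]mulrA [K * _]mulrC -[X in _ * X]mulr1 -!mulrA.
have p0 n : 0 <= (2^-1 : R) ^+ n by rewrite exprn_ge0// invr_ge0.
have ub0 n : u n 0 = x by case: n => [|n]; [rewrite u0|have [_ []] := uS n].
have bnd n s : 0 <= s -> `|u n.+1 s - u n s| <= C * 2^-1 ^+ n * expR (K * s).
  elim: n s => [|n IH] s s0.
    rewrite expr0 mulr1 u0.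
    apply: (@curve_le _ _ _ (fun s => u 1%N s - x) (fun=> F x) (fun t => C * expR (K * t))
       (fun t => C * K * expR (K * t)) s) => //; last by rewrite lexx s0.
    - by rewrite ub0 subrr normr0 mulr_ge0// expR_ge0.
    - move=> r /andP[r0 _]; have [_ [_ /(_ r r0)]] := uS 0%N; rewrite u0 => d.
      by have := is_deriveB d (is_derive_cst x r 1); rewrite subr0.
    - move=> r /andP[r0 _]; rewrite -mulrA ler_peMr// -[1]mulr1 ler_pM//.
      by rewrite (le_trans _ (expR_ge1Dx _))// lerDl mulr_ge0// (le_trans _ K1).
  apply: (@curve_le _ _ _ (fun s => u n.+2 s - u n.+1 s) (fun t => F (u n.+1 t) - F (u n t))
       (fun t => C * 2^-1 ^+ n.+1 * expR (K * t))
       (fun t => C * 2^-1 ^+ n.+1 * K * expR (K * t)) s) => //; last by rewrite lexx s0.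
  - by rewrite !ub0 subrr normr0 !mulr_ge0// expR_ge0.
  - move=> r /andP[r0 _]; apply: is_deriveB.
      by have [_ [_ /(_ r r0)]] := uS n.+1.
    by have [_ [_ /(_ r r0)]] := uS n.
  - move=> r /andP[r0 _]; apply: le_trans (LF _ _) _.
    apply: le_trans (ler_wpM2l L0 (IH r r0)) _.
    have E : 0 <= C * 2^-1 ^+ n * expR (K * r) by rewrite !mulr_ge0// expR_ge0.
    have -> : C * 2^-1 ^+ n.+1 * K * expR (K * r) = K / 2 * (C * 2^-1 ^+ n * expR (K * r)).
      by rewrite exprS; ring.
    by rewrite ler_wpM2r// /K; lra.
have lim s : exists l, forall n, `|u n (pos s) - l| <= 2 * (C * expR (K * pos s)) * 2^-1 ^+ n.
  apply: geo_lim_mx => n; rewrite mulrAC; exact: bnd.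
pose z s := sval (cid (lim s)).
have zlim' s n : `|u n (pos s) - z s| <= 2 * (C * expR (K * pos s)) * 2^-1 ^+ n.
  exact: (svalP (cid (lim s))).
have zlim s : 0 <= s -> forall n, `|u n s - z s| <= 2 * (C * expR (K * s)) * 2^-1 ^+ n.
  by move=> s0 n; have := zlim' s n; rewrite posE.
have cz : good z.
  move=> s s0; apply/cont_normP => e e0.
  have e3 : 0 < e / 3 by rewrite divr_gt0.
  have [n Hn] := pow_small (2 * (C * expR (K * (s + 1)))) e3.
  have [g0 _] := uS n.
  have cn : {for (s : R), continuous (fun s => u n (pos s))} by exact: pos_cont.
  have [r r0 Hr] := (cont_normP _ _).1 cn _ e3.
  exists (Num.min r 1); first by rewrite lt_min r0 ltr01.
  move=> t; rewrite lt_min => /andP[/Hr tr t1].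
  have near w : `|w - s| < 1 -> `|u n (pos w) - z w| <= e / 3.
    move=> w1; apply: le_trans (zlim' w n) _; apply: le_trans (ltW Hn).
    rewrite ler_wpM2r// ler_wpM2l// ler_wpM2l// ler_expR ler_wpM2l ?(le_trans _ K1)//.
    have := pos_lip w s; rewrite (posE s0) => /le_lt_trans/(_ w1).
    by rewrite ltr_norml => /andP[_]; lra.
  have h1 := near t t1.
  have h2 := near s _; rewrite subrr normr0 in h2; have {}h2 := h2 ltr01.
  have -> : z t - z s = - (u n (pos t) - z t) + (u n (pos t) - u n (pos s)) + (u n (pos s) - z s).
    by rewrite opprB !subrKA.
  apply: le_trans (ler_normD _ _) _; apply: le_trans (lerD (ler_normD _ _) (lexx _)) _.
  rewrite normrN; move: h1 h2 tr.
  move: (`|u n (pos t) - z t|) (`|u n (pos s) - z s|) (`|u n (pos t) - u n (pos s)|).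
  by move=> p q w; lra.
have [w [w0 dw]] := step z cz.
have zw s : 0 <= s -> z s = w s.
  move=> s0; apply/eqP; rewrite -subr_eq0 -normr_eq0; apply/eqP.
  apply: (@small_pow _ _ (4 * (C * expR (K * s)))) => // n.
  have H1 := zlim s s0 n.+1.
  have H2 : `|u n.+1 s - w s| <= 2 * C * 2^-1 ^+ n * expR (K * s).
    apply: (@curve_le _ _ _ (fun s => u n.+1 s - w s) (fun t => F (u n t) - F (z t))
       (fun t => 2 * C * 2^-1 ^+ n * expR (K * t))
       (fun t => 2 * C * 2^-1 ^+ n * K * expR (K * t)) s) => //; last by rewrite lexx s0.
    - by rewrite ub0 w0 subrr normr0 !mulr_ge0// expR_ge0.
    - move=> r /andP[r0 _]; apply: is_deriveB; last exact: dw.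
      by have [_ [_ /(_ r r0)]] := uS n.
    - move=> r /andP[r0 _]; apply: le_trans (LF _ _) _.
      apply: le_trans (ler_wpM2l L0 (zlim r r0 n)) _.
      have E : 0 <= C * 2^-1 ^+ n * expR (K * r) by rewrite !mulr_ge0// expR_ge0.
      have -> : 2 * C * 2^-1 ^+ n * K * expR (K * r) = 2 * K * (C * 2^-1 ^+ n * expR (K * r)).
        by ring.
      have -> : L * (2 * (C * expR (K * r)) * 2^-1 ^+ n) = 2 * L * (C * 2^-1 ^+ n * expR (K * r)).
        by ring.
      by rewrite ler_wpM2r// /K; lra.
  have -> : z s - w s = - (u n.+1 s - z s) + (u n.+1 s - w s).
    by rewrite opprB subrKA.
  apply: le_trans (ler_normD _ _) _; rewrite normrN.
  have E : 0 <= C * expR (K * s) * 2^-1 ^+ n by rewrite !mulr_ge0// expR_ge0.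
  have E2 : 2 * C * 2^-1 ^+ n * expR (K * s) = 2 * (C * expR (K * s) * 2^-1 ^+ n) by ring.
  have E1 : 2 * (C * expR (K * s)) * 2^-1 ^+ n.+1 = C * expR (K * s) * 2^-1 ^+ n.
    by rewrite exprS; field.
  rewrite E1 in H1; rewrite E2 in H2; rewrite -mulrA; move: E H1 H2.
  by move: (C * expR (K * s) * 2^-1 ^+ n) (`|u n.+1 s - z s|) (`|u n.+1 s - w s|) => p A B; lra.
exists w; split=> // s /andP[s0 _]; rewrite -zw//; exact: dw.
Qed.

End picard.

Section gronwall.
Context {R : realType} {N : nat}.

Definition sqn n (w : 'cV[R]_n) : R := \sum_i w i 0 ^+ 2.

Lemma sqn_ge0 n (w : 'cV[R]_n) : 0 <= sqn w.
Proof. by apply: sumr_ge0 => i _; exact: sqr_ge0. Qed.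

Lemma sqn_le n (w : 'cV[R]_n) : sqn w <= n%:R * `|w| ^+ 2.
Proof.
apply: (@le_trans _ _ (\sum_(i < n) `|w| ^+ 2)).
  apply: ler_sum => i _; rewrite -real_normK ?num_real// ler_pXn2r ?nnegrE//.
  exact: mx_entry_le.
by rewrite sumr_const card_ord mulr_natl lexx.
Qed.

Lemma sqn_ge n (w : 'cV[R]_n) : `|w| ^+ 2 <= sqn w.
Proof.
have h : 0 <= Num.sqrt (sqn w) by exact: sqrtr_ge0.
rewrite -[leRHS]sqr_sqrtr ?sqn_ge0// ler_pXn2r ?nnegrE//.
apply/mx_norm_leP => // i j; rewrite (ord1 j) -sqrtr_sqr ler_wsqrtr//.
by rewrite /sqn (bigD1 i)//= lerDl; apply: sumr_ge0 => k _; exact: sqr_ge0.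
Qed.

Lemma gronwall (w w' : R -> 'cV[R]_N) (C e : R) : 0 <= C -> 0 <= e ->
  (forall s : R, 0 <= s <= 1 -> is_derive s 1 w (w' s)) ->
  (forall s, 0 <= s <= 1 -> sqn (w' s) <= C * sqn (w s) + e) ->
  forall s, 0 <= s <= 1 -> sqn (w s) <= expR (C + 1) * (sqn (w 0) + e).
Proof.
move=> C0 e0 dw Hw s s01; pose K := C + 1.
have dq (r : R) : 0 <= r <= 1 ->
    is_derive r (1 : R) (fun t => sqn (w t)) (\sum_i 2 * (w r i 0 * w' r i 0)).
  move=> r01.
  have -> : (fun t => sqn (w t)) = \sum_(i < N) ((fun t => w t i 0) * (fun t => w t i 0)).
    by apply/funext => t; rewrite fct_sumE; apply: eq_bigr => i _; rewrite expr2.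
  have di i : is_derive r (1 : R) ((fun t => w t i 0) * (fun t => w t i 0)) (2 * (w r i 0 * w' r i 0)).
    have /is_derive_entry/(_ i 0) d := dw r r01.
    have := is_deriveM d d; rewrite /GRing.scale /= => d2.
    by apply: is_derive_eq d2 _; ring.
  exact: is_derive_sum.
have dx (r : R) : is_derive r (1 : R) (fun t : R => expR (- K * t)) (- K * expR (- K * r)).
  have d1 : is_derive r (1 : R) (fun t : R => - K * t) (- K * 1).
    exact: is_deriveZ.
  have := is_derive1_comp (f := expR) (is_derive_expR (- K * r)) d1.
  by rewrite mulr1 mulrC.
pose psi t := expR (- K * t) * (sqn (w t) + e).
pose dpsi t := expR (- K * t) * (\sum_i 2 * (w t i 0 * w' t i 0)) + (- K * expR (- K * t)) * (sqn (w t) + e).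
have dps (r : R) : 0 <= r <= 1 -> is_derive r (1 : R) psi (dpsi r).
  move=> r01; have d1 := is_deriveD (dq r r01) (is_derive_cst e r 1).
  have := is_deriveM (dx r) d1; rewrite /GRing.scale /= addr0 => d2.
  by apply: is_derive_eq d2 _; rewrite /dpsi; congr (_ + _); rewrite mulrC.
have : psi s <= psi 0.
  apply: (@derive_le _ psi (cst (psi 0)) dpsi (cst 0) 1) => //.
  move=> r r01; have E0 := expR_ge0 (- K * r).
  have H1 : \sum_i 2 * (w r i 0 * w' r i 0) <= sqn (w r) + sqn (w' r).
    rewrite /sqn -big_split /=; apply: ler_sum => i _; rewrite -subr_ge0.
    have -> : w r i 0 ^+ 2 + w' r i 0 ^+ 2 - 2 * (w r i 0 * w' r i 0) = (w r i 0 - w' r i 0) ^+ 2 by ring.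
    exact: sqr_ge0.
  have H2 := Hw r r01.
  have -> : dpsi r = expR (- K * r) * (\sum_i 2 * (w r i 0 * w' r i 0) - K * (sqn (w r) + e)).
    by rewrite /dpsi; move: (\sum_i _) (expR _) => p q; ring.
  rewrite /cst mulr_ge0_le0// /K; move: H1 H2 (mulr_ge0 C0 e0).
  by move: (\sum_i _) (sqn (w r)) (sqn (w' r)) => a b d; lra.
rewrite /psi mulr0 expR0 mul1r mulNr expRN ler_pdivrMl ?expR_gt0// => H.
have sq := sqn_ge0 (w 0).
apply: le_trans (_ : expR (K * s) * (sqn (w 0) + e) <= _); last first.
  rewrite ler_wpM2r ?addr_ge0// ler_expR -[leRHS]mulr1 ler_wpM2l//.
    by rewrite /K addr_ge0.
  by case/andP: s01.
by apply: le_trans H; rewrite lerDl.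
Qed.

End gronwall.

Section cV_compact.
Context {R : realType} {m : nat}.

Lemma cV_cball_compact (a : 'cV[R]_m) (r : R) : compact [set y : 'cV[R]_m | `|y - a| <= r].
Proof.
have ct p q : continuous (fun y : 'M[R]_(p, q) => y^T).
  move=> y; apply/continuous_mxP => i j.
  have -> : (fun z : 'M[R]_(p, q) => z^T i j : R^o) = (fun z => z j i).
    by apply/funext => z; rewrite mxE.
  exact: coord_continuous.
have -> : [set y : 'cV[R]_m | `|y - a| <= r] =
   (fun y : 'rV[R]_m => y^T) @` [set y : 'rV[R]_m | `|y - a^T| <= r].
  have nt p q (y : 'M[R]_(p, q)) : `|y^T| <= `|y|.
    by apply/mx_norm_leP => // i j; rewrite mxE; exact: mx_entry_le.
  apply/seteqP; split=> [y /= yr|_ [y /= yr <-]].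
    exists y^T; last by rewrite trmxK.
    by rewrite /= -linearB; apply: le_trans yr; exact: nt.
  rewrite -[a]trmxK -linearB; apply: le_trans yr; exact: nt.
apply: continuous_compact.
  by apply: continuous_subspaceT => y; exact: ct.
apply: bounded_closed_compact.
  exists (`|a^T| + r); split; first exact: num_real.
  move=> M Mr y /= yr; apply: le_trans (ltW Mr).
  by rewrite -[y](subrK a^T) addrC; apply: le_trans (ler_normD _ _) _; rewrite lerD.
rewrite -[X in closed X]setCK; apply: open_closedC.
rewrite openE => y /= /negP; rewrite -ltNge => ry; apply/nbhs_normP.
exists (`|y - a^T| - r); first by rewrite subr_gt0.
move=> z zy /= ; apply/negP; rewrite -ltNge.
have := ler_distD z y a^T; rewrite [`|y - z|]distrC; move: zy.
by move: (`|z - y|) (`|y - a^T|) (`|z - a^T|) => p q t; lra.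
Qed.

Lemma cball_bounded (f : 'cV[R]_m -> R^o) a (r : R) :
  (forall x, {for x, continuous f}) -> exists2 B : R, 0 <= B &
  forall x, `|x - a| <= r -> `|f x : R| <= B.
Proof.
move=> cf; have [r0|r0] := ltP r 0.
  exists 0 => // x xr; have : 0 <= r by exact: le_trans xr.
  by rewrite leNgt r0.
have cn : continuous (fun x => `|f x : R|).
  by move=> x; apply: (continuous_comp (g := fun y : R => `|y|)) (cf x) _; exact: norm_continuous.
have [c _ Hc] : exists2 c, c \in [set y : 'cV[R]_m | `|y - a| <= r] &
    forall t, t \in [set y : 'cV[R]_m | `|y - a| <= r] -> `|f t : R| <= `|f c : R|.
  apply: (@compact_EVT_max _ R (fun x => `|f x : R|)).
  - by exists a; rewrite /= subrr normr0.
  - exact: cV_cball_compact.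
  - exact: continuous_subspaceT.
by exists (`|f c : R|) => // x xr; apply: Hc; rewrite inE.
Qed.

End cV_compact.

Section cpt_supp.
Context {R : realType} {m p : nat}.

(* Smooth maps with compact support; this class is closed under derivation and
   under the extension of a vector field by its (cut off) variational equation. *)
Definition csm (F : 'cV[R]_m -> 'cV[R]_p) :=
  (forall x, sm F x) /\ exists rho : R, forall x, rho < `|x| -> F x = 0.

Lemma dd_supp (F : 'cV[R]_m -> 'cV[R]_p) v (rho : R) : (forall x, rho < `|x| -> F x = 0) ->
  forall x, rho < `|x| -> dd v F x = 0.
Proof.
move=> F0 x rx; rewrite -[RHS](@Dcst _ _ _ (0 : 'cV[R]_p) x v); apply: D_eq.
apply/nbhs_normP; exists (`|x| - rho); first by rewrite subr_gt0.
move=> y yx; apply: F0; have := lerB_dist x y; rewrite distrC; move: yx.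
by move: (`|y - x|) (`|x|) (`|y|) => a b c; lra.
Qed.

Lemma csm_D F v : csm F -> csm (dd v F).
Proof.
by move=> [sF [rho F0]]; split=> [x|]; [exact: sm_D|exists rho; exact: dd_supp].
Qed.

Lemma csm_bounded F : csm F -> exists2 B : R, 0 <= B & forall x, `|F x| <= B.
Proof.
move=> [sF [rho F0]].
have H i : exists2 B : R, 0 <= B & forall x, `|x - 0| <= rho -> `|F x i 0| <= B.
  apply: (cball_bounded (f := fun x => F x i 0 : R^o)) => x; apply: sm_cont.
  exact: (sm_mxP F x).1.
pose B i := s2val (cid2 (H i)).
have B0 i : 0 <= B i by exact: (s2valP (cid2 (H i))).
exists (\sum_i B i) => [|x]; first exact: sumr_ge0.
apply/mx_norm_leP => [|i j]; first exact: sumr_ge0.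
rewrite (ord1 j) (bigD1 i)//=; have [xr|xr] := leP `|x| rho; last first.
  by rewrite F0// mxE normr0 addr_ge0// sumr_ge0.
apply: (@le_trans _ _ (B i)); last by rewrite lerDl sumr_ge0.
by apply: (s2valP' (cid2 (H i))); rewrite subr0.
Qed.

Lemma dd_bounded F : csm F -> exists2 B : R, 0 <= B & forall x v, `|dd v F x| <= B * `|v|.
Proof.
move=> cF; have H i := csm_bounded (csm_D (delta_mx i 0 : 'cV[R]_m) cF).
pose B i := s2val (cid2 (H i)).
have B0 i : 0 <= B i by exact: (s2valP (cid2 (H i))).
have Bx i x : `|dd (delta_mx i 0 : 'cV[R]_m) F x| <= B i by exact: (s2valP' (cid2 (H i))).
exists (\sum_i B i) => [|x v]; first exact: sumr_ge0.
rewrite {1}(col_sum_delta v) D_dir_sum; last exact: cF.1.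
rewrite mulr_suml; apply: le_trans (ler_norm_sum _ _ _) _; apply: ler_sum => i _.
rewrite D_dirZ; last exact: cF.1.
by rewrite normrZ mulrC ler_pM// mx_entry_le.
Qed.

Lemma MVT_le (F : 'cV[R]_m -> 'cV[R]_p) x v (G : 'cV[R]_p) (B : R) :
  (forall r : R, 0 <= r <= 1 -> sm F (x + r *: v)) ->
  (forall r : R, 0 <= r <= 1 -> `|dd v F (x + r *: v) - G| <= B) ->
  `|F (x + v) - F x - G| <= B.
Proof.
move=> sF H; have B0 : 0 <= B by apply: le_trans (H 0 _); rewrite ?lexx ?ler01.
apply/mx_norm_leP => // i j; rewrite (ord1 j).
have [r r01|r r01 E] := @MVT_line R _ (fun y => F y i 0 : R^o) x v.
  by apply: sm_derivable; apply: (sm_mxP F _).1; exact: sF.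
have E' : (dd v F (x + r *: v)) i 0 = F (x + v) i 0 - F x i 0.
  by rewrite (D_entry v i 0 (sF _ r01)) unlock E.
apply: le_trans (H r r01); have := mx_entry_le (dd v F (x + r *: v) - G) i 0.
by rewrite !mxE E'.
Qed.

Lemma csm_lip F : csm F -> exists2 L : R, 0 <= L & forall a b, `|F a - F b| <= L * `|a - b|.
Proof.
move=> cF; have [B B0 HB] := dd_bounded cF; exists B => // a b.
have := @MVT_le F b (a - b) 0 (B * `|a - b|) (fun _ _ => cF.1 _).
rewrite subr0 [b + _]addrC subrK; apply => r _; rewrite subr0; exact: HB.
Qed.

End cpt_supp.

Section cpt_supp2.
Context {R : realType} {m p : nat}.

Lemma dd_lip (F : 'cV[R]_m -> 'cV[R]_p) : csm F -> exists2 C : R, 0 <= C &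
  forall a b v, `|dd v F a - dd v F b| <= C * `|v| * `|a - b|.
Proof.
move=> cF; have H i := csm_lip (csm_D (delta_mx i 0 : 'cV[R]_m) cF).
pose L i := s2val (cid2 (H i)).
have L0 i : 0 <= L i by exact: (s2valP (cid2 (H i))).
have HL i a b : `|dd (delta_mx i 0 : 'cV[R]_m) F a - dd (delta_mx i 0 : 'cV[R]_m) F b| <= L i * `|a - b|.
  exact: (s2valP' (cid2 (H i))).
exists (\sum_i L i) => [|a b v]; first exact: sumr_ge0.
rewrite {1 2}(col_sum_delta v) !D_dir_sum; try exact: cF.1.
rewrite -sumrB !mulr_suml; apply: le_trans (ler_norm_sum _ _ _) _; apply: ler_sum => i _.
rewrite !D_dirZ; try exact: cF.1.
rewrite -scalerBr normrZ [L i * _]mulrC -mulrA ler_pM//; exact: mx_entry_le.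
Qed.

Lemma csm_taylor (F : 'cV[R]_m -> 'cV[R]_p) : csm F -> exists2 C : R, 0 <= C &
  forall a b, `|F b - F a - dd (b - a) F a| <= C * `|b - a| ^+ 2.
Proof.
move=> cF; have [C C0 HC] := dd_lip cF; exists C => // a b.
have := @MVT_le _ _ _ F a (b - a) (dd (b - a) F a) (C * `|b - a| ^+ 2) (fun _ _ => cF.1 _).
rewrite [a + _]addrC subrK; apply => r /andP[r0 r1].
apply: le_trans (HC _ _ _) _; rewrite expr2 -mulrA ler_wpM2l// ler_wpM2l//.
by rewrite addrC addKr normrZ ger0_norm// ler_piMl.
Qed.

End cpt_supp2.

Section flow.
Context {R : realType}.

Lemma flow_ex N (F : 'cV[R]_N -> 'cV[R]_N) x : csm F -> exists z, sol F x z.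
Proof. by move=> /csm_lip[L L0 HL]; exact: picard L0 HL. Qed.

Lemma flow_lip N (F : 'cV[R]_N -> 'cV[R]_N) : csm F -> exists2 C : R, 0 <= C &
  forall x x' z z', sol F x z -> sol F x' z' ->
  forall s, 0 <= s <= 1 -> `|z s - z' s| <= C * `|x - x'|.
Proof.
move=> /csm_lip[L L0 HL]; pose K := N%:R * L ^+ 2.
have K0 : 0 <= K by rewrite mulr_ge0// exprn_ge0.
exists (Num.sqrt (expR (K + 1) * N%:R)); first exact: sqrtr_ge0.
move=> x x' z z' [z0 dz] [z0' dz'] s s01.
have H := @gronwall R N (fun s => z s - z' s) (fun s => F (z s) - F (z' s)) K 0 K0 (lexx 0).
have {}H : sqn (z s - z' s) <= expR (K + 1) * (sqn (z 0 - z' 0) + 0).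
  apply: H s01 => [r r01|r _].
    by apply: is_deriveB; [exact: dz|exact: dz'].
  rewrite addr0; apply: le_trans (sqn_le _) _; rewrite /K -mulrA ler_wpM2l//.
  apply: le_trans (_ : (L * `|z r - z' r|) ^+ 2 <= _).
    by rewrite ler_pXn2r ?nnegrE ?mulr_ge0.
  by rewrite exprMn ler_wpM2l ?exprn_ge0// sqn_ge.
have : `|z s - z' s| ^+ 2 <= (Num.sqrt (expR (K + 1) * N%:R) * `|x - x'|) ^+ 2.
  apply: le_trans (sqn_ge _) _; apply: le_trans H _.
  rewrite exprMn sqr_sqrtr ?mulr_ge0 ?expR_ge0// addr0 z0 z0' -mulrA.
  by rewrite ler_wpM2l ?expR_ge0// sqn_le.
by rewrite ler_pXn2r ?nnegrE// mulr_ge0// sqrtr_ge0.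
Qed.

Lemma flow_uniq N (F : 'cV[R]_N -> 'cV[R]_N) x z z' : csm F ->
  sol F x z -> sol F x z' -> forall s, 0 <= s <= 1 -> z s = z' s.
Proof.
move=> /flow_lip[C C0 HC] sz sz' s s01; apply/eqP; rewrite -subr_eq0 -normr_le0.
by apply: le_trans (HC _ _ _ _ sz sz' s s01) _; rewrite subrr normr0 mulr0.
Qed.

(* The deviation z_h - z - h y solves a linear inhomogeneous equation whose
   right-hand side is O(h^2). *)
Lemma flow_variation N (F : 'cV[R]_N -> 'cV[R]_N) x v z y : csm F ->
  sol F x z -> y 0 = v ->
  (forall s : R, 0 <= s <= 1 -> is_derive s 1 y (dd (y s) F (z s))) ->
  exists2 C : R, 0 <= C & forall (h : R) zh, sol F (x + h *: v) zh ->
    `|zh 1 - z 1 - h *: y 1| <= C * h ^+ 2.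
Proof.
move=> cF sz y0 dy; have [C1 C10 HC1] := flow_lip cF.
have [C2 C20 HC2] := csm_taylor cF; have [B B0 HB] := dd_bounded cF.
pose K := 2 * N%:R * B ^+ 2.
have K0 : 0 <= K by rewrite !mulr_ge0// exprn_ge0.
pose E := C2 * (C1 * `|v|) ^+ 2.
have E0 : 0 <= E by rewrite mulr_ge0// exprn_ge0// mulr_ge0.
exists (Num.sqrt (expR (K + 1) * (2 * N%:R)) * E); first by rewrite mulr_ge0// sqrtr_ge0.
move=> h zh szh; have [zh0 dzh] := szh; have [z0 dz] := sz.
have e0 : 0 <= 2 * N%:R * (E * h ^+ 2) ^+ 2 by rewrite mulr_ge0 ?sqr_ge0// mulr_ge0.
have i1 : 0 <= (1 : R) <= 1 by rewrite lexx ler01.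
have H := @gronwall R N (fun s => zh s - z s - h *: y s)
  (fun s => F (zh s) - F (z s) - h *: dd (y s) F (z s)) K _ K0 e0 _ _ 1 i1.
have {}H : sqn (zh 1 - z 1 - h *: y 1) <= expR (K + 1) * (2 * N%:R * (E * h ^+ 2) ^+ 2).
  apply: le_trans (H _ _) _ => [r r01|r r01|].
  - apply: is_deriveB; last by apply: is_deriveZ; apply: dy.
    by apply: is_deriveB; [exact: dzh|exact: dz].
  - pose T := F (zh r) - F (z r) - dd (zh r - z r) F (z r).
    pose D := dd (zh r - z r - h *: y r) F (z r).
    have -> : F (zh r) - F (z r) - h *: dd (y r) F (z r) = T + D.
      rewrite /T /D !D_dirB ?D_dirZ; try exact: cF.1.
      by rewrite addrA subrK.
    have hT : `|T| <= E * h ^+ 2.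
      apply: le_trans (HC2 _ _) _; rewrite /E -mulrA ler_wpM2l//.
      rewrite -[h ^+ 2]real_normK ?num_real// -exprMn ler_pXn2r ?nnegrE ?mulr_ge0//.
      apply: le_trans (HC1 _ _ _ _ szh sz r r01) _.
      by rewrite addrC addKr normrZ -mulrA [`|v| * _]mulrC.
    have hD : `|D| <= B * `|zh r - z r - h *: y r| by exact: HB.
    apply: (@le_trans _ _ (2 * (sqn T + sqn D))).
      rewrite /sqn -big_split mulr_sumr; apply: ler_sum => i _ /=.
      rewrite [(T + D) i 0]mxE; move: (T i 0) (D i 0) => a b.
      rewrite -subr_ge0 (_ : _ - _ = (a - b) ^+ 2) ?sqr_ge0//; ring.
    rewrite mulrDr addrC; apply: lerD.
      rewrite /K -[2 * _ * _ * _]mulrA -[2 * _ * _]mulrA ler_wpM2l//.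
      apply: le_trans (sqn_le _) _; rewrite ler_wpM2l//.
      apply: le_trans (_ : (B * `|zh r - z r - h *: y r|) ^+ 2 <= _).
        by rewrite ler_pXn2r ?nnegrE ?mulr_ge0.
      by rewrite exprMn ler_wpM2l ?exprn_ge0// sqn_ge.
    rewrite -mulrA ler_wpM2l//; apply: le_trans (sqn_le _) _; rewrite ler_wpM2l//.
    by rewrite ler_pXn2r ?nnegrE// mulr_ge0// sqr_ge0.
  - have -> : zh 0 - z 0 - h *: y 0 = 0 by rewrite zh0 z0 y0 [x + _]addrC addrK subrr.
    by rewrite /sqn big1 ?add0r// => i _; rewrite mxE expr0n.
have S0 : 0 <= Num.sqrt (expR (K + 1) * (2 * N%:R)) by exact: sqrtr_ge0.
have : `|zh 1 - z 1 - h *: y 1| ^+ 2 <= (Num.sqrt (expR (K + 1) * (2 * N%:R)) * E * h ^+ 2) ^+ 2.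
  apply: le_trans (sqn_ge _) _; apply: le_trans H _.
  by rewrite -[_ * E * h ^+ 2]mulrA [leRHS]exprMn sqr_sqrtr ?mulr_ge0 ?expR_ge0// [leLHS]mulrA lexx.
by rewrite ler_pXn2r ?nnegrE// mulr_ge0 ?sqr_ge0// mulr_ge0.
Qed.

Lemma flow_derive N (F E : 'cV[R]_N -> 'cV[R]_N) x v z y : csm F ->
  (forall x, exists2 z, sol F x z & z 1 = E x) ->
  sol F x z -> y 0 = v ->
  (forall s : R, 0 <= s <= 1 -> is_derive s 1 y (dd (y s) F (z s))) ->
  derivable E x v /\ 'D_v E x = y 1.
Proof.
move=> cF HE sz y0 dy; have [C C0 HC] := flow_variation cF sz y0 dy.
have Ex : E x = z 1.
  have [z' sz' <-] := HE x; apply: (flow_uniq cF sz' sz); by rewrite lexx ler01.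
suff H : h^-1 *: (E (h *: v + x) - E x) @[h --> (0 : R)^'] --> y 1.
  by split; [apply/cvg_ex; exists (y 1)|exact: cvg_lim H].
apply/cvgrPdist_le => e e0; near=> h.
have h0 : h != 0 by near: h; exact: nbhs_dnbhs_neq.
have [zh szh Eh] := HE (h *: v + x); rewrite -Eh Ex.
rewrite addrC in szh; have := HC h zh szh => Hh.
have -> : y 1 - h^-1 *: (zh 1 - z 1) = - (h^-1 *: (zh 1 - z 1 - h *: y 1)).
  by rewrite [in RHS]scalerBr scalerA mulVf// scale1r opprB.
rewrite normrN normrZ normfV ler_pdivrMl ?normr_gt0//; apply: le_trans Hh _.
rewrite -real_normK ?num_real// expr2 mulrA mulrC ler_wpM2l// mulrC.
have Ce : `|h| <= e / (C + 1).
  near: h; apply: dnbhs0_le; by rewrite divr_gt0// ltr_pwDr.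
apply: le_trans (ler_wpM2r C0 Ce) _; rewrite mulrAC ler_pdivrMr ?ltr_pwDr//.
by rewrite ler_wpM2l ?(ltW e0)// lerDl.
Unshelve. all: by end_near. Qed.

End flow.

Section blocks.
Context {R : realType} {V : normedModType R}.

Lemma sm_usubmx m n p (f : V -> 'M[R]_(m + n, p)) x : sm f x -> sm (fun y => usubmx (f y)) x.
Proof. by move=> /sm_mxP H; apply/sm_mxP => i j; apply: sm_ext (H _ j) => y; rewrite mxE. Qed.

Lemma sm_dsubmx m n p (f : V -> 'M[R]_(m + n, p)) x : sm f x -> sm (fun y => dsubmx (f y)) x.
Proof. by move=> /sm_mxP H; apply/sm_mxP => i j; apply: sm_ext (H _ j) => y; rewrite mxE. Qed.

Lemma sm_col_mx m n p (f : V -> 'M[R]_(m, p)) (g : V -> 'M[R]_(n, p)) x :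
  sm f x -> sm g x -> sm (fun y => col_mx (f y) (g y)) x.
Proof.
move=> /sm_mxP H /sm_mxP H'; apply/sm_mxP => i j.
by case: (splitP i) => k ik; [apply: sm_ext (H k j) => y|apply: sm_ext (H' k j) => y];
  [rewrite (_ : i = lshift n k) ?col_mxEu//|rewrite (_ : i = rshift m k) ?col_mxEd//]; apply: val_inj.
Qed.

Lemma D_usubmx m n p (f : V -> 'M[R]_(m + n, p)) x v : sm f x ->
  dd v (fun y => usubmx (f y)) x = usubmx (dd v f x).
Proof.
move=> sf; apply/matrixP => i j; rewrite mxE !D_entry//; last exact: sm_usubmx.
by apply: D_ext => y; rewrite mxE.
Qed.

Lemma D_dsubmx m n p (f : V -> 'M[R]_(m + n, p)) x v : sm f x ->
  dd v (fun y => dsubmx (f y)) x = dsubmx (dd v f x).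
Proof.
move=> sf; apply/matrixP => i j; rewrite mxE !D_entry//; last exact: sm_dsubmx.
by apply: D_ext => y; rewrite mxE.
Qed.

Lemma D_col_mx m n p (f : V -> 'M[R]_(m, p)) (g : V -> 'M[R]_(n, p)) x v :
  sm f x -> sm g x ->
  dd v (fun y => col_mx (f y) (g y)) x = col_mx (dd v f x) (dd v g x).
Proof.
move=> sf sg; have sc := sm_col_mx sf sg.
rewrite -[LHS]vsubmxK -D_usubmx// -D_dsubmx//.
by congr col_mx; apply: D_ext => y; rewrite ?col_mxKu ?col_mxKd.
Qed.

Lemma mx_norm_usub m n p (A : 'M[R]_(m + n, p)) : `|usubmx A| <= `|A|.
Proof. by apply/mx_norm_leP => // i j; rewrite mxE; exact: mx_entry_le. Qed.

Lemma mx_norm_dsub m n p (A : 'M[R]_(m + n, p)) : `|dsubmx A| <= `|A|.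
Proof. by apply/mx_norm_leP => // i j; rewrite mxE; exact: mx_entry_le. Qed.

Lemma mx_norm_col m n p (A : 'M[R]_(m, p)) (B : 'M[R]_(n, p)) (e : R) :
  `|A| <= e -> `|B| <= e -> `|col_mx A B| <= e.
Proof.
move=> Ae Be; have e0 : 0 <= e by exact: le_trans Ae.
apply/mx_norm_leP => // i j; case: (splitP i) => k ik.
  rewrite (_ : i = lshift n k) ?col_mxEu; first exact: le_trans (mx_entry_le _ _ _) Ae.
  exact: val_inj.
rewrite (_ : i = rshift m k) ?col_mxEd; first exact: le_trans (mx_entry_le _ _ _) Be.
exact: val_inj.
Qed.

End blocks.

Section curve_blocks.
Context {R : realType}.

Lemma is_derive_usubmx m n p (z : R -> 'M[R]_(m + n, p)) (s : R) w :
  is_derive s 1 z w -> is_derive s 1 (fun t => usubmx (z t)) (usubmx w).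
Proof.
move=> /is_derive_entry H; apply/is_derive_entry => i j; rewrite mxE.
have -> : (fun t => usubmx (z t) i j) = (fun t => z t (lshift n i) j) by apply/funext => t; rewrite mxE.
exact: H.
Qed.

Lemma is_derive_dsubmx m n p (z : R -> 'M[R]_(m + n, p)) (s : R) w :
  is_derive s 1 z w -> is_derive s 1 (fun t => dsubmx (z t)) (dsubmx w).
Proof.
move=> /is_derive_entry H; apply/is_derive_entry => i j; rewrite mxE.
have -> : (fun t => dsubmx (z t) i j) = (fun t => z t (rshift m i) j) by apply/funext => t; rewrite mxE.
exact: H.
Qed.

Lemma is_derive_col_mx m n p (z : R -> 'M[R]_(m, p)) (z' : R -> 'M[R]_(n, p)) (s : R) w w' :
  is_derive s 1 z w -> is_derive s 1 z' w' ->
  is_derive s 1 (fun t => col_mx (z t) (z' t)) (col_mx w w').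
Proof.
move=> /is_derive_entry H /is_derive_entry H'; apply/is_derive_entry => i j.
case: (splitP i) => k ik.
  rewrite (_ : i = lshift n k) ?col_mxEu; last exact: val_inj.
  have -> : (fun t => col_mx (z t) (z' t) (lshift n k) j) = (fun t => z t k j).
    by apply/funext => t; rewrite col_mxEu.
  exact: H.
rewrite (_ : i = rshift m k) ?col_mxEd; last exact: val_inj.
have -> : (fun t => col_mx (z t) (z' t) (rshift m k) j) = (fun t => z' t k j).
  by apply/funext => t; rewrite col_mxEd.
exact: H'.
Qed.

Lemma curve_const m n (z : R -> 'M[R]_(m, n)) :
  (forall s : R, 0 <= s <= 1 -> is_derive s 1 z 0) -> forall s, 0 <= s <= 1 -> z s = z 0.
Proof.
move=> dz s s01; apply/eqP; rewrite -subr_eq0 -normr_le0.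
apply: (@curve_le _ _ _ (fun s => z s - z 0) (fun=> 0) (cst 0) (cst 0) 1) => //.
- by rewrite subrr normr0.
- move=> r r01; have := is_deriveB (dz r r01) (is_derive_cst (z 0) r 1).
  by rewrite subr0.
- by move=> r r01; rewrite normr0.
Qed.

End curve_blocks.

Section variation.
Context {R : realType}.

Lemma variation_ext N (F : 'cV[R]_N -> 'cV[R]_N) : csm F ->
  exists (Ft Et : 'cV[R]_(N + N) -> 'cV[R]_(N + N)), [/\ csm Ft,
    forall y, exists2 z, sol Ft y z & z 1 = Et y &
    forall x v z, `|v| <= 1 -> sol F x z ->
    exists y : R -> 'cV[R]_N, [/\ y 0 = v,
      forall s : R, 0 <= s <= 1 -> is_derive s 1 y (dd (y s) F (z s)) &
      y 1 = dsubmx (Et (col_mx x v))]].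
Proof.
move=> cF; have [B B0 HB] := dd_bounded cF; have [sF [rho F0]] := cF.
pose K := N%:R * B ^+ 2; have K0 : 0 <= K by rewrite mulr_ge0// exprn_ge0.
pose r := Num.sqrt (expR (K + 1) * N%:R) + 1.
have r0 : 0 < r by rewrite ltr_pwDr// sqrtr_ge0.
have [chi [schi chi01 chi1 chi0]] := plateau (0 : 'cV[R]_N) r0.
pose Ft (y : 'cV[R]_(N + N)) : 'cV[R]_(N + N) :=
  chi (dsubmx y) *: col_mx (F (usubmx y)) (jac F (usubmx y) *m dsubmx y).
have cFt : csm Ft.
  split=> [y|].
    apply: (sm_scale (a := fun y => chi (dsubmx y))).
      apply: (sm_comp_real (f := fun y : 'cV[R]_(N + N) => dsubmx y)); last exact: schi.
      exact: sm_dsubmx (sm_id y).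
    have su := sm_usubmx (sm_id y); have sd := sm_dsubmx (sm_id y).
    apply: sm_col_mx; first exact: (sm_comp su).
    by apply: sm_mulmx sd; apply: (sm_comp su); exact: sm_jac.
  exists (Num.max rho (2 * N.+1%:R * r)) => y; rewrite gt_max => /andP[y1 y2].
  rewrite /Ft; have [->|c0] := eqVneq (chi (dsubmx y)) 0; first by rewrite scale0r.
  have := chi0 _ c0; rewrite subr0 => d1.
  have u1 : rho < `|usubmx y|.
    rewrite ltNge; apply/negP => u1; have : `|y| <= Num.max rho (2 * N.+1%:R * r).
      by rewrite -[y]vsubmxK; apply: mx_norm_col; rewrite le_max ?u1// (ltW d1) orbT.
    by rewrite leNgt gt_max y1 y2.
  rewrite F0// -D_jac; last exact: sF.
  by rewrite (dd_supp _ F0)// col_mx0 scaler0.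
pose Et y := sval (cid (flow_ex y cFt)) 1.
exists Ft, Et; split=> // [y|x v z v1 sz].
  by exists (sval (cid (flow_ex y cFt))) => //; exact: (svalP (cid (flow_ex y cFt))).
have [w0 dw] := svalP (cid (flow_ex (col_mx x v) cFt)); rewrite /Et.
move: (sval _) w0 dw => w w0 dw.
pose u s := usubmx (w s); pose y s := dsubmx (w s).
have dy (s : R) : 0 <= s <= 1 -> is_derive s 1 y ((chi (y s) : R) *: (jac F (u s) *m y s)).
  move=> s01; have := is_derive_dsubmx (dw s s01).
  by rewrite /Ft -[X in dsubmx X]vsubmxK; rewrite scale_col_mx !col_mxKd.
have du (s : R) : 0 <= s <= 1 -> is_derive s 1 u ((chi (y s) : R) *: F (u s)).
  move=> s01; have := is_derive_usubmx (dw s s01).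
  by rewrite /Ft scale_col_mx !col_mxKu.
have u0 : u 0 = x by rewrite /u w0 col_mxKu.
have y0 : y 0 = v by rewrite /y w0 col_mxKd.
have ys s : 0 <= s <= 1 -> `|y s| <= r.
  move=> s01; have H := @gronwall R N y _ K 0 K0 (lexx 0) dy.
  have {}H : sqn (y s) <= expR (K + 1) * (sqn (y 0) + 0).
    apply: H s01 => t t01; rewrite addr0; apply: le_trans (sqn_le _) _.
    rewrite /K -mulrA ler_wpM2l//.
    apply: le_trans (_ : (B * `|y t|) ^+ 2 <= _); last first.
      by rewrite exprMn ler_wpM2l ?exprn_ge0// sqn_ge.
    rewrite ler_pXn2r ?nnegrE ?mulr_ge0// normrZ -D_jac; last exact: sF.
    have /andP[c0 c1] := chi01 (y t); rewrite (ger0_norm c0).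
    by apply: le_trans (HB (u t) (y t)); rewrite ler_piMl.
  have sv : sqn v <= N%:R.
    by apply: le_trans (sqn_le v) _; rewrite ler_piMr// exprn_ile1.
  have : `|y s| ^+ 2 <= Num.sqrt (expR (K + 1) * N%:R) ^+ 2.
    apply: le_trans (sqn_ge _) _; apply: le_trans H _.
    by rewrite sqr_sqrtr ?mulr_ge0 ?expR_ge0// addr0 y0 ler_wpM2l ?expR_ge0.
  rewrite ler_pXn2r ?nnegrE ?sqrtr_ge0// => /le_trans; apply.
  by rewrite /r lerDl.
have cy s : 0 <= s <= 1 -> chi (y s) = 1 by move=> s01; apply: chi1; rewrite subr0; exact: ys.
have su : sol F x u.
  by split=> // s s01; have := du s s01; rewrite cy// scale1r.
exists y; split=> // s s01; rewrite -(flow_uniq cF su sz s01).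
by have := dy s s01; rewrite cy// scale1r -D_jac.
Qed.

Lemma variation_ex N (F : 'cV[R]_N -> 'cV[R]_N) x v z : csm F -> sol F x z ->
  exists y : R -> 'cV[R]_N, y 0 = v /\
    forall s : R, 0 <= s <= 1 -> is_derive s 1 y (dd (y s) F (z s)).
Proof.
move=> cF sz; have [Ft [Et [_ _ H]]] := variation_ext cF.
pose a := `|v| + 1; have a0 : 0 < a by rewrite ltr_pwDr.
have v1 : `|a^-1 *: v| <= 1.
  by rewrite normrZ gtr0_norm ?invr_gt0// ler_pdivrMl// mulr1 lerDl.
have [y [y0 dy _]] := H x _ z v1 sz; exists (fun s => a *: y s); split.
  by rewrite y0 scalerA divff ?gt_eqF// scale1r.
move=> s s01; rewrite D_dirZ; last exact: cF.1.
by apply: is_deriveZ; exact: dy.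
Qed.

Lemma flow_Ck k N (F E : 'cV[R]_N -> 'cV[R]_N) : csm F ->
  (forall x, exists2 z, sol F x z & z 1 = E x) -> Ck k setT E.
Proof.
have i1 : 0 <= (1 : R) <= 1 by rewrite lexx ler01.
elim: k N F E => [|k IH] N F E cF HE.
  split=> // x _; have [C C0 HC] := flow_lip cF.
  apply/cont_normP => e e0; exists (e / (C + 1)); first by rewrite divr_gt0// ltr_pwDr.
  move=> y; have C1 : 0 < C + 1 by rewrite ltr_pwDr.
  have [z sz <-] := HE x; have [z' sz' <-] := HE y.
  rewrite ltr_pdivlMr// => h; apply: le_trans (HC _ _ _ _ sz' sz 1 i1) _.
  by apply: le_trans (ltW h); rewrite mulrC ler_wpM2l// lerDl.
split=> [x _|v].
  by have := IH N F E cF HE; move=> /Ck_cont; exact.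
have [Ft [Et [cFt HEt H]]] := variation_ext cF.
pose a := `|v| + 1; have a0 : 0 < a by rewrite ltr_pwDr.
pose v1 := a^-1 *: v.
have v11 : `|v1| <= 1.
  by rewrite normrZ gtr0_norm ?invr_gt0// ler_pdivrMl// mulr1 lerDl.
have vE : v = a *: v1 by rewrite scalerA divff ?gt_eqF// scale1r.
have D x : derivable E x v /\ 'D_v E x = a *: dsubmx (Et (col_mx x v1)).
  have [z sz _] := HE x; have [y [y0 dy y1]] := H x v1 z v11 sz.
  have [d1 d2] := flow_derive cF HE sz y0 dy.
  by have := derive_dirZ a d1; rewrite -vE d2 y1.
split=> [x _|]; first by have [] := D x.
have -> : 'D_v E = (fun x => a *: dsubmx (Et (col_mx x v1))).
  by apply/funext => x; have [] := D x.
apply: CkZ; first exact: openT.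
apply/Ck_mx => [|i j]; first exact: openT.
apply: (@Ck_eq _ _ _ _ _ (fun x => Et (col_mx x v1) (rshift N i) j : R^o)) => [|x _|].
- exact: openT.
- by rewrite mxE.
apply: (@Ck_comp _ _ _ _ setT setT (fun x => col_mx x v1)
  (fun y => Et y (rshift N i) j : R^o)) => //; try exact: openT.
  have /(smooth_onP _ openT) : forall x, setT x -> sm (fun x : 'cV[R]_N => col_mx x v1) x.
    by move=> x _; exact: sm_col_mx (sm_id x) (sm_cst v1 x).
  exact.
by apply: (Ck_mx _ _ openT).1; exact: IH cFt HEt.
Qed.

End variation.

Section frobenius.
Context {R : realType} {m k : nat}.

Lemma param_flow (K : 'cV[R]_m -> 'M[R]_(m, k)) (x0 : 'cV[R]_m) (r0 : R) : 0 < r0 ->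
  (forall x, `|x - x0| < r0 -> sm K x) ->
  exists (delta : R) (Phi : 'cV[R]_(m + k) -> 'cV[R]_m), [/\ 0 < delta,
    forall y, sm Phi y &
    forall x t, `|x - x0| < delta -> `|t| < delta ->
    exists z : R -> 'cV[R]_m, [/\ z 0 = x, z 1 = Phi (col_mx x t),
      forall s : R, 0 <= s <= 1 ->
        `|z s - x0| < r0 /\ is_derive s 1 z (K (z s) *m t) &
      forall (v : 'cV[R]_m) (tau : 'cV[R]_k),
        (exists y : R -> 'cV[R]_m, y 0 = v /\ forall s : R, 0 <= s <= 1 ->
          is_derive s 1 y (dd (y s) K (z s) *m t + K (z s) *m tau)) /\
        (forall y : R -> 'cV[R]_m, y 0 = v ->
          (forall s : R, 0 <= s <= 1 ->
             is_derive s 1 y (dd (y s) K (z s) *m t + K (z s) *m tau)) ->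
          dd (col_mx v tau) Phi (col_mx x t) = y 1)]].
Proof.
move=> r00 sK; have i1 : 0 <= (1 : R) <= 1 by rewrite lexx ler01.
pose r1 := r0 / (4 * m.+1%:R).
have m0 : 0 < m.+1%:R :> R by rewrite ltr0n.
have r10 : 0 < r1 by rewrite divr_gt0// mulr_gt0.
have r1E : 2 * m.+1%:R * r1 = r0 / 2.
  by rewrite /r1; move: (m.+1%:R : R) m0 => p p0; field; rewrite gt_eqF.
have r1r : r1 < r0.
  have p1 : 1 <= m.+1%:R :> R by rewrite ler1n.
  by rewrite /r1 ltr_pdivrMr ?mulr_gt0// ltr_pMr//; lra.
have [chi1 [sc1 c101 c11 c10]] := plateau x0 r10.
have [chi2 [sc2 c201 c21 c20]] := plateau (0 : 'cV[R]_k) ltr01.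
pose G (y : 'cV[R]_(m + k)) : 'cV[R]_(m + k) := col_mx (K (usubmx y) *m dsubmx y) 0.
pose F (y : 'cV[R]_(m + k)) := (chi1 (usubmx y) * chi2 (dsubmx y) : R) *: G y.
have su y := sm_usubmx (@sm_id R (m + k) 1 y).
have sd y := sm_dsubmx (@sm_id R (m + k) 1 y).
have sG y : `|usubmx y - x0| < r0 -> sm G y.
  move=> yr; apply: sm_col_mx (sm_cst _ _).
  by apply: sm_mulmx (sd y); apply: (sm_comp (su y)); exact: sK.
have F0 y : r0 / 2 <= `|usubmx y - x0| -> F y = 0.
  move=> h; rewrite /F; have [->|/c10] := eqVneq (chi1 (usubmx y)) 0.
    by rewrite mul0r scale0r.
  by rewrite r1E ltNge h.
have cF : csm F.
  split=> [y|].
    have [yr|yr] := ltP `|usubmx y - x0| r0.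
      apply: (sm_scale (a := fun y => (chi1 (usubmx y) : R) * (chi2 (dsubmx y) : R) : R^o)); last exact: sG.
      apply: (smM (f := fun y => chi1 (usubmx y)) (g := fun y => chi2 (dsubmx y))).
        exact: sm_comp_real (su y) (sc1 _).
      exact: sm_comp_real (sd y) (sc2 _).
    apply: (@sm_eq _ _ _ (fun=> 0)); last exact: sm_cst.
    apply/nbhs_normP; exists (r0 / 2) => [|y' yy']; first by rewrite divr_gt0.
    apply/esym/F0; have h : `|usubmx y' - usubmx y| < r0 / 2.
      by apply: le_lt_trans yy'; rewrite -linearB; exact: mx_norm_usub.
    have := ler_distD (usubmx y') (usubmx y) x0; rewrite distrC in h.
    move: yr h; move: (`|usubmx y - x0|) (`|usubmx y - usubmx y'|) (`|usubmx y' - x0|) => a b d; lra.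
  exists (Num.max (`|x0| + r0) (2 * k.+1%:R * 1)) => y; rewrite gt_max => /andP[y1 y2].
  have [h|h] := ltP `|usubmx y - x0| (r0 / 2); last exact: F0.
  rewrite /F; have [->|/c20] := eqVneq (chi2 (dsubmx y)) 0; first by rewrite mulr0 scale0r.
  rewrite subr0 => h2; have : `|y| <= Num.max (`|x0| + r0) (2 * k.+1%:R * 1).
    rewrite -[y]vsubmxK; apply: mx_norm_col; rewrite le_max ?(ltW h2) ?orbT//.
    rewrite -[usubmx y](subrK x0) addrC (le_trans (ler_normD _ _))// lerD//.
    by apply: le_trans (ltW h) _; rewrite ler_pdivrMr// ler_pMr// ler1n.
  by rewrite leNgt gt_max y1 y2.
have [L L0 HL] := csm_lip cF.
have Fs y : `|F y| <= L * `|dsubmx y|.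
  have -> : F y = F y - F (col_mx (usubmx y) 0).
    by rewrite {3}/F /G col_mxKd mulmx0 col_mx0 scaler0 subr0.
  apply: le_trans (HL _ _) _; rewrite ler_wpM2l//.
  by rewrite -{1}[y]vsubmxK opp_col_mx add_col_mx subrr subr0; apply: mx_norm_col; rewrite ?normr0.
have Fd y : dsubmx (F y) = 0 by rewrite /F /G scale_col_mx col_mxKd scaler0.
pose E y := sval (cid (flow_ex y cF)) 1.
have HE y : exists2 z, sol F y z & z 1 = E y.
  by exists (sval (cid (flow_ex y cF))) => //; exact: (svalP (cid (flow_ex y cF))).
have sE y : sm E y by exists setT; split=> //; [exact: openT|move=> j; exact: flow_Ck cF HE].
pose delta := Num.min 1 (r1 / (2 * (L + 1))).
have L1 : 0 < L + 1 by rewrite ltr_pwDr.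
exists delta, (fun y => usubmx (E y)); split=> [|y|x t xd].
- by rewrite lt_min ltr01 divr_gt0// mulr_gt0.
- exact: sm_usubmx (sE y).
move=> td; have [w [w0 dw] w1] := HE (col_mx x t).
have wd s : 0 <= s <= 1 -> dsubmx (w s) = t.
  move=> s01; have -> : dsubmx (w s) = dsubmx (w 0).
    apply: (@curve_const _ _ _ (fun s => dsubmx (w s))) => // r r01.
    by have := is_derive_dsubmx (dw r r01); rewrite Fd.
  by rewrite w0 col_mxKd.
have [t1 tr] : `|t| < 1 /\ `|t| < r1 / (2 * (L + 1)) by move: td; rewrite lt_min => /andP.
have xr : `|x - x0| < r1 / (2 * (L + 1)) by move: xd; rewrite lt_min => /andP[].
have half : r1 / (2 * (L + 1)) <= r1 / 2.
  rewrite ler_pM2l// lef_pV2 ?posrE ?mulr_gt0// ler_pMr// lerDr//.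
have wu s : 0 <= s <= 1 -> `|usubmx (w s) - x0| < r1.
  move=> s01; have H : `|usubmx (w s) - x| <= L * `|t| * s.
    apply: (@curve_le _ _ _ (fun s => usubmx (w s) - x) (fun s => usubmx (F (w s)))
      (fun s => L * `|t| * s) (fun=> L * `|t|) 1) => //.
    - by rewrite w0 col_mxKu subrr normr0 mulr0.
    - move=> r r01; have := is_deriveB (is_derive_usubmx (dw r r01)) (is_derive_cst x r 1).
      by rewrite subr0.
    - move=> r r01; have := is_deriveZ (L * `|t|) (is_derive_id r (1 : R)).
      by rewrite /GRing.scale /= mulr1.
    - move=> r r01; apply: le_trans (mx_norm_usub _) _; apply: le_trans (Fs _) _.
      by rewrite wd.
  have H2 : L * `|t| * s <= r1 / 2.
    have /andP[s0 s1] := s01; apply: (@le_trans _ _ (L * `|t|)); first by rewrite ler_piMr// mulr_ge0.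
    apply: (@le_trans _ _ ((L + 1) * (r1 / (2 * (L + 1))))).
      by rewrite ler_pM// ?lerDl// ltW.
    have -> : (L + 1) * (r1 / (2 * (L + 1))) = r1 / 2; last exact: lexx.
    by move: (L + 1) L1 => a a0; field; rewrite gt_eqF.
  have := ler_distD x (usubmx (w s)) x0; move: xr half H H2.
  by move: (r1 / (2 * _)) (`|usubmx (w s) - x0|) (`|usubmx (w s) - x|) (`|x - x0|) (L * _ * s) => a b d e f; lra.
have near_plateau s : 0 <= s <= 1 -> \forall y \near w s, G y = F y.
  move=> s01; apply/nbhs_normP.
  exists (Num.min (r1 - `|usubmx (w s) - x0|) (1 - `|t|)).
    by rewrite lt_min !subr_gt0 wu.
  move=> y; rewrite lt_min => /andP[h1 h2]; rewrite /F c11 ?c21 ?mulr1 ?scale1r//.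
    rewrite subr0 -[dsubmx y](subrK t) (le_trans (ler_normD _ _))// -lerBrDr ltW//.
    by apply: le_lt_trans h2; rewrite -(wd s s01) -linearB; exact: mx_norm_dsub.
  rewrite (le_trans (ler_distD (usubmx (w s)) _ _))// -lerBrDr ltW//.
  by apply: le_lt_trans h1; rewrite -linearB; exact: mx_norm_usub.
have FG s : 0 <= s <= 1 -> F (w s) = G (w s).
  by move=> s01; rewrite (nbhs_singleton (near_plateau s s01)).
have dF s v : 0 <= s <= 1 -> dd v F (w s) =
    col_mx (dd (usubmx v) K (usubmx (w s)) *m t + K (usubmx (w s)) *m dsubmx v) 0.
  move=> s01; rewrite -(D_eq v (near_plateau s s01)).
  have sKw : sm K (usubmx (w s)) by apply: sK; apply: lt_trans (wu s s01) r1r.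
  have sKu := sm_comp (su (w s)) sKw.
  rewrite D_col_mx; [|exact: sm_mulmx sKu (sd _)|exact: sm_cst].
  rewrite Dcst (D_mulmx _ sKu (sd _)) wd//.
  by rewrite (D_comp _ (su _) sKw) (D_usubmx _ (sm_id _)) (D_dsubmx _ (sm_id _)) D_id.
exists (fun s => usubmx (w s)); split=> [||s s01|v tau].
- by rewrite w0 col_mxKu.
- by rewrite w1.
- split; first exact: lt_trans (wu s s01) r1r.
  by have := is_derive_usubmx (dw s s01); rewrite FG// /G col_mxKu wd.
have sw : sol F (col_mx x t) w by split.
split.
  have [y [y0 dy]] := variation_ex (col_mx v tau) cF sw.
  exists (fun s => usubmx (y s)); split=> [|s s01]; first by rewrite y0 col_mxKu.
  have yd : dsubmx (y s) = tau.
    have -> : dsubmx (y s) = dsubmx (y 0).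
      apply: (@curve_const _ _ _ (fun s => dsubmx (y s))) => // r r01.
      by have := is_derive_dsubmx (dy r r01); rewrite dF// col_mxKd.
    by rewrite y0 col_mxKd.
  by have := is_derive_usubmx (dy s s01); rewrite dF// col_mxKu yd.
move=> y y0 dy; rewrite (D_usubmx _ (sE _)).
have [|s s01|_ D] := @flow_derive R _ F E (col_mx x t) (col_mx v tau) w (fun s => col_mx (y s) tau) cF HE sw.
- by rewrite y0.
- by rewrite dF// col_mxKu col_mxKd; apply: is_derive_col_mx; exact: dy.
by rewrite unlock D col_mxKu.
Qed.

End frobenius.

(** * Local inverses *)

Section ift.
Context {R : realType} {m : nat}.

Lemma mulmx_norm p q r (A : 'M[R]_(p, q)) (B : 'M[R]_(q, r)) :
  `|A *m B| <= q%:R * `|A| * `|B|.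
Proof.
apply/mx_norm_leP => [|i j]; first by rewrite !mulr_ge0.
rewrite mxE; apply: le_trans (ler_norm_sum _ _ _) _.
apply: (@le_trans _ _ (\sum_(l < q) `|A| * `|B|)).
  by apply: ler_sum => l _; rewrite normrM ler_pM// mx_entry_le.
by rewrite sumr_const card_ord -mulrA mulr_natl lexx.
Qed.

Lemma local_inverse (G : 'cV[R]_m -> 'cV[R]_m) (x0 : 'cV[R]_m) (e : R) : 0 < e ->
  sm G x0 -> jac G x0 \in unitmx ->
  exists r rho : R, [/\ 0 < r < e, 0 < rho,
    forall a b, `|a - x0| < r -> `|b - x0| < r -> G a = G b -> a = b &
    forall y, `|y - G x0| < rho -> exists2 x, `|x - x0| < r & G x = y].
Proof.
move=> e0 sG uA; pose A := invmx (jac G x0).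
have sJ := sm_jac sG.
pose c := m%:R * (m%:R * `|A|) + 1.
have c0 : 0 < c by rewrite ltr_pwDr// !mulr_ge0.
have c1 : 0 < 2^-1 / c by rewrite divr_gt0// invr_gt0.
have [r1 r10 Hr1] := (cont_normP _ _).1 (sm_cont sJ) _ c1.
have [r2 r20 Hr2] := (nbhs_normP _ _).1 (sm_near sG).
pose r := Num.min (e / 2) (Num.min r1 r2).
have r0 : 0 < r by rewrite !lt_min r10 r20 divr_gt0.
have re : r < e by rewrite gt_min ltr_pdivrMr// ltr_pMr// ltr1n.
have rr1 x : `|x - x0| < r -> `|x - x0| < r1 by rewrite !lt_min => /and3P[].
have rr2 x : `|x - x0| < r -> sm G x by rewrite !lt_min => /and3P[_ _ /Hr2].
pose H x := x - A *m G x.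
have sH x : `|x - x0| < r -> sm H x.
  by move=> xr; apply: smB (sm_id x) _; apply: sm_mulmxl; exact: rr2.
have dH x v : `|x - x0| < r -> `|dd v H x| <= 2^-1 * `|v|.
  move=> xr; have sx := rr2 x xr.
  rewrite (DB v (sm_id x) (sm_mulmxl A sx)) D_id (D_mulmxl _ _ sx) D_jac//.
  have -> : v - A *m (jac G x *m v) = A *m (jac G x0 - jac G x) *m v.
    by rewrite mulmxBr mulVmx// mulmxBl mul1mx mulmxA.
  apply: le_trans (mulmx_norm _ _) _; rewrite ler_wpM2r//.
  apply: (@le_trans _ _ (m%:R * (m%:R * `|A| * (2^-1 / c)))).
    rewrite ler_wpM2l//; apply: le_trans (mulmx_norm _ _) _.
    by rewrite ler_wpM2l ?mulr_ge0// distrC Hr1// rr1.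
  rewrite mulrA mulrCA ler_piMr ?invr_ge0// ler_pdivrMr// mul1r.
  by rewrite /c lerDl.
have lip a b : `|a - x0| < r -> `|b - x0| < r -> `|H a - H b| <= 2^-1 * `|a - b|.
  move=> ar br; have seg (s : R) : 0 <= s <= 1 -> `|b + s *: (a - b) - x0| < r.
    move=> /andP[s0 s1].
    have -> : b + s *: (a - b) - x0 = (1 - s) *: (b - x0) + s *: (a - x0).
      by apply/matrixP => i j; rewrite !mxE; ring.
    apply: le_lt_trans (ler_normD _ _) _; rewrite !normrZ (ger0_norm s0) ger0_norm ?subr_ge0//.
    have [s00|s00] := eqVneq s 0; first by rewrite s00 subr0 mul1r mul0r addr0.
    have sp : 0 < s by rewrite lt_neqAle eq_sym s00.
    have := ler_wpM2l _ (ltW br) => /(_ (1 - s)); rewrite subr_ge0 => /(_ s1).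
    have : s * `|a - x0| < s * r by rewrite ltr_pM2l.
    by move: (s * `|_|) ((1 - s) * `|_|) => p q; lra.
  have := @MVT_le _ _ _ H b (a - b) 0 (2^-1 * `|a - b|) (fun s h => sH _ (seg s h)).
  rewrite subr0 [b + _]addrC subrK; apply => s s01; rewrite subr0; exact: dH (seg s s01).
have inj a b : `|a - x0| < r -> `|b - x0| < r -> G a = G b -> a = b.
  move=> ar br Gab; have := lip a b ar br; rewrite /H Gab opprB addrA subrK => h.
  apply/eqP; rewrite -subr_eq0 -normr_le0; move: h (normr_ge0 (a - b)).
  by move: (`|a - b|) => p; lra.
pose rho := r / (4 * c).
exists r, rho; split=> //; [by rewrite r0|by rewrite divr_gt0// mulr_gt0|].
move=> y yr; pose T x := H x + A *m y.
have TE a b : T a - T b = H a - H b by rewrite /T opprD addrACA subrr addr0.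
pose C := `|T x0 - x0|; have C0 : 0 <= C by exact: normr_ge0.
have Cr : C < r / 4.
  have -> : C = `|A *m (y - G x0)| by rewrite /C /T /H mulmxBr; congr (`|_|); rewrite -!addrA [RHS]addrC [x0 + _]addrC -!addrA addNr addr0.
  apply: le_lt_trans (mulmx_norm _ _) _.
  apply: (@le_lt_trans _ _ (c * `|y - G x0|)).
    rewrite ler_wpM2r// /c; have [m0|mp] := posnP m.
      by have -> : m%:R = 0 :> R; [rewrite m0|rewrite !mul0r add0r].
    apply: le_trans (_ : m%:R * (m%:R * `|A|) <= _); last by rewrite lerDl.
    by rewrite ler_peMl ?mulr_ge0// ler1n.
  move: yr; rewrite /rho invfM mulrA ltr_pdivlMr// mulrC.
  by [].
pose u n := iter n T x0.
have ub n : `|u n.+1 - u n| <= C * 2^-1 ^+ n /\ `|u n - x0| <= 2 * C * (1 - 2^-1 ^+ n).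
  have p0 j : 0 <= (2^-1 : R) ^+ j by rewrite exprn_ge0// invr_ge0.
  have small j : 2 * C * (1 - 2^-1 ^+ j) < r.
    apply: le_lt_trans (_ : 2 * C < r); last by move: Cr; lra.
    by rewrite ler_piMr ?mulr_ge0// lerBlDr lerDl.
  elim: n => [|n [IH1 IH2]].
    by rewrite expr0 mulr1 subrr normr0 subrr mulr0.
  have h2 : `|u n.+1 - x0| <= 2 * C * (1 - 2^-1 ^+ n.+1).
    apply: le_trans (ler_distD (u n) _ _) _; apply: le_trans (lerD IH1 IH2) _.
    by rewrite exprS; have := mulr_ge0 C0 (p0 n); move: (_ ^+ n) => p; nra.
  split=> //; have -> : u n.+2 - u n.+1 = H (u n.+1) - H (u n) by rewrite -TE.
  apply: le_trans (lip _ _ _ _) _.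
  - exact: le_lt_trans h2 (small _).
  - exact: le_lt_trans IH2 (small _).
  - by rewrite exprS mulrCA ler_wpM2l// invr_ge0.
have [l Hl] := geo_lim_mx (fun n => (ub n).1).
have lx : `|l - x0| <= 2 * C.
  have := Hl 0%N; rewrite expr0 mulr1 distrC; exact.
have lr : `|l - x0| < r by apply: le_lt_trans lx _; move: Cr; lra.
exists l => //.
have Tl : T l = l.
  apply/eqP; rewrite -subr_eq0 -normr_eq0; apply/eqP.
  apply: (@small_pow _ _ (3 * C)) => // n.
  apply: le_trans (ler_distD (u n.+1) _ _) _.
  have -> : T l - u n.+1 = H l - H (u n) by rewrite -TE.
  have un : `|u n - x0| < r.
    have p0 : 0 <= (2^-1 : R) ^+ n by rewrite exprn_ge0// invr_ge0.
    apply: le_lt_trans (ub n).2 _; apply: le_lt_trans (_ : 2 * C < r); last by move: Cr; lra.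
    by rewrite ler_piMr ?mulr_ge0// lerBlDr lerDl.
  have := lip l (u n) lr un; rewrite [`|l - _|]distrC; have := Hl n; have := Hl n.+1; rewrite exprS.
  have : 0 <= C * 2^-1 ^+ n by rewrite mulr_ge0// exprn_ge0// invr_ge0.
  move: (`|H l - _|) (`|u n.+1 - l|) (`|u n - l|) => p q t h h1 h2 h3; nra.
have : A *m (y - G l) = 0.
  rewrite mulmxBr; move: Tl; rewrite /T /H => /eqP; rewrite -addrA addrC eq_sym -subr_eq subrr eq_sym addrC => /eqP.
  by [].
move=> /(congr1 (mulmx (jac G x0))); rewrite mulmx0 mulmxA mulmxV// mul1mx => /eqP.
by rewrite subr_eq0 => /eqP.
Qed.

End ift.

(** * Balls as manifolds *)

Section second_countable_cV.
Context {R : realType} {k : nat}.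

Lemma cV_second_countable : @second_countable 'cV[R]_k.
Proof.
pose B (qn : 'cV[rat]_k * nat) : set 'cV[R]_k :=
  [set y | `|y - map_mx ratr qn.1| < qn.2.+1%:R^-1].
exists [set B qn | qn in setT].
  by apply: card_le_trans (card_image_le _ _) _; exact: countableP.
split=> [_ [qn _ <-]|x]; first exact: open_normball.
move=> A /nbhs_normP[r r0 rA].
have [n nr] : exists n, n.+1%:R^-1 < r / 2.
  exists (Num.truncn (r / 2)^-1); rewrite invf_plt ?posrE ?divr_gt0//.
  exact: truncnS_gt.
have H i : exists q : rat, `|ratr q - x i 0| < n.+1%:R^-1.
  have lt : x i 0 - n.+1%:R^-1 < x i 0 + n.+1%:R^-1.
    by rewrite ltrD2l gtrN// invr_gt0.
  have [q] := rat_in_itvoo lt; rewrite in_itv /= => /andP[h1 h2].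
  by exists q; rewrite ltr_distl h1 h2.
pose q : 'cV[rat]_k := \col_i sval (cid (H i)).
have qx : `|x - map_mx ratr q| < n.+1%:R^-1.
  rewrite /Num.norm/= mx_normrE; apply/bigmax_ltP; split=> [|[i j] _ /=]; first by rewrite invr_gt0.
  by rewrite (ord1 j) !mxE distrC; exact: (svalP (cid (H i))).
exists (B (q, n)); first by split=> //; exists (q, n).
move=> y /= yq; apply: rA; rewrite [r]splitr.
apply: le_lt_trans (ler_distD (map_mx ratr q) _ _) _; rewrite [X in _ + X]distrC.
by apply: ltrD; [exact: lt_trans yq nr|exact: lt_trans qx nr].
Qed.

End second_countable_cV.

Section ball_manifold.
Context {R : realType} (k : nat) (r : R) (r0 : 0 < r).
Implicit Types x y : 'cV[R]_k.

Definition to_ball x : 'cV[R]_k := (r / (1 + `|x|)) *: x.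
Definition of_ball y : 'cV[R]_k := (r - `|y|)^-1 *: y.

Lemma to_ball_norm x : `|to_ball x| = r * (`|x| / (1 + `|x|)).
Proof.
by rewrite normrZ ger0_norm ?divr_ge0 ?addr_ge0 ?(ltW r0)// mulrAC mulrA.
Qed.

Lemma to_ball_lt x : `|to_ball x| < r.
Proof.
rewrite to_ball_norm -[X in _ < X]mulr1 ltr_pM2l// ltr_pdivrMr ?ltr_pwDl//.
by rewrite mul1r ltrDr.
Qed.

Lemma to_ballK x : of_ball (to_ball x) = x.
Proof.
have h : 0 < 1 + `|x| by rewrite ltr_pwDl.
rewrite /of_ball to_ball_norm /to_ball scalerA.
rewrite (_ : _ * _ = 1) ?scale1r//.
by move: (`|x|) h => t h; field; rewrite ?gt_eqF//= (_ : _ - _ = r) ?gt_eqF//; ring.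
Qed.

Lemma of_ballK y : `|y| < r -> to_ball (of_ball y) = y.
Proof.
move=> yr; have h : 0 < r - `|y| by rewrite subr_gt0.
rewrite /to_ball /of_ball normrZ gtr0_norm ?invr_gt0// scalerA (_ : _ * _ = 1) ?scale1r//.
move: (`|y|) h => t h; field; rewrite gt_eqF//= (_ : _ + _ = r) ?gt_eqF//; ring.
Qed.

Lemma to_ball_img : to_ball @` setT = [set y | `|y| < r].
Proof.
apply/seteqP; split=> [_ [x _ <-]|y /= yr]; first exact: to_ball_lt.
by exists (of_ball y) => //; exact: of_ballK.
Qed.

Lemma to_ball_continuous x : {for x, continuous to_ball}.
Proof.
apply/continuous_mxP => i j.
have -> : (fun y => to_ball y i j : R^o) = (fun y => (r / (1 + `|y|)) * y i j).
  by apply/funext => y; rewrite mxE.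
apply: (@continuousM _ _ (fun y => r / (1 + `|y|))); last exact: coord_continuous.
apply: (@continuousM _ _ (cst r) (fun y => (1 + `|y|)^-1)); first exact: cst_continuous.
apply: (@continuousV _ _ (fun y => 1 + `|y|)); first by rewrite gt_eqF// ltr_pwDl.
by apply: (@continuousD _ _ _ (cst (1 : R^o)) (fun y => `|y|));
  [exact: cst_continuous|exact: norm_continuous].
Qed.

Lemma of_ball_continuous y : `|y| < r -> {for y, continuous of_ball}.
Proof.
move=> yr; apply/continuous_mxP => i j.
have -> : (fun y => of_ball y i j : R^o) = (fun y => (r - `|y|)^-1 * y i j).
  by apply/funext => z; rewrite mxE.
apply: (@continuousM _ _ (fun y => (r - `|y|)^-1)); last exact: coord_continuous.
apply: (@continuousV _ _ (fun y => r - `|y|)); first by rewrite gt_eqF// subr_gt0.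
by apply: (@continuousB _ _ _ (cst (r : R^o)) (fun y => `|y|));
  [exact: cst_continuous|exact: norm_continuous].
Qed.

Lemma to_ball_img_open : open (to_ball @` setT).
Proof.
rewrite to_ball_img (_ : [set y | _] = [set y : 'cV[R]_k | `|y - 0| < r]); first exact: open_normball.
by apply/seteqP; split=> y /=; rewrite subr0.
Qed.

Definition ball_chart : chart R 'cV[R]_k k :=
  @Chart R 'cV[R]_k k setT to_ball of_ball openT to_ball_img_open
    (fun x _ => to_ballK x) (fun x _ => @to_ball_continuous x)
    (fun y (Hy : (to_ball @` setT) y) =>
       of_ball_continuous (eq_ind _ (fun A : set 'cV[R]_k => A y) Hy _ to_ball_img)).

Lemma ball_chart_compatible (c d : chart R 'cV[R]_k k) :
  [set ball_chart] c -> [set ball_chart] d ->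
  smooth_on (c @` (chart_dom c `&` chart_dom d)) (d \o chart_inv c).
Proof.
move=> -> -> j /=; rewrite setTI to_ball_img => //.
have oB : open [set y : 'cV[R]_k | `|y| < r] by rewrite -to_ball_img; exact: to_ball_img_open.
by apply: (@Ck_eq _ _ _ _ _ id) => // [y yr|]; [rewrite /= of_ballK|exact: Ck_id].
Qed.

Definition ball_manifold : manifold R k :=
  @Manifold R k 'cV[R]_k [set ball_chart] (@norm_hausdorff R 'cV[R]_k) cV_second_countable
   (fun p => ex_intro _ ball_chart (conj erefl I)) ball_chart_compatible.

End ball_manifold.

(** * Tensors in charts *)

Section man.
Context {R : realType} {m : nat} {M : manifold R m}.
Implicit Types (c d : chart R M m) (X Y Z : vfield M) (p q : M).

Lemma chart_atP p : atlas (chart_at p) /\ chart_dom (chart_at p) p.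
Proof. by rewrite /chart_at; case: cid. Qed.

Lemma near_chart c q (P : set M) : chart_dom c q -> nbhs q P ->
  \forall y \near c q, [/\ chart_dom c (chart_inv c y), c (chart_inv c y) = y & P (chart_inv c y)].
Proof.
move=> cq Pq.
have im : (c @` chart_dom c) (c q) by exists q.
have n1 : nbhs (c q) (c @` chart_dom c) by apply: open_nbhs_nbhs; split=> //; exact: chart_img_open.
have n2 : nbhs (c q) (chart_inv c @^-1` P).
  by apply: (chart_inv_continuous im); rewrite chart_funK.
apply: filterS2 n1 n2 => y [q' dq' <-] Py; rewrite !(chart_funK dq'); split=> //.
by move: Py; rewrite /preimage /= (chart_funK dq').
Qed.

Lemma near_dom c q : chart_dom c q -> 
  \forall y \near c q, chart_dom c (chart_inv c y) /\ c (chart_inv c y) = y.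
Proof.
by move=> cq; apply: filterS (near_chart (P := setT) cq filterT) => y [].
Qed.

Lemma chart_dom_nbhs c q : chart_dom c q -> nbhs q (chart_dom c).
Proof. by move=> cq; apply: open_nbhs_nbhs; split=> //; exact: chart_dom_open. Qed.

Lemma img_open c (P : set M) : open P -> open (c @` (chart_dom c `&` P)).
Proof.
move=> oP; rewrite openE => y [q [cq Pq] <-]; rewrite /interior.
apply: filterS (near_chart cq (open_nbhs_nbhs (conj oP Pq))) => z [dz ez Pz].
by exists (chart_inv c z).
Qed.

Lemma trans_sm c d q : atlas c -> atlas d -> chart_dom c q -> chart_dom d q ->
  sm (d \o chart_inv c) (c q).
Proof.
move=> ac ad cq dq; apply: sm_on (atlas_compatible ac ad) _.
  by apply: img_open; exact: chart_dom_open.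
by exists q.
Qed.

Definition Jt c q := jac (c \o chart_inv (chart_at q)) (chart_at q q).

Lemma Jt_self q : Jt (chart_at q) q = 1%:M.
Proof.
rewrite /Jt (@jac_eq _ _ _ _ id) ?jac_id//.
have [_ /near_dom] := chart_atP q.
by apply: filterS => y [_].
Qed.

Lemma jac_trans c d q : atlas c -> atlas d -> chart_dom c q -> chart_dom d q ->
  jac (d \o chart_inv c) (c q) *m Jt c q = Jt d q.
Proof.
move=> ac ad cq dq; have [aa aq] := chart_atP q.
rewrite /Jt; set e := chart_at q in aa aq *.
have E : (c \o chart_inv e) (e q) = c q by rewrite /= chart_funK.
rewrite -{1}E -jac_comp; [|exact: trans_sm|by rewrite E; exact: trans_sm].
apply: jac_eq; apply: filterS (near_chart aq (chart_dom_nbhs cq)) => y [_ _ cy].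
by rewrite /= chart_funK.
Qed.

Lemma Jt_unit c q : atlas c -> chart_dom c q -> Jt c q \in unitmx.
Proof.
move=> ac cq; have [aa aq] := chart_atP q.
by have := jac_trans ac aa cq aq; rewrite Jt_self => /mulmx1_unit[].
Qed.

Lemma dfun_sm {k l : nat} (f : M -> 'M[R]_(k, l)) x v :
  sm (f \o chart_inv (chart_at x)) (chart_at x x) ->
  dfun f x v = dd v (f \o chart_inv (chart_at x)) (chart_at x x).
Proof. by move=> /sm_diff df; rewrite unlock /dfun (deriveE _ df). Qed.

Lemma componentsE c X q : atlas c -> chart_dom c q -> components c X q = Jt c q *m X q.
Proof.
move=> ac cq; have [aa aq] := chart_atP q.
by rewrite /components dfun_sm ?D_jac//; exact: trans_sm.
Qed.

Lemma smf_change {k l : nat} (f : M -> 'M[R]_(k, l)) c d q :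
  atlas c -> atlas d -> chart_dom c q -> chart_dom d q ->
  sm (f \o chart_inv c) (c q) -> sm (f \o chart_inv d) (d q).
Proof.
move=> ac ad cq dq sf.
have E : (c \o chart_inv d) (d q) = c q by rewrite /= chart_funK.
have := @sm_comp _ _ _ _ _ (c \o chart_inv d) (f \o chart_inv c) (d q) (trans_sm ad ac dq cq).
rewrite E => /(_ sf); apply: sm_eq.
by apply: filterS (near_chart dq (chart_dom_nbhs cq)) => y [_ _ cy]; rewrite /= chart_funK.
Qed.

Lemma smfR_change (f : M -> R^o) c d q :
  atlas c -> atlas d -> chart_dom c q -> chart_dom d q ->
  sm (f \o chart_inv c) (c q) -> sm (f \o chart_inv d) (d q).
Proof.
move=> ac ad cq dq sf.
have E : (c \o chart_inv d) (d q) = c q by rewrite /= chart_funK.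
have := @sm_comp_real _ _ _ (c \o chart_inv d) (f \o chart_inv c) (d q) (trans_sm ad ac dq cq).
rewrite E => /(_ sf); apply: sm_eq.
by apply: filterS (near_chart dq (chart_dom_nbhs cq)) => y [_ _ cy]; rewrite /= chart_funK.
Qed.

Lemma dfun_chart {k l : nat} (f : M -> 'M[R]_(k, l)) c q v :
  atlas c -> chart_dom c q -> sm (f \o chart_inv c) (c q) ->
  dfun f q v = dd (Jt c q *m v) (f \o chart_inv c) (c q).
Proof.
move=> ac cq sf; have [aa aq] := chart_atP q.
rewrite dfun_sm; last exact: smf_change sf.
have E : (c \o chart_inv (chart_at q)) (chart_at q q) = c q by rewrite /= chart_funK.
have sc := trans_sm aa ac aq cq.
rewrite /Jt -D_jac// -[X in dd _ (f \o chart_inv c) X]E -D_comp//=; last by rewrite chart_funK.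
by apply: D_eq; apply: filterS (near_chart aq (chart_dom_nbhs cq)) => y [_ _ cy]; rewrite /= chart_funK.
Qed.

Lemma dfunR_chart (f : M -> R^o) c q v :
  atlas c -> chart_dom c q -> sm (f \o chart_inv c) (c q) ->
  dfun f q v = dd (Jt c q *m v) (f \o chart_inv c) (c q).
Proof.
move=> ac cq sf; have [aa aq] := chart_atP q.
have sf' := smfR_change ac aa cq aq sf.
rewrite /dfun -(deriveE _ (sm_diff_real sf')).
have E : (c \o chart_inv (chart_at q)) (chart_at q q) = c q by rewrite /= chart_funK.
have sc := trans_sm aa ac aq cq.
rewrite /Jt -D_jac// -[X in dd _ (f \o chart_inv c) X]E -(@D_comp_real _ _ _ _ (f \o chart_inv c))//=; last by rewrite chart_funK.
rewrite unlock; apply: near_eq_derive.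
by apply: filterS (near_chart aq (chart_dom_nbhs cq)) => y [_ _ cy]; rewrite /= chart_funK.
Qed.

(* Representatives in the chart [c] of a vector field, an endomorphism field,
   a 1-form and a metric. *)
Definition lv c X y := Jt c (chart_inv c y) *m X (chart_inv c y).
Definition lE c (f : endofield M) y := let q := chart_inv c y in Jt c q *m f q *m invmx (Jt c q).
Definition le c (e : oneform M) y := let q := chart_inv c y in e q *m invmx (Jt c q).
Definition lg c (g : metric M) y := let q := chart_inv c y in
  (invmx (Jt c q))^T *m g q *m invmx (Jt c q).

Definition smv c X q := sm (lv c X) (c q).

Lemma lv_at c X q : chart_dom c q -> lv c X (c q) = Jt c q *m X q.
Proof. by move=> cq; rewrite /lv chart_funK. Qed.

Lemma lv_components c X q : atlas c -> chart_dom c q ->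
  \forall y \near c q, components c X (chart_inv c y) = lv c X y.
Proof.
move=> ac cq; apply: filterS (near_dom cq) => y [dy _].
by rewrite componentsE.
Qed.

Lemma lv_change c d X q : atlas c -> atlas d -> chart_dom c q -> chart_dom d q ->
  \forall y \near c q, lv d X (d (chart_inv c y)) = jac (d \o chart_inv c) y *m lv c X y.
Proof.
move=> ac ad cq dq; apply: filterS (near_chart cq (chart_dom_nbhs dq)) => y [cy ey dy].
rewrite /lv (chart_funK dy) mulmxA; congr (_ *m _).
by rewrite -{2}ey jac_trans.
Qed.

Lemma smv_change c d X q : atlas c -> atlas d -> chart_dom c q -> chart_dom d q ->
  smv c X q -> smv d X q.
Proof.
move=> ac ad cq dq sX; rewrite /smv.
have E : (c \o chart_inv d) (d q) = c q by rewrite /= chart_funK.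
have s1 := trans_sm ad ac dq cq.
have s2 := trans_sm ac ad cq dq.
have : sm (fun z => jac (d \o chart_inv c) ((c \o chart_inv d) z) *m lv c X ((c \o chart_inv d) z)) (d q).
  apply: sm_mulmx; first by apply: (sm_comp s1); rewrite E; exact: sm_jac.
  by apply: (sm_comp s1); rewrite E.
apply: sm_eq; apply: filterS (near_chart dq (chart_dom_nbhs cq)) => y [dy ey cy].
by rewrite /lv /= -{4}ey !chart_funK// mulmxA -[X in jac _ (c X)]/(chart_inv d y) jac_trans.
Qed.

Lemma smooth_vfieldP X : smooth_vfield X <->
  (forall c q, atlas c -> chart_dom c q -> smv c X q).
Proof.
split=> [sX c q ac cq|H c ac d ad].
  have := sX c ac c ac; rewrite setIid => /(smooth_onP _ (chart_img_open (c:=c))).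
  move=> /(_ (c q)) H; rewrite /smv; apply: sm_eq (H _); last by exists q.
  exact: lv_components.
apply/smooth_onP; first by apply: img_open; exact: chart_dom_open.
move=> _ [q [dq cq] <-].
apply: (@smf_change _ _ _ c) => //.
by apply: sm_eq (H c q ac cq); apply: filterS (lv_components X ac cq) => y /= ->.
Qed.

Lemma smooth_funRP (U : set M) (f : M -> R^o) : open U -> smooth_fun U f <->
  (forall c q, atlas c -> chart_dom c q -> U q -> sm (f \o chart_inv c) (c q)).
Proof.
move=> oU; split=> [sf c q ac cq Uq|H c ac].
  have /(smooth_onP _ (img_open (c:=c) oU)) := sf c ac; apply.
  by exists q.
apply/(smooth_onP _ (img_open (c:=c) oU)) => _ [q [cq Uq] <-]; exact: H.
Qed.

Lemma smooth_funP {k l : nat} (U : set M) (f : M -> 'M[R]_(k, l)) : open U -> smooth_fun U f <->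
  (forall c q, atlas c -> chart_dom c q -> U q -> sm (f \o chart_inv c) (c q)).
Proof.
move=> oU; split=> [sf c q ac cq Uq|H c ac].
  have /(smooth_onP _ (img_open (c:=c) oU)) := sf c ac; apply.
  by exists q.
apply/(smooth_onP _ (img_open (c:=c) oU)) => _ [q [cq Uq] <-]; exact: H.
Qed.

Lemma derivE c q X f : atlas c -> chart_dom c q -> sm (f \o chart_inv c) (c q) ->
  Defs.deriv X f q = dd (lv c X (c q)) (f \o chart_inv c) (c q).
Proof. by move=> ac cq sf; rewrite /Defs.deriv (dfunR_chart _ ac cq sf) /lv chart_funK. Qed.

Lemma bracketE0 X Y p : smv (chart_at p) X p -> smv (chart_at p) Y p ->
  let c := chart_at p in
  bracket X Y p = dd (X p) (lv c Y) (c p) - dd (Y p) (lv c X) (c p).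
Proof.
move=> sX sY c; have [ac cp] := chart_atP p.
have H W v : smv c W p -> dfun (components c W) p v = dd v (lv c W) (c p).
  move=> sW; rewrite dfun_sm; last first.
    by apply: sm_eq sW; apply: filterS (lv_components W ac cp) => y /= ->.
  by apply: D_eq; exact: lv_components.
by rewrite /bracket -/c !H.
Qed.

Lemma smv_eq c X q : atlas c -> chart_dom c q -> smv c X q -> smv (chart_at q) X q.
Proof. by move=> ac cq; have [aa aq] := chart_atP q; exact: smv_change. Qed.

Lemma bracket_chart c q X Y : atlas c -> chart_dom c q -> smv c X q -> smv c Y q ->
  Jt c q *m bracket X Y q =
  dd (lv c X (c q)) (lv c Y) (c q) - dd (lv c Y (c q)) (lv c X) (c q).
Proof.
move=> ac cq sX sY; have [ad dq] := chart_atP q; set d := chart_at q in ad dq.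
have sX' := smv_eq ac cq sX; have sY' := smv_eq ac cq sY.
rewrite bracketE0// -/d.
have ss := trans_sm ad ac dq cq.
have E : (c \o chart_inv d) (d q) = c q by rewrite /= chart_funK.
have H W v : smv c W q -> dd (Jt c q *m v) (lv c W) (c q) =
   dd v (jac (c \o chart_inv d)) (d q) *m W q + Jt c q *m dd v (lv d W) (d q).
  move=> sW; have sW' := smv_eq ac cq sW.
  rewrite {1}/Jt -/d -D_jac// -[X in dd _ (lv c W) X]E -D_comp//; last by rewrite E.
  rewrite (D_eq v (lv_change W ad ac dq cq)) D_mulmx//; last exact: sm_jac.
  by rewrite /lv chart_funK// Jt_self mul1mx.
rewrite !lv_at// !H// mulmxBr.
have -> : dd (X q) (jac (c \o chart_inv d)) (d q) *m Y q = dd (Y q) (jac (c \o chart_inv d)) (d q) *m X q.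
  exact: D_jac_sym.
by rewrite opprD addrACA subrr add0r.
Qed.

Lemma lv_bracket c q X Y : atlas c -> chart_dom c q -> smv c X q -> smv c Y q ->
  \forall y \near c q, lv c (bracket X Y) y = dd (lv c X y) (lv c Y) y - dd (lv c Y y) (lv c X) y.
Proof.
move=> ac cq sX sY.
apply: filterS3 (sm_near sX) (sm_near sY) (near_dom cq) => y sXy sYy [dy ey].
rewrite {1}/lv bracket_chart ?ey// /smv ?ey//.
Qed.

Lemma const_field c q (v : 'cV[R]_m) : atlas c -> chart_dom c q ->
  exists2 X, smooth_vfield X & \forall y \near c q, lv c X y = v.
Proof.
move=> ac cq.
have [r r0 Hr] : exists2 r : R, 0 < r & forall y, `|y - c q| < r -> (c @` chart_dom c) y.
  apply/nbhs_normP; apply: open_nbhs_nbhs; split; first exact: chart_img_open.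
  by exists q.
pose rho := r / 2 / (2 * m.+1%:R).
have m0 : 0 < 2 * m.+1%:R :> R by rewrite mulr_gt0// ltr0n.
have rho0 : 0 < rho by rewrite !divr_gt0.
have [chi [schi _ chi1 chi0]] := plateau (c q) rho0.
have chi0' y : chi y != 0 -> `|y - c q| < r / 2.
  by move=> /chi0; rewrite /rho mulrC divfK// gt_eqF.
pose B := [set y : 'cV[R]_m | `|y - c q| <= r / 2].
have Bim y : B y -> (c @` chart_dom c) y.
  move=> By; apply: Hr; apply: (le_lt_trans By); rewrite ltr_pdivrMr// ltr_pMr// ltr1n//.
have clK : closed (chart_inv c @` B).
  apply: compact_closed; first exact: manifold_hausdorff.
  apply: continuous_compact.
    apply/subspace_continuousP => y By.
    apply: cvg_within_filter; exact: chart_inv_continuous (Bim _ By).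
  exact: cV_cball_compact.
pose X : vfield M := fun p => if `[< chart_dom c p >] then invmx (Jt c p) *m (chi (c p) *: v) else 0.
exists X.
  apply/smooth_vfieldP => d p ad dp.
  have [cp|cp] := pselect (chart_dom c p).
    apply: (@smv_change c) => //.
    have : sm (fun y => chi y *: v) (c p) by apply: sm_scale; [exact: schi|exact: sm_cst].
    apply: sm_eq; apply: filterS (near_dom cp) => y [cy ey].
    by rewrite /lv /X asboolT// mulKVmx ?ey//; exact: Jt_unit.
  apply: sm_eq (sm_cst 0 _).
  have nK : nbhs p (~` (chart_inv c @` B)).
    apply: open_nbhs_nbhs; split; first exact: closed_openC.
    by move=> [y /Bim[q' cq' <-]]; rewrite chart_funK// => e; apply: cp; rewrite -e.
  apply: filterS (near_chart dp nK) => y [dy _ nB].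
  rewrite /lv /X; case: asboolP => cy; last by rewrite mulmx0.
  have [->|/chi0' cn] := eqVneq (chi (c (chart_inv d y))) 0; first by rewrite scale0r !mulmx0.
  case: nB; exists (c (chart_inv d y)); last by rewrite chart_funK.
  exact: ltW.
have nr : \forall y \near c q, `|y - c q| < rho by apply/nbhs_normP; exists rho.
apply: filterS2 (near_dom cq) nr => y [cy ey] yr.
by rewrite /lv /X asboolT// mulKVmx ?ey ?chi1 ?scale1r// ?(ltW yr)//; exact: Jt_unit.
Qed.

End man.

Section local_ops.
Context {R : realType} {m : nat}.
Implicit Types (x u v w : 'cV[R]_m).

(* On constant vectors [ext1] is 2 d eta, [ext2] is 3 d omega and [tor] is the
   Nijenhuis torsion, in the normalisation of [d1] and [d2]. *)
Definition ext1 (E : 'cV[R]_m -> 'rV[R]_m) x u v : 'M[R]_1 :=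
  dd u E x *m v - dd v E x *m u.
Definition ext2 (B : 'cV[R]_m -> 'M[R]_m) x u v w : 'M[R]_1 :=
  v^T *m dd u B x *m w + w^T *m dd v B x *m u + u^T *m dd w B x *m v.
Definition tor (F : 'cV[R]_m -> 'M[R]_m) x u v : 'cV[R]_m :=
  dd (F x *m u) F x *m v - dd (F x *m v) F x *m u
  + F x *m (dd v F x *m u) - F x *m (dd u F x *m v).

(* The matrix of [nabla_u] minus the derivative in the direction [u]. *)
Definition chr_low (g : 'cV[R]_m -> 'M[R]_m) u x : 'M[R]_m :=
  \matrix_(i < m) (u^T *m dd (delta_mx i 0) g x).
Definition chr (g : 'cV[R]_m -> 'M[R]_m) u x : 'M[R]_m :=
  2^-1 *: (invmx (g x) *m (dd u g x + (chr_low g u x)^T - chr_low g u x)).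
Definition lRm (g : 'cV[R]_m -> 'M[R]_m) x u v : 'M[R]_m :=
  dd u (chr g v) x - dd v (chr g u) x + chr g u x *m chr g v x - chr g v x *m chr g u x.
Definition lric (g : 'cV[R]_m -> 'M[R]_m) x v w : R :=
  \sum_i (lRm g x (delta_mx i 0) v *m w) i 0.

Lemma mx11D (A B : 'M[R]_1) : (A + B) 0 0 = A 0 0 + B 0 0. Proof. by rewrite mxE. Qed.
Lemma mx11N (A : 'M[R]_1) : (- A) 0 0 = - A 0 0. Proof. by rewrite mxE. Qed.
Lemma mx11_inj (A B : 'M[R]_1) : A 0 0 = B 0 0 -> A = B.
Proof. by move=> h; apply/matrixP => i j; rewrite !ord1. Qed.
Lemma tr11 (A : 'M[R]_1) : A^T = A. Proof. by apply: mx11_inj; rewrite mxE. Qed.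

Lemma trZ {p q} (a : R) (A : 'M[R]_(p, q)) : (a *: A)^T = a *: A^T.
Proof. by apply/matrixP => i j; rewrite !mxE. Qed.
Lemma trD {p q} (A B : 'M[R]_(p, q)) : (A + B)^T = A^T + B^T.
Proof. by apply/matrixP => i j; rewrite !mxE. Qed.
Lemma trB {p q} (A B : 'M[R]_(p, q)) : (A - B)^T = A^T - B^T.
Proof. by apply/matrixP => i j; rewrite !mxE. Qed.
Lemma trN {p q} (A : 'M[R]_(p, q)) : (- A)^T = - A^T.
Proof. by apply/matrixP => i j; rewrite !mxE. Qed.

Lemma chr_lowE g u v x : chr_low g u x *m v = \col_i (u^T *m dd (delta_mx i 0) g x *m v) 0 0.
Proof.
apply/colP => i; rewrite !mxE; apply: eq_bigr => j _; by rewrite !mxE.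
Qed.

Lemma chr_lowT g u v x : sm g x -> (forall u, (dd u g x)^T = dd u g x) ->
  (chr_low g u x)^T *m v = dd v g x *m u.
Proof.
move=> sg gT; apply/colP => i; rewrite mxE.
transitivity (((\sum_j v j 0 *: dd (delta_mx j 0) g x) *m u) i 0); last first.
  congr ((_ *m _) i 0); rewrite {2}(matrix_sum_delta v).
  under [in RHS]eq_bigr => j _ do rewrite big_ord1.
  rewrite D_dir_sum//; apply: eq_bigr => j _; by rewrite D_dirZ.
rewrite mulmx_suml summxE; apply: eq_bigr => j _.
rewrite (_ : (_ *m u) i 0 = v j 0 * (dd (delta_mx j 0) g x *m u) i 0); last by rewrite -scalemxAl mxE.
rewrite mulrC; congr (_ * _); rewrite mxE mxE.
rewrite -[X in X = _]/((u^T *m dd (delta_mx j 0) g x) 0 i).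
transitivity ((dd (delta_mx j 0) g x *m u)^T 0 i); last by rewrite mxE.
by rewrite trmx_mul gT.
Qed.

Definition lin_fam {n p q} (L : 'cV[R]_n -> 'cV[R]_m -> 'M[R]_(p, q)) (x : 'cV[R]_m) :=
  (forall v : 'cV[R]_n, sm (L v) x) /\ \forall y \near x, forall v : 'cV[R]_n, L v y = \sum_j v j 0 *: L (delta_mx j 0) y.

Lemma D_msum {p q} (I : Type) (r : seq I) (F : I -> 'cV[R]_m -> 'M[R]_(p, q)) x u :
  (forall j, sm (F j) x) -> sm (fun y => \sum_(j <- r) F j y) x /\
      dd u (fun y => \sum_(j <- r) F j y) x = \sum_(j <- r) dd u (F j) x.
Proof.
move=> sF; elim: r => [|j r [IH1 IH2]].
  split; first by apply: sm_ext (sm_cst 0 x) => y; rewrite big_nil.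
  by rewrite big_nil -[RHS](Dcst 0 x u); apply: D_ext => y; rewrite big_nil.
split; first by apply: sm_ext (smD (sF j) IH1) => y; rewrite big_cons.
by rewrite big_cons -IH2 -DD//; apply: D_ext => y; rewrite big_cons.
Qed.

Lemma dd_lin_fam {n p q} (L : 'cV[R]_n -> 'cV[R]_m -> 'M[R]_(p, q)) (Y : 'cV[R]_m -> 'cV[R]_n) x u :
  lin_fam L x -> sm Y x ->
  sm (fun y => L (Y y) y) x /\
  dd u (fun y => L (Y y) y) x = dd u (L (Y x)) x + L (dd u Y x) x.
Proof.
move=> [sL LL] sY.
have E1 (Z : 'cV[R]_m -> 'cV[R]_n) : \forall y \near x, \sum_j Z y j 0 *: L (delta_mx j 0) y = L (Z y) y.
  by apply: filterS LL => y ->.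
have sYj j : sm (fun y => Y y j 0 : R^o) x by exact: (sm_mxP Y x).1.
have sj j : sm (fun y => Y y j 0 *: L (delta_mx j 0) y) x by apply: sm_scale.
have smsum (F : 'I_n -> 'cV[R]_m -> 'M[R]_(p, q)) : (forall j, sm (F j) x) ->
    sm (fun y => \sum_j F j y) x /\ dd u (fun y => \sum_j F j y) x = \sum_j dd u (F j) x by exact: D_msum.
have [S1 S2] := smsum (fun j y => Y y j 0 *: L (delta_mx j 0) y) sj.
split; first exact: sm_eq (E1 Y) S1.
rewrite -(D_eq u (E1 Y)) S2.
have LL0 := nbhs_singleton LL.
rewrite [in RHS]addrC (LL0 (dd u Y x)).
have [S3 S4] := smsum (fun j y => Y x j 0 *: L (delta_mx j 0) y) (fun j => smZ (Y x j 0) (sL _)).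
rewrite -(D_eq u (E1 (fun=> Y x))) S4 -big_split /=; apply: eq_bigr => j _.
rewrite D_scale// DZ//; congr (_ + _); by rewrite D_entry.
Qed.

Lemma dd_lin_fam_D {p q} (f : 'cV[R]_m -> 'M[R]_(p, q)) x : sm f x -> lin_fam (fun v => dd v f) x.
Proof.
move=> sf; split=> [v|]; first exact: sm_D.
apply: filterS (sm_near sf) => y sy v.
rewrite {1}(matrix_sum_delta v) (_ : \sum_i _ = \sum_i v i 0 *: delta_mx i 0); last first.
  by apply: eq_bigr => i _; rewrite big_ord1.
by rewrite D_dir_sum//; apply: eq_bigr => j _; rewrite D_dirZ.
Qed.

Section christoffel.
Variables (g : 'cV[R]_m -> 'M[R]_m) (x : 'cV[R]_m).
Hypotheses (sg : sm g x) (gT : \forall y \near x, (g y)^T = g y)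
  (gU : \forall y \near x, g y \in unitmx).

Lemma dd_sym u : (dd u g x)^T = dd u g x.
Proof. by rewrite -D_trmx//; apply: D_eq. Qed.

Lemma sm_chr_low u : sm (chr_low g u) x.
Proof.
apply/sm_mxP => i j.
have := (sm_mxP _ _).1 (sm_mulmxl u^T (sm_D (delta_mx i 0 : 'cV[R]_m) sg)) 0 j.
by apply: sm_ext => y; rewrite [RHS]mxE.
Qed.

Lemma sm_chr u : sm (chr g u) x.
Proof.
apply: smZ; apply: sm_mulmx.
  by apply: sm_invmx => //; exact: nbhs_singleton gU.
apply: smB; last exact: sm_chr_low.
apply: smD; first exact: sm_D.
by apply: sm_trmx; exact: sm_chr_low.
Qed.

Lemma lin_fam_chr : lin_fam (chr g) x.
Proof.
split; first exact: sm_chr.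
have [_ H] := dd_lin_fam_D sg.
apply: filterS H => y Hy v.
have L1 : chr_low g v y = \sum_j v j 0 *: chr_low g (delta_mx j 0) y.
  apply/row_matrixP => i; rewrite rowK linear_sum /=.
  rewrite {1}(matrix_sum_delta v) linear_sum mulmx_suml /=; apply: eq_bigr => j _.
  by rewrite big_ord1 linearZ/= -scalemxAl [in RHS]linearZ /= rowK.
rewrite {1}/chr Hy L1 linear_sum -big_split -sumrN -big_split /= mulmx_sumr scaler_sumr.
apply: eq_bigr => j _; rewrite /chr scalerA [v j 0 * _]mulrC -scalerA; congr (_ *: _).
by rewrite linearZ /= -scalerDr -scalerBr -scalemxAr.
Qed.

Let gx := nbhs_singleton gU.

Lemma chr_sym u v : chr g u x *m v = chr g v x *m u.
Proof.
rewrite /chr -!scalemxAl -!mulmxA; congr (_ *: (_ *m _)).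
rewrite !mulmxBl !mulmxDl !chr_lowT//; [|exact: dd_sym|exact: dd_sym].
rewrite [X in X - _]addrC; congr (_ - _); rewrite !chr_lowE; apply/colP => i; rewrite [LHS]mxE [RHS]mxE.
rewrite (_ : u^T *m dd (delta_mx i 0) g x *m v = v^T *m dd (delta_mx i 0) g x *m u)//.
by rewrite -[LHS]tr11 !trmx_mul trmxK dd_sym mulmxA.
Qed.

Lemma g_chr u : g x *m chr g u x = 2^-1 *: (dd u g x + (chr_low g u x)^T - chr_low g u x).
Proof. by rewrite /chr -scalemxAr mulKVmx. Qed.

Lemma chr_metric u : dd u g x = g x *m chr g u x + (chr g u x)^T *m g x.
Proof.
have h : (chr g u x)^T *m g x = (g x *m chr g u x)^T by rewrite trmx_mul (nbhs_singleton gT).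
rewrite h g_chr trZ -scalerDr trB trD dd_sym trmxK.
set A := dd u g x; set B := _^T; set C := chr_low _ _ _.
rewrite (_ : _ + _ = 2 *: A) ?scalerA ?mulVf ?scale1r ?pnatr_eq0//.
by apply/matrixP => i j; rewrite !mxE; lra.
Qed.

Lemma chr_koszul u v w : w^T *m g x *m chr g u x *m v = 2^-1 *:
  (v^T *m dd u g x *m w + u^T *m dd v g x *m w - u^T *m dd w g x *m v).
Proof.
rewrite -[w^T *m _ *m _]mulmxA g_chr -scalemxAr -scalemxAl; congr (_ *: _).
rewrite -[LHS]mulmxA mulmxBl mulmxDl !chr_lowT//; last exact: dd_sym.
rewrite mulmxBr mulmxDr; congr (_ + _ - _).
- by rewrite -[LHS]tr11 !trmx_mul trmxK dd_sym.
- by rewrite -[LHS]tr11 !trmx_mul trmxK dd_sym.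
apply: mx11_inj; rewrite chr_lowE mxE.
have [_ /nbhs_singleton H] := dd_lin_fam_D sg.
rewrite (H w) mulmx_sumr mulmx_suml summxE; apply: eq_bigr => j _.
by rewrite -scalemxAr -scalemxAl [RHS]mxE mxE mxE.
Qed.

End christoffel.

End local_ops.

Section man.
Context {R : realType} {m : nat} {M : manifold R m}.
Implicit Types (c d : chart R M m) (X Y Z : vfield M) (p q : M) (f : endofield M) (e : oneform M) (g : metric M).

Lemma app1E c e X y : atlas c -> chart_dom c (chart_inv c y) ->
  app1 e X (chart_inv c y) = (le c e y *m lv c X y) 0 0.
Proof. by move=> ac dy; rewrite /app1 /le /lv mulmxA mulmxKV//; exact: Jt_unit. Qed.

Lemma lv_appE c f X y : atlas c -> chart_dom c (chart_inv c y) ->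
  lv c (appE f X) y = lE c f y *m lv c X y.
Proof. by move=> ac dy; rewrite /appE /lE /lv [RHS]mulmxA mulmxKV ?mulmxA//; exact: Jt_unit. Qed.

Lemma innerE c g X Y y : atlas c -> chart_dom c (chart_inv c y) ->
  inner g X Y (chart_inv c y) = ((lv c X y)^T *m lg c g y *m lv c Y y) 0 0.
Proof.
move=> ac dy; have u := Jt_unit ac dy; rewrite /inner /lg /lv trmx_mul.
set J := Jt _ _ in u *; rewrite !mulmxA mulmxKV// -[_ *m J^T *m _]mulmxA -trmx_mul mulVmx//.
by rewrite trmx1 mulmx1.
Qed.

Lemma sv_sm X c q : smooth_vfield X -> atlas c -> chart_dom c q -> smv c X q.
Proof. by move=> /smooth_vfieldP; exact. Qed.

Lemma sv_D X Y : smooth_vfield X -> smooth_vfield Y -> smooth_vfield (fun p => X p + Y p).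
Proof.
move=> /smooth_vfieldP sX /smooth_vfieldP sY; apply/smooth_vfieldP => c q ac cq.
apply: sm_ext (smD (sX c q ac cq) (sY c q ac cq)) => y.
by rewrite /lv mulmxDr.
Qed.

Lemma sv_Z (a : M -> R^o) X : smooth_fun setT a -> smooth_vfield X ->
  smooth_vfield (fun p => a p *: X p).
Proof.
move=> /(smooth_funRP _ openT) sa /smooth_vfieldP sX; apply/smooth_vfieldP => c q ac cq.
apply: sm_ext (sm_scale (sa c q ac cq I) (sX c q ac cq)) => y.
by rewrite /lv -scalemxAr.
Qed.

Lemma sv_0 : smooth_vfield (fun _ : M => 0).
Proof.
apply/smooth_vfieldP => c q ac cq.
by apply: sm_ext (sm_cst 0 _) => y; rewrite /lv mulmx0.
Qed.

Lemma smooth_cst (a : R^o) : smooth_fun setT (fun _ : M => a).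
Proof. by apply/(smooth_funRP _ openT) => c q _ _ _; exact: sm_cst. Qed.

Lemma sm_le c q e : smooth_oneform e -> atlas c -> chart_dom c q -> sm (le c e) (c q).
Proof.
move=> se ac cq; apply/sm_mxP => i j.
have [X sX X1] := const_field (delta_mx j 0) ac cq.
have /(smooth_funRP _ openT)/(_ c q ac cq I) := se X sX.
apply: sm_eq; apply: filterS2 X1 (near_dom cq) => y Xy [dy _] /=.
by rewrite app1E// Xy -colE !mxE ord1.
Qed.

Lemma sm_lE c q f : smooth_endofield f -> atlas c -> chart_dom c q -> sm (lE c f) (c q).
Proof.
move=> sf ac cq; apply/sm_mxP => i j.
have [X sX X1] := const_field (delta_mx j 0) ac cq.
have /smooth_vfieldP/(_ c q ac cq)/sm_mxP/(_ i 0) := sf X sX.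
apply: sm_eq; apply: filterS2 X1 (near_dom cq) => y Xy [dy _].
by rewrite lv_appE// Xy -colE !mxE.
Qed.

Lemma sm_lg c q g : riemannian g -> atlas c -> chart_dom c q -> sm (lg c g) (c q).
Proof.
move=> rg ac cq; apply/sm_mxP => i j.
have [X sX X1] := const_field (delta_mx i 0) ac cq.
have [Y sY Y1] := const_field (delta_mx j 0) ac cq.
have /(smooth_funRP _ openT)/(_ c q ac cq I) := metric_smooth rg sX sY.
apply: sm_eq; apply: filterS3 X1 Y1 (near_dom cq) => y Xy Yy [dy _] /=.
by rewrite innerE// Xy Yy -colE trmx_delta -rowE !mxE.
Qed.

Lemma near_app1 c q e X : atlas c -> chart_dom c q ->
  \forall y \near c q, ((le c e y *m lv c X y) 0 0) = (app1 e X \o chart_inv c) y.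
Proof. by move=> ac cq; apply: filterS (near_dom cq) => y [dy _] /=; rewrite app1E. Qed.

Lemma near_inner c q g X Y : atlas c -> chart_dom c q ->
  \forall y \near c q, ((lv c X y)^T *m lg c g y *m lv c Y y) 0 0 = (inner g X Y \o chart_inv c) y.
Proof. by move=> ac cq; apply: filterS (near_dom cq) => y [dy _] /=; rewrite innerE. Qed.

Lemma deriv_app1 c q e X Y : atlas c -> chart_dom c q -> sm (le c e) (c q) -> smv c Y q ->
  Defs.deriv X (app1 e Y) q = (dd (lv c X (c q)) (le c e) (c q) *m lv c Y (c q)
     + le c e (c q) *m dd (lv c X (c q)) (lv c Y) (c q)) 0 0.
Proof.
move=> ac cq se sY; have se1 := sm_mulmx se sY.
rewrite (derivE _ ac cq); last by apply: sm_eq (near_app1 _ _ ac cq) _; exact: (sm_mxP _ _).1.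
rewrite -(D_eq _ (near_app1 _ _ ac cq)) -D_mulmx//.
by rewrite D_entry.
Qed.

Lemma deriv_bil c q (w : M -> R^o) (B : 'cV[R]_m -> 'M[R]_m) X Y Z : atlas c -> chart_dom c q ->
  sm B (c q) -> smv c Y q -> smv c Z q ->
  (\forall y \near c q, ((lv c Y y)^T *m B y *m lv c Z y) 0 0 = (w \o chart_inv c) y) ->
  let u := lv c X (c q) in
  Defs.deriv X w q = ((lv c Y (c q))^T *m dd u B (c q) *m lv c Z (c q)
     + (dd u (lv c Y) (c q))^T *m B (c q) *m lv c Z (c q)
     + (lv c Y (c q))^T *m B (c q) *m dd u (lv c Z) (c q)) 0 0.
Proof.
move=> ac cq sB sY sZ nw u.
have s1 := sm_mulmx (sm_trmx sY) sB; have s2 := sm_mulmx s1 sZ.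
rewrite (derivE _ ac cq); last by apply: sm_eq nw _; exact: (sm_mxP _ _).1.
rewrite -(D_eq _ nw) (_ : dd _ _ _ = (dd u (fun y => (lv c Y y)^T *m B y *m lv c Z y) (c q)) 0 0).
  rewrite (D_mulmx u s1 sZ) (D_mulmx u (sm_trmx sY) sB) D_trmx// mulmxDl.
  congr (fun_of_matrix _ 0 0); congr (_ + _); exact: addrC.
by rewrite D_entry.
Qed.

Lemma app1_at c q e X : atlas c -> chart_dom c q -> app1 e X q = (le c e (c q) *m lv c X (c q)) 0 0.
Proof. by move=> ac cq; rewrite -app1E ?chart_funK. Qed.

Lemma inner_at c q g X Y : atlas c -> chart_dom c q ->
  inner g X Y q = ((lv c X (c q))^T *m lg c g (c q) *m lv c Y (c q)) 0 0.
Proof. by move=> ac cq; rewrite -innerE ?chart_funK. Qed.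

Lemma lv_bracket_at c q X Y : atlas c -> chart_dom c q -> smv c X q -> smv c Y q ->
  lv c (bracket X Y) (c q) = dd (lv c X (c q)) (lv c Y) (c q) - dd (lv c Y (c q)) (lv c X) (c q).
Proof. by move=> ac cq sX sY; exact: (nbhs_singleton (lv_bracket ac cq sX sY)). Qed.

Lemma d1_chart c q e X Y : atlas c -> chart_dom c q -> smooth_oneform e -> smv c X q -> smv c Y q ->
  d1 e X Y q = 2^-1 * (ext1 (le c e) (c q) (lv c X (c q)) (lv c Y (c q))) 0 0.
Proof.
move=> ac cq se sX sY; have sE := sm_le se ac cq.
rewrite /d1 (deriv_app1 _ ac cq sE sY) (deriv_app1 _ ac cq sE sX) (app1_at _ _ ac cq) lv_bracket_at//.
rewrite mulmxBr /ext1; congr (_ * _).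
set a := (_ *m lv c Y _); set b := (_ *m dd _ (lv c Y) _); set a' := (_ *m lv c X _); set b' := (_ *m dd _ (lv c X) _).
by rewrite !mxE; ring.
Qed.

Lemma d2_chart c q g f X Y Z : atlas c -> chart_dom c q -> riemannian g -> smooth_endofield f ->
  (let B := lg c g (c q) *m lE c f (c q) in B^T = - B) ->
  smv c X q -> smv c Y q -> smv c Z q ->
  d2 (fundamental_form g f) X Y Z q = 3^-1 *
   (ext2 (fun y => lg c g y *m lE c f y) (c q) (lv c X (c q)) (lv c Y (c q)) (lv c Z (c q))) 0 0.
Proof.
move=> ac cq rg sf skB sX sY sZ.
pose B y := lg c g y *m lE c f y.
have sB : sm B (c q) by apply: sm_mulmx; [exact: sm_lg|exact: sm_lE].
have nB V W : \forall y \near c q, ((lv c V y)^T *m B y *m lv c W y) 0 0 = (fundamental_form g f V W \o chart_inv c) y.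
  apply: filterS (near_dom cq) => y [dy _] /=.
  by rewrite /fundamental_form innerE// lv_appE// !mulmxA.
have eB V W : fundamental_form g f V W q = ((lv c V (c q))^T *m B (c q) *m lv c W (c q)) 0 0.
  by rewrite (nbhs_singleton (nB V W)) /= chart_funK.
rewrite /d2 !(deriv_bil _ ac cq sB _ _ (nB _ _))// !eB !lv_bracket_at//.
congr (_ * _); rewrite /ext2 -/B.
have sk (u v : 'cV[R]_m) : (u^T *m B (c q) *m v) 0 0 = - (v^T *m B (c q) *m u) 0 0.
  by rewrite -[in LHS](tr11 (_ *m v)) 2!trmx_mul trmxK mulmxA [(B (c q))^T]skB !(mulmxN, mulNmx) mxE.
rewrite !trB !mulmxBl !mx11D !mx11N.
rewrite (sk (lv c X (c q)) (dd _ _ _)) (sk (lv c Y (c q)) (dd _ _ _)) (sk (lv c Z (c q)) (dd _ _ _)).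
ring.
Qed.

Lemma nij_chart c q f X Y : atlas c -> chart_dom c q -> smooth_endofield f ->
  smooth_vfield X -> smooth_vfield Y ->
  Jt c q *m nijenhuis f X Y q = tor (lE c f) (c q) (lv c X (c q)) (lv c Y (c q)).
Proof.
move=> ac cq sf sX sY; have sF := sm_lE sf ac cq.
have sx W : smooth_vfield W -> smv c W q by move=> sW; exact: sv_sm.
have ap W : Jt c q *m appE f W q = lE c f (c q) *m (Jt c q *m W q).
  by rewrite -!lv_at// lv_appE ?chart_funK.
have nF W : \forall y \near c q, lv c (appE f W) y = lE c f y *m lv c W y.
  by apply: filterS (near_dom cq) => y [dy _]; rewrite lv_appE.
have dF W v : smooth_vfield W -> dd v (lv c (appE f W)) (c q) =
   dd v (lE c f) (c q) *m lv c W (c q) + lE c f (c q) *m dd v (lv c W) (c q).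
  by move=> sW; rewrite (D_eq _ (nF W)) D_mulmx//; exact: sx.
have sfX := sf X sX; have sfY := sf Y sY.
have H (A : 'M[R]_m) (a1 a2 a3 a4 : 'cV[R]_m) :
    A *m (a1 + a2 - a3 - a4) = A *m a1 + A *m a2 - A *m a3 - A *m a4.
  by rewrite !mulmxBr mulmxDr.
pose bb V W := dd (lv c V (c q)) (lv c W) (c q) - dd (lv c W (c q)) (lv c V) (c q).
have br V W : smooth_vfield V -> smooth_vfield W -> Jt c q *m bracket V W q = bb V W.
  by move=> sV sW; rewrite bracket_chart//; exact: sx.
transitivity (lE c f (c q) *m (lE c f (c q) *m bb X Y)
    + bb (appE f X) (appE f Y)
    - lE c f (c q) *m bb (appE f X) Y
    - lE c f (c q) *m bb X (appE f Y)).
  apply: (etrans (H _ _ _ _ _)); congr (_ + _ - _ - _).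
  - exact: (etrans (ap _) (congr1 _ (etrans (ap _) (congr1 _ (br _ _ sX sY))))).
  - exact: br.
  - exact: (etrans (ap _) (congr1 _ (br _ _ sfX sY))).
  - exact: (etrans (ap _) (congr1 _ (br _ _ sX sfY))).
rewrite /bb !(dF X)// !(dF Y)// (nbhs_singleton (nF X)) (nbhs_singleton (nF Y)) /tor.
set F := lE c f (c q); set u := lv c X _; set v := lv c Y _.
rewrite !(mulmxBr, mulmxDr).
set a1 := F *m (F *m dd u _ _); set a2 := F *m (F *m dd v _ _).
set b1 := F *m dd (F *m u) _ _; set b2 := F *m dd (F *m v) _ _.
set c1 := dd _ _ _ *m v; set c2 := dd _ _ _ *m u; set c3 := F *m _; set c4 := F *m _.
by apply/colP => i; rewrite !mxE; ring.
Qed.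

End man.

Section lc.
Context {R : realType} {m : nat} {M : manifold R m} (g : metric M) (rg : riemannian g).
Implicit Types (c d : chart R M m) (X Y Z : vfield M) (p q : M).

Lemma posdef_unit n (A : 'M[R]_n) : (forall v : 'cV[R]_n, v != 0 -> 0 < (v^T *m A *m v) 0 0) ->
  A \in unitmx.
Proof.
move=> pA; rewrite -row_free_unit -kermx_eq0; apply/rowV0P => v /sub_kermxP vA.
apply/eqP; apply: contraT => v0.
have := pA v^T; rewrite trmxK vA mul0mx mxE ltxx; apply.
by apply: contra v0 => /eqP /(congr1 trmx); rewrite trmxK trmx0 => ->.
Qed.

Lemma lg_sym c y : (lg c g y)^T = lg c g y.
Proof. by rewrite /lg !trmx_mul trmxK (Defs.metric_sym rg) mulmxA. Qed.

Lemma lg_pos c y (v : 'cV[R]_m) : atlas c -> chart_dom c (chart_inv c y) -> v != 0 ->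
  0 < (v^T *m lg c g y *m v) 0 0.
Proof.
move=> ac dy v0; have := Defs.metric_pos rg (chart_inv c y) (v := invmx (Jt c (chart_inv c y)) *m v).
rewrite trmx_mul /lg !mulmxA; apply.
by apply: contra v0 => /eqP/(congr1 (mulmx (Jt c (chart_inv c y)))); rewrite mulKVmx ?Jt_unit// mulmx0 => ->.
Qed.

Lemma lg_unit c y : atlas c -> chart_dom c (chart_inv c y) -> lg c g y \in unitmx.
Proof. by move=> ac dy; apply: posdef_unit => v; exact: lg_pos. Qed.

Lemma near_unit c q : atlas c -> chart_dom c q -> \forall y \near c q, lg c g y \in unitmx.
Proof. by move=> ac cq; apply: filterS (near_dom cq) => y [dy _]; exact: lg_unit. Qed.

Lemma near_sym c q : \forall y \near c q, (lg c g y)^T = lg c g y.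
Proof. by apply: (@nearW _ (nbhs (c q))) => y; exact: lg_sym. Qed.

Lemma lg_at c q : chart_dom c q -> lg c g (c q) = (invmx (Jt c q))^T *m g q *m invmx (Jt c q).
Proof. by move=> cq; rewrite /lg chart_funK. Qed.

Local Opaque bracket lv lg inner.

Lemma koszul_chart c q X Y Z : atlas c -> chart_dom c q -> smv c X q -> smv c Y q -> smv c Z q ->
  let u := lv c X (c q) in let v := lv c Y (c q) in let w := lv c Z (c q) in
  2^-1 * koszul g X Y Z q =
  (w^T *m lg c g (c q) *m (dd u (lv c Y) (c q) + chr (lg c g) u (c q) *m v)) 0 0.
Proof.
move=> ac cq sX sY sZ u v w; have sG := sm_lg rg ac cq.
have nI := near_inner g _ _ ac cq; have iA := inner_at g _ _ ac cq.
have iB A B D : smv c A q -> smv c B q -> inner g (bracket A B) D q =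
    ((dd (lv c A (c q)) (lv c B) (c q) - dd (lv c B (c q)) (lv c A) (c q))^T *m lg c g (c q) *m lv c D (c q)) 0 0.
  by move=> sA sB; rewrite -(lv_bracket_at ac cq sA sB); exact: iA.
transitivity (2^-1 * 
  (((v^T *m dd u (lg c g) (c q) *m w + (dd u (lv c Y) (c q))^T *m lg c g (c q) *m w
     + v^T *m lg c g (c q) *m dd u (lv c Z) (c q)) 0 0)
  + ((u^T *m dd v (lg c g) (c q) *m w + (dd v (lv c X) (c q))^T *m lg c g (c q) *m w
     + u^T *m lg c g (c q) *m dd v (lv c Z) (c q)) 0 0)
  - ((u^T *m dd w (lg c g) (c q) *m v + (dd w (lv c X) (c q))^T *m lg c g (c q) *m v
     + u^T *m lg c g (c q) *m dd w (lv c Y) (c q)) 0 0)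
  + ((dd u (lv c Y) (c q) - dd v (lv c X) (c q))^T *m lg c g (c q) *m w) 0 0
  - ((dd u (lv c Z) (c q) - dd w (lv c X) (c q))^T *m lg c g (c q) *m v) 0 0
  - ((dd v (lv c Z) (c q) - dd w (lv c Y) (c q))^T *m lg c g (c q) *m u) 0 0)).
  congr (_ * _); rewrite /koszul; congr (_ + _ - _ + _ - _ - _).
  - exact: (deriv_bil X ac cq sG sY sZ (nI Y Z)).
  - exact: (deriv_bil Y ac cq sG sX sZ (nI X Z)).
  - exact: (deriv_bil Z ac cq sG sX sY (nI X Y)).
  - exact: iB.
  - exact: iB.
  - exact: iB.
rewrite [in RHS]mulmxDr mulmxA.
rewrite (chr_koszul sG (near_sym c q) (near_unit ac cq)).
have m11Z (a : R) (A : 'M[R]_1) : (a *: A) 0 0 = a * A 0 0 by rewrite mxE.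
rewrite !trB !mulmxBl !(mx11D, m11Z, mx11N).
have sk (a b : 'cV[R]_m) : (a^T *m lg c g (c q) *m b) 0 0 = (b^T *m lg c g (c q) *m a) 0 0.
  by rewrite -[in LHS](tr11 (_ *m b)) 2!trmx_mul trmxK mulmxA lg_sym.
rewrite !(sk u (dd _ _ _)) !(sk v (dd _ _ _)) !(sk w (dd _ _ _)).
lra.
Qed.

Lemma smv_coord_field c p i : atlas c -> chart_dom c p ->
  \forall y \near c p, lv c (coord_field c i) y = delta_mx i 0.
Proof.
move=> ac cp; apply: filterS (near_dom cp) => y [dy ey].
rewrite -{1}ey lv_at// /coord_field; set q := chart_inv c y in dy ey *; rewrite ey.
have [ad dq] := chart_atP q.
have st : sm (chart_at q \o chart_inv c) y by rewrite -ey; exact: trans_sm.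
have -> : 'd (chart_at q \o chart_inv c) y (delta_mx i 0 : 'cV[R]_m) =
   dd (delta_mx i 0 : 'cV[R]_m) (chart_at q \o chart_inv c) y.
  by rewrite unlock (deriveE _ (sm_diff st)).
rewrite D_jac// mulmxA.
have := jac_trans ac ad dy dq; rewrite ey Jt_self => /mulmx1C ->.
by rewrite mul1mx.
Qed.

Lemma levi_civita_chart c q X Y : atlas c -> chart_dom c q -> smv c X q -> smv c Y q ->
  Jt c q *m levi_civita g X Y q =
  dd (lv c X (c q)) (lv c Y) (c q) + chr (lg c g) (lv c X (c q)) (c q) *m lv c Y (c q).
Proof.
move=> ac cq sX sY; have [ad dq] := chart_atP q; set d := chart_at q in ad dq *.
set W := _ + _; have uJ := Jt_unit ac cq.
suff -> : levi_civita g X Y q = invmx (Jt c q) *m W by rewrite mulKVmx.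
rewrite /levi_civita; have gq : g q \in unitmx.
  by apply: posdef_unit; exact: (Defs.metric_pos rg q).
apply: (canLR (mulKmx gq)); apply/colP => i; rewrite mxE.
have nc := smv_coord_field i ad dq.
have sd : smv d (coord_field d i) q.
  apply: sm_eq (sm_cst (delta_mx i 0) _); by apply: filterS nc => y ->.
rewrite (koszul_chart ac cq sX sY (smv_change ad ac dq cq sd)) -/W.
rewrite lv_at//; have := nbhs_singleton nc; rewrite lv_at// Jt_self mul1mx => ->.
rewrite lg_at// trmx_mul !mulmxA -[_ *m _ *m (invmx _)^T]mulmxA -trmx_mul mulVmx//.
by rewrite -[_ *m W]mulmxA -!mulmxA trmx1 mul1mx trmx_delta -rowE [LHS]mxE.
Qed.

Lemma lv_levi_civita c q X Y : atlas c -> chart_dom c q -> smv c X q -> smv c Y q ->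
  \forall y \near c q, lv c (levi_civita g X Y) y =
    dd (lv c X y) (lv c Y) y + chr (lg c g) (lv c X y) y *m lv c Y y.
Proof.
move=> ac cq sX sY.
apply: filterS3 (sm_near sX) (sm_near sY) (near_dom cq) => y sXy sYy [dy ey].
by rewrite -{1}ey lv_at// levi_civita_chart ?ey// /smv ?ey.
Qed.

Lemma smv_levi_civita c q X Y : atlas c -> chart_dom c q -> smv c X q -> smv c Y q ->
  smv c (levi_civita g X Y) q.
Proof.
move=> ac cq sX sY; have sG := sm_lg rg ac cq.
have n := lv_levi_civita ac cq sX sY.
apply: (sm_eq (f := fun y => dd (lv c X y) (lv c Y) y + chr (lg c g) (lv c X y) y *m lv c Y y)).
  by apply: filterS n => y ->.
apply: smD; first by have [] := dd_lin_fam 0 (dd_lin_fam_D sY) sX.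
apply: sm_mulmx => //.
by have [] := dd_lin_fam 0 (lin_fam_chr sG (near_unit ac cq)) sX.
Qed.

Lemma curvature_chart c q X Y Z : atlas c -> chart_dom c q -> smv c X q -> smv c Y q -> smv c Z q ->
  Jt c q *m curvature g X Y Z q =
  lRm (lg c g) (c q) (lv c X (c q)) (lv c Y (c q)) *m lv c Z (c q).
Proof.
move=> ac cq sX sY sZ; have sG := sm_lg rg ac cq.
have lD := dd_lin_fam_D sZ; have lC := lin_fam_chr sG (near_unit ac cq).
have sV V : smv c V q -> sm (fun y => chr (lg c g) (lv c V y) y) (c q).
  by move=> sV; have [] := dd_lin_fam 0 lC sV.
have sD V : smv c V q -> sm (fun y => dd (lv c V y) (lv c Z) y) (c q).
  by move=> sV'; have [] := dd_lin_fam 0 lD sV'.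
have H V u : smv c V q -> dd u (lv c (levi_civita g V Z)) (c q) =
   dd u (dd (lv c V (c q)) (lv c Z)) (c q) + dd (dd u (lv c V) (c q)) (lv c Z) (c q)
   + ((dd u (chr (lg c g) (lv c V (c q))) (c q) + chr (lg c g) (dd u (lv c V) (c q)) (c q)) *m lv c Z (c q)
      + chr (lg c g) (lv c V (c q)) (c q) *m dd u (lv c Z) (c q)).
  move=> sV'; rewrite (D_eq _ (lv_levi_civita ac cq sV' sZ)).
  have [_ E1] := dd_lin_fam u lD sV'; have [_ E2] := dd_lin_fam u lC sV'.
  have sA := sV _ sV'; have sB := sD _ sV'.
  by rewrite (DD u sB (sm_mulmx sA sZ)) E1 (D_mulmx u sA sZ) E2.
have sb : smv c (bracket X Y) q.
  have n := lv_bracket ac cq sX sY.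
  apply: (sm_eq (f := fun y => dd (lv c X y) (lv c Y) y - dd (lv c Y y) (lv c X) y)).
    by apply: filterS n => y ->.
  apply: smB; first by have [] := dd_lin_fam 0 (dd_lin_fam_D sY) sX.
  by have [] := dd_lin_fam 0 (dd_lin_fam_D sX) sY.
have sYZ := smv_levi_civita ac cq sY sZ; have sXZ := smv_levi_civita ac cq sX sZ.
have L V : smv c V q -> lv c (levi_civita g V Z) (c q) =
    dd (lv c V (c q)) (lv c Z) (c q) + chr (lg c g) (lv c V (c q)) (c q) *m lv c Z (c q).
  by move=> sV'; exact: (nbhs_singleton (lv_levi_civita ac cq sV' sZ)).
have HY := H Y (lv c X (c q)) sY; have HX := H X (lv c Y (c q)) sX.
have LY := L Y sY; have LX := L X sX; have LB := lv_bracket_at ac cq sX sY.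
have H3 (A : 'M[R]_m) (a1 a2 a3 : 'cV[R]_m) : A *m (a1 - a2 - a3) = A *m a1 - A *m a2 - A *m a3.
  by rewrite !mulmxBr.
apply: (etrans (H3 _ _ _ _)).
have E1 := levi_civita_chart ac cq sX sYZ.
have E2 := levi_civita_chart ac cq sY sXZ.
have E3 := levi_civita_chart ac cq sb sZ.
apply: (etrans (f_equal2 (fun a b => a - b) (f_equal2 (fun a b => a - b) E1 E2) E3)).
clear E1 E2 E3 H3; rewrite HY HX LY LX LB D_dirB//; clear HY HX LY LX LB.
have -> : chr (lg c g) (dd (lv c X (c q)) (lv c Y) (c q) - dd (lv c Y (c q)) (lv c X) (c q)) (c q)
  = chr (lg c g) (dd (lv c X (c q)) (lv c Y) (c q)) (c q) - chr (lg c g) (dd (lv c Y (c q)) (lv c X) (c q)) (c q).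
  have [_ /nbhs_singleton L'] := lC.
  rewrite !(L' (_ - _)) (L' (dd (lv c X _) _ _)) (L' (dd (lv c Y _) _ _)) -sumrB.
  by apply: eq_bigr => j _; rewrite 2!mxE scalerBl.
rewrite (D_swap (lv c Y (c q)) (lv c X (c q)) sZ) /lRm.
move: (chr (lg c g) (dd (lv c X (c q)) (lv c Y) (c q)) (c q)) (chr (lg c g) (dd (lv c Y (c q)) (lv c X) (c q)) (c q)) => B1 B2.
move: (dd (lv c X (c q)) (dd (lv c Y (c q)) (lv c Z)) (c q)) (dd (dd (lv c X (c q)) (lv c Y) (c q)) (lv c Z) (c q))
  (dd (dd (lv c Y (c q)) (lv c X) (c q)) (lv c Z) (c q)) => a1 a2 a3.
move: (dd (lv c X (c q)) (chr (lg c g) (lv c Y (c q))) (c q)) (dd (lv c Y (c q)) (chr (lg c g) (lv c X (c q))) (c q)) => C1 C2.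
move: (dd (lv c X (c q)) (lv c Z) (c q)) (dd (lv c Y (c q)) (lv c Z) (c q)) => z1 z2.
move: (chr (lg c g) (lv c X (c q)) (c q)) (chr (lg c g) (lv c Y (c q)) (c q)) (lv c Z (c q)) => D1 D2 zz.
clear; rewrite !(mulmxDl, mulmxDr, mulmxBl, mulNmx) !mulmxA.
move: (B1 *m zz) (B2 *m zz) (C1 *m zz) (C2 *m zz) (D1 *m z2) (D2 *m z1) => b1 b2 c1 c2 d1 d2.
move: (_ *m zz) (_ *m zz) => f1 f2.
by apply/colP => i; rewrite !mxE; ring.
Qed.

Lemma ricci_chart p Y Z : smooth_vfield Y -> smooth_vfield Z ->
  ricci g Y Z p = lric (lg (chart_at p) g) (chart_at p p) (Y p) (Z p).
Proof.
move=> sY sZ; have [ac cp] := chart_atP p; set c := chart_at p in ac cp *.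
rewrite /ricci /lric; apply: eq_bigr => i _.
have nc := smv_coord_field i ac cp.
have sd : smv c (coord_field c i) p.
  by apply: sm_eq (sm_cst (delta_mx i 0) _); apply: filterS nc => y ->.
have := curvature_chart ac cp sd (sv_sm sY ac cp) (sv_sm sZ ac cp).
rewrite Jt_self mul1mx => ->; rewrite (nbhs_singleton nc) !lv_at// Jt_self !mul1mx.
by [].
Qed.

End lc.

(** * 3-quasi-Sasakian structures in coordinates *)

Lemma I3_cases (a b : 'I_3) : [\/ b = a, b = a + 1 | b = a + 2].
Proof.
have [/eqP ab|ab] := boolP (b == a); first by constructor 1.
have [/eqP ab1|ab1] := boolP (b == a + 1); first by constructor 2.
have [/eqP ab2|ab2] := boolP (b == a + 2); first by constructor 3.
exfalso; move: ab ab1 ab2; move: a b => [[|[|[|//]]] ia] [[|[|[|//]]] ib]; rewrite -?val_eqE //=.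
Qed.

Lemma I3_11 (a : 'I_3) : a + 1 + 1 = a + 2.
Proof. by apply: val_inj; move: a => [[|[|[|//]]] ia]. Qed.
Lemma I3_12 (a : 'I_3) : a + 1 + 2 = a.
Proof. by apply: val_inj; move: a => [[|[|[|//]]] ia]. Qed.
Lemma I3_21 (a : 'I_3) : a + 2 + 1 = a.
Proof. by apply: val_inj; move: a => [[|[|[|//]]] ia]. Qed.
Lemma I3_22 (a : 'I_3) : a + 2 + 2 = a + 1.
Proof. by apply: val_inj; move: a => [[|[|[|//]]] ia]. Qed.
Lemma I3_sum {V : zmodType} (F : 'I_3 -> V) (a : 'I_3) : \sum_i F i = F a + F (a + 1) + F (a + 2).
Proof.
rewrite !big_ord_recl big_ord0 addr0.
have h (k l : 'I_3) : val k = val l -> F k = F l by move=> /val_inj ->.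
rewrite (h ord0 0)// (h (lift ord0 ord0) 1)// (h (lift ord0 (lift ord0 ord0)) 2)//.
move: a => [[|[|[|//]]] ia]; set a := Ordinal ia.
- by rewrite (h a 0)// (h (a + 1) 1)// (h (a + 2) 2)// addrA.
- by rewrite (h a 1)// (h (a + 1) 2)// (h (a + 2) 0)// addrC.
- by rewrite (h a 2)// (h (a + 1) 0)// (h (a + 2) 1)// [RHS]addrAC [RHS]addrC [F 2 + _]addrC.
Qed.

Section alg.
Context {R : realType} {m : nat}.

Lemma scal11 n (a : 'M[R]_1) (x : 'cV[R]_n) : x *m a = a 0 0 *: x.
Proof. by rewrite [a]mx11_scalar mul_mx_scalar mxE eqxx mulr1n. Qed.

Section acm.
Variables (P : 'M[R]_m) (X : 'cV[R]_m) (E : 'rV[R]_m) (G : 'M[R]_m).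
Hypotheses (P2 : P *m P = - 1%:M + X *m E) (EX : E *m X = 1%:M)
  (met : P^T *m G *m P = G - E^T *m E).

Lemma acm_PX : P *m X = 0.
Proof.
have h : P *m (P *m X) = 0 by rewrite mulmxA P2 mulmxDl mulNmx mul1mx -mulmxA EX mulmx1 addNr.
have e : P *m X = (E *m (P *m X)) 0 0 *: X.
  have : P *m (P *m (P *m X)) = 0 by rewrite h mulmx0.
  rewrite mulmxA P2 mulmxDl mulNmx mul1mx -mulmxA => /eqP.
  by rewrite addrC scal11 subr_eq0 => /eqP/esym.
have [z|nz] := eqVneq ((E *m (P *m X)) 0 0) 0; first by rewrite e z scale0r.
move: h; rewrite {1}e -scalemxAr => /eqP; rewrite scaler_eq0 (negPf nz) /= => /eqP h.
by exfalso; move: nz; rewrite h mulmx0 mxE eqxx.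
Qed.

Lemma acm_EP : E *m P = 0.
Proof.
have : P *m (P *m P) = P *m P *m P by rewrite mulmxA.
rewrite {1}P2 {1}P2 mulmxDr mulmxDl mulmxN mulNmx mulmx1 mul1mx mulmxA acm_PX mul0mx.
move=> /addrI /(congr1 (mulmx E)); rewrite mulmx0 -mulmxA mulmxA EX mul1mx => <-; done.
Qed.

Lemma acm_GX : G *m X = E^T.
Proof.
have := congr1 (mulmxr X) met; rewrite /= -!mulmxA acm_PX !mulmx0 mulmxBl -mulmxA EX mulmx1.
by move=> /eqP; rewrite eq_sym subr_eq0 => /eqP.
Qed.

Lemma acm_skew : P^T *m G = - (G *m P).
Proof.
have := congr1 (mulmxr P) met; rewrite /= -!mulmxA P2 mulmxBl -mulmxA acm_EP mulmx0 subr0.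
rewrite !mulmxDr !mulmxA -[P^T *m G *m X]mulmxA acm_GX -trmx_mul acm_EP trmx0 mul0mx addr0.
by rewrite mulmxN mulmx1 => <-; rewrite opprK.
Qed.

Lemma acm_G : G = E^T *m E - G *m P *m P.
Proof.
have := met; rewrite acm_skew mulNmx => /eqP; rewrite eq_sym subr_eq => /eqP {1}->.
by rewrite addrC.
Qed.

End acm.
End alg.

Section lie.
Context {R : realType} {m : nat}.
Implicit Types (Z : 'cV[R]_m -> 'cV[R]_m) (y u v w : 'cV[R]_m).

Definition Lvec Z (X : 'cV[R]_m -> 'cV[R]_m) y := dd (Z y) X y - jac Z y *m X y.
Definition Lrow Z (E : 'cV[R]_m -> 'rV[R]_m) y := dd (Z y) E y + E y *m jac Z y.
Definition Lend Z (P : 'cV[R]_m -> 'M[R]_m) y := dd (Z y) P y - jac Z y *m P y + P y *m jac Z y.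
Definition Lbil Z (B : 'cV[R]_m -> 'M[R]_m) y := dd (Z y) B y + (jac Z y)^T *m B y + B y *m jac Z y.
Definition dmx (E : 'cV[R]_m -> 'rV[R]_m) y : 'M[R]_m := (jac (fun z => (E z)^T) y)^T - jac (fun z => (E z)^T) y.

Lemma dmxE E y u v : sm E y -> u^T *m dmx E y *m v = ext1 E y u v.
Proof.
move=> sE; rewrite /dmx mulmxBr mulmxBl -trmx_mul -[_ *m jac _ _ *m v]mulmxA.
have sT := sm_trmx sE.
rewrite -!D_jac// !D_trmx// trmxK /ext1; congr (_ - _).
by rewrite -trmx_mul tr11.
Qed.

Lemma dmx_skew E y : (dmx E y)^T = - dmx E y.
Proof. by rewrite /dmx trB trmxK opprB. Qed.

Lemma Lrow_ext Z E y u : sm Z y -> sm E y ->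
  Lrow Z E y *m u = ext1 E y (Z y) u + dd u (fun z => E z *m Z z) y.
Proof.
move=> sZ sE; rewrite D_mulmx// /Lrow /ext1 mulmxDl -mulmxA -D_jac//.
by rewrite addrA subrK.
Qed.

Lemma Lend_mulE Z E P y : sm Z y -> sm E y -> sm P y ->
  Lrow Z (fun z => E z *m P z) y = Lrow Z E y *m P y + E y *m Lend Z P y.
Proof.
move=> sZ sE sP; rewrite /Lrow /Lend D_mulmx// !(mulmxDl, mulmxDr) mulmxN !mulmxA.
set a := dd _ E _ *m _; set b := _ *m dd _ P _; set c := _ *m jac _ _ *m _; set d := _ *m jac _ _.
by apply/rowP => i; rewrite !mxE; ring.
Qed.

Lemma Lbil_mul Z G P y : sm Z y -> sm G y -> sm P y ->
  Lbil Z (fun z => G z *m P z) y = Lbil Z G y *m P y + G y *m Lend Z P y.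
Proof.
move=> sZ sE sP; rewrite /Lbil /Lend D_mulmx// !(mulmxDl, mulmxDr) mulmxN !mulmxA.
set a := dd _ G _ *m _; set b := _ *m dd _ P _; set c := _ *m jac _ _ *m _; set d := _ *m jac _ _.
set e := _ *m G y *m P y.
by apply/matrixP => i j; rewrite !mxE; ring.
Qed.

Lemma Lend_mul Z P Q y : sm Z y -> sm P y -> sm Q y ->
  Lend Z (fun z => P z *m Q z) y = Lend Z P y *m Q y + P y *m Lend Z Q y.
Proof.
move=> sZ sE sP; rewrite /Lend D_mulmx// !(mulmxDl, mulmxDr, mulNmx, mulmxN) !mulmxA.
set a := dd _ P _ *m _; set b := _ *m dd _ Q _; set c := P y *m jac _ _ *m _; set d := _ *m jac _ _.
set e := _ *m P y *m Q y.
by apply/matrixP => i j; rewrite !mxE; ring.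
Qed.

Lemma Lvec_row Z (X : 'cV[R]_m -> 'cV[R]_m) (E : 'cV[R]_m -> 'rV[R]_m) y :
  sm Z y -> sm X y -> sm E y ->
  Lend Z (fun z => X z *m E z) y = Lvec Z X y *m E y + X y *m Lrow Z E y.
Proof.
move=> sZ sX sE; rewrite /Lend /Lvec /Lrow D_mulmx// !(mulmxDl, mulmxDr, mulmxBl, mulNmx) !mulmxA.
set a := dd _ X _ *m _; set b := _ *m dd _ E _; set c := X y *m E _ *m _; set d := _ *m X y *m _.
by apply/matrixP => i j; rewrite !mxE; ring.
Qed.

Lemma Lbil_row Z (E : 'cV[R]_m -> 'rV[R]_m) y : sm Z y -> sm E y ->
  Lbil Z (fun z => (E z)^T *m E z) y = (Lrow Z E y)^T *m E y + (E y)^T *m Lrow Z E y.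
Proof.
move=> sZ sE; have sT := sm_trmx sE.
rewrite /Lbil /Lrow D_mulmx// D_trmx// !trD trmx_mul !(mulmxDl, mulmxDr) !mulmxA.
set a := _^T *m E y; set b := _ *m dd _ _ _; set c := _ *m jac _ _; set d := _ *m _ *m E y.
by apply/matrixP => i j; rewrite !mxE; ring.
Qed.

Lemma Lrow_bil Z (X : 'cV[R]_m -> 'cV[R]_m) (G : 'cV[R]_m -> 'M[R]_m) y : sm Z y -> sm X y -> sm G y ->
  Lrow Z (fun z => (X z)^T *m G z) y = (Lvec Z X y)^T *m G y + (X y)^T *m Lbil Z G y.
Proof.
move=> sZ sX sG; have sT := sm_trmx sX.
rewrite /Lbil /Lrow /Lvec D_mulmx// D_trmx// trB trmx_mul !(mulmxDl, mulmxDr, mulNmx, mulmxN) !mulmxA.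
set a := _^T *m G y; set b := _ *m dd _ G _; set c := _ *m jac _ _; set d := _ *m _ *m G y.
by apply/matrixP => i j; rewrite !mxE; ring.
Qed.

Lemma cartan2 Z B y : sm Z y -> sm B y -> (\forall z \near y, (B z)^T = - B z) ->
  (forall u v w, ext2 B y u v w = 0) ->
  Lbil Z B y = dmx (fun z => (Z z)^T *m B z) y.
Proof.
move=> sZ sB skB cl; apply: form_ext => u v.
have sZT := sm_trmx sZ; have sE := sm_mulmx sZT sB.
rewrite dmxE// /ext1 !D_mulmx// !D_trmx//.
have sk w : (dd w B y)^T = - dd w B y.
  by rewrite -D_trmx// -DN//; apply: D_eq.
have skb (a b : 'cV[R]_m) w : a^T *m dd w B y *m b = - (b^T *m dd w B y *m a).
  by rewrite -[LHS]tr11 2!trmx_mul trmxK sk mulNmx mulmxN mulmxA.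
have skB0 (a b : 'cV[R]_m) : a^T *m B y *m b = - (b^T *m B y *m a).
  by rewrite -[LHS]tr11 2!trmx_mul trmxK (nbhs_singleton skB) mulNmx mulmxN mulmxA.
have := cl (Z y) u v; rewrite /ext2 (skb v).
rewrite /Lbil !(mulmxDl, mulmxDr) [u^T *m (_ *m _)]mulmxA -trmx_mul -D_jac//.
rewrite [u^T *m (_ *m _)]mulmxA -[_ *m jac _ _ *m v]mulmxA -D_jac// (skB0 u).
set a := u^T *m _ *m _; set b := (Z y)^T *m _ *m v; set c := (Z y)^T *m _ *m u.
move=> h; have {h} -> : a = b - c.
  by apply/eqP; rewrite -subr_eq0 opprB addrA addrAC h.
by apply/matrixP => i j; rewrite !mxE; ring.
Qed.

End lie.

Section loc3.
Context {R : realType} {m : nat}.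

(* A 3-quasi-Sasakian structure in coordinates, on the open set [D]. *)
Record loc3 (D : set 'cV[R]_m) (k : R) (G : 'cV[R]_m -> 'M[R]_m) (P : 'I_3 -> 'cV[R]_m -> 'M[R]_m)
    (E : 'I_3 -> 'cV[R]_m -> 'rV[R]_m) (X : 'I_3 -> 'cV[R]_m -> 'cV[R]_m) : Prop := Loc3 {
  l_open : open D;
  l_smG : forall y, D y -> sm G y;
  l_smP : forall a y, D y -> sm (P a) y;
  l_smE : forall a y, D y -> sm (E a) y;
  l_smX : forall a y, D y -> sm (X a) y;
  l_sym : forall y, D y -> (G y)^T = G y;
  l_pos : forall y (v : 'cV[R]_m), D y -> v != 0 -> 0 < (v^T *m G y *m v) 0 0;
  l_P2 : forall a y, D y -> P a y *m P a y = - 1%:M + X a y *m E a y;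
  l_EX : forall a y, D y -> E a y *m X a y = 1%:M;
  l_met : forall a y, D y -> (P a y)^T *m G y *m P a y = G y - (E a y)^T *m E a y;
  l_phi : forall a y, D y -> P (a + 2) y = P a y *m P (a + 1) y - X a y *m E (a + 1) y /\
    P (a + 2) y = - (P (a + 1) y *m P a y) + X (a + 1) y *m E a y;
  l_xi : forall a y, D y -> X (a + 2) y = P a y *m X (a + 1) y /\ X (a + 2) y = - (P (a + 1) y *m X a y);
  l_eta : forall a y, D y -> E (a + 2) y = E a y *m P (a + 1) y /\ E (a + 2) y = - (E (a + 1) y *m P a y);
  l_tor : forall a y u v, D y -> tor (P a) y u v + (ext1 (E a) y u v) 0 0 *: X a y = 0;
  l_ext2 : forall a y u v w, D y -> ext2 (fun z => G z *m P a z) y u v w = 0;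
  l_br : forall a y, D y -> Lvec (X a) (X (a + 1)) y = k *: X (a + 2) y }.

Variables (D : set 'cV[R]_m) (k : R) (G : 'cV[R]_m -> 'M[R]_m) (P : 'I_3 -> 'cV[R]_m -> 'M[R]_m)
    (E : 'I_3 -> 'cV[R]_m -> 'rV[R]_m) (X : 'I_3 -> 'cV[R]_m -> 'cV[R]_m).
Hypothesis L : loc3 D k G P E X.

Lemma l_near (Q : 'cV[R]_m -> Prop) y : D y -> (forall z, D z -> Q z) -> \forall z \near y, Q z.
Proof.
move=> Dy H; apply: (filterS (P := D)); first by move=> z; exact: H.
by apply: open_nbhs_nbhs; split=> //; exact: l_open L.
Qed.

Section pointwise.
Variables (y : 'cV[R]_m).
Hypothesis Dy : D y.

Lemma l_PX a : P a y *m X a y = 0.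
Proof. exact: acm_PX (l_P2 L a Dy) (l_EX L a Dy). Qed.
Lemma l_EP a : E a y *m P a y = 0.
Proof. exact: acm_EP (l_P2 L a Dy) (l_EX L a Dy). Qed.
Lemma l_GX a : G y *m X a y = (E a y)^T.
Proof. exact: acm_GX (l_P2 L a Dy) (l_EX L a Dy) (l_met L a Dy). Qed.
Lemma l_skew a : (P a y)^T *m G y = - (G y *m P a y).
Proof. exact: acm_skew (l_P2 L a Dy) (l_EX L a Dy) (l_met L a Dy). Qed.
Lemma l_G a : G y = (E a y)^T *m E a y - G y *m P a y *m P a y.
Proof. exact: acm_G (l_P2 L a Dy) (l_EX L a Dy) (l_met L a Dy). Qed.
Lemma l_E a : E a y = (X a y)^T *m G y.
Proof. by rewrite -[LHS]trmxK -l_GX trmx_mul (l_sym L Dy). Qed.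

Lemma l_unit : G y \in unitmx.
Proof.
rewrite -row_free_unit -kermx_eq0; apply/rowV0P => v /sub_kermxP vA.
apply/eqP; apply: contraT => v0.
have := @l_pos _ _ _ _ _ _ L y v^T Dy; rewrite trmxK vA mul0mx mxE ltxx; apply.
by apply: contra v0 => /eqP /(congr1 trmx); rewrite trmxK trmx0 => ->.
Qed.

Lemma l_EX12 a : E a y *m X (a + 1) y = 0.
Proof.
have := l_xi L (a + 2) Dy; rewrite I3_22 I3_21 => -[_ ->].
by rewrite mulmxN mulmxA l_EP// mul0mx oppr0.
Qed.

Lemma l_EX13 a : E a y *m X (a + 2) y = 0.
Proof. by have [-> _] := l_xi L a Dy; rewrite mulmxA l_EP mul0mx. Qed.

Lemma l_EXE a b : E a y *m X b y = (a == b)%:R%:M.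
Proof.
have [->|->|->] := I3_cases a b; first by rewrite (l_EX L) // eqxx.
  by rewrite l_EX12 (_ : (a == a + 1) = false) ?raddf0//; apply/eqP => /(congr1 val); move: a => [[|[|[|//]]] ia].
by rewrite l_EX13 (_ : (a == a + 2) = false) ?raddf0//; apply/eqP => /(congr1 val); move: a => [[|[|[|//]]] ia].
Qed.

End pointwise.

Section first_order.
Variables (y : 'cV[R]_m).
Hypothesis Dy : D y.
Let sG := l_smG L Dy.
Let sP a := l_smP L a Dy.
Let sE a := l_smE L a Dy.
Let sX a := l_smX L a Dy.

Lemma l_torX a u : P a y *m (Lend (X a) (P a) y *m u) = tor (P a) y u (X a y).
Proof.
have Z w : dd w (P a) y *m X a y + P a y *m dd w (X a) y = 0.
  rewrite -D_mulmx// -[RHS](Dcst (0 : 'cV[R]_m) y w); apply: D_eq.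
  by apply: l_near => // z Dz; rewrite l_PX.
rewrite /tor l_PX//; have -> : dd (P a y *m u) (P a) y *m X a y = - (P a y *m dd (P a y *m u) (X a) y).
  by apply/eqP; rewrite -addr_eq0 Z.
have -> : dd u (P a) y *m X a y = - (P a y *m dd u (X a) y) by apply/eqP; rewrite -addr_eq0 Z.
have -> : dd 0 (P a) y = 0 by have := Dscale 0 0 (sP a); rewrite !scale0r.
rewrite mul0mx subr0 /Lend !(mulmxDl, mulmxDr, mulNmx, mulmxN) opprK !D_jac// !mulmxA.
by rewrite [- _ + _]addrC.
Qed.

Lemma l_d1_xi a u : ext1 (E a) y u (X a y) = 0.
Proof.
have := l_tor L a u (X a y) Dy; rewrite -l_torX => /(congr1 (mulmx (E a y))).
rewrite mulmxDr mulmxA l_EP// mul0mx add0r mulmx0 -scalemxAr (l_EX L)// => /matrixP/(_ 0 0).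
have e1 : (1%:M : 'M[R]_1) 0 0 = 1 by rewrite mxE.
by rewrite [LHS]mxE e1 mulr1 => h0; apply: mx11_inj.
Qed.

Lemma ext1N a u v : ext1 (E a) y u v = - ext1 (E a) y v u.
Proof. by rewrite /ext1 opprB. Qed.

Lemma l_LE a : Lrow (X a) (E a) y = 0.
Proof.
apply: mulmx_ext => u; rewrite Lrow_ext// mul0mx ext1N l_d1_xi oppr0 add0r.
transitivity (dd u (fun=> 1%:M : 'M[R]_1) y); last exact: Dcst.
by apply: D_eq; apply: l_near => // z Dz; exact: (l_EX L a Dz).
Qed.

Lemma l_LP a : Lend (X a) (P a) y = 0.
Proof.
have hE : E a y *m Lend (X a) (P a) y = 0.
  have := Lend_mulE (sX a) (sE a) (sP a); rewrite l_LE mul0mx add0r => <-.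
  have nz : \forall z \near y, (fun z => E a z *m P a z) z = 0.
    by apply: l_near => // z Dz; exact: l_EP.
  by rewrite /Lrow (D_eq _ nz) Dcst l_EP// mul0mx addr0.
have h : P a y *m Lend (X a) (P a) y = 0.
  apply: mulmx_ext => u.
  have := l_tor L a u (X a y) Dy; rewrite l_d1_xi mxE scale0r addr0 -l_torX mulmxA => ->.
  by rewrite mul0mx.
have := l_P2 L a Dy => /(congr1 (mulmxr (Lend (X a) (P a) y))) /=.
rewrite mulmxDl mulNmx mul1mx -!mulmxA h mulmx0 hE mulmx0 addr0 => /eqP.
by rewrite eq_sym oppr_eq0 => /eqP.
Qed.

Definition Bf a z := G z *m P a z.

Lemma l_skB a z : D z -> (Bf a z)^T = - Bf a z.
Proof. by move=> Dz; rewrite /Bf trmx_mul (l_sym L)// l_skew. Qed.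

Lemma sm_Bf a : sm (Bf a) y. Proof. exact: sm_mulmx. Qed.

Lemma l_LB b a : Lbil (X b) (Bf a) y = dmx (fun z => E b z *m P a z) y.
Proof.
rewrite cartan2//; first last.
- by move=> u v w; exact: (l_ext2 L a u v w Dy).
- by apply: l_near => // z; exact: l_skB.
- exact: sm_Bf.
have H : \forall z \near y, ((X b z)^T *m Bf a z)^T = (E b z *m P a z)^T.
  by apply: l_near => // z Dz; rewrite l_E// /Bf mulmxA.
by rewrite /dmx (jac_eq H).
Qed.

Lemma dmxN (e : 'cV[R]_m -> 'rV[R]_m) : sm e y -> dmx (fun z => - e z) y = - dmx e y.
Proof.
move=> se; apply: form_ext => u v.
have sN := smN se; rewrite mulmxN mulNmx !dmxE// /ext1 !DN// !mulNmx.
by rewrite opprB [RHS]addrC opprK addrC.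
Qed.

Lemma dmx_eq (e f : 'cV[R]_m -> 'rV[R]_m) : (\forall z \near y, e z = f z) -> dmx e y = dmx f y.
Proof.
move=> H; rewrite /dmx (_ : jac _ y = jac (fun z => (f z)^T) y)//.
by apply: jac_eq; apply: filterS H => z ->.
Qed.

Lemma l_LBself a : Lbil (X a) (Bf a) y = 0.
Proof.
rewrite l_LB (dmx_eq (f := fun=> 0)); last by apply: l_near => // z Dz; rewrite l_EP.
by apply: form_ext => u v; rewrite dmxE ?mulmx0 ?mul0mx ?/ext1 ?Dcst ?mul0mx ?subr0//; exact: sm_cst.
Qed.

Lemma l_LG a : Lbil (X a) G y = 0.
Proof.
have H : \forall z \near y, G z = (fun z => (E a z)^T *m E a z - Bf a z *m P a z) z.
  by apply: l_near => // z Dz; rewrite {1}(l_G Dz a).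
have s1 : sm (fun z => (E a z)^T *m E a z) y by apply: sm_mulmx => //; exact: sm_trmx.
have s2 : sm (fun z => Bf a z *m P a z) y by apply: sm_mulmx => //; exact: sm_Bf.
have -> : Lbil (X a) G y = Lbil (X a) (fun z => (E a z)^T *m E a z) y - Lbil (X a) (fun z => Bf a z *m P a z) y.
  rewrite /Lbil (D_eq _ H) (nbhs_singleton H) DB// mulmxBr mulmxBl.
  by apply/matrixP => i j; rewrite !mxE; ring.
rewrite Lbil_row// Lbil_mul//; last exact: sm_Bf.
by rewrite l_LE l_LP l_LBself trmx0 !(mul0mx, mulmx0, addr0, subr0).
Qed.

Lemma l_GLP b a : G y *m Lend (X b) (P a) y = Lbil (X b) (Bf a) y.
Proof. by rewrite Lbil_mul// l_LG mul0mx add0r. Qed.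

Lemma l_LPp a : G y *m Lend (X (a + 1)) (P a) y = - dmx (E (a + 2)) y.
Proof.
rewrite l_GLP l_LB -dmxN//; apply: dmx_eq; apply: l_near => // z Dz.
by have [_ ->] := l_eta L a Dz; rewrite opprK.
Qed.

Lemma l_LPm a : G y *m Lend (X (a + 2)) (P a) y = dmx (E (a + 1)) y.
Proof.
rewrite l_GLP l_LB; apply: dmx_eq; apply: l_near => // z Dz.
by have := l_eta L (a + 2) Dz; rewrite I3_22 I3_21 => -[-> _].
Qed.

Lemma l_LEb d b : Lrow (X d) (E b) y = (Lvec (X d) (X b) y)^T *m G y.
Proof.
have H : \forall z \near y, E b z = (X b z)^T *m G z by apply: l_near => // z Dz; exact: l_E.
have -> : Lrow (X d) (E b) y = Lrow (X d) (fun z => (X b z)^T *m G z) y.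
  by rewrite /Lrow (D_eq _ H) (nbhs_singleton H).
by rewrite Lrow_bil// l_LG mulmx0 addr0.
Qed.

Lemma LvecN (Z W : 'cV[R]_m -> 'cV[R]_m) : sm Z y -> sm W y -> Lvec Z W y = - Lvec W Z y.
Proof. by move=> sZ sW; rewrite /Lvec -!D_jac// opprB. Qed.

Lemma l_LEp b : Lrow (X (b + 1)) (E b) y = - (k *: E (b + 2) y).
Proof. by rewrite l_LEb LvecN// (l_br L)// !(trN, trZ) mulNmx -scalemxAl -l_E. Qed.

Lemma l_LEm b : Lrow (X (b + 2)) (E b) y = k *: E (b + 1) y.
Proof.
rewrite l_LEb; have := l_br L (b + 2) Dy; rewrite I3_21 I3_22 => ->.
by rewrite trZ -scalemxAl -l_E.
Qed.

Lemma l_iE d b u : ext1 (E b) y (X d y) u = Lrow (X d) (E b) y *m u.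
Proof.
rewrite Lrow_ext//.
have H : \forall z \near y, (fun z => E b z *m X d z) z = (fun=> (b == d)%:R%:M : 'M[R]_1) z.
  by apply: l_near => // z Dz; exact: l_EXE.
by rewrite (D_eq _ H) Dcst addr0.
Qed.

Lemma l_iH d b (u : 'cV[R]_m) : (forall a, E a y *m u = 0) -> ext1 (E b) y (X d y) u = 0.
Proof.
move=> Hu; rewrite l_iE; have [->|->|->] := I3_cases b d.
- by rewrite l_LE mul0mx.
- by rewrite l_LEp mulNmx -scalemxAl Hu scaler0 oppr0.
- by rewrite l_LEm -scalemxAl Hu scaler0.
Qed.

Definition hor z : 'M[R]_m := 1%:M - \sum_a X a z *m E a z.

Lemma E_hor a : E a y *m hor y = 0.
Proof.
rewrite /hor mulmxBr mulmx1 mulmx_sumr (bigD1 a)//= mulmxA (l_EX L)// mul1mx big1 ?addr0 ?subrr//.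
by move=> b ba; rewrite mulmxA l_EXE// eq_sym (negPf ba) raddf0 mul0mx.
Qed.

Lemma hor_split u : u = hor y *m u + \sum_a (E a y *m u) 0 0 *: X a y.
Proof.
rewrite /hor mulmxBl mul1mx mulmx_suml (eq_bigr (fun a => (E a y *m u) 0 0 *: X a y)) ?subrK//.
by move=> a _; rewrite -mulmxA scal11.
Qed.

Definition lii := forall a (u v : 'cV[R]_m), (forall b, E b y *m u = 0) -> (forall b, E b y *m v = 0) -> ext1 (E a) y u v = 0.

Lemma dmx_pair a u v : u^T *m dmx (E a) y *m v = ext1 (E a) y u v.
Proof. exact: dmxE. Qed.

Lemma l_dmx0 a (u : 'cV[R]_m) : lii -> (forall b, E b y *m u = 0) -> dmx (E a) y *m u = 0.
Proof.
move=> ii Hu; apply: trmx_inj; rewrite trmx0; apply: mulmx_ext => w; rewrite mul0mx.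
rewrite -[LHS]tr11 !trmx_mul !trmxK {1}(hor_split w) trD mulmxDl mulmxA dmx_pair.
have -> : ext1 (E a) y (hor y *m w) u = 0.
  by apply: ii => // b; rewrite mulmxA E_hor mul0mx.
rewrite add0r.
rewrite linear_sum mulmx_suml big1// => b _.
by rewrite linearZ /= -scalemxAl mulmxA dmx_pair l_iH// scaler0.
Qed.

Lemma l_i_ii : (forall a b (u : 'cV[R]_m), (forall d, E d y *m u = 0) -> Lend (X b) (P a) y *m u = 0) <-> lii.
Proof.
split=> [H a u v Hu Hv|ii a b u Hu].
  have := l_LPm (a + 2); rewrite I3_21 I3_22 => /(congr1 (fun Z => u^T *m Z *m v)).
  by rewrite dmx_pair -[_ *m v]mulmxA -mulmxA (H (a + 2) (a + 1) v Hv) !mulmx0 => <-.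
apply: (can_inj (mulKmx (l_unit Dy))); rewrite mulmx0 mulmxA.
have [->|->|->] := I3_cases a b.
- by rewrite l_LP mulmx0 mul0mx.
- by rewrite l_LPp mulNmx l_dmx0// oppr0.
- by rewrite l_LPm l_dmx0.
Qed.

End first_order.
End loc3.

Section pfaffian.
Context {R : realType} {m : nat} (D : set 'cV[R]_m) (k : R) (G : 'cV[R]_m -> 'M[R]_m) (P : 'I_3 -> 'cV[R]_m -> 'M[R]_m)
    (E : 'I_3 -> 'cV[R]_m -> 'rV[R]_m) (X : 'I_3 -> 'cV[R]_m -> 'cV[R]_m).
Hypothesis L : loc3 D k G P E X.
Variable (y : 'cV[R]_m).
Hypothesis Dy : D y.

Let sP a := l_smP L a Dy.
Let sE a := l_smE L a Dy.
Let sX a := l_smX L a Dy.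

Lemma l_anti c (u : 'cV[R]_m) : (forall b, E b y *m u = 0) ->
  let W := Lend (X (c + 1)) (P (c + 2)) y in
  W *m (P (c + 2) y *m u) = - (P (c + 2) y *m (W *m u)).
Proof.
move=> Hu W; have H : \forall z \near y, P (c + 2) z *m P (c + 2) z = - 1%:M + X (c + 2) z *m E (c + 2) z.
  by apply: (l_near L) => // z Dz; rewrite (l_P2 L).
have := Lend_mul (sX (c + 1)) (sP (c + 2)) (sP (c + 2)).
have sXE : sm (fun z => X (c + 2) z *m E (c + 2) z) y by exact: sm_mulmx.
have -> : Lend (X (c + 1)) (fun z => P (c + 2) z *m P (c + 2) z) y =
    Lend (X (c + 1)) (fun z => X (c + 2) z *m E (c + 2) z) y.
  rewrite /Lend (D_eq _ H) (nbhs_singleton H) DD//; last exact: sm_cst.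
  rewrite Dcst add0r mulmxDl mulmxDr mulmxN mulNmx mulmx1 mul1mx.
  by apply/matrixP => i j; rewrite !mxE; ring.
rewrite Lvec_row// => /(congr1 (mulmxr u)) /=.
rewrite mulmxDl -!mulmxA Hu mulmx0 add0r.
have := l_LEm L Dy (c + 2); rewrite I3_22 I3_21 => ->.
rewrite -scalemxAl Hu scaler0 mulmx0 mulmxDl -!mulmxA => /esym/eqP.
by rewrite addr_eq0 => /eqP.
Qed.

Lemma l_pf_ii : (forall a (u0 u1 u2 u3 : 'cV[R]_m), let w u v := (ext1 (E a) y u v) 0 0 in
    w u0 u1 * w u2 u3 - w u0 u2 * w u1 u3 + w u0 u3 * w u1 u2 = 0) -> lii E y.
Proof.
move=> pf c w0 u Hw0 Hu.
pose W := Lend (X (c + 1)) (P (c + 2)) y; pose f := P (c + 2) y.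
have GW : G y *m W = dmx (E c) y by have := l_LPm L Dy (c + 2); rewrite I3_21 I3_22.
pose b (x z : 'cV[R]_m) := (x^T *m G y *m z) 0 0.
have bC x z : b x z = b z x.
  by rewrite /b; congr (fun_of_matrix _ 0 0); rewrite -[LHS]tr11 2!trmx_mul trmxK (l_sym L)// mulmxA.
have wE x z : (ext1 (E c) y x z) 0 0 = b x (W *m z) by rewrite -dmxE// -GW /b !mulmxA.
have bW x z : b x (W *m z) = - b (W *m x) z by rewrite -wE ext1N mxE wE bC.
have bf x z : b x (f *m z) = - b (f *m x) z.
  by rewrite /b trmx_mul -[x^T *m f^T *m G y]mulmxA (l_skew L Dy) mulmxN mulNmx [in RHS]mxE opprK !mulmxA.
have bN x z : b x (- z) = - b x z by rewrite /b mulmxN mxE.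
have bNl x z : b (- x) z = - b x z by rewrite bC bN bC.
have an (z : 'cV[R]_m) : (forall d, E d y *m z = 0) -> W *m (f *m z) = - (f *m (W *m z)) by exact: l_anti.
pose v := W *m u.
have Hv d : E d y *m v = 0.
  rewrite (l_E L Dy) -mulmxA [G y *m v]mulmxA GW mulmxA dmxE//; exact: (l_iH L Dy).
have ff (z : 'cV[R]_m) : (forall d, E d y *m z = 0) -> f *m (f *m z) = - z.
  by move=> Hz; rewrite mulmxA (l_P2 L)// mulmxDl mulNmx mul1mx -mulmxA Hz mulmx0 addr0.
have w01 : (ext1 (E c) y u v) 0 0 = - b v v by rewrite wE bW.
have w23 : (ext1 (E c) y (f *m u) (f *m v)) 0 0 = b v v.
  by rewrite wE an// bN bf opprK ff// bNl bW opprK.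
have z0 (t : R) : t = - t -> t = 0 by lra.
have w0' (z : 'cV[R]_m) : (forall d, E d y *m z = 0) -> (ext1 (E c) y z (f *m z)) 0 0 = 0.
  by move=> Hz; rewrite wE; apply: z0; rewrite {1}bW an// bN opprK (bf z) bC.
have w03 : (ext1 (E c) y u (f *m v)) 0 0 = 0.
  by rewrite wE bW -/v; apply: z0; rewrite opprK {1}bf opprK bC.
have := pf c u v (f *m u) (f *m v); rewrite /= w01 w23 (w0' _ Hu) (w0' _ Hv) w03 !mul0r subr0 addr0 mulNr => /eqP.
rewrite oppr_eq0 mulf_eq0 orbb => /eqP bvv.
have v0 : v = 0.
  apply/eqP; apply: contraT => v0; have := l_pos L Dy v0.
  by rewrite -[X in 0 < X]/(b v v) bvv ltxx.
by apply: mx11_inj; rewrite wE -/v v0 /b mulmx0.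
Qed.

Lemma l_ii_ext : lii E y -> forall a (u v : 'cV[R]_m), (ext1 (E a) y u v) 0 0 =
  - k * ((E (a + 1) y *m u) 0 0 * (E (a + 2) y *m v) 0 0 - (E (a + 2) y *m u) 0 0 * (E (a + 1) y *m v) 0 0).
Proof.
move=> ii a u v; have dk := l_iE L Dy.
rewrite -dmxE// {1}(hor_split E X y v) mulmxDr.
have -> : u^T *m dmx (E a) y *m (hor E X y *m v) = 0.
  rewrite -mulmxA (l_dmx0 L) ?mulmx0// => b; by rewrite mulmxA (E_hor L)// mul0mx.
rewrite add0r mulmx_sumr summxE (I3_sum _ a).
have h b : (u^T *m dmx (E a) y *m ((E b y *m v) 0 0 *: X b y)) 0 0 = - ((E b y *m v) 0 0 * (Lrow (X b) (E a) y *m u) 0 0).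
  by rewrite -scalemxAr mxE dmxE// ext1N mx11N dk mulrN.
rewrite !h (l_LE L)// (l_LEp L)// (l_LEm L)// mul0mx mulNmx -!scalemxAl !mxE.
by ring.
Qed.

End pfaffian.

(** * Wedge powers *)

Section alternating_sums.
Context {R : realType}.

Lemma sum_perm_recl n (F : 'S_n.+1 -> R) :
  \sum_s F s = \sum_(i < n.+1) \sum_(t : 'S_n) F (lift_perm ord0 i t).
Proof.
rewrite pair_bigA /= (reindex (fun p : 'I_n.+1 * 'S_n => lift_perm ord0 p.1 p.2)) //=.
apply/onW_bij; apply: inj_card_bij => [[i s] [j t] /= e|]; last first.
  by rewrite card_prod card_ord !card_Sn factS.
have ij : i = j by have := congr1 (fun u : 'S_n.+1 => u ord0) e; rewrite !lift_perm_id.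
rewrite ij in e *; congr (_, _); apply/permP => k.
by have := congr1 (fun u : 'S_n.+1 => u (lift ord0 k)) e; rewrite !lift_perm_lift => /lift_inj.
Qed.

Lemma sum_perm0 (F : 'S_0 -> R) : \sum_s F s = F 1%g.
Proof. by rewrite (big_pred1 1%g)// => s; apply/esym/eqP/permP => -[]. Qed.

Lemma sumS2 (F : nat -> nat -> R) :
  \sum_(s : 'S_2) (-1) ^+ s * F (s ord0) (s (lift ord0 ord0)) = F 0%N 1%N - F 1%N 0%N.
Proof.
rewrite sum_perm_recl !big_ord_recl big_ord0 !sum_perm_recl !big_ord_recl !big_ord0 !sum_perm0.
rewrite !odd_lift_perm !odd_perm1 !lift_perm_lift !lift_perm_id /= /bump /=.
by rewrite ?expr0 ?expr1; ring.
Qed.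

Lemma sumS3 (F : nat -> nat -> nat -> R) :
  \sum_(s : 'S_3) (-1) ^+ s * F (s ord0) (s (lift ord0 ord0)) (s (lift ord0 (lift ord0 ord0))) =
  F 0%N 1%N 2%N - F 0%N 2%N 1%N + F 1%N 2%N 0%N - F 1%N 0%N 2%N + F 2%N 0%N 1%N - F 2%N 1%N 0%N.
Proof.
rewrite sum_perm_recl !big_ord_recl big_ord0 !sum_perm_recl !big_ord_recl !big_ord0.
rewrite !sum_perm_recl !big_ord_recl !big_ord0 !sum_perm0.
rewrite !odd_lift_perm !odd_perm1 !lift_perm_lift !lift_perm_id /= /bump /=.
by rewrite ?expr0 ?expr1; ring.
Qed.

Lemma sumS4 (w : nat -> nat -> R) : (forall i j, w j i = - w i j) ->
  \sum_(s : 'S_4) (-1) ^+ s * (w (s ord0) (s (lift ord0 ord0)) *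
     w (s (lift ord0 (lift ord0 ord0))) (s (lift ord0 (lift ord0 (lift ord0 ord0))))) =
  8 * (w 0%N 1%N * w 2%N 3%N - w 0%N 2%N * w 1%N 3%N + w 0%N 3%N * w 1%N 2%N).
Proof.
move=> sk.
rewrite sum_perm_recl !big_ord_recl big_ord0 !sum_perm_recl !big_ord_recl !big_ord0.
rewrite !sum_perm_recl !big_ord_recl !big_ord0.
rewrite !sum_perm_recl !big_ord_recl !big_ord0 !sum_perm0.
rewrite !odd_lift_perm !odd_perm1 !lift_perm_lift !lift_perm_id /= /bump /=.
rewrite ?expr0 ?expr1.
rewrite (sk 0 1)%N (sk 0 2)%N (sk 0 3)%N (sk 1 2)%N (sk 1 3)%N (sk 2 3)%N.
ring.
Qed.

End alternating_sums.

Section wedge.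
Context {R : realType} {m : nat} {M : manifold R m}.
Implicit Types (e : oneform M) (X Y : vfield M).

Lemma d1N e X Y p : d1 e Y X p = - d1 e X Y p.
Proof.
rewrite /d1 (_ : app1 e (bracket Y X) p = - app1 e (bracket X Y) p); first by ring.
by rewrite /app1 /bracket -(opprB _ (dfun (components _ X) p _)) mulmxN mxE.
Qed.

Lemma wedge_pow1 e (Xs : 'I_2 -> vfield M) p :
  wedge_pow (form_d1 e) 1 Xs p = d1 e (Xs ord0) (Xs (lift ord0 ord0)) p.
Proof.
pose Y n := Xs (inord n).
have YE i : Xs i = Y (val i) by rewrite /Y inord_val.
rewrite /= /wedge /form_d1.
pose F i j := d1 e (Y i) (Y j) p.
transitivity ((2`!%:R)^-1 * \sum_(s : 'S_2) (-1) ^+ s * F (s ord0) (s (lift ord0 ord0))).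
  congr (_ * _); apply: eq_bigr => s _; rewrite mulr1 /F -!YE; congr (_ * d1 e (Xs (s _)) (Xs (s _)) p); exact: val_inj.
rewrite sumS2 /F [d1 e (Y 1%N) _ p]d1N !YE /= (_ : 2`! = 2)%N//; by field.
Qed.

Lemma wedge_pow2 e (Xs : 'I_4 -> vfield M) p :
  wedge_pow (form_d1 e) 2 Xs p = 3^-1 * (let w i j := d1 e (Xs (inord i)) (Xs (inord j)) p in
    w 0%N 1%N * w 2%N 3%N - w 0%N 2%N * w 1%N 3%N + w 0%N 3%N * w 1%N 2%N).
Proof.
pose Y n := Xs (inord n).
have YE i : Xs i = Y (val i) by rewrite /Y inord_val.
pose w i j := d1 e (Y i) (Y j) p.
transitivity ((4`!%:R)^-1 * \sum_(s : 'S_4) (-1) ^+ s * (w (s ord0) (s (lift ord0 ord0)) *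
     w (s (lift ord0 (lift ord0 ord0))) (s (lift ord0 (lift ord0 (lift ord0 ord0)))))).
  rewrite -[LHS]/(wedge (form_d1 e) (wedge_pow (form_d1 e) 1) Xs p) /wedge.
  congr (_ * _); apply: eq_bigr => s _; rewrite wedge_pow1 /form_d1 /w -!YE.
  congr (_ * (d1 e (Xs (s _)) (Xs (s _)) p * d1 e (Xs (s _)) (Xs (s _)) p)); exact: val_inj.
rewrite sumS4 => [|i j]; last exact: d1N.
rewrite mulrA; congr (_ * _).
by rewrite (_ : 4`! = 24)%N//; field.
Qed.

Lemma wedge_form1_pow1 e (Xs : 'I_3 -> vfield M) p :
  wedge (form1 e) (wedge_pow (form_d1 e) 1) Xs p =
  3^-1 * (let A i := app1 e (Xs (inord i)) p in let w i j := d1 e (Xs (inord i)) (Xs (inord j)) p in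
    A 0%N * w 1%N 2%N + A 1%N * w 2%N 0%N + A 2%N * w 0%N 1%N).
Proof.
pose Y n := Xs (inord n).
have YE i : Xs i = Y (val i) by rewrite /Y inord_val.
pose F i j k := app1 e (Y i) p * d1 e (Y j) (Y k) p.
transitivity ((3`!%:R)^-1 * \sum_(s : 'S_3) (-1) ^+ s * F (s ord0) (s (lift ord0 ord0)) (s (lift ord0 (lift ord0 ord0)))).
  rewrite /wedge; congr (_ * _); apply: eq_bigr => s _; rewrite wedge_pow1 /form1 /F -!YE.
  congr (_ * (app1 e (Xs (s _)) p * d1 e (Xs (s _)) (Xs (s _)) p)); exact: val_inj.
rewrite sumS3 /F (d1N e (Y 1%N) (Y 2)) (d1N e (Y 2) (Y 0%N)) (d1N e (Y 0%N) (Y 1%N)).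
by rewrite (_ : 3`! = 6)%N//; field.
Qed.

Lemma wedge_form1_pow_eq0 e j (Xs : 'I_(1 + j.+1 * 2) -> vfield M) p :
  (forall i, smooth_vfield (Xs i)) ->
  (forall X Y, smooth_vfield X -> smooth_vfield Y -> d1 e X Y p = 0) ->
  wedge (form1 e) (wedge_pow (form_d1 e) j.+1) Xs p = 0.
Proof.
move=> sXs H; rewrite /wedge big1 ?mulr0// => s _.
rewrite /= /wedge big1 ?mulr0 ?mulr0// => t _.
by rewrite /form_d1 H ?mul0r ?mulr0.
Qed.

End wedge.

(** * Conditions (i), (ii), (iii) and (v) *)

Lemma even_triple_succ (a : 'I_3) : even_triple a (a + 1) (a + 2).
Proof.
have inj : injective (fun i : 'I_3 => i + a) by exact: addIr.
pose s := perm inj.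
have s3 : (s * s * s = 1)%g.
  apply/permP => i; rewrite !permM !permE -!addrA (_ : a + (a + a) = 0) ?addr0//.
  by apply: val_inj; move: a {inj s} => [[|[|[|//]]] ia].
exists s.
  have := congr1 (@odd_perm _) s3; rewrite !odd_permM odd_perm1.
  by case: odd_perm.
by rewrite !permE add0r [1 + a]addrC [2 + a]addrC.
Qed.

Section tq.
Context {R : realType} {m : nat} {M : manifold R m}.
Variables (phi : 'I_3 -> endofield M) (xi : 'I_3 -> vfield M) (eta : 'I_3 -> oneform M) (g : metric M) (k : R).
Hypotheses (tq : three_quasi_Sasakian phi xi eta g)
  (hk : forall a b d : 'I_3, even_triple a b d -> forall p : M, bracket (xi a) (xi b) p = k *: xi d p).

Let acm a := qs_acm (tqs_qs tq a).
Let rg : riemannian g := acm_riemannian (acm 0).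

Lemma tq_loc3 c : atlas c -> loc3 (c @` chart_dom c) k (lg c g) (fun a => lE c (phi a))
  (fun a => le c (eta a)) (fun a => lv c (xi a)).
Proof.
move=> ac.
have H (Q : 'cV[R]_m -> Prop) : (forall q, chart_dom c q -> Q (c q)) -> forall y, (c @` chart_dom c) y -> Q y.
  by move=> HQ y [q cq <-]; exact: HQ.
have U q : chart_dom c q -> Jt c q \in unitmx by exact: Jt_unit.
have sx a := acm_xi_smooth (acm a).
have sf a := acm_phi_smooth (acm a).
have sxq a q : chart_dom c q -> smv c (xi a) q by move=> cq; exact: sv_sm.
have cf (v : 'cV[R]_m) q : chart_dom c q -> exists2 Y, smooth_vfield Y & lv c Y (c q) = v.
  by move=> cq; have [Y sY /nbhs_singleton nY] := const_field v ac cq; exists Y.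
have eP2 a q : chart_dom c q -> lE c (phi a) (c q) *m lE c (phi a) (c q) = - 1%:M + lv c (xi a) (c q) *m le c (eta a) (c q).
  move=> cq; rewrite /lE /lv /le chart_funK// !mulmxA mulmxKV ?U//.
  rewrite -[Jt c q *m _ *m phi a q]mulmxA (acm_phi2 (acm a)) mulmxDr mulmxDl mulmxN mulNmx mulmx1 mulmxV ?U//.
  by rewrite !mulmxA.
have eEX a q : chart_dom c q -> le c (eta a) (c q) *m lv c (xi a) (c q) = 1%:M.
  by move=> cq; rewrite /lv /le chart_funK// mulmxA mulmxKV ?U// (acm_eta_xi (acm a)).
have emet a q : chart_dom c q -> (lE c (phi a) (c q))^T *m lg c g (c q) *m lE c (phi a) (c q) =
    lg c g (c q) - (le c (eta a) (c q))^T *m le c (eta a) (c q).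
  move=> cq; rewrite /lE /lg /le chart_funK// !trmx_mul; set J := Jt c q; have uJ : J \in unitmx by exact: U.
  rewrite !mulmxA -[_ *m J^T *m _]mulmxA -[J^T *m _]trmx_mul mulVmx// trmx1 mulmx1 mulmxKV//.
  rewrite -[_ *m _ *m g q]mulmxA -[_ *m _ *m phi a q]mulmxA (acm_metric (acm a)).
  by rewrite mulmxBr mulmxBl !mulmxA.
split.
- exact: chart_img_open.
- by apply: H => q cq; exact: sm_lg.
- by move=> a; apply: H => q cq; exact: sm_lE.
- by move=> a; apply: H => q cq; exact: sm_le (acm_eta_smooth (acm a)) ac cq.
- by move=> a; apply: H => q cq; exact: sxq.
- by move=> y _; exact: lg_sym.
- move=> y v Dy; move: y Dy v; apply: H => q cq v; apply: lg_pos => //; by rewrite chart_funK.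
- by move=> a; apply: H => q cq; exact: eP2.
- by move=> a; apply: H => q cq; exact: eEX.
- by move=> a; apply: H => q cq; exact: emet.
- move=> a; apply: H => q cq; have [h1 h2] := tqs_phi tq (even_triple_succ a) q.
  rewrite /lE /lv /le chart_funK// !mulmxA !mulmxKV ?U//; split.
    by rewrite h1 mulmxBr mulmxBl !mulmxA.
  by rewrite h2 mulmxDr mulmxDl mulmxN mulNmx !mulmxA.
- move=> a; apply: H => q cq; have [h1 h2] := tqs_xi tq (even_triple_succ a) q.
  rewrite /lE /lv chart_funK// !mulmxA !mulmxKV ?U//; split; first by rewrite h1 mulmxA.
  by rewrite h2 mulmxN mulmxA.
- move=> a; apply: H => q cq; have [h1 h2] := tqs_eta tq (even_triple_succ a) q.
  rewrite /lE /le chart_funK// !mulmxA !mulmxKV ?U//; split; first by rewrite h1.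
  by rewrite h2 mulNmx.
- move=> a y u v Dy; move: y Dy u v; apply: H => q cq u v.
  have [Y sY <-] := cf u q cq; have [Z sZ <-] := cf v q cq.
  rewrite -(nij_chart ac cq (sf a) sY sZ) (lv_at (xi a) cq) scalemxAr -mulmxDr.
  have := qs_normal (tqs_qs tq a) sY sZ q.
  rewrite (d1_chart ac cq (acm_eta_smooth (acm a)) (sv_sm sY ac cq) (sv_sm sZ ac cq)).
  by rewrite mulrA divff ?mul1r ?pnatr_eq0// => ->; rewrite mulmx0.
- move=> a y u v w Dy; move: y Dy u v w; apply: H => q cq u v w.
  have [Y sY <-] := cf u q cq; have [Z sZ <-] := cf v q cq; have [W sW <-] := cf w q cq.
  have := qs_closed (tqs_qs tq a) sY sZ sW q.
  rewrite (d2_chart ac cq rg (sf a) _ (sv_sm sY ac cq) (sv_sm sZ ac cq) (sv_sm sW ac cq)); last first.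
    by rewrite /= trmx_mul lg_sym// (acm_skew (eP2 a q cq) (eEX a q cq) (emet a q cq)).
  by move=> /eqP; rewrite mulf_eq0 invr_eq0 pnatr_eq0 /= => /eqP h0; apply: mx11_inj; rewrite h0 mxE.
- move=> a; apply: H => q cq; have := hk (even_triple_succ a) q.
  move=> /(congr1 (mulmx (Jt c q))); rewrite bracket_chart; [|exact: ac|exact: cq|exact: sxq|exact: sxq].
  rewrite -scalemxAr -lv_at// => <-; rewrite /Lvec D_jac//; last exact: sxq.
  by rewrite D_jac//; last exact: sxq.
Qed.

End tq.

Section tq.
Context {R : realType} {m : nat} {M : manifold R m}.
Variables (phi : 'I_3 -> endofield M) (xi : 'I_3 -> vfield M) (eta : 'I_3 -> oneform M) (g : metric M) (k : R).
Hypotheses (tq : three_quasi_Sasakian phi xi eta g)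
  (hk : forall a b d : 'I_3, even_triple a b d -> forall p : M, bracket (xi a) (xi b) p = k *: xi d p).

Let acm a := qs_acm (tqs_qs tq a).
Lemma tq_rg : riemannian g. Proof. exact: acm_riemannian (acm 0). Qed.
Lemma tq_sx a : smooth_vfield (xi a). Proof. exact: acm_xi_smooth (acm a). Qed.
Lemma tq_se a : smooth_oneform (eta a). Proof. exact: acm_eta_smooth (acm a). Qed.
Lemma tq_sf a : smooth_endofield (phi a). Proof. exact: acm_phi_smooth (acm a). Qed.

Let Lc c (ac : atlas c) := tq_loc3 tq hk ac.

Lemma in_img (c : chart R M m) q : chart_dom c q -> (c @` chart_dom c) (c q).
Proof. by exists q. Qed.

Lemma le_at (c : chart R M m) e q : chart_dom c q -> le c e (c q) = e q *m invmx (Jt c q).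
Proof. by move=> cq; rewrite /le chart_funK. Qed.

Lemma tq_delta a b p : eta a p *m xi b p = (a == b)%:R%:M.
Proof.
have [ac cp] := chart_atP p; rewrite -(l_EXE (Lc ac) (in_img cp)) le_at// lv_at//.
by rewrite Jt_self invmx1 mulmx1 mul1mx.
Qed.

Lemma hor_field c q (u : 'cV[R]_m) : atlas c -> chart_dom c q ->
  (forall a, le c (eta a) (c q) *m u = 0) -> exists2 X, horizontal_field eta X & lv c X (c q) = u.
Proof.
move=> ac cq Hu; have [Y sY /nbhs_singleton nY] := const_field u ac cq.
pose X : vfield M := fun p => Y p + (-1) *: (\sum_a (app1 (eta a) Y p) *: xi a p).
have sZ : smooth_vfield (fun p => \sum_a (app1 (eta a) Y p) *: xi a p).
  have sT a : smooth_vfield (fun p => app1 (eta a) Y p *: xi a p).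
    by apply: sv_Z; [exact: tq_se|exact: tq_sx].
  suff H (r : seq 'I_3) : smooth_vfield (fun p => \sum_(a <- r) app1 (eta a) Y p *: xi a p) by exact: H.
  elim: r => [|a r IH].
    rewrite (_ : (fun p => _) = (fun _ : M => 0)); first exact: sv_0.
    by apply/funext => p; rewrite big_nil.
  rewrite (_ : (fun p => _) = (fun p => app1 (eta a) Y p *: xi a p + \sum_(a <- r) app1 (eta a) Y p *: xi a p)).
    exact: sv_D.
  by apply/funext => p; rewrite big_cons.
exists X; first split.
- by apply: sv_D => //; apply: sv_Z => //; exact: smooth_cst.
- move=> p a; rewrite /X mulmxDr scaleN1r mulmxN mulmx_sumr (bigD1 a)//= big1 => [|b ba].
    rewrite addr0 -scalemxAr tq_delta eqxx scalemx1.
    by rewrite /app1 -mx11_scalar subrr.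
  by rewrite -scalemxAr tq_delta eq_sym (negPf ba) raddf0 scaler0.
rewrite lv_at// /X mulmxDr -lv_at// nY -scalemxAr mulmx_sumr big1 ?scaler0 ?addr0// => a _.
by rewrite -scalemxAr (app1_at _ _ ac cq) nY Hu mxE scale0r.
Qed.

Lemma hor_lv c q X : atlas c -> chart_dom c q -> horizontal_field eta X ->
  forall a, le c (eta a) (c q) *m lv c X (c q) = 0.
Proof.
move=> ac cq [sX hX] a; rewrite le_at// lv_at// mulmxA mulmxKV ?Jt_unit//; exact: hX.
Qed.

Definition tq_ii := forall (a : 'I_3) (X Y : vfield M),
  horizontal_field eta X -> horizontal_field eta Y -> forall p : M, d1 (eta a) X Y p = 0.

Lemma tq_iiP : tq_ii <-> forall c q, atlas c -> chart_dom c q -> lii (fun a => le c (eta a)) (c q).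
Proof.
split=> [ii c q ac cq a u v Hu Hv|H a X Y hX hY p].
  have [X hX <-] := hor_field ac cq Hu; have [Y hY <-] := hor_field ac cq Hv.
  have := ii a X Y hX hY q; have [[sX _] [sY _]] := (hX, hY).
  rewrite (d1_chart ac cq (tq_se a) (sv_sm sX ac cq) (sv_sm sY ac cq)) => /eqP.
  by rewrite mulf_eq0 invr_eq0 pnatr_eq0 /= => /eqP h0; apply: mx11_inj; rewrite h0 mxE.
have [ac cp] := chart_atP p; have [[sX _] [sY _]] := (hX, hY).
rewrite (d1_chart ac cp (tq_se a) (sv_sm sX ac cp) (sv_sm sY ac cp)).
by rewrite (H _ _ ac cp a) ?mxE ?mulr0// => b; exact: hor_lv.
Qed.

Lemma tq_Lend c q a b X : atlas c -> chart_dom c q -> smooth_vfield X ->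
  Jt c q *m (bracket (xi b) (appE (phi a) X) q - appE (phi a) (bracket (xi b) X) q) =
  Lend (lv c (xi b)) (lE c (phi a)) (c q) *m lv c X (c q).
Proof.
move=> ac cq sX; have sfX := tq_sf a sX.
have sx := sv_sm (tq_sx b) ac cq; have sXq := sv_sm sX ac cq; have sF := sm_lE (tq_sf a) ac cq.
have nF : \forall y \near c q, lv c (appE (phi a) X) y = lE c (phi a) y *m lv c X y.
  by apply: filterS (near_dom cq) => y [dy _]; rewrite lv_appE.
have e1 := bracket_chart ac cq sx (sv_sm sfX ac cq).
have e2 : Jt c q *m appE (phi a) (bracket (xi b) X) q = lE c (phi a) (c q) *m (Jt c q *m bracket (xi b) X q).
  by rewrite -!lv_at// lv_appE ?chart_funK.
have e3 := bracket_chart ac cq sx sXq.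
have H (A : 'M[R]_m) (u v : 'cV[R]_m) : A *m (u - v) = A *m u - A *m v by rewrite mulmxBr.
apply: (etrans (H _ _ _)); apply: (etrans (f_equal2 (fun u v => u - v) e1 (etrans e2 (congr1 _ e3)))).
rewrite (D_eq _ nF) (nbhs_singleton nF) D_mulmx//; clear e1 e2 e3 nF H sfX sX.
rewrite /smv in sx sXq; move: (lE c (phi a)) (lv c (xi b)) (lv c X) sF sx sXq => F x X' sF sx sX'.
rewrite mulmxBr /Lend mulmxDl mulmxBl -!mulmxA -!D_jac//.
by apply/colP => i; rewrite !mxE; ring.
Qed.

Lemma tq_i_ii : (forall a, projectable phi xi eta a) <-> tq_ii.
Proof.
rewrite tq_iiP; split=> [H c q ac cq|H a b X hX p].
  apply/(l_i_ii (Lc ac) (in_img cq)) => a b u Hu.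
  have [X hX <-] := hor_field ac cq Hu; have := H a b X hX q.
  by move=> /(congr1 (mulmx (Jt c q))); rewrite mulmx0 tq_Lend//; case: hX.
have [ac cp] := chart_atP p.
have /(l_i_ii (Lc ac) (in_img cp)) := H _ _ ac cp.
move=> /(_ a b (lv (chart_at p) X (chart_at p p))) h.
have [sX _] := hX.
rewrite -[LHS]mul1mx -(Jt_self p) tq_Lend// h// => d; exact: hor_lv.
Qed.

Lemma tq_v_ii : (forall a, qs_rank (eta a) 3) -> tq_ii.
Proof.
move=> v; apply/tq_iiP => c q ac cq; apply: (l_pf_ii (Lc ac) (in_img cq)) => a u0 u1 u2 u3 /=.
have [p [p3 _ e0]] := v a.
have p1 : p = 1%N by move: p3; case: p {e0} => [|[|p]]//.
rewrite p1 in e0.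
have cf (w : 'cV[R]_m) : exists2 Y, smooth_vfield Y & lv c Y (c q) = w.
  by have [Y sY /nbhs_singleton nY] := const_field w ac cq; exists Y.
have [X0 s0 <-] := cf u0; have [X1 s1 <-] := cf u1; have [X2 s2 <-] := cf u2; have [X3 s3 <-] := cf u3.
pose Xs (i : 'I_4) := nth X0 [:: X0; X1; X2; X3] i.
have sXs i : smooth_vfield (Xs i) by move: i => [[|[|[|[|//]]]] hi].
have := e0 Xs sXs q; rewrite wedge_pow2 /= /Xs !inordK//=.
rewrite !(d1_chart ac cq (tq_se a)); try exact: sv_sm.
set t := (_ + _) => h.
have t0 : t = 0 by apply/eqP; move/eqP: h; rewrite mulf_eq0 invr_eq0 pnatr_eq0.
by transitivity (4 * t); [rewrite /t; field|rewrite t0 mulr0].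
Qed.

Lemma tq_d1 : tq_ii -> forall a X Y, smooth_vfield X -> smooth_vfield Y -> forall p,
  d1 (eta a) X Y p = - (k / 2) * (app1 (eta (a + 1)) X p * app1 (eta (a + 2)) Y p - app1 (eta (a + 2)) X p * app1 (eta (a + 1)) Y p).
Proof.
move=> /tq_iiP ii a X Y sX sY p; have [ac cp] := chart_atP p.
rewrite (d1_chart ac cp (tq_se a) (sv_sm sX ac cp) (sv_sm sY ac cp)).
rewrite (l_ii_ext (Lc ac) (in_img cp) (ii _ _ ac cp)) !(app1_at _ _ ac cp).
by field.
Qed.

Lemma tq_k_neq0 (l : nat) (p : M) : (forall a, qs_rank (eta a) (4 * l + 3)%N) -> tq_ii -> k != 0.
Proof.
move=> rk ii; apply/eqP => k0; have [[|j] [j3 nz _]] := rk 0.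
  by move: j3; rewrite addn3.
have [Xs [sXs /eqP]] := nz p; apply; apply: wedge_form1_pow_eq0 => // X Y sX sY.
by rewrite tq_d1// k0 mul0r oppr0 mul0r.
Qed.

Lemma tq_ii_v (l : nat) : (forall a, qs_rank (eta a) (4 * l + 3)%N) -> tq_ii -> forall a, qs_rank (eta a) 3.
Proof.
move=> rk ii a; exists 1%N; split=> //.
  move=> p; have k0 := tq_k_neq0 p rk ii.
  exists (fun i : 'I_3 => nth (xi a) [:: xi a; xi (a + 1); xi (a + 2)] i); split.
    by move=> [[|[|[|//]]] hi] /=; exact: tq_sx.
  rewrite wedge_form1_pow1 /= !inordK//= !tq_d1//; try exact: tq_sx.
  have E b d : app1 (eta b) (xi d) p = (b == d)%:R by rewrite /app1 tq_delta mxE eqxx mulr1n.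
  have n1 : (a == a + 1) = false by apply/eqP => /(congr1 val); move: a => [[|[|[|//]]] ia].
  have n2 : (a == a + 2) = false by apply/eqP => /(congr1 val); clear; move: a => [[|[|[|//]]] ia].
  have n3 : (a + 1 == a + 2) = false by apply/eqP => /(congr1 val); clear; move: a => [[|[|[|//]]] ia].
  rewrite !E !eqxx n1 n2 n3 ![a + 1 == _]eq_sym ![a + 2 == _]eq_sym n1 n2 n3.
  rewrite [X in X != 0](_ : _ = - (k / 6)); last by rewrite /= ?mulr1n ?mulr0n; field.
  by rewrite oppr_eq0 mulf_eq0 negb_or k0 invr_eq0 pnatr_eq0.
move=> Xs sXs p; rewrite wedge_pow2 /= !tq_d1//.
by ring.
Qed.

End tq.

Section maps.
Context {R : realType} {m k : nat} {M : manifold R m} {N : manifold R k}.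
Variables (U : set M) (F : M -> N).
Hypotheses (oU : open U) (sF : smooth_map U F).

Lemma smooth_map_open (V : set N) : open V -> open (U `&` F @^-1` V).
Proof.
move=> oV; rewrite openE => q [Uq Vq]; apply: filterI.
  exact: open_nbhs_nbhs.
exact: (sF.1 q Uq V (open_nbhs_nbhs (conj oV Vq))).
Qed.

Lemma smooth_map_sm q c d : U q -> atlas c -> chart_dom c q -> atlas d -> chart_dom d (F q) ->
  sm ((d \o F) \o chart_inv c) (c q).
Proof.
move=> Uq ac cq ad dq.
have oV : open (U `&` F @^-1` chart_dom d) by apply: smooth_map_open; exact: chart_dom_open.
by have /(smooth_funP _ oV) := sF.2 d ad; apply.
Qed.

Lemma smooth_map_near q c d : U q -> atlas c -> chart_dom c q -> atlas d -> chart_dom d (F q) ->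
  \forall y \near c q, [/\ chart_dom c (chart_inv c y), c (chart_inv c y) = y, U (chart_inv c y) &
    chart_dom d (F (chart_inv c y))].
Proof.
move=> Uq ac cq ad dq.
have oV : open (U `&` F @^-1` chart_dom d) by apply: smooth_map_open; exact: chart_dom_open.
by apply: filterS (near_chart cq (open_nbhs_nbhs (conj oV (conj Uq dq)))) => y [? ? []].
Qed.

Lemma tangent_map_chart q c d v : U q -> atlas c -> chart_dom c q -> atlas d -> chart_dom d (F q) ->
  Jt d (F q) *m tangent_map F q v = dd (Jt c q *m v) ((d \o F) \o chart_inv c) (c q).
Proof.
move=> Uq ac cq ad dq; have [ae eq] := chart_atP (F q); set e := chart_at (F q) in ae eq.
have se := smooth_map_sm Uq ac cq ae eq.
rewrite /tangent_map -/e (dfun_chart v ac cq se).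
have st := trans_sm ae ad eq dq.
have E : ((e \o F) \o chart_inv c) (c q) = e (F q) by rewrite /= chart_funK.
rewrite /Jt -/e -D_jac// -[X in dd _ _ X]E -D_comp//; last by rewrite E.
apply: D_eq; apply: filterS (smooth_map_near Uq ac cq ae eq) => y [_ _ _ ey].
by rewrite /= chart_funK.
Qed.

End maps.

Section tq3.
Context {R : realType} {m : nat} {M : manifold R m}.
Variables (phi : 'I_3 -> endofield M) (xi : 'I_3 -> vfield M) (eta : 'I_3 -> oneform M) (g : metric M) (k : R).
Hypotheses (tq : three_quasi_Sasakian phi xi eta g)
  (hk : forall a b d : 'I_3, even_triple a b d -> forall p : M, bracket (xi a) (xi b) p = k *: xi d p).

Lemma tq_iii_ii n : integrable_distribution n (horizontal_space eta) -> tq_ii eta.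
Proof.
move=> H; apply/(tq_iiP tq hk) => c q ac cq a u v Hu Hv.
have [N [iota [siota _ _ [s es] Him]]] := H q.
have [ad ds] := chart_atP s; set d := chart_at s in ad ds.
have cs : chart_dom c (iota s) by rewrite es.
have oT : open [set: N] by exact: openT.
pose f := (c \o iota) \o chart_inv d.
have sf : sm f (d s) by exact: (smooth_map_sm oT siota I ad ds ac cs).
have fs : f (d s) = c q by rewrite /f /= chart_funK// es.
have sE : sm (le c (eta a)) (c q) by exact: sm_le (tq_se tq a) ac cq.
have Z : \forall y \near d s, le c (eta a) (f y) *m jac f y = 0.
  apply: filterS2 (smooth_map_near oT siota I ad ds ac cs) (sm_near sf) => y [dy ey _ cy] sfy.
  set s' := chart_inv d y in dy ey cy.
  apply: mulmx_ext => w; rewrite mul0mx -mulmxA -D_jac//.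
  have := tangent_map_chart oT siota (invmx (Jt d s') *m w) I ad dy ac cy.
  rewrite mulKVmx ?Jt_unit// ey -/f => <-.
  rewrite /f /= -/s' le_at// mulmxA mulmxKV ?Jt_unit//.
  have : [set tangent_map iota s' w | w in setT] (tangent_map iota s' (invmx (Jt d s') *m w)) by exists (invmx (Jt d s') *m w).
  by rewrite -Him; exact.
have sEf : sm (fun y => le c (eta a) (f y)) (d s).
  by apply: sm_comp => //; rewrite fs.
have dZ w w' : dd w (fun y => le c (eta a) (f y)) (d s) *m dd w' f (d s) = - (le c (eta a) (c q) *m (dd w (jac f) (d s) *m w')).
  have := D_eq w Z; rewrite Dcst D_mulmx//; last exact: sm_jac.
  move=> /(congr1 (mulmxr w')) /=; rewrite mulmxDl mul0mx -!mulmxA -D_jac// fs => /eqP.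
  by rewrite addr_eq0 => /eqP.
have sp x : (forall b, le c (eta b) (c q) *m x = 0) -> exists w, x = dd w f (d s).
  move=> Hx; have : horizontal_space eta (iota s) (invmx (Jt c q) *m x).
    by move=> b; have := Hx b; rewrite le_at// es mulmxA.
  rewrite Him => -[w _ ew]; exists (Jt d s *m w).
  by rewrite -(tangent_map_chart oT siota w I ad ds ac cs) ew es mulKVmx ?Jt_unit.
have [w ->] := sp u Hu; have [w' ->] := sp v Hv.
have E1 (b b' : 'cV[R]_n) : dd (dd b f (d s)) (le c (eta a)) (c q) = dd b (fun y => le c (eta a) (f y)) (d s).
  by rewrite -fs -D_comp// fs.
rewrite /ext1 !(E1 _ 0) !dZ (D_jac_sym w' w sf).
by rewrite subrr.
Qed.

End tq3.

(** * Curvature of a product with a sphere *)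

Section curv.
Context {R : realType} {m : nat}.
Implicit Types (x u v w : 'cV[R]_m).
Variables (g : 'cV[R]_m -> 'M[R]_m) (x : 'cV[R]_m).
Hypotheses (sg : sm g x) (gT : \forall y \near x, (g y)^T = g y)
  (gU : \forall y \near x, g y \in unitmx).

Lemma near_near (Q : 'cV[R]_m -> Prop) : (\forall y \near x, Q y) -> \forall y \near x, \forall z \near y, Q z.
Proof. by move=> H; exact: near_join. Qed.

Lemma lRmN u v : lRm g x v u = - lRm g x u v.
Proof. by rewrite /lRm; apply/matrixP => i j; rewrite !mxE; ring. Qed.

Lemma lRm_bianchi u v w : lRm g x u v *m w + lRm g x v w *m u + lRm g x w u *m v = 0.
Proof.
have cs := chr_sym sg gT.
have H a b c : dd a (chr g b) x *m c = dd a (chr g c) x *m b.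
  have sb := sm_chr sg gU b; have sc := sm_chr sg gU c.
  rewrite -!D_mulmxr//; apply: D_eq.
  apply: filterS3 (sm_near sg) (near_near gT) gU => y sy Ty Uy.
  by apply: chr_sym.
rewrite /lRm; move: (chr g) H cs => C H cs.
rewrite !(mulmxDl, mulmxBl, mulNmx) -!mulmxA (H u v w) (H v w u) (H w u v).
rewrite (cs v w) (cs w u) (cs u v).
move: (dd u (C w) x *m v) (dd v (C u) x *m w) (dd w (C v) x *m u) => a1 a2 a3.
move: (C u x) (C v x) (C w x) => A B D.
set b1 := A *m _; set b2 := B *m _; set b3 := D *m _; move: b1 b2 b3 => b1 b2 b3; clear.
by apply/colP => i; rewrite !mxE; ring.
Qed.

Lemma lRm_lin u v : lRm g x u v = \sum_j u j 0 *: lRm g x (delta_mx j 0) v.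
Proof.
have lC := lin_fam_chr sg gU; have sC := sm_chr sg gU.
have H1 : chr g u x = \sum_j u j 0 *: chr g (delta_mx j 0) x by have [_ /nbhs_singleton ->] := lC.
have H2 : dd v (chr g u) x = \sum_j u j 0 *: dd v (chr g (delta_mx j 0)) x.
  have [_ E] := lC.
  have n : \forall y \near x, chr g u y = (fun y => \sum_j u j 0 *: chr g (delta_mx j 0) y) y.
    by apply: filterS E => y ->.
  rewrite (D_eq v n).
  have [_ ->] := D_msum (index_enum 'I_m) v (fun j => smZ (u j 0) (sC (delta_mx j 0))).
  by apply: eq_bigr => j _; rewrite DZ.
have H3 : dd u (chr g v) x = \sum_j u j 0 *: dd (delta_mx j 0) (chr g v) x.
  by have [_ /nbhs_singleton ->] := dd_lin_fam_D (sC v).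
rewrite /lRm H2 H3 H1 mulmx_suml mulmx_sumr -!sumrB -!big_split /= -sumrB; apply: eq_bigr => j _.
by rewrite !scalerDr !scalerN -[(_ *: _) *m _]scalemxAl -[_ *m (_ *: _)]scalemxAr.
Qed.

Lemma lRm_skew u v : (g x *m lRm g x u v)^T = - (g x *m lRm g x u v).
Proof.
have sC := sm_chr sg gU.
have E w : \forall y \near x, dd w g y = (fun y => g y *m chr g w y + (chr g w y)^T *m g y) y.
  apply: filterS3 (sm_near sg) (near_near gT) (near_near gU) => y sy Ty Uy.
  exact: chr_metric.
have H a b : dd a (dd b g) x = (g x *m chr g a x + (chr g a x)^T *m g x) *m chr g b x
   + g x *m dd a (chr g b) x + (dd a (chr g b) x)^T *m g x
   + (chr g b x)^T *m (g x *m chr g a x + (chr g a x)^T *m g x).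
  have s1 := sm_mulmx sg (sC b); have s2 := sm_mulmx (sm_trmx (sC b)) sg.
  rewrite (D_eq a (E b)) DD// !D_mulmx//; last exact: sm_trmx.
  by rewrite D_trmx// (nbhs_singleton (E a)) !addrA.
have := D_swap u v sg; rewrite !H /lRm; have := nbhs_singleton gT.
move: (g x) (chr g u x) (chr g v x) (dd u (chr g v) x) (dd v (chr g u) x) => G A B C C' GT h; clear -GT h.
rewrite trmx_mul !(trB, trD) !trmx_mul GT.
move: h; rewrite !(mulmxDl, mulmxDr, mulmxBl, mulmxBr, mulmxN, mulNmx) !mulmxA => h.
apply/matrixP => i j; move/matrixP/(_ i j): h; rewrite !mxE.
set a1 := \sum_(_ | _) _; set a2 := \sum_(_ | _) _; set a3 := \sum_(_ | _) _; set a4 := \sum_(_ | _) _.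
set a5 := \sum_(_ | _) _; set a6 := \sum_(_ | _) _; set a7 := \sum_(_ | _) _; set a8 := \sum_(_ | _) _.
lra.
Qed.

End curv.

Lemma mulmx1C_cast {R : comUnitRingType} {p q : nat} (e : p = q) (A : 'M[R]_(p, q)) (B : 'M[R]_(q, p)) :
  A *m B = 1%:M -> B *m A = 1%:M.
Proof. by case: q / e A B => A B; exact: mulmx1C. Qed.

Lemma skew_sym_eq0 {R : realType} {m} (T : 'cV[R]_m -> 'M[R]_m) :
  (forall u, (T u)^T = - T u) -> (forall u v, T u *m v = T v *m u) -> forall w, T w = 0.
Proof.
move=> sk sy w.
have t1 (v u z : 'cV[R]_m) : v^T *m T z *m u = - (u^T *m T z *m v).
  by rewrite -[LHS]tr11 2!trmx_mul trmxK sk mulNmx mulmxN mulmxA.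
have t2 (v u z : 'cV[R]_m) : v^T *m T z *m u = v^T *m T u *m z by rewrite -!mulmxA sy.
apply: form_ext => v u; rewrite mulmx0 mul0mx.
have h : v^T *m T w *m u = - (v^T *m T w *m u).
  by rewrite {1}t1 t2 t1 opprK t2 t1 t2.
by apply: mx11_inj; move/matrixP/(_ 0 0): h; rewrite [X in _ = X -> _]mxE [X in _ -> _ = X]mxE; lra.
Qed.

Section iso_algebra.
Context {R : realType} {m n : nat}.

Let T_skew_alg (c : 'M[R]_m) (d h : 'M[R]_n) (a j1 : 'M[R]_(n, m)) (b j2 : 'M[R]_(4, m)) : h^T = h ->
  (j1^T *m h *m j1 + j2^T *m j2) *m c + c^T *m (j1^T *m h *m j1 + j2^T *m j2) =
  (a^T *m h + j1^T *m (h *m d + d^T *m h)) *m j1 + j1^T *m h *m a + (b^T *m j2 + j2^T *m b) ->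
  (j1^T *m h *m (a + d *m j1 - j1 *m c) + j2^T *m (b - j2 *m c))^T =
  - (j1^T *m h *m (a + d *m j1 - j1 *m c) + j2^T *m (b - j2 *m c)).
Proof.
move=> hT; rewrite !(trD, trB, trN, trmx_mul, trmxK) hT.
rewrite !(mulmxDl, mulmxDr, mulmxBl, mulmxBr, mulmxN, mulNmx) !mulmxA => h0.
apply/matrixP => i k; move/matrixP/(_ i k): h0; rewrite !mxE.
set a1 := \sum_(_ | _) _; set a2 := \sum_(_ | _) _; set a3 := \sum_(_ | _) _; set a4 := \sum_(_ | _) _.
set a5 := \sum_(_ | _) _; set a6 := \sum_(_ | _) _; set a7 := \sum_(_ | _) _; set a8 := \sum_(_ | _) _.
set a9 := \sum_(_ | _) _; set a10 := \sum_(_ | _) _.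
lra.
Qed.

Let R1_alg (d1 d2 b1 b2 : 'M[R]_m) (c1 c2 c3 a1 a2 : 'M[R]_n) (j : 'M[R]_(n, m)) :
  (j *m d1 - c1 *m j) *m d2 + j *m b1 - ((a1 + c3) *m j + c2 *m (j *m d1 - c1 *m j)) =
  (j *m d2 - c2 *m j) *m d1 + j *m b2 - ((a2 + c3) *m j + c1 *m (j *m d2 - c2 *m j)) ->
  j *m (b1 - b2 + d1 *m d2 - d2 *m d1) = (a1 - a2 + c1 *m c2 - c2 *m c1) *m j.
Proof.
rewrite !(mulmxDl, mulmxDr, mulmxBl, mulmxBr, mulmxN, mulNmx) !mulmxA => h.
apply/matrixP => i k; move/matrixP/(_ i k): h; rewrite !mxE.
set e1 := \sum_(_ | _) _; set e2 := \sum_(_ | _) _; set e3 := \sum_(_ | _) _; set e4 := \sum_(_ | _) _.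
set e5 := \sum_(_ | _) _; set e6 := \sum_(_ | _) _; set e7 := \sum_(_ | _) _; set e8 := \sum_(_ | _) _.
set e9 := \sum_(_ | _) _; set e10 := \sum_(_ | _) _.
lra.
Qed.

Let R2_alg (ka : R) (d1 d2 b1 b2 : 'M[R]_m) (j : 'M[R]_(4, m)) (u v p : 'cV[R]_4) (uT vT x : 'rV[R]_4) :
  uT *m p = 0 -> vT *m p = 0 ->
  (j *m d1 - ka *: (p *m uT *m j)) *m d2 + j *m b1
    - ka *: ((u *m vT + p *m x) *m j + p *m vT *m (j *m d1 - ka *: (p *m uT *m j))) =
  (j *m d2 - ka *: (p *m vT *m j)) *m d1 + j *m b2
    - ka *: ((v *m uT + p *m x) *m j + p *m uT *m (j *m d2 - ka *: (p *m vT *m j))) ->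
  j *m (b1 - b2 + d1 *m d2 - d2 *m d1) = ka *: (u *m vT *m j - v *m uT *m j).
Proof.
move=> up vp; rewrite !(mulmxBr (p *m _)).
have z1 : p *m vT *m (ka *: (p *m uT *m j)) = 0.
  by rewrite -scalemxAr !mulmxA -[p *m vT *m p]mulmxA vp mulmx0 !mul0mx scaler0.
have z2 : p *m uT *m (ka *: (p *m vT *m j)) = 0.
  by rewrite -scalemxAr !mulmxA -[p *m uT *m p]mulmxA up mulmx0 !mul0mx scaler0.
rewrite z1 z2 !subr0 !mulmxBl -!scalemxAl !mulmxDl !mulmxDr !mulmxA !mulmxN !mulmxA => h.
apply/matrixP => i k; move/matrixP/(_ i k): h; rewrite !mxE.
set e1 := \sum_(_ | _) _; set e2 := \sum_(_ | _) _; set e3 := \sum_(_ | _) _; set e4 := \sum_(_ | _) _.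
set e5 := \sum_(_ | _) _; set e6 := \sum_(_ | _) _; set e7 := \sum_(_ | _) _; set e8 := \sum_(_ | _) _.
set e9 := \sum_(_ | _) _.
lra.
Qed.

Variables (D : set 'cV[R]_m) (p1 : 'cV[R]_m -> 'cV[R]_n) (p2 : 'cV[R]_m -> 'cV[R]_4)
  (G : 'cV[R]_m -> 'M[R]_m) (H : 'cV[R]_n -> 'M[R]_n) (ka : R).
Local Notation J1 := (jac p1).
Local Notation J2 := (jac p2).
Hypotheses (oD : open D) (s1 : forall y, D y -> sm p1 y) (s2 : forall y, D y -> sm p2 y)
  (sG : forall y, D y -> sm G y) (sH : forall y, D y -> sm H (p1 y))
  (GT : forall y, D y -> (G y)^T = G y) (GU : forall y, D y -> G y \in unitmx)
  (HT : forall y, D y -> \forall z \near p1 y, (H z)^T = H z)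
  (HU : forall y, D y -> \forall z \near p1 y, H z \in unitmx)
  (iso : forall y, D y -> G y = (J1 y)^T *m H (p1 y) *m J1 y + (J2 y)^T *m J2 y)
  (sph : forall y, D y -> ka *: ((p2 y)^T *m p2 y) = 1%:M)
  (e : (n + 4 = m + 1)%N) (ka0 : ka != 0).

Let near_D (Q : 'cV[R]_m -> Prop) y : D y -> (forall z, D z -> Q z) -> \forall z \near y, Q z.
Proof.
move=> Dy HQ; apply: (filterS (P := D)); first by move=> z; exact: HQ.
exact: open_nbhs_nbhs.
Qed.

Lemma iso_p2 y : D y -> (p2 y)^T *m J2 y = 0.
Proof.
move=> Dy; apply: mulmx_ext => w; rewrite mul0mx -mulmxA -D_jac; last exact: s2.
have E : \forall z \near y, (p2 z)^T *m p2 z = (fun=> ka^-1%:M : 'M[R]_1) z.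
  apply: near_D => // z Dz; rewrite -[LHS]scale1r -(mulVf ka0) -scalerA sph//.
  by rewrite scalemx1.
have sp := s2 Dy; have sT := sm_trmx sp.
have := D_eq w E; rewrite Dcst D_mulmx// D_trmx// => h.
have {h} : 2 *: ((p2 y)^T *m dd w p2 y) = 0.
  rewrite -[RHS]h scaler_nat mulr2n; congr (_ + _).
  by rewrite -[LHS]tr11 trmx_mul trmxK.
by move=> /eqP; rewrite scaler_eq0 pnatr_eq0 => /eqP.
Qed.

Section pt.
Variable (y : 'cV[R]_m).
Hypothesis Dy : D y.
Let sJ1 : sm J1 y. Proof. exact: sm_jac (s1 Dy). Qed.
Let sJ2 : sm J2 y. Proof. exact: sm_jac (s2 Dy). Qed.
Let nGT : \forall z \near y, (G z)^T = G z. Proof. exact: near_D. Qed.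
Let nGU : \forall z \near y, G z \in unitmx. Proof. exact: near_D. Qed.

Lemma iso_blocks :
  [/\ J1 y *m invmx (G y) *m (J1 y)^T *m H (p1 y) = 1%:M, J1 y *m invmx (G y) *m (J2 y)^T = 0,
      J2 y *m invmx (G y) *m (J1 y)^T *m H (p1 y) = 0 &
      J2 y *m invmx (G y) *m (J2 y)^T + ka *: (p2 y *m (p2 y)^T) = 1%:M].
Proof.
pose Q : 'M[R]_(n + 4, m + 1) := block_mx (J1 y) 0 (J2 y) (p2 y).
pose L : 'M[R]_(m + 1, n + 4) := block_mx (invmx (G y) *m (J1 y)^T *m H (p1 y)) (invmx (G y) *m (J2 y)^T) 0 (ka *: (p2 y)^T).
have LQ : L *m Q = 1%:M.
  have p2J : (J2 y)^T *m p2 y = 0 by apply: trmx_inj; rewrite trmx_mul trmxK iso_p2// trmx0.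
  rewrite /L /Q mulmx_block scalar_mx_block; congr block_mx.
  - by rewrite -!mulmxA -mulmxDr !mulmxA -iso// mulVmx ?GU.
  - by rewrite mulmx0 add0r -mulmxA p2J mulmx0.
  - by rewrite mul0mx add0r -scalemxAl iso_p2// scaler0.
  - by rewrite mul0mx add0r -scalemxAl sph.
have := mulmx1C_cast (esym e) LQ.
rewrite /L /Q mulmx_block !mul0mx !mulmx0 !addr0 (@scalar_mx_block _ n 4) => /eq_block_mx[b1 b2 b3 b4].
by split; [rewrite -b1 !mulmxA|rewrite -b2 !mulmxA|rewrite -b3 !mulmxA|rewrite -b4 !mulmxA scalemxAr].
Qed.

Lemma iso_T w : (J1 y)^T *m H (p1 y) *m (dd w J1 y + chr H (J1 y *m w) (p1 y) *m J1 y - J1 y *m chr G w y)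
  + (J2 y)^T *m (dd w J2 y - J2 y *m chr G w y) = 0.
Proof.
pose A w := dd w J1 y + chr H (J1 y *m w) (p1 y) *m J1 y - J1 y *m chr G w y.
pose B w := dd w J2 y - J2 y *m chr G w y.
pose T w := (J1 y)^T *m H (p1 y) *m A w + (J2 y)^T *m B w.
rewrite -/(A w) -/(B w) -/(T w).
have sk u : (T u)^T = - T u.
  have E : \forall z \near y, G z = (fun z => (J1 z)^T *m H (p1 z) *m J1 z + (J2 z)^T *m J2 z) z by exact: near_D.
  have sHp : sm (fun z => H (p1 z)) y by apply: sm_comp; [exact: s1|exact: sH].
  have sT1 := sm_trmx sJ1; have sT2 := sm_trmx sJ2; have sTH := sm_mulmx sT1 sHp.
  have := D_eq u E; rewrite DD; [|exact: sm_mulmx|exact: sm_mulmx].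
  rewrite (D_mulmx u sTH sJ1) (D_mulmx u sT1 sHp) (D_mulmx u sT2 sJ2) !D_trmx//.
  rewrite (D_comp u (s1 Dy) (sH Dy)) (D_jac _ (s1 Dy)).
  rewrite (chr_metric (sG Dy) nGT nGU) (chr_metric (sH Dy) (HT Dy) (HU Dy)) iso//.
  by move=> /T_skew_alg; apply; exact: nbhs_singleton (HT Dy).
have hl (a1 : 'M[R]_(m, n)) (a2 : 'M[R]_(m, 4)) b1 b2 (v : 'cV[R]_m) : (a1 *m b1 + a2 *m b2) *m v = a1 *m (b1 *m v) + a2 *m (b2 *m v).
  by rewrite mulmxDl !mulmxA.
have sA u v : A u *m v = A v *m u.
  have h3 (a b : 'M[R]_(n, m)) c1 c2 (x : 'cV[R]_m) : (a + c1 *m b - b *m c2) *m x = a *m x + c1 *m (b *m x) - b *m (c2 *m x).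
    by rewrite mulmxBl mulmxDl !mulmxA.
  apply: (etrans (h3 _ _ _ _ _)); apply: (etrans _ (esym (h3 _ _ _ _ _))).
  congr (_ - _); last by congr (_ *m _); exact: (chr_sym (sG Dy) nGT).
  congr (_ + _); first exact: (D_jac_sym u v (s1 Dy)).
  exact: (chr_sym (sH Dy) (HT Dy)).
have sB u v : B u *m v = B v *m u.
  have h2 (a b : 'M[R]_(4, m)) c2 (x : 'cV[R]_m) : (a - b *m c2) *m x = a *m x - b *m (c2 *m x).
    by rewrite mulmxBl !mulmxA.
  apply: (etrans (h2 _ _ _ _)); apply: (etrans _ (esym (h2 _ _ _ _))).
  congr (_ - _); last by congr (_ *m _); exact: (chr_sym (sG Dy) nGT).
  exact: (D_jac_sym u v (s2 Dy)).
have sy u v : T u *m v = T v *m u.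
  apply: (etrans (hl _ _ _ _ _)); rewrite sA sB; exact: (esym (hl _ _ _ _ _)).
exact: (skew_sym_eq0 (T := T)).
Qed.

Lemma iso_A w : dd w J1 y = J1 y *m chr G w y - chr H (J1 y *m w) (p1 y) *m J1 y.
Proof.
have [b1 b2 _ _] := iso_blocks; have := iso_T w.
set A := dd w J1 y + _ - _; set B := dd w J2 y - _ => h.
have : J1 y *m invmx (G y) *m ((J1 y)^T *m H (p1 y) *m A + (J2 y)^T *m B) = 0 by rewrite h mulmx0.
rewrite mulmxDr !mulmxA b1 b2 mul0mx mul1mx addr0 /A => /eqP.
by rewrite subr_eq0 => /eqP <-; rewrite addrK.
Qed.

Lemma iso_B w : dd w J2 y = J2 y *m chr G w y - ka *: (p2 y *m (J2 y *m w)^T *m J2 y).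
Proof.
have [_ _ b3 b4] := iso_blocks; have := iso_T w.
set A := dd w J1 y + _ - _; set B := dd w J2 y - _ => h.
have E : \forall z \near y, (p2 z)^T *m J2 z = (fun=> 0 : 'rV[R]_m) z.
  by apply: near_D => // z Dz; exact: iso_p2.
have : J2 y *m invmx (G y) *m ((J1 y)^T *m H (p1 y) *m A + (J2 y)^T *m B) = 0 by rewrite h mulmx0.
rewrite mulmxDr !mulmxA b3 mul0mx add0r.
have -> : J2 y *m invmx (G y) *m (J2 y)^T = 1%:M - ka *: (p2 y *m (p2 y)^T) by rewrite -b4 addrK.
have sp := s2 Dy; have sT := sm_trmx sp.
have := D_eq w E; rewrite Dcst D_mulmx// D_trmx// => /eqP; rewrite addr_eq0 => /eqP h2.
have h3 : (p2 y)^T *m B = - ((J2 y *m w)^T *m J2 y).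
  by rewrite /B mulmxBr mulmxA iso_p2// mul0mx subr0 -D_jac// h2 opprK.
rewrite mulmxBl mul1mx -scalemxAl -[p2 y *m _ *m B]mulmxA h3 mulmxN scalerN opprK mulmxA => /eqP.
by rewrite addr_eq0 /B => /eqP /(canRL (subrK _)) ->; rewrite addrC.
Qed.

End pt.

Section pt2.
Variable (y : 'cV[R]_m).
Hypothesis Dy : D y.
Let sJ1 : sm J1 y. Proof. exact: sm_jac (s1 Dy). Qed.
Let sJ2 : sm J2 y. Proof. exact: sm_jac (s2 Dy). Qed.
Let nGT : \forall z \near y, (G z)^T = G z. Proof. exact: near_D. Qed.
Let nGU : \forall z \near y, G z \in unitmx. Proof. exact: near_D. Qed.

Lemma iso_R1 u v : J1 y *m lRm G y u v = lRm H (p1 y) (J1 y *m u) (J1 y *m v) *m J1 y.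
Proof.
have sC := sm_chr (sG Dy) nGU.
have lH := lin_fam_chr (sH Dy) (HU Dy).
have lHp : lin_fam (fun w z => chr H w (p1 z)) y.
  split=> [w|]; first by apply: sm_comp; [exact: s1|exact: sm_chr (sH Dy) (HU Dy) w].
  have [_ nH] := lH; have cp := sm_cont (s1 Dy).
  exact: (cp _ nH).
have F b : \forall z \near y, dd b J1 z = (fun z => J1 z *m chr G b z - chr H (J1 z *m b) (p1 z) *m J1 z) z.
  by apply: near_D => // z Dz; exact: iso_A.
have K a b : dd a (dd b J1) y = dd a J1 y *m chr G b y + J1 y *m dd a (chr G b) y
    - ((dd (J1 y *m a) (chr H (J1 y *m b)) (p1 y) + chr H (dd a J1 y *m b) (p1 y)) *m J1 y
       + chr H (J1 y *m b) (p1 y) *m dd a J1 y).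
  have sJb : sm (fun z => J1 z *m b) y by exact: sm_mulmxr.
  have [sL EL] := dd_lin_fam a lHp sJb.
  rewrite (D_eq a (F b)) DB; [|exact: sm_mulmx|exact: sm_mulmx].
  rewrite (D_mulmx a sJ1 (sC b)) (D_mulmx a sL sJ1) EL (D_mulmxr b a sJ1).
  rewrite (D_comp a (s1 Dy) (sm_chr (sH Dy) (HU Dy) (J1 y *m b))) (D_jac _ (s1 Dy)).
  by [].
have := D_swap u v sJ1; rewrite !K /lRm (D_jac_sym v u (s1 Dy)).
rewrite (iso_A Dy u) (iso_A Dy v).
exact: R1_alg.
Qed.

Lemma iso_R2 u v : J2 y *m lRm G y u v =
  ka *: (J2 y *m u *m (J2 y *m v)^T *m J2 y - J2 y *m v *m (J2 y *m u)^T *m J2 y).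
Proof.
have sC := sm_chr (sG Dy) nGU; have sp := s2 Dy.
have F b : \forall z \near y, dd b J2 z = (fun z => J2 z *m chr G b z - ka *: (p2 z *m (J2 z *m b)^T *m J2 z)) z.
  by apply: near_D => // z Dz; exact: iso_B.
have K a b : dd a (dd b J2) y = dd a J2 y *m chr G b y + J2 y *m dd a (chr G b) y
    - ka *: ((J2 y *m a *m (J2 y *m b)^T + p2 y *m (dd a J2 y *m b)^T) *m J2 y + p2 y *m (J2 y *m b)^T *m dd a J2 y).
  have sJb : sm (fun z => J2 z *m b) y by exact: sm_mulmxr.
  have sJT := sm_trmx sJb; have spJ := sm_mulmx sp sJT; have spJJ := sm_mulmx spJ sJ2.
  rewrite (D_eq a (F b)) DB; [|exact: sm_mulmx|exact: smZ].
  rewrite (D_mulmx a sJ2 (sC b)) (DZ ka a spJJ) (D_mulmx a spJ sJ2) (D_mulmx a sp sJT) D_trmx// (D_mulmxr b a sJ2).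
  by rewrite (D_jac _ sp).
have := D_swap u v sJ2; rewrite !K /lRm (D_jac_sym v u sp).
rewrite (iso_B Dy u) (iso_B Dy v).
have o (b : 'cV[R]_m) : (J2 y *m b)^T *m p2 y = 0.
  by apply: trmx_inj; rewrite trmx_mul trmxK mulmxA iso_p2// mul0mx trmx0.
exact: R2_alg (o u) (o v).
Qed.

End pt2.
End iso_algebra.

Lemma dotC {R : comNzRingType} {m} (a b : 'cV[R]_m) : (a^T *m b) 0 0 = (b^T *m a) 0 0.
Proof. by rewrite -[a^T *m b]trmxK trmx_mul trmxK [LHS]mxE. Qed.

Definition Smx {R : realType} {m} (K : 'cV[R]_m -> 'M[R]_m) x (v w : 'cV[R]_m) : 'M[R]_m :=
  \matrix_(i, j) (lRm K x (delta_mx j 0) v *m w) i 0.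

Lemma lric_tr {R : realType} {m} (K : 'cV[R]_m -> 'M[R]_m) x v w : lric K x v w = \tr (Smx K x v w).
Proof. by rewrite /lric /mxtrace /Smx; apply: eq_bigr => i _; rewrite [RHS]mxE. Qed.

Lemma SmxE {R : realType} {m} (K : 'cV[R]_m -> 'M[R]_m) x v w u : sm K x ->
  (\forall y \near x, K y \in unitmx) -> Smx K x v w *m u = lRm K x u v *m w.
Proof.
move=> sK UK; rewrite (lRm_lin sK UK) mulmx_suml; apply/colP => i; rewrite summxE mxE.
by apply: eq_bigr => j _; rewrite -scalemxAl [RHS]mxE mulrC; congr (_ * _); rewrite [LHS]mxE.
Qed.

Section iso_ric.
Context {R : realType} {m n : nat}.
Variables (D : set 'cV[R]_m) (p1 : 'cV[R]_m -> 'cV[R]_n) (p2 : 'cV[R]_m -> 'cV[R]_4)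
  (G : 'cV[R]_m -> 'M[R]_m) (H : 'cV[R]_n -> 'M[R]_n) (ka : R).
Local Notation J1 := (jac p1).
Local Notation J2 := (jac p2).
Hypotheses (oD : open D) (s1 : forall y, D y -> sm p1 y) (s2 : forall y, D y -> sm p2 y)
  (sG : forall y, D y -> sm G y) (sH : forall y, D y -> sm H (p1 y))
  (GT : forall y, D y -> (G y)^T = G y) (GU : forall y, D y -> G y \in unitmx)
  (HT : forall y, D y -> \forall z \near p1 y, (H z)^T = H z)
  (HU : forall y, D y -> \forall z \near p1 y, H z \in unitmx)
  (iso : forall y, D y -> G y = (J1 y)^T *m H (p1 y) *m J1 y + (J2 y)^T *m J2 y)
  (sph : forall y, D y -> ka *: ((p2 y)^T *m p2 y) = 1%:M)
  (e : (n + 4 = m + 1)%N) (ka0 : ka != 0).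
Variable (y : 'cV[R]_m).
Hypothesis Dy : D y.

Lemma iso_ricci v w : lric G y v w = lric H (p1 y) (J1 y *m v) (J1 y *m w)
   + 2 * ka * ((J2 y *m w)^T *m (J2 y *m v)) 0 0.
Proof.
have nGU : \forall z \near y, G z \in unitmx.
  apply: (filterS (P := D)); first by move=> z; exact: GU.
  exact: open_nbhs_nbhs.
have [b1 b2 b3 b4] := iso_blocks oD s2 GU iso sph e ka0 Dy.
have p2J := iso_p2 oD s2 sph ka0 Dy.
pose S := Smx G y v w; pose S' := Smx H (p1 y) (J1 y *m v) (J1 y *m w).
pose av := J2 y *m v; pose aw := J2 y *m w; pose N := (aw^T *m av) 0 0 *: 1%:M - av *m aw^T.
have E1 : J1 y *m S = S' *m J1 y.
  apply: mulmx_ext => u; rewrite -!mulmxA SmxE//; last exact: sG.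
  by rewrite SmxE; [|exact: sH|exact: HU]; rewrite mulmxA (iso_R1 oD s1 s2 sG sH GT GU HT HU iso sph e ka0 Dy) -mulmxA.
have E2 : J2 y *m S = ka *: (N *m J2 y).
  apply: mulmx_ext => u; rewrite -mulmxA SmxE//; last exact: sG.
  rewrite mulmxA (iso_R2 oD s1 s2 sG sH GT GU HT HU iso sph e ka0 Dy) -!scalemxAl; congr (_ *: _).
  rewrite [in RHS]/N [in LHS]mulmxBl !(mulmxBl, mul1mx, =^~ scalemxAl); congr (_ - _).
    have -> : J2 y *m u *m (J2 y *m v)^T *m J2 y *m w = J2 y *m u *m ((J2 y *m v)^T *m aw) by rewrite /aw !mulmxA.
    by rewrite scal11 dotC.
  by rewrite -!mulmxA; congr (_ *m (_ *m _)); rewrite -[LHS]tr11 trmx_mul trmxK mulmxA.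
rewrite !lric_tr -/S -/S'.
have -> : \tr S = \tr (invmx (G y) *m ((J1 y)^T *m H (p1 y) *m (J1 y *m S) + (J2 y)^T *m (J2 y *m S))).
  congr mxtrace; rewrite 2!mulmxA -!mulmxDl.
  by rewrite -iso// mulmxA mulVmx ?mul1mx//; exact: GU.
rewrite E1 E2 mulmxDr mxtraceD; congr (_ + _).
  have -> : invmx (G y) *m ((J1 y)^T *m H (p1 y) *m (S' *m J1 y)) = (invmx (G y) *m (J1 y)^T *m H (p1 y) *m S') *m J1 y.
    by rewrite !mulmxA.
  by rewrite mxtrace_mulC !mulmxA b1 mul1mx.
rewrite -!scalemxAr mxtraceZ.
have -> : invmx (G y) *m ((J2 y)^T *m (N *m J2 y)) = (invmx (G y) *m (J2 y)^T *m N) *m J2 y by rewrite !mulmxA.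
rewrite mxtrace_mulC.
have -> : J2 y *m (invmx (G y) *m (J2 y)^T *m N) = (1%:M - ka *: (p2 y *m (p2 y)^T)) *m N by rewrite -b4 !mulmxA addrK.
set s := (aw^T *m av) 0 0.
have trN : \tr N = 3 * s.
  rewrite /N raddfB /= mxtraceZ mxtrace1 [\tr (av *m _)]mxtrace_mulC -/s /mxtrace big_ord1 -/s.
  by ring.
have pN : (p2 y)^T *m N = s *: (p2 y)^T.
  have pav : (p2 y)^T *m av = 0 by rewrite mulmxA p2J mul0mx.
  have hN (p : 'rV[R]_4) (a b : 'cV[R]_4) t : p *m a = 0 -> p *m (t *: 1%:M - a *m b^T) = t *: p.
    by move=> pa; rewrite mulmxBr -scalemxAr mulmx1 mulmxA pa mul0mx subr0.
  exact: hN.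
rewrite mulmxBl mul1mx raddfB /= trN -scalemxAl mxtraceZ -mulmxA pN -scalemxAr mxtraceZ mxtrace_mulC.
have : ka * \tr ((p2 y)^T *m p2 y) = 1.
  by rewrite -mxtraceZ sph// mxtrace1.
rewrite -/s; move: (\tr _) => t h; transitivity (ka * s * (3 - ka * t)); first by ring.
by rewrite h; ring.
Qed.

End iso_ric.

(** * Hyper-Kähler metrics are Ricci-flat *)

Section curvature_algebra.
Context {R : realType} {m : nat}.
Variables (G : 'M[R]_m) (Rc : 'cV[R]_m -> 'cV[R]_m -> 'M[R]_m) (S : 'cV[R]_m -> 'cV[R]_m -> 'M[R]_m)
  (j : 'I_3 -> 'M[R]_m).
Hypotheses (GT : G^T = G) (GU : G \in unitmx) (RcA : forall u v, Rc v u = - Rc u v)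
  (RcB : forall u v w, Rc u v *m w + Rc v w *m u + Rc w u *m v = 0)
  (RcS : forall u v, (G *m Rc u v)^T = - (G *m Rc u v)) (RcN : forall u v, Rc (- u) v = - Rc u v)
  (SE : forall v w u, S v w *m u = Rc u v *m w).

Let r (u v w z : 'cV[R]_m) := (z^T *m (G *m Rc u v) *m w) 0 0.

Let r1 a b c d : r b a c d = - r a b c d.
Proof. by rewrite /r RcA !(mulmxN, mulNmx) mx11N. Qed.
Let r2 a b c d : r a b d c = - r a b c d.
Proof. by rewrite /r -[in LHS](tr11 (_ *m d)) 2!trmx_mul trmxK RcS !(mulmxN, mulNmx) mulmxA mx11N. Qed.
Let r3 a b c d : r a b c d + r b c a d + r c a b d = 0.
Proof. by rewrite /r -!mx11D -!mulmxA -!mulmxDr RcB !mulmx0 mxE. Qed.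

Lemma curv_pair u v w z : r u v w z = r w z u v.
Proof.
have b1 := r3 u v w z; have b2 := r3 v w z u; have b3 := r3 w z u v; have b4 := r3 z u v w.
have t1 := r1 u w v z; have t2 := r2 v w u z; have t3 := r2 w z u v; have t4 := r1 v z w u.
have t5 := r2 v z u w; have t6 := r1 u z w v; have t7 := r2 u z v w; have t8 := r2 u w v z.
have t9 := r1 u z v w; have t10 := r2 u v w z.
lra.
Qed.

Lemma ric_sym v w : \tr (S v w) = \tr (S w v).
Proof.
have E : G *m S v w = (S w v)^T *m G.
  apply: form_ext => z u.
  have -> : z^T *m (G *m S v w) *m u = z^T *m (G *m Rc u v) *m w by rewrite -!mulmxA SE.
  have -> : z^T *m ((S w v)^T *m G) *m u = u^T *m (G *m Rc z w) *m v.
    by rewrite -[LHS]tr11 2!trmx_mul trmx_mul !trmxK GT -!mulmxA SE.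
  by apply: mx11_inj; rewrite -[LHS]/(r u v w z) -[RHS]/(r z w v u) curv_pair r1 r2 opprK.
have -> : S v w = invmx G *m ((S w v)^T *m G) by rewrite -E mulKmx.
by rewrite mxtrace_mulC mulmxK// mxtrace_tr.
Qed.

Hypotheses (j2 : forall a, j a *m j a = - 1%:M) (her : forall a, (j a)^T *m G *m j a = G)
  (quat : forall a, j (a + 2) = j a *m j (a + 1) /\ j (a + 2) = - (j (a + 1) *m j a))
  (comm : forall a u v, j a *m Rc u v = Rc u v *m j a).

Lemma ric_J a v w : \tr (S (j a *m v) (j a *m w)) = \tr (S v w).
Proof.
have RJJ u z : Rc (j a *m u) (j a *m z) = Rc u z.
  apply: (can_inj (mulKmx GU)); apply: form_ext => p q; apply: mx11_inj.
  rewrite -[LHS]/(r (j a *m u) (j a *m z) q p) -[RHS]/(r u z q p) curv_pair [RHS]curv_pair /r.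
  have -> : (j a *m z)^T *m (G *m Rc q p) *m (j a *m u) = (j a *m z)^T *m G *m (Rc q p *m j a) *m u.
    by rewrite !mulmxA.
  rewrite -comm; congr (fun_of_matrix _ 0 0); rewrite -[in RHS](her a) trmx_mul.
  by rewrite !mulmxA.
have -> : S (j a *m v) (j a *m w) = - (j a *m S v w *m j a).
  apply: mulmx_ext => u; rewrite SE mulNmx -!mulmxA SE.
  have -> : Rc u (j a *m v) = - Rc (j a *m u) v.
    by rewrite -(RJJ (j a *m u) v) mulmxA j2 mulNmx mul1mx RcN opprK.
  by rewrite mulmxA mulNmx -comm mulNmx -mulmxA.
by rewrite raddfN /= mxtrace_mulC mulmxA j2 mulNmx mul1mx raddfN opprK.
Qed.

Lemma alg_ricci_flat v w : \tr (S v w) = 0.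
Proof.
have trJ u z : \tr (j 0 *m Rc u z) = 0.
  have [e1 e2] := quat 1.
  have e0 : (1 + 2 = 0 :> 'I_3) by exact: val_inj.
  rewrite e0 in e1 e2.
  have h : \tr (j 0 *m Rc u z) = - \tr (j 0 *m Rc u z).
    by rewrite {1}e1 e2 mulNmx raddfN opprK -mulmxA mxtrace_mulC -!mulmxA comm.
  lra.
have h1 u z : \tr (S z (j 0 *m u)) = \tr (S u (j 0 *m z)).
  have h := trJ u z; apply/eqP; rewrite -subr_eq0 -raddfB /= -h; apply/eqP.
  congr mxtrace; apply: mulmx_ext => x; rewrite mulmxBl !SE -mulmxA.
  have e : Rc u z *m x = Rc x z *m u - Rc x u *m z.
    have := RcB u z x; rewrite (RcA x z) mulNmx => /eqP.
    by rewrite addrAC subr_eq0 => /eqP <-; rewrite addrK.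
  by rewrite e mulmxBr !mulmxA !comm.
have h2 : \tr (S v (j 0 *m (j 0 *m w))) = - \tr (S v w).
  rewrite mulmxA j2 mulNmx mul1mx (_ : S v (- w) = - S v w) ?raddfN//.
  by apply: mulmx_ext => x; rewrite SE mulNmx SE mulmxN.
move: h2; rewrite h1 ric_sym ric_J; lra.
Qed.

End curvature_algebra.

Section hk.
Context {R : realType} {m : nat}.

Let NG_alg (j G g d : 'M[R]_m) : G^T = G -> j^T *m G = - (G *m j) ->
  d^T *m G + j^T *m (G *m g + g^T *m G) = - ((G *m g + g^T *m G) *m j + G *m d) ->
  (G *m (d + g *m j - j *m g))^T = - (G *m (d + g *m j - j *m g)).
Proof.
move=> GT sk h.
have h1 : G *m j *m g = - (j^T *m G *m g) by rewrite sk mulNmx opprK.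
have h2 : g^T *m j^T *m G = - (g^T *m G *m j) by rewrite -mulmxA sk mulmxN mulmxA.
rewrite trmx_mul trB trD !trmx_mul GT !(mulmxDl, mulmxDr, mulmxN, mulNmx) !mulmxA h1 h2.
move: h; rewrite !(mulmxDl, mulmxDr) !mulmxA => h.
apply/matrixP => i k; move/matrixP/(_ i k): h; rewrite !mxE; lra.
Qed.

Let NJ_alg (j g d : 'M[R]_m) : j *m j = - 1%:M -> d *m j + j *m d = 0 ->
  (d + g *m j - j *m g) *m j = - (j *m (d + g *m j - j *m g)).
Proof.
move=> jj h; have h1 : g *m j *m j = - g by rewrite -mulmxA jj mulmxN mulmx1.
have h2 : j *m j *m g = - g by rewrite jj mulNmx mul1mx.
rewrite !(mulmxDl, mulmxDr, mulmxN, mulNmx) !mulmxA h1 h2.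
apply/matrixP => i k; move/matrixP/(_ i k): h; rewrite !mxE; lra.
Qed.

Section kahler.
Variables (D : set 'cV[R]_m) (G J : 'cV[R]_m -> 'M[R]_m).
Hypotheses (oD : open D) (sG : forall y, D y -> sm G y) (sJ : forall y, D y -> sm J y)
  (GT : forall y, D y -> (G y)^T = G y) (GU : forall y, D y -> G y \in unitmx)
  (J2 : forall y, D y -> J y *m J y = - 1%:M) (her : forall y, D y -> (J y)^T *m G y *m J y = G y)
  (tor0 : forall y u v, D y -> tor J y u v = 0)
  (cl : forall y u v w, D y -> ext2 (fun z => G z *m J z) y u v w = 0).

Let near_D (Q : 'cV[R]_m -> Prop) y : D y -> (forall z, D z -> Q z) -> \forall z \near y, Q z.
Proof.
move=> Dy HQ; apply: (filterS (P := D)); first by move=> z; exact: HQ.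
exact: open_nbhs_nbhs.
Qed.

Lemma kahler_skew y : D y -> (J y)^T *m G y = - (G y *m J y).
Proof.
move=> Dy; have := congr1 (mulmxr (J y)) (her Dy); rewrite /= -[_ *m J y *m J y]mulmxA J2// mulmxN mulmx1.
by move=> <-; rewrite opprK.
Qed.

(* Four times [nabla J] is a combination of [d omega] and the torsion. *)
Lemma kahler_parallel y w : D y -> dd w J y = J y *m chr G w y - chr G w y *m J y.
Proof.
move=> Dy; have nGT : \forall z \near y, (G z)^T = G z by exact: near_D.
have nGU : \forall z \near y, G z \in unitmx by exact: near_D.
have sGy := sG Dy; have sJy := sJ Dy.
pose N u := dd u J y + chr G u y *m J y - J y *m chr G u y.
suff N0 : N w = 0 by move/eqP: N0; rewrite /N subr_eq0 => /eqP <-; rewrite addrK.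
have NJ u : N u *m J y = - (J y *m N u).
  have E : \forall z \near y, (fun z => J z *m J z) z = (fun=> - 1%:M : 'M[R]_m) z by exact: near_D.
  by have := D_eq u E; rewrite Dcst D_mulmx// => h; apply: NJ_alg => //; exact: J2.
have NG u : (G y *m N u)^T = - (G y *m N u).
  have E : \forall z \near y, (fun z => (J z)^T *m G z) z = (fun z => - (G z *m J z)) z.
    by apply: near_D => // z Dz; exact: kahler_skew.
  have sT := sm_trmx sJy; have sGJ := sm_mulmx sGy sJy.
  have := D_eq u E; rewrite DN// !D_mulmx// D_trmx// (chr_metric sGy nGT nGU) => h.
  by apply: NG_alg; [exact: GT|exact: kahler_skew|].
have NE u : N u = dd u J y + chr G u y *m J y - J y *m chr G u y by [].
clearbody N.
pose a (u v w : 'cV[R]_m) := (w^T *m G y *m (N u *m v)) 0 0.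
have jG (v : 'cV[R]_m) : (J y *m v)^T *m G y = - (v^T *m G y *m J y).
  by rewrite trmx_mul -[LHS]mulmxA kahler_skew// mulmxN mulmxA.
have ask u v z : a u v z = - a u z v.
  rewrite /a !mulmxA -[z^T *m G y *m N u]mulmxA -[v^T *m G y *m N u]mulmxA.
  by rewrite -[in LHS](tr11 (_ *m v)) 2!trmx_mul trmxK NG mulNmx mulmxN mulmxA mxE.
have aJ u (v z : 'cV[R]_m) : a u (J y *m v) z = a u v (J y *m z).
  by rewrite /a [N u *m (_ *m _)]mulmxA NJ mulNmx mulmxN jG mulNmx !mulmxA.
have aJJ u (v z : 'cV[R]_m) : a u v (J y *m (J y *m z)) = - a u v z.
  by rewrite /a [J y *m (_ *m _)]mulmxA J2// mulNmx mul1mx trN !mulNmx mxE.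
have aZ u v v' (z : 'cV[R]_m) : a u v z + a v' z v = (z^T *m G y *m (N u *m v) + v^T *m G y *m (N v' *m z)) 0 0.
  by rewrite mxE.
have cs p q := chr_sym sGy nGT p q.
have cyc u v (z : 'cV[R]_m) : a u v z + a v z u + a z u v = 0.
  have sGJ := sm_mulmx sGy sJy.
  have B p (q r : 'cV[R]_m) : (q^T *m dd p (fun z => G z *m J z) y *m r) 0 0 =
      a p r q + (q^T *m (G y *m J y) *m (chr G p y *m r)) 0 0 - (r^T *m (G y *m J y) *m (chr G p y *m q)) 0 0.
    have t : r^T *m (G y *m J y) *m (chr G p y *m q) = - (q^T *m ((chr G p y)^T *m G y *m J y) *m r).
      rewrite -[LHS]tr11 !trmx_mul trmxK -[(J y)^T *m _]/((J y)^T *m (G y)^T) GT// kahler_skew//.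
      by rewrite mulNmx mulmxN !mulmxA.
    rewrite t mx11N opprK /a D_mulmx// (chr_metric sGy nGT nGU) -!mx11D.
    congr (fun_of_matrix _ 0 0); rewrite !mulmxA -!mulmxDl; congr (_ *m _).
    rewrite -!mulmxA -!mulmxDr; congr (_ *m _); rewrite NE !(mulmxDl, mulmxDr, mulmxN) !mulmxA.
    by apply/matrixP => i j; rewrite !mxE; ring.
  have := cl u z v Dy => /matrixP/(_ 0 0); rewrite /ext2 !mx11D !B [RHS]mxE (cs v u) (cs z v) (cs u z).
  by rewrite (ask u v z) (ask v z u) (ask z u v); lra.
have tN u v : N (J y *m u) *m v - N (J y *m v) *m u + J y *m (N v *m u) - J y *m (N u *m v) = 0.
  have ex (A g : 'M[R]_m) (x : 'cV[R]_m) : (A + g *m J y - J y *m g) *m x = A *m x + g *m (J y *m x) - J y *m (g *m x).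
    by rewrite mulmxBl mulmxDl !mulmxA.
  rewrite -(tor0 u v Dy) /tor !NE !ex (cs (J y *m v) (J y *m u)) (cs v (J y *m u)) (cs u (J y *m v)) (cs v u).
  rewrite !(mulmxDr, mulmxN).
  move: (dd (J y *m u) J y *m v) (dd (J y *m v) J y *m u) (J y *m (dd v J y *m u)) (J y *m (dd u J y *m v)) => a1 a2 a3 a4.
  move: (chr G (J y *m u) y *m (J y *m v)) (J y *m (chr G (J y *m u) y *m v)) (J y *m (chr G (J y *m v) y *m u)) (J y *m (J y *m _)) => b1 b2 b3 b4.
  by apply/colP => i; rewrite !mxE; ring.
have T X Y (Z : 'cV[R]_m) : a (J y *m Y) (J y *m Z) X + a (J y *m Z) X (J y *m Y) - a Z X Y - a Y Z X = 0.
  have jGj (x : 'cV[R]_m) : (J y *m X)^T *m G y *m (J y *m x) = X^T *m G y *m x.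
    by rewrite -[in RHS](her Dy) trmx_mul !mulmxA.
  have := congr1 (mulmx ((J y *m X)^T *m G y)) (tN Y Z).
  rewrite mulmx0 !(mulmxBr, mulmxDr) !jGj => /matrixP/(_ 0 0).
  rewrite !mx11D !mx11N [RHS]mxE -!/(a _ _ _) aJ (ask (J y *m Z) X) aJ -/(a _ _ _).
  by rewrite (ask Z X Y) -(ask (J y *m Z) (J y *m X) Y) opprK => <-; rewrite /a; ring.
apply: form_ext => z v; rewrite mulmx0 mul0mx; apply: mx11_inj; rewrite [RHS]mxE.
suff az : a w v ((invmx (G y))^T *m z) = 0.
  by rewrite -az /a trmx_mul trmxK -[_ *m G y]mulmxA mulVmx ?GU// mulmx1 mulmxA.
move: (_ *m z) => x.
have c1 := cyc w v x; have c2 := cyc w (J y *m v) (J y *m x); have t := T w v x.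
by rewrite aJ aJJ in c2; lra.
Qed.

Let comm_alg (j a b x z : 'M[R]_m) :
  (j *m a - a *m j) *m b + j *m x - (x *m j + b *m (j *m a - a *m j)) =
  (j *m b - b *m j) *m a + j *m z - (z *m j + a *m (j *m b - b *m j)) ->
  j *m (x - z + a *m b - b *m a) = (x - z + a *m b - b *m a) *m j.
Proof.
rewrite !(mulmxDl, mulmxDr, mulmxN, mulNmx) !mulmxA => h.
apply/matrixP => i k; move/matrixP/(_ i k): h; rewrite !mxE; lra.
Qed.

Lemma kahler_comm y u v : D y -> J y *m lRm G y u v = lRm G y u v *m J y.
Proof.
move=> Dy; have nGU : \forall z \near y, G z \in unitmx by exact: near_D.
have sC := sm_chr (sG Dy) nGU; have sJy := sJ Dy.
have F b : \forall z \near y, dd b J z = (fun z => J z *m chr G b z - chr G b z *m J z) z.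
  by apply: near_D => // z Dz; exact: kahler_parallel.
have K a b : dd a (dd b J) y = (J y *m chr G a y - chr G a y *m J y) *m chr G b y + J y *m dd a (chr G b) y
    - (dd a (chr G b) y *m J y + chr G b y *m (J y *m chr G a y - chr G a y *m J y)).
  have s1 := sm_mulmx sJy (sC b); have s2 := sm_mulmx (sC b) sJy.
  by rewrite (D_eq a (F b)) (DB a s1 s2) (D_mulmx a sJy (sC b)) (D_mulmx a (sC b) sJy) (kahler_parallel a Dy).
by have := D_swap u v sJy; rewrite !K; exact: comm_alg.
Qed.

End kahler.

Section ricci_flat.
Variables (D : set 'cV[R]_m) (G : 'cV[R]_m -> 'M[R]_m) (J : 'I_3 -> 'cV[R]_m -> 'M[R]_m).
Hypotheses (oD : open D) (sG : forall y, D y -> sm G y) (sJ : forall a y, D y -> sm (J a) y)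
  (GT : forall y, D y -> (G y)^T = G y) (GU : forall y, D y -> G y \in unitmx)
  (J2 : forall a y, D y -> J a y *m J a y = - 1%:M) (her : forall a y, D y -> (J a y)^T *m G y *m J a y = G y)
  (quat : forall a y, D y -> J (a + 2) y = J a y *m J (a + 1) y /\ J (a + 2) y = - (J (a + 1) y *m J a y))
  (tor0 : forall a y u v, D y -> tor (J a) y u v = 0)
  (cl : forall a y u v w, D y -> ext2 (fun z => G z *m J a z) y u v w = 0).
Variable y : 'cV[R]_m.
Hypothesis Dy : D y.

Let nGT : \forall z \near y, (G z)^T = G z.
Proof. by apply: (filterS (P := D)) => [z|]; [exact: GT|exact: open_nbhs_nbhs]. Qed.
Let nGU : \forall z \near y, G z \in unitmx.
Proof. by apply: (filterS (P := D)) => [z|]; [exact: GU|exact: open_nbhs_nbhs]. Qed.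

Lemma hk_ricci_flat v w : lric G y v w = 0.
Proof.
have gy := GT Dy; have gu := GU Dy.
rewrite lric_tr; apply: (alg_ricci_flat (G := G y) (Rc := lRm G y) (j := fun a => J a y)) => //.
- by move=> a b; rewrite lRmN.
- by move=> a b c; rewrite (lRm_bianchi (sG Dy) nGT nGU).
- by move=> a b; rewrite (lRm_skew (sG Dy) nGT nGU).
- move=> a b; rewrite (lRm_lin (sG Dy) nGU (- a)) (lRm_lin (sG Dy) nGU a) -sumrN.
  by apply: eq_bigr => i _; rewrite mxE scaleNr.
- by move=> a b c; rewrite SmxE//; exact: sG.
- by move=> a; exact: J2.
- by move=> a; exact: her.
- by move=> a; exact: quat.
- move=> a p q; exact: (kahler_comm oD sG (sJ a) GT GU (J2 a) (her a) (tor0 a) (cl a)).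
Qed.

End ricci_flat.
End hk.

(** * Bochner's identity *)

Section posdef.
Context {R : realType}.

Definition posdef n (G : 'M[R]_n) := forall v : 'cV[R]_n, v != 0 -> 0 < (v^T *m G *m v) 0 0.

Lemma posdef_ge0 n (G : 'M[R]_n) (v : 'cV[R]_n) : posdef G -> 0 <= (v^T *m G *m v) 0 0.
Proof.
move=> pG; have [->|v0] := eqVneq v 0; first by rewrite mulmx0 mxE.
exact: ltW (pG v v0).
Qed.

Lemma cholesky_step n (G : 'M[R]_(1 + n)) : G^T = G -> posdef G ->
  (forall C : 'M[R]_n, C^T = C -> posdef C -> exists2 P : 'M[R]_n, P \in unitmx & P^T *m C *m P = 1%:M) ->
  exists2 P : 'M[R]_(1 + n), P \in unitmx & P^T *m G *m P = 1%:M.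
Proof.
move=> GT pG IH.
pose b := dlsubmx G; pose C := drsubmx G; pose t := ulsubmx G 0 0.
have GE : G = block_mx t%:M b^T b C.
  by rewrite /t -mx11_scalar /b trmx_dlsub GT submxK.
have CT : C^T = C by rewrite /C trmx_drsub GT.
have t0 : 0 < t.
  have := pG (col_mx 1%:M 0); rewrite GE tr_col_mx mul_row_block mul_row_col.
  rewrite trmx1 trmx0 !mul1mx !mul0mx !mulmx1 mulmx0 !addr0 mxE eqxx mulr1n; apply.
  apply/eqP => /(congr1 usubmx); rewrite col_mxKu => /matrixP/(_ 0 0).
  by rewrite linear0 !mxE eqxx => /eqP; rewrite oner_eq0.
pose U : 'M[R]_(1 + n) := block_mx 1%:M (- (t^-1 *: b^T)) 0 1%:M.
pose C' := C - t^-1 *: (b *m b^T).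
have UT : U^T = block_mx 1%:M 0 (- (t^-1 *: b)) 1%:M.
  by rewrite /U tr_block_mx !trmx1 trmx0 trN trZ trmxK.
have UGU : U^T *m G *m U = block_mx t%:M 0 0 C'.
  have tt : t *: (t^-1 *: b^T) = b^T by rewrite scalerA mulfV ?scale1r ?gt_eqF.
  rewrite UT GE /U !mulmx_block !(mul1mx, mul0mx, mulmx0, mulmx1, addr0, add0r).
  rewrite mulmxN mul_scalar_mx tt addNr mulNmx mul_mx_scalar scalerA mulrC.
  rewrite mulVf ?(lt0r_neq0 t0)// scale1r addNr mul0mx add0r mulNmx -scalemxAl.
  by rewrite addrC.
have uU : U \in unitmx by rewrite unitmxE det_ublock !det1 mulr1 unitr1.
have pC' : posdef C'.
  move=> v v0; have := pG (U *m col_mx 0 v).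
  rewrite trmx_mul !mulmxA -[_ *m U^T *m G]mulmxA -[_ *m (U^T *m G) *m U]mulmxA UGU.
  rewrite tr_col_mx mul_row_block mul_row_col trmx0 !mul0mx mulmx0 !add0r; apply.
  apply/eqP => /(congr1 (mulmx (invmx U))); rewrite mulKmx// mulmx0 => /(congr1 dsubmx).
  by rewrite col_mxKd linear0 => /eqP; rewrite (negPf v0).
have C'T : C'^T = C' by rewrite /C' trB trZ trmx_mul trmxK CT.
have [P' uP' PCP] := IH C' C'T pC'.
pose s := (Num.sqrt t)^-1.
have s0 : s != 0 by rewrite invr_eq0 sqrtr_eq0 -ltNge.
exists (U *m block_mx s%:M 0 0 P').
  by rewrite unitmx_mul uU unitmxE det_ublock unitrM det_scalar1 unitfE s0 -unitmxE.
rewrite trmx_mul !mulmxA -[_ *m U^T *m G]mulmxA -[_ *m (U^T *m G) *m U]mulmxA UGU.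
rewrite tr_block_mx !mulmx_block !trmx0 !(mul0mx, mulmx0, addr0, add0r) PCP tr_scalar_mx.
rewrite -!scalar_mxM (_ : s * t * s = 1) -?scalar_mx_block//.
by rewrite mulrAC -invfM -expr2 sqr_sqrtr ?(ltW t0)// mulVf ?gt_eqF.
Qed.

Lemma cholesky n (G : 'M[R]_n) : G^T = G -> posdef G ->
  exists2 P : 'M[R]_n, P \in unitmx & P^T *m G *m P = 1%:M.
Proof.
elim: n G => [|n IH] G GT pG; last exact: (@cholesky_step n).
by exists 1%:M; [exact: unitmx1|apply/matrixP => -[]].
Qed.

Lemma pos_tr n k (G : 'M[R]_n) (K : 'M[R]_k) (S : 'M[R]_(k, n)) :
  G^T = G -> posdef G -> posdef K ->
  0 <= \tr (invmx G *m (S^T *m K *m S)) /\ (\tr (invmx G *m (S^T *m K *m S)) = 0 -> S = 0).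
Proof.
move=> GT pG pK; have [P uP PGP] := cholesky GT pG.
have iG : invmx G = P *m P^T.
  have uG : G \in unitmx by have := unitmx1 R n; rewrite -PGP unitmx_mul => /andP[]; rewrite unitmx_mul => /andP[].
  apply: (can_inj (mulmxK uG)); rewrite mulVmx//.
  apply: (can_inj (mulmxK uP)); rewrite mul1mx -!mulmxA mulmxA in PGP *.
  by rewrite PGP mulmx1.
have E : \tr (invmx G *m (S^T *m K *m S)) = \sum_i ((col i (S *m P))^T *m K *m col i (S *m P)) 0 0.
  have -> : \tr (invmx G *m (S^T *m K *m S)) = \tr (P^T *m (S^T *m K *m S) *m P).
    by rewrite iG -[P *m P^T *m _]mulmxA mxtrace_mulC.
  rewrite /mxtrace; apply: eq_bigr => i _; rewrite colE trmx_mul trmx_delta.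
  have -> : delta_mx 0 i *m (S *m P)^T *m K *m (S *m P *m delta_mx i 0) =
     delta_mx (0 : 'I_1) i *m (P^T *m (S^T *m K *m S) *m P) *m delta_mx i (0 : 'I_1) by rewrite trmx_mul !mulmxA.
  by rewrite -rowE -colE [RHS]mxE [RHS]mxE.
rewrite E; split; first by apply: sumr_ge0 => i _; exact: posdef_ge0.
move=> /eqP; rewrite psumr_eq0 => [/allP H|i _]; last exact: posdef_ge0.
have SP : S *m P = 0.
  apply/matrixP => a i; have /implyP/(_ isT) := H i (mem_index_enum i).
  have [/colP/(_ a)|c0] := eqVneq (col i (S *m P)) 0; first by rewrite mxE => -> _; rewrite !mxE.
  by move=> /eqP h; have := pK _ c0; rewrite h ltxx.
by apply: (can_inj (mulmxK uP)); rewrite SP mul0mx.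
Qed.

End posdef.

Section bochner.
Context {R : realType} {m : nat} (D : set 'cV[R]_m) (k : R) (G : 'cV[R]_m -> 'M[R]_m) (P : 'I_3 -> 'cV[R]_m -> 'M[R]_m)
    (E : 'I_3 -> 'cV[R]_m -> 'rV[R]_m) (X : 'I_3 -> 'cV[R]_m -> 'cV[R]_m).
Hypothesis L : loc3 D k G P E X.

Let Bf c z := jac (X c) z + chr G (X c z) z.

Let near_D (Q : 'cV[R]_m -> Prop) y : D y -> (forall z, D z -> Q z) -> \forall z \near y, Q z.
Proof. exact: (l_near L). Qed.

Let gT y (Dy : D y) : \forall z \near y, (G z)^T = G z. Proof. by apply: near_D => // z; exact: (l_sym L). Qed.
Let gU y (Dy : D y) : \forall z \near y, G z \in unitmx. Proof. by apply: near_D => // z; exact: (l_unit L). Qed.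

Let half_alg p q (A B : 'M[R]_(p, q)) : A = - B -> B = - (2^-1 *: (A - B)).
Proof. by move=> ->; apply/matrixP => i j; rewrite !mxE; lra. Qed.

Lemma Bf_skew c y : D y -> (Bf c y)^T *m G y = - (G y *m Bf c y).
Proof.
move=> Dy; have := l_LG L Dy c; rewrite /Lbil (chr_metric (l_smG L Dy) (gT Dy) (gU Dy)) => h.
apply/eqP; rewrite -addr_eq0 -[X in _ == X]h /Bf trD mulmxDl mulmxDr; apply/eqP.
by apply/matrixP => i j; rewrite !mxE; ring.
Qed.

Lemma Bf_dmx c y : D y -> G y *m Bf c y = - (2^-1 *: dmx (E c) y).
Proof.
move=> Dy; have sX := l_smX L c Dy; have sG := l_smG L Dy.
suff -> : dmx (E c) y = (Bf c y)^T *m G y - G y *m Bf c y.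
  exact: half_alg (Bf_skew c Dy).
have sT := sm_trmx sX.
rewrite (dmx_eq (f := fun z => (X c z)^T *m G z)); last by apply: near_D => // z Dz; exact: (l_E L Dz).
apply: form_ext => u v; rewrite dmxE; last exact: sm_mulmx.
have Bu w : Bf c y *m w = dd w (X c) y + chr G w y *m X c y.
  by apply: (etrans (mulmxDl _ _ _)); rewrite -D_jac// (chr_sym sG (gT Dy) (X c y)).
have tX : (X c y)^T *m G y *m chr G u y *m v = (X c y)^T *m G y *m chr G v y *m u.
  by rewrite -!mulmxA (chr_sym sG (gT Dy)).
rewrite /ext1 !(D_mulmx _ sT sG) !D_trmx// !(chr_metric sG (gT Dy) (gU Dy)) mulmxBr mulmxBl.
rewrite mulmxA -trmx_mul Bu -!mulmxA Bu; rewrite trD.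
have sw (a : 'cV[R]_m) : u^T *m (G y *m a) = a^T *m (G y *m u).
  by rewrite -[LHS]tr11 !trmx_mul trmxK (l_sym L Dy) mulmxA.
rewrite sw trD.
rewrite !(mulmxDl, mulmxDr) !trmx_mul !mulmxA tX.
move: ((X c y)^T *m G y *m chr G v y *m u) => t.
by apply/matrixP => i j; rewrite !mxE; ring.
Qed.

Let boch_alg (B C Z : 'M[R]_m) (u : 'cV[R]_m) :
  (- (B *m B) - (Z + C *m B - B *m C)) *m u = - (B *m (B *m u)) - (Z *m u + C *m (B *m u) - B *m (C *m u)).
Proof. by rewrite !(mulmxBl, mulmxDl, mulNmx) -!mulmxA. Qed.

Lemma Bf_X c y : D y -> Bf c y *m X c y = 0.
Proof.
move=> Dy; apply: (can_inj (mulKmx (l_unit L Dy))); rewrite mulmx0 mulmxA Bf_dmx//.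
apply: trmx_inj; rewrite trmx0; apply: mulmx_ext => u; rewrite mul0mx.
rewrite -[LHS]tr11 trmx_mul trmxK mulNmx mulmxN -scalemxAl -scalemxAr mulmxA dmxE; last exact: (l_smE L c Dy).
by rewrite (l_d1_xi L Dy) scaler0 oppr0.
Qed.

Lemma Bf_tr c y : D y -> \tr (Bf c y) = 0.
Proof.
move=> Dy; have u := l_unit L Dy.
have h : Bf c y = - (invmx (G y) *m ((Bf c y)^T *m G y)) by rewrite Bf_skew// mulmxN opprK mulKmx.
have : \tr (Bf c y) = - \tr (Bf c y) by rewrite {1}h raddfN /= mxtrace_mulC mulmxK// mxtrace_tr.
lra.
Qed.

Lemma Bf_sm c y : D y -> sm (Bf c) y.
Proof.
move=> Dy; have sX := l_smX L c Dy; apply: smD; first exact: sm_jac.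
by have [] := dd_lin_fam 0 (lin_fam_chr (l_smG L Dy) (gU Dy)) sX.
Qed.

Lemma bochner_tr c y : D y -> lric G y (X c y) (X c y) = - \tr (Bf c y *m Bf c y).
Proof.
move=> Dy; have sX := l_smX L c Dy; have sG := l_smG L Dy; have sB := Bf_sm c Dy.
have sC := sm_chr sG (gU Dy).
have F v : \forall z \near y, Bf c z *m v = dd v (X c) z + chr G v z *m X c z.
   apply: near_D => // z Dz; apply: (etrans (mulmxDl _ _ _)); rewrite -D_jac; last exact: (l_smX L c Dz).
  by rewrite (chr_sym (l_smG L Dz) (gT Dz) (X c z)).
have K u v : dd u (Bf c) y *m v = dd u (dd v (X c)) y + dd u (chr G v) y *m X c y + chr G v y *m dd u (X c) y.
  rewrite -D_mulmxr// (D_eq u (F v)) DD; [|exact: sm_D|exact: sm_mulmx].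
  by rewrite (D_mulmx u (sC v) sX) addrA.
have K2 u v : lRm G y u v *m X c y = dd u (Bf c) y *m v + chr G u y *m (Bf c y *m v)
    - dd v (Bf c) y *m u - chr G v y *m (Bf c y *m u).
  rewrite !K (nbhs_singleton (F u)) (nbhs_singleton (F v)) (D_swap u v sX) /lRm.
  rewrite !(mulmxDl, mulmxDr, mulNmx) !mulmxA.
  move: (dd u (chr G v) y *m X c y) (dd v (chr G u) y *m X c y) (chr G u y *m chr G v y *m X c y) (chr G v y *m chr G u y *m X c y) => a1 a2 a3 a4.
  move: (dd v (dd u (X c)) y) (chr G u y *m dd v (X c) y) (chr G v y *m dd u (X c) y) => b1 b2 b3.
  by apply/colP => i; rewrite !mxE; ring.
have S : Smx G y (X c y) (X c y) = - (Bf c y *m Bf c y)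
   - (dd (X c y) (Bf c) y + chr G (X c y) y *m Bf c y - Bf c y *m chr G (X c y) y).
  apply: mulmx_ext => u; rewrite (SmxE (X c y) (X c y) u sG (gU Dy)).
  rewrite K2 Bf_X// mulmx0 addr0.
  have -> : dd u (Bf c) y *m X c y = - (Bf c y *m dd u (X c) y).
    have Z : \forall z \near y, (fun z => Bf c z *m X c z) z = (fun=> 0 : 'cV[R]_m) z.
      by apply: near_D => // z Dz; exact: Bf_X.
    by have := D_eq u Z; rewrite Dcst D_mulmx// => /eqP; rewrite addr_eq0 => /eqP.
  rewrite boch_alg.
  have -> : dd u (X c) y = Bf c y *m u - chr G u y *m X c y by rewrite (nbhs_singleton (F u)) addrK.
  rewrite (chr_sym sG (gT Dy) u) mulmxBr.
  move: (Bf c y *m (Bf c y *m u)) (Bf c y *m (chr G (X c y) y *m u)) (dd (X c y) (Bf c) y *m u) (chr G (X c y) y *m (Bf c y *m u)) => a1 a2 a3 a4.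
  by apply/colP => i; rewrite !mxE; ring.
rewrite lric_tr S raddfB /= raddfN /= (raddfB (@mxtrace _ _)) /= mxtraceD.
have -> : \tr (dd (X c y) (Bf c) y) = 0.
  rewrite /mxtrace; have Z : \forall z \near y, (fun z => \sum_i (Bf c z i i : R^o)) z = (fun=> 0 : R^o) z.
    by apply: near_D => // z Dz; exact: (Bf_tr c Dz).
  have sii i : sm (fun z => Bf c z i i : R^o) y by exact: (sm_mxP _ _).1.
  have := D_eq (X c y) Z; rewrite Dcst D_sum// => h.
  by rewrite -[RHS]h; apply: eq_bigr => i _; rewrite D_entry.
by rewrite add0r [\tr (Bf c y *m chr _ _ _)]mxtrace_mulC subrr subr0.
Qed.

Let h y := hor E X y.

Definition Mh c y := (h y)^T *m dmx (E c) y *m h y.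

Lemma bochner c y : D y -> lric G y (X c y) (X c y) =
  k ^+ 2 / 2 + 4^-1 * \tr (invmx (G y) *m ((Mh c y)^T *m invmx (G y) *m Mh c y)).
Proof.
move=> Dy; have u := l_unit L Dy; rewrite bochner_tr//.
have B : Bf c y = - (2^-1 *: (invmx (G y) *m dmx (E c) y)).
  by apply: (can_inj (mulKmx u)); rewrite Bf_dmx// mulmxN -scalemxAr mulKVmx.
pose M := dmx (E c) y.
have MX d : M *m X d y = - (Lrow (X d) (E c) y)^T.
  apply: trmx_inj; rewrite trN trmxK; apply: mulmx_ext => w.
  rewrite [RHS]mulNmx -(l_iE L Dy) trmx_mul dmx_skew mulmxN [LHS]mulNmx -[_ *m M *m w]/((X d y)^T *m dmx (E c) y *m w) dmxE//.
  exact: (l_smE L c Dy).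
have XM d : (X d y)^T *m M = Lrow (X d) (E c) y.
  by apply: mulmx_ext => w; rewrite -(l_iE L Dy) dmxE//; exact: (l_smE L c Dy).
have hE : h y = 1%:M - (X c y *m E c y + X (c + 1) y *m E (c + 1) y + X (c + 2) y *m E (c + 2) y).
  by rewrite /h /hor (I3_sum _ c).
have XX a b : E a y *m X b y = (a == b)%:R%:M by exact: (l_EXE L Dy).
have n1 : (c == c + 1) = false by apply/eqP => /(congr1 val); clear; move: c => [[|[|[|//]]] ia].
have n2 : (c == c + 2) = false by apply/eqP => /(congr1 val); clear; move: c => [[|[|[|//]]] ia].
have n3 : (c + 1 == c + 2) = false by apply/eqP => /(congr1 val); clear; move: c => [[|[|[|//]]] ia].
have M0 : M *m X c y = 0 by rewrite MX (l_LE L) // trmx0 oppr0.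
have M1 : M *m X (c + 1) y = k *: (E (c + 2) y)^T by rewrite MX (l_LEp L)// trN trZ opprK.
have M2 : M *m X (c + 2) y = - (k *: (E (c + 1) y)^T) by rewrite MX (l_LEm L)// trZ.
have Mh1 : M *m h y = M - k *: ((E (c + 2) y)^T *m E (c + 1) y - (E (c + 1) y)^T *m E (c + 2) y).
  rewrite hE mulmxBr mulmx1 !mulmxDr !mulmxA M0 M1 M2 mul0mx add0r mulNmx -!scalemxAl -scalerBr.
  by [].
have Eh a : E a y *m h y = 0 by exact: (E_hor L Dy).
have hEt a : (h y)^T *m (E a y)^T = 0 by rewrite -trmx_mul Eh trmx0.
have XhM a : (X a y)^T *m (M *m h y) = 0.
  rewrite mulmxA XM; have [->|->|->] := I3_cases c a.
  - by rewrite (l_LE L)// mul0mx.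
  - by rewrite (l_LEp L)// mulNmx -scalemxAl Eh scaler0 oppr0.
  - by rewrite (l_LEm L)// -scalemxAl Eh scaler0.
have MhE : Mh c y = M *m h y.
  rewrite /Mh -/M -mulmxA; move: (M *m h y) XhM => Z XZ.
  rewrite hE trB trmx1 mulmxBl mul1mx !trD !trmx_mul !mulmxDl -!mulmxA !XZ.
  by rewrite !mulmx0 !addr0 subr0.
have Xh a : h y *m X a y = 0.
  rewrite /h /hor mulmxBl mul1mx mulmx_suml (bigD1 a)//= -mulmxA XX eqxx mulmx1 big1 ?addr0 ?subrr//.
  by move=> b ba; rewrite -mulmxA XX (negPf ba) raddf0 mulmx0.
have MhX a : Mh c y *m X a y = 0 by rewrite MhE -mulmxA Xh mulmx0.
have MhT : (Mh c y)^T = - Mh c y.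
  by rewrite /Mh !trmx_mul trmxK dmx_skew mulNmx mulmxN mulmxA.
have iE a : invmx (G y) *m (E a y)^T = X a y by apply: (can_inj (mulKmx u)); rewrite mulKVmx// (l_GX L).
have EMh a : E a y *m invmx (G y) *m Mh c y = 0.
  have -> : E a y *m invmx (G y) = (X a y)^T by rewrite -iE trmx_mul trmxK trmx_inv (l_sym L).
  by apply: trmx_inj; rewrite trmx_mul MhT trmxK mulNmx MhX oppr0 trmx0.
have ME : M = Mh c y + k *: ((E (c + 2) y)^T *m E (c + 1) y - (E (c + 1) y)^T *m E (c + 2) y).
  by rewrite MhE Mh1 subrK.
move: (Mh c y) MhX MhT EMh ME => N NX NT EN ME.
pose W := invmx (G y) *m N.
pose V := X (c + 2) y *m E (c + 1) y - X (c + 1) y *m E (c + 2) y.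
have GM : invmx (G y) *m M = W + k *: V.
  by rewrite ME mulmxDr -scalemxAr mulmxBr !mulmxA !iE.
have WV : W *m V = 0 by rewrite /W /V mulmxBr -!mulmxA ![N *m (_ *m _)]mulmxA !NX !mul0mx !mulmx0 subrr.
have VW : V *m W = 0 by rewrite /W /V mulmxBl -!mulmxA ![E _ y *m (_ *m _)]mulmxA !EN !mulmx0 subrr.
have tV : \tr (V *m V) = - 2.
  rewrite /V !(mulmxBl, mulmxBr) !mulmxA -![X _ y *m E _ y *m X _ y]mulmxA !XX !eqxx [c + 2 == _]eq_sym n3.
  rewrite ?raddf0 ?mulmx0 ?mul0mx ?mulmx1 ?subr0 ?sub0r !raddfB /= ?raddfN /= ?raddf0.
  rewrite ![\tr (X _ y *m _)]mxtrace_mulC !XX !eqxx !mxtrace1.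
  by ring.
rewrite B mulNmx mulmxN opprK -scalemxAl -scalemxAr scalerA mxtraceZ GM.
rewrite mulmxDl !mulmxDr -!scalemxAl -!scalemxAr WV VW !scaler0 addr0 add0r mxtraceD !mxtraceZ tV.
have -> : \tr (invmx (G y) *m (N^T *m invmx (G y) *m N)) = - \tr (W *m W).
  by rewrite NT !mulNmx mulmxN raddfN /= /W !mulmxA.
by field.
Qed.

Lemma inv_posdef y : D y -> posdef (invmx (G y)).
Proof.
move=> Dy v v0; have u := l_unit L Dy.
have := l_pos L Dy (v := invmx (G y) *m v).
rewrite trmx_mul trmx_inv (l_sym L Dy) !mulmxA mulmxKV//; apply.
by apply: contra v0 => /eqP/(congr1 (mulmx (G y))); rewrite mulKVmx// mulmx0 => ->.
Qed.

Lemma bochner_ii y : D y -> (forall c, lric G y (X c y) (X c y) <= k ^+ 2 / 2) -> lii E y.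
Proof.
move=> Dy H c u v Hu Hv; have uG := l_unit L Dy.
have [t0 t1] := pos_tr (Mh c y) (l_sym L Dy) (fun v => @l_pos _ _ _ _ _ _ _ _ L y v Dy) (inv_posdef Dy).
have := H c; rewrite bochner// gerDl pmulr_rle0 ?invr_gt0// => tle.
have M0 : Mh c y = 0 by apply: t1; apply/eqP; rewrite eq_le tle t0.
have hu (w : 'cV[R]_m) : (forall b, E b y *m w = 0) -> h y *m w = w.
  move=> Hw; rewrite [in RHS](hor_split E X y w) big1 ?addr0// => b _; by rewrite Hw mxE scale0r.
rewrite -dmxE; last exact: (l_smE L c Dy).
by rewrite -(hu u Hu) -(hu v Hv) trmx_mul mulmxA -[_ *m dmx _ _]mulmxA -[_ *m (_ *m _) *m h y]mulmxA -/(Mh c y) M0 mulmx0 mul0mx.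
Qed.

Lemma ii_bochner y : D y -> lii E y -> forall c, lric G y (X c y) (X c y) = k ^+ 2 / 2.
Proof.
move=> Dy ii c; rewrite bochner// (_ : Mh c y = 0) ?mulmx0 ?raddf0 ?mulr0 ?addr0//.
apply: form_ext => u v; rewrite mulmx0 mul0mx /Mh !mulmxA -trmx_mul -[_ *m h y *m v]mulmxA dmxE; last exact: (l_smE L c Dy).
by apply: ii => b; rewrite mulmxA (E_hor L)// mul0mx.
Qed.

End bochner.

(** * Condition (iv) implies (ii) *)

Lemma hk_chart_flat {R : realType} {k : nat} (K : manifold R k) (gK : metric K) (J : 'I_3 -> endofield K) d q v w :
  hyperKahler gK J -> atlas d -> chart_dom d q -> lric (lg d gK) (d q) v w = 0.
Proof.
move=> hk ad dq; have rg := hk_riemannian hk; have U q' (dq' : chart_dom d q') := Jt_unit ad dq'.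
have H (Q : 'cV[R]_k -> Prop) : (forall q, chart_dom d q -> Q (d q)) -> forall y, (d @` chart_dom d) y -> Q y.
  by move=> HQ y [q' dq' <-]; exact: HQ.
have cf (x : 'cV[R]_k) q' : chart_dom d q' -> exists2 Y, smooth_vfield Y & lv d Y (d q') = x.
  by move=> dq'; have [Y sY /nbhs_singleton nY] := const_field x ad dq'; exists Y.
have eJ2 a q' : chart_dom d q' -> lE d (J a) (d q') *m lE d (J a) (d q') = - 1%:M.
  move=> dq'; rewrite /lE chart_funK// !mulmxA mulmxKV ?U//.
  by rewrite -[Jt d q' *m _ *m J a q']mulmxA (hk_square hk) mulmxN mulNmx mulmx1 mulmxV ?U.
have eher a q' : chart_dom d q' -> (lE d (J a) (d q'))^T *m lg d gK (d q') *m lE d (J a) (d q') = lg d gK (d q').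
  move=> dq'; rewrite /lE /lg chart_funK// !trmx_mul; set A := Jt d q'; have uA : A \in unitmx by exact: U.
  rewrite !mulmxA -[_ *m A^T *m _]mulmxA -[A^T *m _]trmx_mul mulVmx// trmx1 mulmx1 mulmxKV//.
  by rewrite -[_ *m _ *m gK q']mulmxA -[_ *m _ *m J a q']mulmxA (hk_hermitian hk).
apply: (hk_ricci_flat (D := d @` chart_dom d) (J := fun a => lE d (J a))).
- exact: chart_img_open.
- by apply: H => q' dq'; exact: sm_lg.
- by move=> a; apply: H => q' dq'; apply: sm_lE => //; exact: (hk_smooth hk).
- by move=> y _; exact: lg_sym.
- by apply: H => q' dq'; apply: lg_unit => //; rewrite chart_funK.
- by move=> a; apply: H => q' dq'; exact: eJ2.
- by move=> a; apply: H => q' dq'; exact: eher.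
- move=> a; apply: H => q' dq'; have [h1 h2] := hk_quaternion hk (even_triple_succ a) q'.
  rewrite /lE chart_funK// !mulmxA !mulmxKV ?U//; split; first by rewrite h1 mulmxA.
  by rewrite h2 mulmxN mulNmx !mulmxA.
- move=> a y u u' Dy; move: y Dy u u'; apply: H => q' dq' u u'.
  have [Y sY <-] := cf u q' dq'; have [Z sZ <-] := cf u' q' dq'.
  by rewrite -(nij_chart ad dq' (hk_smooth hk a) sY sZ) (hk_integrable hk) ?mulmx0.
- move=> a y u u' u'' Dy; move: y Dy u u' u''; apply: H => q' dq' u u' u''.
  have [Y sY <-] := cf u q' dq'; have [Z sZ <-] := cf u' q' dq'; have [W sW <-] := cf u'' q' dq'.
  have := hk_closed hk a sY sZ sW q'.
  rewrite (d2_chart ad dq' rg (hk_smooth hk a) _ (sv_sm sY ad dq') (sv_sm sZ ad dq') (sv_sm sW ad dq')); last first.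
    rewrite /= trmx_mul lg_sym//; set B := lE _ _ _.
    rewrite -[B^T *m _]mulmx1 -[1%:M]opprK -(eJ2 a q' dq') -/B mulmxN mulmxA.
    by rewrite (eher a q' dq').
  by move=> /eqP; rewrite mulf_eq0 invr_eq0 pnatr_eq0 /= => /eqP h0; apply: mx11_inj; rewrite h0 mxE.
- by exists q.
Qed.

Lemma product_ricci {R : realType} {m k : nat} (M : manifold R m) (g : metric M) (kappa : R) (p : M) :
  (k + 4 = m + 1)%N -> riemannian g -> locally_hyperKahler_times_sphere g k kappa ->
  exists (J1 : 'M[R]_(k, m)) (J2 : 'M[R]_(4, m)) (H : 'M[R]_k),
  [/\ kappa != 0, posdef H, g p = J1^T *m H *m J1 + J2^T *m J2, \tr (invmx (g p) *m (J2^T *m J2)) = 3 &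
    forall v w, lric (lg (chart_at p) g) (chart_at p p) v w = 2 * kappa * ((J2 *m w)^T *m (J2 *m v)) 0 0].
Proof.
move=> e rg /(_ p)[U [K [gK [J [A [V [F1 [F2]]]]]]]] [[oU Up] hk _ [sF1 sF2 [FI _ _]] iso].
have [ac cp] := chart_atP p; set c := chart_at p in ac cp *.
have [ad dp] := chart_atP (F1 p); set d := chart_at (F1 p) in ad dp.
pose D := interior [set y | [/\ chart_dom c (chart_inv c y), c (chart_inv c y) = y, U (chart_inv c y) &
    chart_dom d (F1 (chart_inv c y))]].
have Dp : D (c p) by exact: (smooth_map_near oU sF1 Up ac cp ad dp).
have oD : open D by exact: open_interior.
have DP y : D y -> exists q, [/\ y = c q, chart_dom c q, U q & chart_dom d (F1 q)].
  by move=> /interior_subset[cy ey Uy dy]; exists (chart_inv c y); rewrite ey.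
pose p1 := (d \o F1) \o chart_inv c; pose p2 := F2 \o chart_inv c.
have sph q : U q -> kappa *: ((F2 q)^T *m F2 q) = 1%:M.
  move=> Uq; have [_ [s _]] := FI q Uq; apply: mx11_inj; rewrite !mxE -s; congr (_ * _).
  by apply: eq_bigr => i _; rewrite mxE expr2.
have ka0 : kappa != 0.
  apply/eqP => k0; have /matrixP/(_ 0 0) := sph p Up; rewrite k0 scale0r !mxE eqxx => /eqP.
  by rewrite eq_sym oner_eq0.
have s1 y : D y -> sm p1 y by move=> /DP[q [-> cq Uq dq]]; exact: smooth_map_sm oU sF1 q c d Uq ac cq ad dq.
have s2q q c' : U q -> atlas c' -> chart_dom c' q -> sm (F2 \o chart_inv c') (c' q).
  by move=> Uq ac' cq; have /(smooth_funP _ oU) := sF2; apply.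
have s2 y : D y -> sm p2 y by move=> /DP[q [-> cq Uq dq]]; exact: s2q.
have isoD y : D y -> lg c g y = (jac p1 y)^T *m lg d gK (p1 y) *m jac p1 y + (jac p2 y)^T *m jac p2 y.
  move=> /DP[q [-> cq Uq dq]]; apply: form_ext => u v.
  have uc := Jt_unit ac cq; have ud := Jt_unit ad dq.
  have := iso q Uq (invmx (Jt c q) *m u) (invmx (Jt c q) *m v).
  have T x : tangent_map F1 q (invmx (Jt c q) *m x) = invmx (Jt d (F1 q)) *m (jac p1 (c q) *m x).
    apply: (can_inj (mulKmx ud)); rewrite (tangent_map_chart oU sF1 _ Uq ac cq ad dq) !mulKVmx//.
    by rewrite D_jac//; exact: smooth_map_sm oU sF1 q c d Uq ac cq ad dq.
  have T2 x : dfun F2 q (invmx (Jt c q) *m x) = jac p2 (c q) *m x.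
    by rewrite (dfun_chart _ ac cq (s2q q c Uq ac cq)) mulKVmx// D_jac//; exact: s2q.
  rewrite !T !T2 (lg_at g cq) /p1 /= chart_funK// (lg_at gK dq) => h.
  apply: mx11_inj; move: h; rewrite -/p1 !trmx_mul !mulmxA => ->.
  by rewrite [in RHS]mulmxDr mulmxDl [RHS]mxE !mulmxA.
have Hsm y : D y -> sm (lg d gK) (p1 y).
  by move=> /DP[q [-> cq Uq dq]]; rewrite /p1 /= chart_funK//; apply: sm_lg => //; exact: hk_riemannian hk.
have Hu y : D y -> \forall z \near p1 y, lg d gK z \in unitmx.
  by move=> /DP[q [-> cq Uq dq]]; rewrite /p1 /= chart_funK//; apply: near_unit => //; exact: hk_riemannian hk.
have Gu y : D y -> lg c g y \in unitmx.
  by move=> /DP[q [-> cq Uq dq]]; apply: lg_unit => //; rewrite chart_funK.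
have sD y : D y -> kappa *: ((p2 y)^T *m p2 y) = 1%:M.
  by move=> /DP[q [-> cq Uq dq]]; rewrite /p2 /= chart_funK//; exact: sph.
have Gp : lg c g (c p) = g p by rewrite lg_at// /c Jt_self invmx1 trmx1 mul1mx mulmx1.
exists (jac p1 (c p)), (jac p2 (c p)), (lg d gK (p1 (c p))); split=> //.
- move=> v v0; apply: lg_pos => //; first exact: hk_riemannian hk.
  by rewrite /p1 /= chart_funK// chart_funK.
- by rewrite -Gp; exact: isoD.
- have [_ _ _ b4] := iso_blocks oD s2 Gu isoD sD e ka0 Dp.
  rewrite -Gp mulmxA mxtrace_mulC mulmxA.
  have -> : jac p2 (c p) *m invmx (lg c g (c p)) *m (jac p2 (c p))^T = 1%:M - kappa *: (p2 (c p) *m (p2 (c p))^T).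
    by rewrite -b4 addrK.
  rewrite raddfB /= mxtrace1 mxtraceZ mxtrace_mulC -mxtraceZ sD// mxtrace1.
  by ring.
have sG y : D y -> sm (lg c g) y by move=> /DP[q [-> cq Uq dq]]; exact: sm_lg.
have GT y : D y -> (lg c g y)^T = lg c g y by move=> _; exact: lg_sym.
have HT y : D y -> \forall z \near p1 y, (lg d gK z)^T = lg d gK z.
  by move=> _; apply: near_sym; exact: hk_riemannian hk.
move=> v w; rewrite (iso_ricci oD s1 s2 sG Hsm GT Gu HT Hu isoD sD e ka0 Dp).
by rewrite {1}/p1 /= chart_funK// (hk_chart_flat _ _ hk ad dp) add0r.
Qed.

Section tq4.
Context {R : realType} {m n : nat} {M : manifold R m}.
Variables (phi : 'I_3 -> endofield M) (xi : 'I_3 -> vfield M) (eta : 'I_3 -> oneform M) (g : metric M) (k : R).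
Hypotheses (tq : three_quasi_Sasakian phi xi eta g)
  (hk : forall a b d : 'I_3, even_triple a b d -> forall p : M, bracket (xi a) (xi b) p = k *: xi d p)
  (em : m = (n + 3)%N) (iv : locally_hyperKahler_times_sphere g n (k ^+ 2 / 4)).

Let e4 : (n + 4 = m + 1)%N. Proof. by rewrite em -addnA. Qed.

Lemma le_self (e : oneform M) (p : M) : le (chart_at p) e (chart_at p p) = e p.
Proof. by rewrite le_at ?Jt_self ?invmx1 ?mulmx1//; case: (chart_atP p). Qed.
Lemma lv_self (X : vfield M) (p : M) : lv (chart_at p) X (chart_at p p) = X p.
Proof. by rewrite lv_at ?Jt_self ?mul1mx//; case: (chart_atP p). Qed.
Lemma lg_self (p : M) : lg (chart_at p) g (chart_at p p) = g p.
Proof. by rewrite lg_at ?Jt_self ?invmx1 ?trmx1 ?mul1mx ?mulmx1//; case: (chart_atP p). Qed.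

Lemma tq_iv_ii_at (p : M) : lii (fun a => le (chart_at p) (eta a)) (chart_at p p).
Proof.
have [ac cp] := chart_atP p; have L := tq_loc3 tq hk ac; have Dp := in_img cp.
apply: (bochner_ii L Dp) => a; rewrite lv_self.
have [J1 [J2 [H [k0 pH gE _ ->]]]] := product_ricci p e4 (tq_rg tq) iv.
have pG (v : 'cV[R]_m) : ((J2 *m v)^T *m (J2 *m v)) 0 0 <= (v^T *m g p *m v) 0 0.
  rewrite gE mulmxDr mulmxDl [leRHS]mxE trmx_mul !mulmxA lerDr.
  by have := posdef_ge0 (J1 *m v) pH; rewrite trmx_mul !mulmxA.
have k4 : 0 <= 2 * (k ^+ 2 / 4) by rewrite mulr_ge0// divr_ge0// sqr_ge0.
apply: (le_trans (ler_wpM2l k4 (pG (xi a p)))).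
have -> : ((xi a p)^T *m g p *m xi a p) 0 0 = 1.
  by have := l_EX L a Dp; rewrite (l_E L Dp) lg_self lv_self => ->; rewrite mxE.
by lra.
Qed.

Lemma tq_iv_ii : tq_ii eta.
Proof.
move=> a X Y hX hY p; have [ac cp] := chart_atP p; have [[sX _] [sY _]] := (hX, hY).
rewrite (d1_chart ac cp (tq_se tq a) (sv_sm sX ac cp) (sv_sm sY ac cp)).
by rewrite (tq_iv_ii_at a) ?mxE ?mulr0// => b; exact: hor_lv.
Qed.

Lemma tq_iv_ricci X Y p : smooth_vfield X -> smooth_vfield Y ->
  ricci g X Y p = k ^+ 2 / 2 * \sum_a app1 (eta a) X p * app1 (eta a) Y p.
Proof.
move=> sX sY; rewrite (ricci_chart (tq_rg tq))//.
have [ac cp] := chart_atP p; have L := tq_loc3 tq hk ac; have Dp := in_img cp.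
have [J1 [J2 [H [k0 pH gE trN ric]]]] := product_ricci p e4 (tq_rg tq) iv.
have pg : posdef (g p) by exact: Defs.metric_pos (tq_rg tq) p.
have gT : (g p)^T = g p by exact: Defs.metric_sym (tq_rg tq) p.
have gu : g p \in unitmx by exact: posdef_unit pg.
have EX a b : eta a p *m xi b p = (a == b)%:R%:M by exact: tq_delta tq hk a b p.
have GX a : g p *m xi a p = (eta a p)^T by have := l_GX L Dp a; rewrite lg_self lv_self le_self.
have J2x a : ((J2 *m xi a p)^T *m (J2 *m xi a p)) 0 0 = 1.
  have := ii_bochner L Dp (@tq_iv_ii_at p) a; rewrite lv_self ric => h.
  have kk : k ^+ 2 / 4 * (k ^+ 2 / 4)^-1 = 1 by rewrite mulfV.
  have : 2 * (k ^+ 2 / 4) != 0 by rewrite mulf_neq0 ?pnatr_eq0.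
  by move=> /mulfI; apply; rewrite h mulr1; field.
have J1x a : J1 *m xi a p = 0.
  apply/eqP; apply: contraT => z0; have := pH _ z0.
  have := J2x a; have : ((xi a p)^T *m g p *m xi a p) 0 0 = 1.
    by rewrite -mulmxA GX -trmx_mul EX eqxx trmx1 mxE eqxx.
  rewrite gE mulmxDr mulmxDl [LHS]mxE !trmx_mul !mulmxA => h1 h2.
  by rewrite h2 in h1; lra.
pose N := J2^T *m J2.
have Nx a : N *m xi a p = (eta a p)^T by rewrite -GX gE mulmxDl -(mulmxA _ J1) J1x mulmx0 add0r.
have NT : N^T = N by rewrite trmx_mul trmxK.
have xN a : (xi a p)^T *m N = eta a p by apply: trmx_inj; rewrite trmx_mul NT trmxK Nx.
pose h := 1%:M - \sum_a xi a p *m eta a p.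
have SS : (J2 *m h)^T *m 1%:M *m (J2 *m h) = N - \sum_a (eta a p)^T *m eta a p.
  have eh a : eta a p *m h = 0.
    rewrite mulmxBr mulmx1 mulmx_sumr (bigD1 a)//= mulmxA EX eqxx mul1mx big1 ?addr0 ?subrr// => b ba.
    by rewrite mulmxA EX eq_sym (negPf ba) raddf0 mul0mx.
  rewrite mulmx1 trmx_mul !mulmxA -[h^T *m _ *m J2]mulmxA -/N -mulmxA {1}/h trB trmx1 mulmxBl mul1mx.
  rewrite raddf_sum /= mulmx_suml big1 ?subr0 => [|a _]; last first.
    by rewrite trmx_mul mulmxA -[_ *m _ *m N]mulmxA xN -mulmxA eh mulmx0.
  by rewrite mulmxBr mulmx1 mulmx_sumr; congr (_ - _); apply: eq_bigr => a _; rewrite mulmxA Nx.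
have ge a : invmx (g p) *m (eta a p)^T = xi a p by rewrite -GX mulKmx.
have J2h : J2 *m h = 0.
  have p1 : posdef (1%:M : 'M[R]_4).
    move=> v v0; rewrite mulmx1 mxE (eq_bigr (fun i => v i 0 ^+ 2)) => [|i _]; last by rewrite mxE expr2.
    rewrite lt0r sumr_ge0 ?andbT => [|i _]; last exact: sqr_ge0.
    apply: contra v0; rewrite psumr_eq0 => [/allP H0|i _]; last exact: sqr_ge0.
    apply/eqP/colP => i; have := H0 i (mem_index_enum i).
    by rewrite /= sqrf_eq0 mxE => /eqP.
  have tS : \tr (invmx (g p) *m \sum_a (eta a p)^T *m eta a p) = 3.
    rewrite mulmx_sumr (linear_sum (@mxtrace _ _)) /= (eq_bigr (fun=> 1)) => [|a _].
      by rewrite sumr_const card_ord.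
    by rewrite mulmxA ge mxtrace_mulC EX eqxx mxtrace1.
  by apply: (pos_tr (J2 *m h) gT pg p1).2; rewrite SS mulmxBr raddfB /= trN tS subrr.
have NE : N = \sum_a (eta a p)^T *m eta a p.
  by apply/eqP; rewrite -subr_eq0 -SS J2h mulmx0.
rewrite ric trmx_mul mulmxA -[_ *m J2]mulmxA -/N NE mulmx_sumr mulmx_suml summxE.
rewrite (_ : 2 * _ = k ^+ 2 / 2); last by field.
congr (_ * _); apply: eq_bigr => a _; rewrite mulmxA -mulmxA -trmx_mul /app1 [LHS]mxE big_ord1 [X in X * _]mxE.
by rewrite mulrC.
Qed.

Lemma tq_iv_einstein : eta_Einstein eta g.
Proof.
exists (fun=> 0), (fun=> k ^+ 2 / 2); split; [exact: smooth_cst|exact: smooth_cst|].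
by move=> X Y sX sY p; rewrite mul0r add0r tq_iv_ricci.
Qed.

End tq4.

(** * Flows of commuting frames *)

Section commuting_flow.
Context {R : realType}.

Lemma is_derive_comp_sm {n p q : nat} (z : R -> 'cV[R]_n) (h : 'cV[R]_n -> 'M[R]_(p, q)) (s : R) w :
  is_derive s 1 z w -> sm h (z s) -> is_derive s 1 (fun r => h (z r)) (dd w h (z s)).
Proof.
move=> [dz <-] sh; have [d1 d2] := derive_comp_diff dz (sm_diff sh).
by split=> //; rewrite d2 unlock.
Qed.

Lemma is_derive_scale {p q : nat} (a : R -> R) (A : R -> 'M[R]_(p, q)) (s b : R) B :
  is_derive s 1 a b -> is_derive s 1 A B ->
  is_derive s 1 (fun r => a r *: A r) (b *: A s + a s *: B).
Proof.
move=> da /is_derive_entry dA; apply/is_derive_entry => i j.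
have -> : (fun t => (a t *: A t) i j) = (fun t => a t * A t i j) by apply/funext => t; rewrite mxE.
apply: is_derive_eq (is_deriveM da (dA i j)) _.
by rewrite !mxE /GRing.scale /= addrC [b * _]mulrC.
Qed.

Variables (m k : nat) (K : 'cV[R]_m -> 'M[R]_(m, k)) (P : 'M[R]_(k, m)) (x0 : 'cV[R]_m) (r0 : R).
Hypotheses (r00 : 0 < r0) (sK : forall x, `|x - x0| < r0 -> sm K x)
  (PK : forall x, `|x - x0| < r0 -> P *m K x = 1%:M)
  (comm : forall x u v, `|x - x0| < r0 -> dd (K x *m u) K x *m v = dd (K x *m v) K x *m u).

Let bil (B : 'cV[R]_m -> 'M[R]_m) (Y : 'cV[R]_(m + (m + m))) : 'M[R]_1 :=
  (usubmx (dsubmx Y))^T *m B (usubmx Y) *m dsubmx (dsubmx Y).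

Let bil_D B (Y w : 'cV[R]_(m + (m + m))) : sm B (usubmx Y) -> sm (bil B) Y /\
  dd w (bil B) Y = (usubmx (dsubmx w))^T *m B (usubmx Y) *m dsubmx (dsubmx Y)
    + (usubmx (dsubmx Y))^T *m dd (usubmx w) B (usubmx Y) *m dsubmx (dsubmx Y)
    + (usubmx (dsubmx Y))^T *m B (usubmx Y) *m dsubmx (dsubmx w).
Proof.
move=> sB; have s1 := sm_usubmx (@sm_id R _ _ Y); have s2 := sm_dsubmx (@sm_id R _ _ Y).
have s3 := sm_usubmx s2; have s4 := sm_dsubmx s2.
have sB1 := sm_comp s1 sB; have s5 := sm_mulmx (sm_trmx s3) sB1.
split; first exact: sm_mulmx.
rewrite (D_mulmx _ s5 s4) (D_mulmx _ (sm_trmx s3) sB1) D_trmx//.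
rewrite (D_usubmx _ s2) (D_dsubmx _ s2) (D_dsubmx _ (@sm_id R _ _ Y)) (D_comp _ s1 sB).
by rewrite (D_usubmx _ (@sm_id R _ _ Y)) !D_id mulmxDl.
Qed.

Lemma comm_flow : exists (delta : R) (Phi : 'cV[R]_(m + k) -> 'cV[R]_m),
  [/\ 0 < delta, forall y, sm Phi y &
  forall x t, `|x - x0| < delta -> `|t| < delta -> let y := Phi (col_mx x t) in
  [/\ `|y - x0| < r0, P *m y = P *m x + t, t = 0 -> y = x,
    (forall tau, dd (col_mx 0 tau) Phi (col_mx x t) = K y *m tau) &
    [/\ forall w, dd (col_mx (K x *m w) 0) Phi (col_mx x t) = K y *m w,
      forall p q (Q : 'cV[R]_m -> 'M[R]_(p, q)),
        (forall x, `|x - x0| < r0 -> sm Q x /\ dd (K x *m t) Q x = 0) -> Q y = Q x &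
      forall (B : 'cV[R]_m -> 'M[R]_m),
        (forall x, `|x - x0| < r0 -> sm B x /\ Lbil (fun z => K z *m t) B x = 0) ->
        forall v w, (dd (col_mx v 0) Phi (col_mx x t))^T *m B y *m dd (col_mx w 0) Phi (col_mx x t) =
          v^T *m B x *m w]]].
Proof.
have i1 : 0 <= (1 : R) <= 1 by rewrite lexx ler01.
have i0 : 0 <= (0 : R) <= 1 by rewrite lexx ler01.
have [delta [Phi [d0 sP HP]]] := param_flow r00 sK.
exists delta, Phi; split=> // x t xd td y.
have [z [z0 z1 dz Hy]] := HP x t xd td.
have zr s (s01 : 0 <= s <= 1) := (dz s s01).1; have dz' s (s01 : 0 <= s <= 1) := (dz s s01).2.
have invQ p q (Q : 'cV[R]_m -> 'M[R]_(p, q)) :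
    (forall x, `|x - x0| < r0 -> sm Q x /\ dd (K x *m t) Q x = 0) -> Q y = Q x.
  move=> HQ; rewrite /y -z1 -[in RHS]z0; apply: (@curve_const _ _ _ (fun s => Q (z s))) i1 => s s01.
  have [sQ Q0] := HQ _ (zr s s01).
  by have := is_derive_comp_sm (dz' s s01) sQ; rewrite Q0.
have yr : `|y - x0| < r0 by rewrite /y -z1; exact: zr.
have sKv (v : 'cV[R]_k) (s : R) : 0 <= s <= 1 -> sm (fun x => K x *m v) (z s).
  by move=> s01; apply: sm_mulmxr; apply: sK; exact: zr.
have cK (s : R) (v w : 'cV[R]_k) : 0 <= s <= 1 -> dd (K (z s) *m v) K (z s) *m w = dd (K (z s) *m w) K (z s) *m v.
  by move=> s01; apply: comm; exact: zr.
have dK (s : R) (v : 'cV[R]_k) : 0 <= s <= 1 -> is_derive s 1 (fun s => K (z s) *m v) (dd (K (z s) *m v) K (z s) *m t).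
  move=> s01; have := is_derive_comp_sm (dz' s s01) (sKv v s s01).
  by rewrite D_mulmxr; [rewrite cK|apply: sK; exact: zr].
split=> //.
- rewrite /y -z1 -z0; apply/eqP; rewrite -subr_eq0; apply/eqP.
  suff H : forall s : R, 0 <= s <= 1 -> is_derive s 1 (fun s => P *m z s - s *: t) 0.
    have := @curve_const _ _ _ (fun s => P *m z s - s *: t) H 1 i1.
    rewrite scale1r scale0r subr0 => /eqP; rewrite subr_eq => /eqP ->.
    by rewrite subrr.
  move=> s s01.
  have := is_derive_comp_sm (dz' s s01) (sm_mulmxl P (sm_id (z s))).
  rewrite D_mulmxl; last exact: sm_id.
  rewrite D_id mulmxA PK ?mul1mx; last exact: zr.
  move=> H1; have := is_deriveB H1 (is_derive_scale (is_derive_id s (1 : R)) (is_derive_cst t s 1)).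
  by rewrite scale1r scaler0 addr0 subrr.
- move=> t0; rewrite /y -z1 -[in RHS]z0; apply: (@curve_const _ _ _ z) i1 => s s01.
  by have := dz' s s01; rewrite t0 mulmx0.
- move=> tau; suff H : forall s : R, 0 <= s <= 1 -> is_derive s 1 (fun s => s *: (K (z s) *m tau))
      (dd (s *: (K (z s) *m tau)) K (z s) *m t + K (z s) *m tau).
    by have /(_ (scale0r _) H) := (Hy 0 tau).2 (fun s => s *: (K (z s) *m tau)); rewrite scale1r z1.
  move=> s s01; apply: is_derive_eq (is_derive_scale (is_derive_id s (1 : R)) (dK s tau s01)) _.
  rewrite scale1r D_dirZ; last by apply: sK; exact: zr.
  by rewrite addrC -scalemxAl.
split=> [w|p q Q|B HB v w].
- suff H : forall s : R, 0 <= s <= 1 -> is_derive s 1 (fun s => K (z s) *m w)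
      (dd (K (z s) *m w) K (z s) *m t + K (z s) *m 0).
    by have := (Hy (K x *m w) 0).2 (fun s => K (z s) *m w); rewrite z0 z1; apply.
  by move=> s s01; rewrite mulmx0 addr0; exact: dK.
- exact: invQ.
have [[y1 [y10 dy1]] Hy1] := Hy v 0; have [[y2 [y20 dy2]] Hy2] := Hy w 0.
rewrite (Hy1 _ y10 dy1) (Hy2 _ y20 dy2) /y -z1 -z0 -y10 -y20.
have E s : (y1 s)^T *m B (z s) *m y2 s = bil B (col_mx (z s) (col_mx (y1 s) (y2 s))).
  by rewrite /bil !(col_mxKu, col_mxKd).
rewrite !E; apply: (@curve_const _ _ _ (fun s => bil B (col_mx (z s) (col_mx (y1 s) (y2 s))))) i1 => s s01.
have [sB LB] := HB _ (zr s s01).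
have dY := is_derive_col_mx (dz' s s01) (is_derive_col_mx (dy1 s s01) (dy2 s s01)).
have sB' : sm B (usubmx (col_mx (z s) (col_mx (y1 s) (y2 s)))) by rewrite col_mxKu.
have [sb db] := bil_D (col_mx (K (z s) *m t) (col_mx (dd (y1 s) K (z s) *m t + K (z s) *m 0) (dd (y2 s) K (z s) *m t + K (z s) *m 0))) sB'.
apply: is_derive_eq (is_derive_comp_sm dY sb) _; rewrite db !(col_mxKu, col_mxKd) mulmx0 !addr0.
have J u : dd u K (z s) *m t = jac (fun z => K z *m t) (z s) *m u.
  by rewrite -D_jac ?D_mulmxr//; [exact: sK (zr s s01)|exact: sKv].
rewrite !J trmx_mul -!mulmxA -!mulmxDr !mulmxA -!mulmxDl.
by have := LB; rewrite /Lbil [X in X + _ = _]addrC => ->; rewrite mul0mx mulmx0.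
Qed.

End commuting_flow.

Lemma frame_comm {R : realType} {m k q : nat} (K : 'cV[R]_m -> 'M[R]_(m, k)) (P : 'M[R]_(k, m))
    (Q : 'cV[R]_m -> 'M[R]_(q, m)) x :
  sm K x -> sm Q x -> (\forall y \near x, P *m K y = 1%:M) -> (\forall y \near x, Q y *m K y = 0) ->
  (forall w : 'cV[R]_m, P *m w = 0 -> Q x *m w = 0 -> w = 0) ->
  (forall u v, dd (K x *m u) Q x *m (K x *m v) = dd (K x *m v) Q x *m (K x *m u)) ->
  forall u v : 'cV[R]_k, dd (K x *m u) K x *m v = dd (K x *m v) K x *m u.
Proof.
move=> sK sQ PK QK inj H u v; apply/eqP; rewrite -subr_eq0; apply/eqP.
have P0 w : P *m dd w K x = 0.
  have -> : P *m dd w K x = dd w (fun y => P *m K y) x by rewrite D_mulmxl.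
  by rewrite (D_eq w PK) Dcst.
have Q0 w : Q x *m dd w K x = - (dd w Q x *m K x).
  have := D_eq w QK; rewrite Dcst (D_mulmx _ sQ sK) => /eqP.
  by rewrite addrC addr_eq0 => /eqP.
apply: inj; first by rewrite mulmxBr !mulmxA !P0 !mul0mx subrr.
by rewrite mulmxBr !mulmxA !Q0 !mulNmx -!mulmxA H subrr.
Qed.

Lemma idempotent_factor {F : fieldType} {m n : nat} (A : 'M[F]_m) : A *m A = A -> \rank A = n ->
  exists (T : 'M[F]_(m, n)) (P : 'M[F]_(n, m)), [/\ T *m P = A, P *m T = 1%:M,
    forall q (B : 'M[F]_(m, q)), A *m B = 0 -> P *m B = 0 &
    forall q (C : 'M[F]_(q, m)), C *m A = 0 -> C *m T = 0].
Proof.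
move=> AA <-; exists (col_base A), (row_base A).
move: (col_base A) (row_base A) (mulmx_base A) (col_base_full A) (row_base_free A).
move: (\rank A) => r T P e /row_fullP[T' T'T] /row_freeP[P' PP'].
split=> // [|q B|q C].
- have : T' *m (A *m A) *m P' = T' *m A *m P' by rewrite AA.
  by rewrite -e !mulmxA T'T !mul1mx -[_ *m P *m P']mulmxA PP' mulmx1.
- by rewrite -e -mulmxA => /(congr1 (mulmx T')); rewrite mulmx0 (mulmxA T') T'T mul1mx.
by rewrite -e mulmxA => /(congr1 (mulmxr P')) /=; rewrite mul0mx -mulmxA PP' mulmx1.
Qed.

Section frames.
Context {R : realType} {n : nat}.
Local Notation m := (n + 3)%N.
Variables (D : set 'cV[R]_m) (k : R) (G : 'cV[R]_m -> 'M[R]_m) (P : 'I_3 -> 'cV[R]_m -> 'M[R]_m)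
    (E : 'I_3 -> 'cV[R]_m -> 'rV[R]_m) (X : 'I_3 -> 'cV[R]_m -> 'cV[R]_m).
Hypothesis L : loc3 D k G P E X.

Definition Em y : 'M[R]_(3, m) := \matrix_(a, j) E a y 0 j.
Definition Xm y : 'M[R]_(m, 3) := \matrix_(i, a) X a y i 0.

Lemma Em_mul y (w : 'cV[R]_m) a : (Em y *m w) a 0 = (E a y *m w) 0 0.
Proof. by rewrite !mxE; apply: eq_bigr => j _; rewrite !mxE. Qed.

Lemma Em_eq0 y (w : 'cV[R]_m) : Em y *m w = 0 <-> forall a, E a y *m w = 0.
Proof.
split=> [h a|h]; last by apply/colP => a; rewrite Em_mul h !mxE.
by apply: mx11_inj; rewrite -Em_mul h !mxE.
Qed.

Lemma Xm_mul y (c : 'cV[R]_3) : Xm y *m c = \sum_a c a 0 *: X a y.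
Proof. by apply/colP => i; rewrite summxE mxE; apply: eq_bigr => a _; rewrite !mxE mulrC. Qed.

Lemma Xm_Em y : Xm y *m Em y = \sum_a X a y *m E a y.
Proof. by apply/matrixP => i j; rewrite summxE mxE; apply: eq_bigr => a _; rewrite !mxE big_ord1. Qed.

Lemma horE y : hor E X y = 1%:M - Xm y *m Em y. Proof. by rewrite Xm_Em. Qed.

Section at_point.
Variable y : 'cV[R]_m.
Hypothesis Dy : D y.

Lemma Em_Xm : Em y *m Xm y = 1%:M.
Proof.
apply/matrixP => a b; have := l_EXE L Dy a b => /matrixP/(_ 0 0).
by rewrite !mxE eqxx mulr1n => <-; apply: eq_bigr => j _; rewrite !mxE.
Qed.

Lemma hor_Xm : hor E X y *m Xm y = 0.
Proof. by rewrite horE mulmxBl mul1mx -mulmxA Em_Xm mulmx1 subrr. Qed.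

Lemma Em_hor : Em y *m hor E X y = 0.
Proof. by rewrite horE mulmxBr mulmx1 mulmxA Em_Xm mul1mx subrr. Qed.

Lemma hor_fix q (A : 'M[R]_(m, q)) : Em y *m A = 0 -> hor E X y *m A = A.
Proof. by move=> h; rewrite horE mulmxBl mul1mx -mulmxA h mulmx0 subr0. Qed.

Lemma hor_basis : exists (T : 'M[R]_(m, n)) (PT : 'M[R]_(n, m)),
  [/\ T *m PT = hor E X y, PT *m T = 1%:M, Em y *m T = 0, PT *m Xm y = 0 &
      row_mx T (Xm y) *m col_mx PT (Em y) = 1%:M].
Proof.
have hh : hor E X y *m hor E X y = hor E X y by apply: hor_fix; exact: Em_hor.
have r1 : (m <= \rank (hor E X y) + 3)%N.
  rewrite -[X in (X <= _)%N](mxrank1 R) (_ : 1%:M = hor E X y + Xm y *m Em y); last by rewrite horE subrK.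
  apply: leq_trans (mxrank_add _ _) _; rewrite leq_add2l.
  by apply: leq_trans (mxrankM_maxl _ _) _; exact: rank_leq_col.
have r2 : (\rank (hor E X y) + 3 <= m)%N.
  have r3 : \rank (Xm y) = 3%N.
    apply/eqP; rewrite eqn_leq rank_leq_col /= -[X in (X <= _)%N](mxrank1 R) -Em_Xm.
    exact: mxrankM_maxr.
  by have := mulmx0_rank_max hor_Xm; rewrite r3.
have rk : \rank (hor E X y) = n by apply/eqP; rewrite -(eqn_add2r 3) eqn_leq r2 r1.
have [T [PT [e PT1 hP hT]]] := idempotent_factor hh rk.
exists T, PT; split=> //; [exact: hT Em_hor|exact: hP hor_Xm|].
by rewrite mul_row_col e horE subrK.
Qed.

Lemma sm_Em : sm Em y.
Proof.
apply/sm_mxP => a j; have /sm_mxP/(_ 0 j) := l_smE L a Dy.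
by apply: sm_ext => z; rewrite mxE.
Qed.

Lemma sm_Xm : sm Xm y.
Proof.
apply/sm_mxP => i a; have /sm_mxP/(_ i 0) := l_smX L a Dy.
by apply: sm_ext => z; rewrite mxE.
Qed.

Lemma sm_hor : sm (hor E X) y.
Proof.
apply: (sm_ext (fun z => esym (horE z))); apply: smB; first exact: sm_cst.
by apply: sm_mulmx; [exact: sm_Xm|exact: sm_Em].
Qed.

End at_point.

Lemma near_unitmx q (A : 'cV[R]_m -> 'M[R]_q) y : sm A y -> A y \in unitmx ->
  \forall z \near y, A z \in unitmx.
Proof.
move=> sA uA; have sd := sm_det sA; have u0 : \det (A y) != 0 by rewrite -unitfE -unitmxE.
have [r r0 Hr] := cont_neq0 (sm_cont sd) u0.
by apply/nbhs_normP; exists r => // z /Hr; rewrite unitmxE unitfE.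
Qed.

Lemma hor_frame y0 : D y0 -> (forall y, D y -> lii E y) ->
  exists (r : R) (K : 'cV[R]_m -> 'M[R]_(m, n)) (PT : 'M[R]_(n, m)), 0 < r /\
  forall y, `|y - y0| < r -> [/\ D y, sm K y, PT *m K y = 1%:M,
    forall u v : 'cV[R]_n, dd (K y *m u) K y *m v = dd (K y *m v) K y *m u &
    forall w : 'cV[R]_m, (forall a, E a y *m w = 0) <-> exists u, w = K y *m u].
Proof.
move=> Dy0 ii; have [T [PT [_ _ _ _ TP]]] := hor_basis Dy0.
pose B y : 'M[R]_m := col_mx PT (Em y).
have sB y : D y -> sm B y by move=> Dy; apply: sm_col_mx (sm_cst _ _) (sm_Em Dy).
have uB : B y0 \in unitmx by have [] := mulmx1_unit TP.
have [r r0 Hr] : exists2 r, 0 < r & forall y, `|y - y0| < r -> D y /\ B y \in unitmx.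
  apply/nbhs_normP; apply: filterS2 (near_unitmx (sB _ Dy0) uB) (l_near L Dy0 (fun z Dz => Dz)).
  by move=> z; split.
pose K y := invmx (B y) *m (col_mx 1%:M 0 : 'M[R]_(m, n)).
have BK y : `|y - y0| < r -> PT *m K y = 1%:M /\ Em y *m K y = 0.
  move=> /Hr[_ u]; have : B y *m K y = col_mx 1%:M 0 by rewrite mulKVmx.
  by rewrite /B mul_col_mx => /eq_col_mx.
have nr y : `|y - y0| < r -> \forall z \near y, `|z - y0| < r.
  by move=> yr; apply: open_nbhs_nbhs; split=> //; exact: open_normball.
have inj y (w : 'cV[R]_m) : `|y - y0| < r -> PT *m w = 0 -> Em y *m w = 0 -> w = 0.
  move=> /Hr[_ u] h1 h2; apply: (can_inj (mulKmx u)).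
  by rewrite mulmx0 /B mul_col_mx h1 h2 col_mx0.
have sK y : `|y - y0| < r -> sm K y.
  by move=> /Hr[Dy u]; apply: sm_mulmxr; apply: sm_invmx => //; exact: sB.
exists r, K, PT; split=> // y yr; have [Dy uy] := Hr y yr; have [PK EK] := BK y yr.
split=> //; first exact: sK.
  have EKu (u : 'cV[R]_n) a : E a y *m (K y *m u) = 0 by apply: (Em_eq0 _ _).1; rewrite mulmxA EK mul0mx.
  apply: (frame_comm (P := PT) (sK y yr) (sm_Em Dy)).
  - by apply: filterS (nr y yr) => z /BK[].
  - by apply: filterS (nr y yr) => z /BK[].
  - by move=> w; exact: inj.
  - move=> u v; apply/colP => a; apply/eqP; rewrite -subr_eq0; apply/eqP.
    have dE (w w' : 'cV[R]_m) : (dd w Em y *m w') a 0 = (dd w (E a) y *m w') 0 0.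
      rewrite -!D_mulmxr ?D_entry; [|exact: sm_mulmxr (l_smE L a Dy)|exact: sm_mulmxr (sm_Em Dy)|exact: (l_smE L a Dy)|exact: (sm_Em Dy)].
      by apply: D_ext => z; exact: Em_mul.
    rewrite !dE; have /matrixP/(_ 0 0) := ii y Dy a (K y *m u) (K y *m v) (EKu u) (EKu v).
    by rewrite /ext1 [LHS]mxE [X in _ + X]mxE [RHS]mxE.
move=> w; split=> [/(Em_eq0 _ _).2 Ew|[u ->]]; last by apply: (Em_eq0 _ _).1; rewrite mulmxA EK mul0mx.
exists (PT *m w); apply/eqP; rewrite -subr_eq0; apply/eqP; apply: (inj y) => //.
  by rewrite mulmxBr (mulmxA PT) PK mul1mx subrr.
by rewrite mulmxBr Ew (mulmxA (Em y)) EK mul0mx subrr.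
Qed.

End frames.

Section ball.
Context {R : realType} {k : nat} (r : R) (r0 : 0 < r).

Lemma ball_chart_at (q : ball_manifold k r0) : chart_at q = ball_chart k r0.
Proof. by have [] := chart_atP q. Qed.

Lemma ball_Jt (q : ball_manifold k r0) : Jt (ball_chart k r0 : chart R (ball_manifold k r0) k) q = 1%:M.
Proof. by rewrite -(ball_chart_at q) Jt_self. Qed.

End ball.

Section ii_iii.
Context {R : realType} {n : nat} {M : manifold R (n + 3)}.
Variables (phi : 'I_3 -> endofield M) (xi : 'I_3 -> vfield M) (eta : 'I_3 -> oneform M) (g : metric M) (k : R).
Hypotheses (tq : three_quasi_Sasakian phi xi eta g)
  (hk : forall a b d : 'I_3, even_triple a b d -> forall p : M, bracket (xi a) (xi b) p = k *: xi d p).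

Lemma tq_ii_iii : tq_ii eta -> integrable_distribution n (horizontal_space eta).
Proof.
move=> /(tq_iiP tq hk) ii p; have [ac cp] := chart_atP p; set c := chart_at p in ac cp.
have L := tq_loc3 tq hk ac.
have iiD y : (c @` chart_dom c) y -> lii (fun a => le c (eta a)) y by move=> [q cq <-]; exact: ii.
have [r [K [PT [r0 HK]]]] := hor_frame L (in_img cp) iiD.
have sK y : `|y - c p| < r -> sm K y by move=> /HK[].
have PK y : `|y - c p| < r -> PT *m K y = 1%:M by move=> /HK[].
have [d [Phi [d0 sP HP]]] := comm_flow r0 sK PK (fun y u v yr => (let: And5 _ _ _ h _ := HK y yr in h) u v).
pose N := ball_manifold n d0; pose b : chart R N n := ball_chart n d0.
pose f (t : 'cV[R]_n) := Phi (col_mx (c p) t).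
pose iota (q : N) : M := chart_inv c (f (b q)).
have cpp : `|c p - c p| < d by rewrite subrr normr0.
have bd (q : N) : `|b q| < d by exact: to_ball_lt.
have Hf (t : 'cV[R]_n) : `|t| < d -> [/\ `|f t - c p| < r, PT *m f t = PT *m c p + t, t = 0 -> f t = c p &
    forall tau, dd tau f t = K (f t) *m tau].
  move=> td; have [h1 h2 h3 h4 _] := HP (c p) t cpp td; split=> // tau.
  have s1 : sm (fun t : 'cV[R]_n => col_mx (c p) t) t by apply: sm_col_mx (sm_cst _ _) (sm_id _).
  rewrite /f (D_comp _ s1 (sP _)) D_col_mx; [|exact: sm_cst|exact: sm_id].
  by rewrite Dcst D_id h4.
have sf (t : 'cV[R]_n) : sm f t.
  by apply: sm_comp => //; apply: sm_col_mx (sm_cst _ _) (sm_id _).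
have fD (t : 'cV[R]_n) : `|t| < d -> (c @` chart_dom c) (f t) by move=> /Hf[/HK[]].
have ci (q : N) : chart_dom c (iota q) /\ c (iota q) = f (b q).
  by have [q' cq' e] := fD _ (bd q); rewrite /iota -e chart_funK.
have nd (t : 'cV[R]_n) : `|t| < d -> \forall y \near t, `|y| < d.
  move=> td; apply/nbhs_normP; exists (d - `|t|); rewrite ?subr_gt0// => y yt.
  by have := ler_distD t y 0; rewrite !subr0 => h; apply: (le_lt_trans h); rewrite -ltrBrDr.
have ciota (q : N) : {for q, continuous iota}.
  have c1 : {for q, continuous (fun q : N => b q)} by exact: to_ball_continuous.
  have c2 : {for q, continuous (fun q : N => f (b q))}.
    by apply: (continuous_comp c1); exact: sm_cont (sf _).
  by apply: (continuous_comp c2); apply: chart_inv_continuous; apply: fD; exact: bd.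
have siota : smooth_map setT iota.
  split=> [q _|e ae]; first exact: ciota.
  have oV : open ([set: N] `&` iota @^-1` chart_dom e).
    rewrite setTI; apply: open_comp; last exact: chart_dom_open.
    by move=> q _; exact: ciota.
  apply/(smooth_funP _ oV) => b' q -> _ [_ /= eq].
  have [cq ec] := ci q.
  have st := trans_sm ac ae cq eq; rewrite ec in st.
  apply: sm_eq (sm_comp (sf (b q)) st).
  by apply: filterS (nd _ (bd q)) => y yd; rewrite /iota /= of_ballK.
have tang (q : N) v : Jt c (iota q) *m tangent_map iota q v = K (f (b q)) *m v.
  have [cq ec] := ci q.
  rewrite (tangent_map_chart openT siota (c := b) v)//.
  have -> : Jt b q *m v = v by rewrite /b ball_Jt mul1mx.
  have [_ _ _ <-] := Hf _ (bd q); apply: D_eq.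
  apply: filterS (nd _ (bd q)) => y yd; rewrite /iota /= of_ballK//.
  by have [q' cq' e] := fD _ yd; rewrite -e chart_funK.
have uJ q : Jt c (iota q) \in unitmx by apply: Jt_unit => //; case: (ci q).
exists N, iota; split=> //.
- move=> q q' e; have := congr1 c e; rewrite !(ci _).2 => /(congr1 (mulmx PT)).
  have [_ -> _ _] := Hf _ (bd q); have [_ -> _ _] := Hf _ (bd q').
  by move=> /addrI /(congr1 (chart_inv b)); rewrite /= !to_ballK.
- move=> q v v' e; have := congr1 (mulmx (Jt c (iota q))) e; rewrite !tang => /(congr1 (mulmx PT)).
  by rewrite !mulmxA PK ?mul1mx//; case: (Hf _ (bd q)).
- have b0 : b (0 : 'cV[R]_n) = 0 by rewrite /b /= /to_ball scaler0.
  exists (0 : 'cV[R]_n); rewrite /iota b0.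
  have [|_ _ -> // _] := Hf 0; first by rewrite normr0.
  by rewrite chart_funK.
move=> q; have [cq ec] := ci q; have [fr _ _ _] := Hf _ (bd q); have [_ _ _ _ hw] := HK _ fr.
apply/seteqP; split=> [w Hw|_ [v _ <-]] /=.
  have [a|u eu] := (hw (Jt c (iota q) *m w)).1.
    by rewrite -ec le_at// mulmxA mulmxKV//; exact: Hw.
  by exists u => //; apply: (can_inj (mulKmx (uJ q))); rewrite tang eu.
move=> a; have := (hw (K (f (b q)) *m v)).2 (ex_intro _ v erefl) a.
by rewrite -tang -ec le_at// mulmxA mulmxKV.
Qed.

End ii_iii.

(** * The transverse hyper-Kähler structure *)

Section dmx_closed.
Context {R : realType} {m : nat}.

Lemma near_all (Q : 'cV[R]_m -> Prop) (y : 'cV[R]_m) : (forall z, Q z) -> \forall z \near y, Q z.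
Proof. by move=> H; apply: filterS filterT => z _. Qed.

Lemma sm_dmx (e : 'cV[R]_m -> 'rV[R]_m) y : sm e y -> sm (dmx e) y.
Proof. by move=> se; have sJ := sm_jac (sm_trmx se); apply: smB => //; exact: sm_trmx. Qed.

Lemma dmx_ext2 (e : 'cV[R]_m -> 'rV[R]_m) y u v w : sm e y -> ext2 (dmx e) y u v w = 0.
Proof.
move=> se; have sd := sm_dmx se.
have K (a b c : 'cV[R]_m) : b^T *m dd a (dmx e) y *m c = dd a (dd b e) y *m c - dd a (dd c e) y *m b.
  have -> : b^T *m dd a (dmx e) y *m c = dd a (fun z => b^T *m dmx e z *m c) y.
    by rewrite D_mulmxr ?D_mulmxl//; exact: sm_mulmxl.
  have H : \forall z \near y, b^T *m dmx e z *m c = (fun z => dd b e z *m c - dd c e z *m b) z.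
    by apply: filterS (sm_near se) => z sz; rewrite dmxE.
  rewrite (D_eq a H) DB; [|exact: sm_mulmxr (sm_D _ se)|exact: sm_mulmxr (sm_D _ se)].
  by rewrite !D_mulmxr; [|exact: sm_D|exact: sm_D].
rewrite /ext2 !K (D_swap v u se) (D_swap w u se) (D_swap w v se).
by apply/matrixP => i j; rewrite !mxE; ring.
Qed.

Lemma sm_Lrow (Z : 'cV[R]_m -> 'cV[R]_m) (e : 'cV[R]_m -> 'rV[R]_m) y : sm Z y -> sm e y -> sm (Lrow Z e) y.
Proof.
move=> sZ se; have sJ := sm_jac (sm_trmx se).
apply: smD; last by apply: sm_mulmx => //; exact: sm_jac.
apply: (sm_eq (f := fun z => (jac (fun z => (e z)^T) z *m Z z)^T)).
  by apply: filterS (sm_near se) => z sz; rewrite -D_jac ?D_trmx ?trmxK//; exact: sm_trmx.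
by apply: sm_trmx; exact: sm_mulmx.
Qed.

Lemma Lbil_dmx (Z : 'cV[R]_m -> 'cV[R]_m) (e : 'cV[R]_m -> 'rV[R]_m) (b : 'M[R]_1) y : sm Z y -> sm e y ->
  (\forall z \near y, e z *m Z z = b) -> Lbil Z (dmx e) y = dmx (Lrow Z e) y.
Proof.
move=> sZ se eZ; rewrite cartan2//; first last.
- by move=> u v w; exact: dmx_ext2.
- by apply: near_all => z; exact: dmx_skew.
- exact: sm_dmx.
apply: dmx_eq; have [r r0 Hr] := (nbhs_normP _ _).1 eZ.
have nb : \forall z \near y, \forall z' \near z, e z' *m Z z' = b.
  apply: (filterS (P := [set z | `|z - y| < r])) => [z zr|].
    by apply: (filterS (P := [set z | `|z - y| < r])) => [z' /Hr//|]; apply: open_nbhs_nbhs; split=> //; exact: open_normball.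
  by apply: open_nbhs_nbhs; split; [exact: open_normball|rewrite /= subrr normr0].
apply: filterS3 nb (sm_near sZ) (sm_near se) => z nz sZz sez; apply: mulmx_ext => u.
by rewrite dmxE// Lrow_ext// (D_eq u nz) Dcst addr0.
Qed.

Lemma LbilB (Z : 'cV[R]_m -> 'cV[R]_m) (A B : 'cV[R]_m -> 'M[R]_m) y : sm A y -> sm B y ->
  Lbil Z (fun z => A z - B z) y = Lbil Z A y - Lbil Z B y.
Proof.
move=> sA sB; rewrite /Lbil DB// mulmxBl mulmxBr.
by apply/matrixP => i j; rewrite !mxE; ring.
Qed.

Lemma LbilD (Z : 'cV[R]_m -> 'cV[R]_m) (A B : 'cV[R]_m -> 'M[R]_m) y : sm A y -> sm B y ->
  Lbil Z (fun z => A z + B z) y = Lbil Z A y + Lbil Z B y.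
Proof.
move=> sA sB; rewrite /Lbil DD// mulmxDl mulmxDr.
by apply/matrixP => i j; rewrite !mxE; ring.
Qed.

Lemma LbilZ (Z : 'cV[R]_m -> 'cV[R]_m) c (A : 'cV[R]_m -> 'M[R]_m) y : sm A y ->
  Lbil Z (fun z => c *: A z) y = c *: Lbil Z A y.
Proof. by move=> sA; rewrite /Lbil DZ// -scalemxAl -scalemxAr !scalerDr. Qed.

Lemma Lbil_eq (Z : 'cV[R]_m -> 'cV[R]_m) (A B : 'cV[R]_m -> 'M[R]_m) y :
  (\forall z \near y, A z = B z) -> Lbil Z A y = Lbil Z B y.
Proof. by move=> H; rewrite /Lbil (D_eq _ H) (nbhs_singleton H). Qed.

Lemma dmxZ c (e : 'cV[R]_m -> 'rV[R]_m) y : sm e y -> dmx (fun z => c *: e z) y = c *: dmx e y.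
Proof.
move=> se; apply: form_ext => u v; rewrite -scalemxAr -scalemxAl !dmxE//; last exact: smZ.
by rewrite /ext1 !DZ// -!scalemxAl scalerBr.
Qed.

End dmx_closed.

Section basic.
Context {R : realType} {n : nat}.
Local Notation m := (n + 3)%N.
Variables (D : set 'cV[R]_m) (k : R) (G : 'cV[R]_m -> 'M[R]_m) (P : 'I_3 -> 'cV[R]_m -> 'M[R]_m)
    (E : 'I_3 -> 'cV[R]_m -> 'rV[R]_m) (X : 'I_3 -> 'cV[R]_m -> 'cV[R]_m).
Hypothesis L : loc3 D k G P E X.

Definition gH z := G z - \sum_a (E a z)^T *m E a z.
Definition om a z := G z *m P a z - k^-1 *: dmx (E a) z.

Section at_point.
Variable y : 'cV[R]_m.
Hypothesis Dy : D y.

Let sE a : sm (E a) y. Proof. exact: (l_smE L a Dy). Qed.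
Let sX a : sm (X a) y. Proof. exact: (l_smX L a Dy). Qed.
Let sG : sm G y. Proof. exact: (l_smG L Dy). Qed.
Let sP a : sm (P a) y. Proof. exact: (l_smP L a Dy). Qed.

Lemma l_EPp a : E (a + 1) y *m P a y = - E (a + 2) y.
Proof. by have [_ ->] := l_eta L a Dy; rewrite opprK. Qed.
Lemma l_EPm a : E (a + 2) y *m P a y = E (a + 1) y.
Proof. by have := l_eta L (a + 2) Dy; rewrite I3_22 I3_21 => -[-> _]. Qed.
Lemma l_PXp a : P a y *m X (a + 1) y = X (a + 2) y.
Proof. by have [-> _] := l_xi L a Dy. Qed.
Lemma l_PXm a : P a y *m X (a + 2) y = - X (a + 1) y.
Proof. by have := l_xi L (a + 2) Dy; rewrite I3_22 I3_21 => -[_ ->]; rewrite opprK. Qed.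

Let sEE a : sm (fun z => (E a z)^T *m E a z) y.
Proof. by apply: sm_mulmx => //; exact: sm_trmx. Qed.

Lemma gHE a : gH y = G y - ((E a y)^T *m E a y + (E (a + 1) y)^T *m E (a + 1) y + (E (a + 2) y)^T *m E (a + 2) y).
Proof. by rewrite /gH (I3_sum _ a). Qed.

Lemma sm_gH : sm gH y.
Proof.
apply: (sm_ext (f := fun z => G z - ((E 0 z)^T *m E 0 z + (E (0 + 1) z)^T *m E (0 + 1) z + (E (0 + 2) z)^T *m E (0 + 2) z))).
  by move=> z; rewrite /gH (I3_sum _ 0).
by apply: smB => //; apply: smD => //; exact: smD.
Qed.

Lemma sm_om a : sm (om a) y.
Proof. by apply: smB; [exact: sm_mulmx|apply: smZ; exact: sm_dmx]. Qed.

Lemma gH_sym : (gH y)^T = gH y.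
Proof.
rewrite /gH trB (l_sym L Dy) raddf_sum /=; congr (_ - _); apply: eq_bigr => a _.
by rewrite trmx_mul trmxK.
Qed.

Lemma gH_Xm : gH y *m Xm X y = 0.
Proof.
apply/matrixP => i b; have : gH y *m X b y = 0.
  rewrite /gH mulmxBl (l_GX L Dy) mulmx_suml (bigD1 b)//= -mulmxA (l_EXE L Dy) eqxx mulmx1 big1 ?addr0 ?subrr// => a ab.
  by rewrite -mulmxA (l_EXE L Dy) (negPf ab) raddf0 mulmx0.
by move=> /colP/(_ i); rewrite !mxE => h; rewrite -[RHS]h; apply: eq_bigr => j _; rewrite !mxE.
Qed.

Lemma Xm_gH : (Xm X y)^T *m gH y = 0.
Proof. by apply: trmx_inj; rewrite trmx_mul gH_sym trmxK gH_Xm trmx0. Qed.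

Lemma gH_split : G y = gH y + \sum_a (E a y)^T *m E a y.
Proof. by rewrite subrK. Qed.

Lemma P_gH_P a : (P a y)^T *m gH y *m P a y = gH y.
Proof.
rewrite !(gHE a) mulmxBr mulmxBl (l_met L a Dy) !mulmxDr !mulmxDl.
have h b : (P a y)^T *m ((E b y)^T *m E b y) *m P a y = (E b y *m P a y)^T *m (E b y *m P a y).
  by rewrite trmx_mul !mulmxA.
rewrite !h (l_EP L) // l_EPp l_EPm trmx0 mul0mx add0r trN mulNmx mulmxN opprK.
by apply/matrixP => i j; rewrite !mxE; ring.
Qed.

Lemma P_Xm a : exists c : 'M[R]_3, P a y *m Xm X y = Xm X y *m c.
Proof.
suff [f Hf] : exists f : 'I_3 -> 'cV[R]_3, forall b, P a y *m X b y = Xm X y *m f b.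
  exists (\matrix_(i, j) f j i 0); apply/matrixP => i j.
  have /colP/(_ i) := Hf j; rewrite !mxE => h.
  rewrite (eq_bigr (fun j0 => P a y i j0 * X j y j0 0)) => [|l _]; last by rewrite mxE.
  by rewrite h; apply: eq_bigr => l _; rewrite !mxE.
have d (b : 'I_3) : Xm X y *m delta_mx b 0 = X b y.
  by apply/colP => i; rewrite -colE mxE mxE.
have H b : exists c : 'cV[R]_3, P a y *m X b y = Xm X y *m c.
  have [->|->|->] := I3_cases a b.
  - by exists 0; rewrite (l_PX L)// mulmx0.
  - by exists (delta_mx (a + 2) 0); rewrite l_PXp d.
  - by exists (- delta_mx (a + 1) 0); rewrite l_PXm mulmxN d.
by exists (fun b => sval (cid (H b))) => b; exact: (svalP (cid (H b))).
Qed.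

Lemma omE a : k != 0 -> lii E y -> om a y = gH y *m P a y.
Proof.
move=> k0 ii; rewrite /om (gHE a) mulmxBl !mulmxDl -!mulmxA (l_EP L)// l_EPp l_EPm mulmx0 add0r mulmxN.
congr (_ - _); rewrite addrC; apply/eqP; rewrite -(inj_eq (scalerI k0)) scalerA mulfV// scale1r; apply/eqP.
apply: form_ext => u v; rewrite dmxE//; apply: mx11_inj; rewrite (l_ii_ext L Dy ii).
rewrite -scalemxAr -scalemxAl [RHS]mxE mulmxBr mulmxBl [X in _ = k * X]mxE [X in _ = k * (_ + X)]mxE.
have h b b' : (u^T *m ((E b y)^T *m E b' y) *m v) 0 0 = (E b y *m u) 0 0 * (E b' y *m v) 0 0.
  by rewrite mulmxA -trmx_mul -mulmxA [LHS]mxE big_ord1 mxE.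
by rewrite !h; ring.
Qed.

Lemma L_gH b : Lbil (X b) gH y = 0.
Proof.
have H : \forall z \near y, gH z = (fun z => G z - ((E b z)^T *m E b z + (E (b + 1) z)^T *m E (b + 1) z + (E (b + 2) z)^T *m E (b + 2) z)) z.
  by apply: near_all => z; rewrite /gH (I3_sum _ b).
have s1 := smD (sEE b) (sEE (b + 1)); have s2 := smD s1 (sEE (b + 2)).
rewrite (Lbil_eq _ H) LbilB// (l_LG L)// LbilD// LbilD// !Lbil_row// (l_LE L)//.
have := l_LEm L Dy (b + 1); rewrite I3_12 I3_11 => ->.
have := l_LEp L Dy (b + 2); rewrite I3_22 I3_21 => ->.
rewrite trmx0 !trN !trZ !mulNmx !mulmxN -!scalemxAl -!scalemxAr mul0mx mulmx0.
by apply/matrixP => i j; rewrite !mxE; ring.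
Qed.

Lemma L_om a b : k != 0 -> Lbil (X b) (om a) y = 0.
Proof.
move=> k0; rewrite LbilB; [|exact: sm_mulmx|by apply: smZ; exact: sm_dmx].
rewrite LbilZ; last exact: sm_dmx.
rewrite (l_LB L)// (Lbil_dmx (b := (a == b)%:R%:M))//; last first.
  by apply: (l_near L Dy) => z Dz; exact: (l_EXE L Dz).
rewrite -dmxZ; last exact: sm_Lrow.
rewrite (dmx_eq (e := fun z => k^-1 *: Lrow (X b) (E a) z) (f := fun z => E b z *m P a z)) ?subrr//.
apply: (l_near L Dy) => z Dz; have [->|->|->] := I3_cases a b.
- by rewrite (l_LE L)// scaler0 (l_EP L).
- rewrite (l_LEp L)// scalerN scalerA mulVf// scale1r.
  by have [_ ->] := l_eta L a Dz; rewrite opprK.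
- rewrite (l_LEm L)// scalerA mulVf// scale1r.
  by have := l_eta L (a + 2) Dz; rewrite I3_22 I3_21 => -[-> _].
Qed.

Lemma om_closed a u v w : ext2 (om a) y u v w = 0.
Proof.
have sGP := sm_mulmx sG (sP a); have sd := sm_dmx (sE a).
have K b c d : c^T *m dd b (om a) y *m d = c^T *m dd b (fun z => G z *m P a z) y *m d - k^-1 *: (c^T *m dd b (dmx (E a)) y *m d).
  rewrite DB//; last exact: smZ.
  by rewrite DZ// mulmxBr mulmxBl -scalemxAr -scalemxAl.
have h1 := l_ext2 L a u v w Dy; have h2 := dmx_ext2 u v w (sE a).
transitivity (ext2 (fun z => G z *m P a z) y u v w - k^-1 *: ext2 (dmx (E a)) y u v w).
  rewrite /ext2 !K; move: (v^T *m _ *m w) (w^T *m _ *m u) (u^T *m _ *m v) (v^T *m dd u (dmx _) y *m w) (w^T *m dd v (dmx _) y *m u) (u^T *m dd w (dmx _) y *m v) => a1 a2 a3 a4 a5 a6.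
  by apply/matrixP => i j; rewrite !mxE; ring.
by rewrite h1 h2 scaler0 subrr.
Qed.

Lemma Lbil_Xm (B : 'cV[R]_m -> 'M[R]_m) (c : 'cV[R]_m -> 'cV[R]_3) : sm B y -> sm c y ->
  (forall b, Lbil (X b) B y = 0) -> B y *m Xm X y = 0 -> (Xm X y)^T *m B y = 0 ->
  Lbil (fun z => Xm X z *m c z) B y = 0.
Proof.
move=> sB sc LB BX XB; have sXm := sm_Xm L Dy.
have sXc := sm_mulmx sXm sc.
have J : jac (fun z => Xm X z *m c z) y = \sum_a c y a 0 *: jac (X a) y + Xm X y *m jac c y.
  apply: jac_uniq => // v; rewrite D_mulmx// mulmxDl -mulmxA -D_jac//; congr (_ + _).
  rewrite -D_mulmxr// mulmx_suml.
  have H : \forall z \near y, Xm X z *m c y = (fun z => c y 0 0 *: X 0 z + c y (0 + 1) 0 *: X (0 + 1) z + c y (0 + 2) 0 *: X (0 + 2) z) z.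
    by apply: near_all => z; rewrite Xm_mul (I3_sum _ 0).
  have s1 a : sm (fun z => c y a 0 *: X a z) y by exact: smZ.
  rewrite (D_eq v H) (I3_sum _ 0) DD//; last exact: smD.
  by rewrite DD// !DZ// -!scalemxAl -!D_jac.
rewrite /Lbil J Xm_mul D_dir_sum// trD mulmxDl mulmxDr.
rewrite trmx_mul -mulmxA XB mulmx0 addr0 mulmxA BX mul0mx addr0.
rewrite raddf_sum /= mulmx_suml mulmx_sumr -!big_split /= big1// => a _.
rewrite D_dirZ// trZ -scalemxAl -scalemxAr -!scalerDr.
by have := LB a; rewrite /Lbil => ->; rewrite scaler0.
Qed.

Lemma hor_dd u v : dd (Xm X y *m u) (hor E X) y *m (Xm X y *m v) = dd (Xm X y *m v) (hor E X) y *m (Xm X y *m u).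
Proof.
have sh := sm_hor L Dy.
have K a b : dd (X a y) (hor E X) y *m X b y = - (hor E X y *m dd (X a y) (X b) y).
  have H : \forall z \near y, hor E X z *m X b z = (fun=> 0 : 'cV[R]_m) z.
    apply: (l_near L Dy) => z Dz; have d : Xm X z *m delta_mx b 0 = X b z.
      by apply/colP => i; rewrite -colE mxE mxE.
    by rewrite -d mulmxA (hor_Xm L Dz) mul0mx.
  by have := D_eq (X a y) H; rewrite Dcst D_mulmx// => /eqP; rewrite addr_eq0 => /eqP.
have S a b : dd (X a y) (hor E X) y *m X b y = dd (X b y) (hor E X) y *m X a y.
  have hX d : hor E X y *m X d y = 0.
    have <- : Xm X y *m delta_mx d 0 = X d y by apply/colP => i; rewrite -colE mxE mxE.
    by rewrite mulmxA (hor_Xm L Dy) mul0mx.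
  rewrite !K; congr (- _); apply/eqP; rewrite -subr_eq0 -mulmxBr; apply/eqP.
  have V d : hor E X y *m (dd (X d y) (X (d + 1)) y - dd (X (d + 1) y) (X d) y) = 0.
    by have := l_br L d Dy; rewrite /Lvec -D_jac// => ->; rewrite -scalemxAr hX scaler0.
  have [->|->|->] := I3_cases a b.
  - by rewrite subrr mulmx0.
  - exact: V.
  - by have := V (a + 2); rewrite I3_21 => /(congr1 -%R); rewrite -mulmxN opprB oppr0.
rewrite !Xm_mul !D_dir_sum// !mulmx_suml.
under eq_bigr => a _ do rewrite mulmx_sumr.
rewrite exchange_big /=; apply: eq_bigr => a _; rewrite mulmx_sumr; apply: eq_bigr => b _.
by rewrite !D_dirZ// -!scalemxAl -!scalemxAr S !scalerA mulrC.
Qed.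

End at_point.

End basic.

Section related.
Context {R : realType} {m n : nat}.

Lemma tor_related (f : 'cV[R]_m -> 'cV[R]_n) (P : 'cV[R]_m -> 'M[R]_m) (F : 'cV[R]_n -> 'M[R]_n) x u v :
  sm f x -> sm P x -> sm F (f x) ->
  (\forall z \near x, F (f z) *m jac f z = jac f z *m P z) ->
  tor F (f x) (jac f x *m u) (jac f x *m v) = jac f x *m tor P x u v.
Proof.
move=> sf sP sF H; have H0 := nbhs_singleton H; have sJ := sm_jac sf.
have sFf := sm_comp sf sF.
have S := D_jac_sym _ _ sf.
have K w (z : 'cV[R]_m) : dd (jac f x *m w) F (f x) *m (jac f x *m z) =
    dd w (jac f) x *m (P x *m z) + jac f x *m (dd w P x *m z) - F (f x) *m (dd w (jac f) x *m z).
  have := D_eq w H; rewrite (D_mulmx w sFf sJ) (D_mulmx w sJ sP) (D_comp w sf sF) (D_jac _ sf).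
  move=> /(congr1 (mulmxr z)) /=; rewrite !mulmxDl -!mulmxA => /eqP.
  by rewrite eq_sym -subr_eq eq_sym => /eqP.
have Fj w : F (f x) *m (jac f x *m w) = jac f x *m (P x *m w) by rewrite !mulmxA H0.
rewrite /tor !Fj !K (S (P x *m u) (P x *m v)) (S (P x *m u) v) (S (P x *m v) u) (S v u).
move: (dd u (jac f) x *m v) (dd v (jac f) x *m (P x *m u)) (dd u (jac f) x *m (P x *m v)) (dd (P x *m v) (jac f) x *m (P x *m u)) => q4 q1 q2 J1.
move: (dd (P x *m u) P x *m v) (dd (P x *m v) P x *m u) (dd v P x *m u) (dd u P x *m v) => p1 p2 p3 p4.
rewrite !mulmxBr !mulmxDr !Fj !mulmxN.
move: (jac f x *m p1) (jac f x *m p2) (jac f x *m (P x *m p3)) (jac f x *m (P x *m p4)) (F (f x) *m q1) (F (f x) *m q2) (F (f x) *m (F (f x) *m q4)) => *.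
by apply/colP => i; rewrite !mxE; ring.
Qed.

End related.

Section transverse.
Context {R : realType} {n : nat}.
Local Notation m := (n + 3)%N.
Variables (D : set 'cV[R]_m) (k : R) (G : 'cV[R]_m -> 'M[R]_m) (P : 'I_3 -> 'cV[R]_m -> 'M[R]_m)
    (E : 'I_3 -> 'cV[R]_m -> 'rV[R]_m) (X : 'I_3 -> 'cV[R]_m -> 'cV[R]_m).
Hypothesis L : loc3 D k G P E X.

Definition basic2 (B : 'cV[R]_m -> 'M[R]_m) := forall x, D x ->
  [/\ sm B x, forall b, Lbil (X b) B x = 0, B x *m Xm X x = 0 & (Xm X x)^T *m B x = 0].

Lemma vert_frame (PS : 'M[R]_(3, m)) (K := fun z => Xm X z *m invmx (PS *m Xm X z)) y : D y ->
  (\forall z \near y, PS *m Xm X z \in unitmx) ->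
  [/\ sm K y, PS *m K y = 1%:M,
    forall u v : 'cV[R]_3, dd (K y *m u) K y *m v = dd (K y *m v) K y *m u &
    forall B t, basic2 B -> Lbil (fun z => K z *m t) B y = 0].
Proof.
move=> Dy nU; have uy := nbhs_singleton nU; have sX := sm_Xm L Dy.
have sC : sm (fun z => invmx (PS *m Xm X z)) y by apply: sm_invmx => //; exact: sm_mulmxl.
have sK : sm K y by exact: sm_mulmx.
have PK : \forall z \near y, PS *m K z = 1%:M.
  by apply: filterS nU => z uz; rewrite /K mulmxA mulmxV.
have KE z (u : 'cV[R]_3) : K z *m u = Xm X z *m (invmx (PS *m Xm X z) *m u) by rewrite /K mulmxA.
split=> //; first exact: nbhs_singleton PK.
  apply: (frame_comm (P := PS) sK (sm_hor L Dy) PK).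
  - apply: (l_near L Dy) => z Dz; rewrite /K mulmxA (hor_Xm L Dz) mul0mx //.
  - move=> w Pw; rewrite horE mulmxBl mul1mx => /eqP; rewrite subr_eq0 -mulmxA => /eqP we.
    have Ew : Em E y *m w = 0.
      by apply: (can_inj (mulKmx uy)); rewrite mulmx0 -mulmxA -we.
    by rewrite we Ew mulmx0.
  - by move=> u v; rewrite !KE; exact: (hor_dd L Dy).
move=> B t bB; have [sB LB BX XB] := bB y Dy.
rewrite (_ : (fun z => K z *m t) = (fun z => Xm X z *m (invmx (PS *m Xm X z) *m t))); last by apply/funext => z; exact: KE.
by apply: (Lbil_Xm L Dy) => //; exact: sm_mulmxr.
Qed.

Let pull_alg (v w : 'cV[R]_m) (J : 'M[R]_(n, m)) (T : 'M[R]_(m, n)) (B : 'M[R]_m) :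
  v^T *m (J^T *m (T^T *m B *m T) *m J) *m w = (T *m (J *m v))^T *m B *m (T *m (J *m w)).
Proof. by rewrite !trmx_mul !mulmxA. Qed.

Lemma transverse_flow y0 : D y0 -> exists (e r : R) (f : 'cV[R]_m -> 'cV[R]_n) (T : 'M[R]_(m, n)),
  [/\ 0 < e, 0 < r, f y0 = 0,
    forall x, `|x - y0| < e -> [/\ D x, sm f x, row_mx T (Xm X x) \in unitmx, jac f x *m Xm X x = 0 &
      forall B, basic2 B -> B x = (jac f x)^T *m (T^T *m B (y0 + T *m f x) *m T) *m jac f x] &
    forall t : 'cV[R]_n, `|t| < r -> `|y0 + T *m t - y0| < e /\ f (y0 + T *m t) = t].
Proof.
move=> Dy0; have [T [PT [TP PT1 ET PX TS]]] := hor_basis L Dy0.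
pose PS := Em E y0; have PSX : PS *m Xm X y0 = 1%:M by exact: (Em_Xm L Dy0).
have sX y : D y -> sm (Xm X) y by move=> Dy; exact: (sm_Xm L Dy).
have sR y : D y -> sm (fun z => row_mx T (Xm X z)) y.
  move=> Dy; apply: (sm_ext (f := fun z => (col_mx T^T (Xm X z)^T)^T)).
    by move=> z; rewrite tr_col_mx !trmxK.
  by apply: sm_trmx; apply: sm_col_mx (sm_cst _ _) _; apply: sm_trmx; exact: sX.
have [r0 r00 Hr] : exists2 r0 : R, 0 < r0 & forall y, `|y - y0| < r0 ->
    [/\ D y, PS *m Xm X y \in unitmx & row_mx T (Xm X y) \in unitmx].
  apply/nbhs_normP; apply: filterS3 (l_near L Dy0 (fun z Dz => Dz)) (near_unitmx (A := fun z => PS *m Xm X z) _ _) (near_unitmx (sR _ Dy0) _) => //.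
  - by apply: sm_mulmxl; exact: sX.
  - by rewrite PSX unitmx1.
  - by have [] := mulmx1_unit TS.
pose K z := Xm X z *m invmx (PS *m Xm X z).
have nr y : `|y - y0| < r0 -> \forall z \near y, PS *m Xm X z \in unitmx.
  move=> yr; apply: (filterS (P := [set z | `|z - y0| < r0])); first by move=> z /Hr[].
  by apply: open_nbhs_nbhs; split=> //; exact: open_normball.
have HK y : `|y - y0| < r0 -> [/\ sm K y, PS *m K y = 1%:M,
    forall u v : 'cV[R]_3, dd (K y *m u) K y *m v = dd (K y *m v) K y *m u &
    forall B t, basic2 B -> Lbil (fun z => K z *m t) B y = 0].
  by move=> yr; have [Dy _ _] := Hr y yr; exact: vert_frame Dy (nr y yr).
have [d [Phi [d0 sP HP]]] := comm_flow r00 (fun y yr => (let: And4 h _ _ _ := HK y yr in h))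
  (fun y yr => (let: And4 _ h _ _ := HK y yr in h)) (fun y u v yr => (let: And4 _ _ h _ := HK y yr in h) u v).
pose tau (x : 'cV[R]_m) : 'cV[R]_3 := - (PS *m (x - y0)).
have stau x : sm tau x.
  by apply: smN; apply: sm_mulmxl; apply: smB; [exact: sm_id|exact: sm_cst].
have dtau v x : dd v tau x = - (PS *m v).
  rewrite DN; last by apply: sm_mulmxl; apply: smB; [exact: sm_id|exact: sm_cst].
  by rewrite D_mulmxl ?DB ?D_id ?Dcst ?subr0//; [exact: sm_id|exact: sm_cst|apply: smB; [exact: sm_id|exact: sm_cst]].
pose Psi x := Phi (col_mx x (tau x)); pose f x := PT *m (Psi x - y0).
have sC x : sm (fun x => col_mx x (tau x)) x by apply: sm_col_mx; [exact: sm_id|exact: stau].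
have sPsi x : sm Psi x by apply: sm_comp; [exact: sC|exact: sP].
have sf x : sm f x by apply: sm_mulmxl; apply: smB; [exact: sPsi|exact: sm_cst].
have tau0 : tau y0 = 0 by rewrite /tau subrr mulmx0 oppr0.
have [e e0 He] : exists2 e : R, 0 < e & forall x, `|x - y0| < e -> [/\ `|x - y0| < d, `|x - y0| < r0 & `|tau x| < d].
  have [e1 e10 He1] := (cont_normP _ _).1 (sm_cont (stau y0)) (d / 2) (divr_gt0 d0 (ltr0Sn R 1)).
  exists (Num.min e1 (Num.min d r0)); first by rewrite !lt_min e10 d0.
  move=> x; rewrite !lt_min => /andP[/He1 h /andP[-> ->]]; split=> //.
  by move: h; rewrite tau0 subr0 => h; apply: (le_lt_trans h); rewrite ltr_pdivrMr// ltr_pMr// ltr1n.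
have PsiE x : `|x - y0| < e -> Psi x = y0 + T *m f x.
  move=> xe; have [xd _ td] := He x xe; have [_ h _ _ _] := HP x (tau x) xd td.
  have P0 : PS *m (Psi x - y0) = 0.
    by rewrite mulmxBr h /tau mulmxBr opprB addrA [_ + PS *m y0]addrC addrK subrr.
  rewrite /f mulmxA -[RHS]addrC -[LHS](subrK y0); congr (_ + _).
  rewrite -[LHS]mul1mx -TS mul_row_col mulmxDl -[Xm X y0 *m _ *m _]mulmxA.
  by rewrite -/PS P0 mulmx0 addr0.
have dPsi x v : dd v Psi x = dd (col_mx v 0) Phi (col_mx x (tau x)) + dd (col_mx 0 (- (PS *m v))) Phi (col_mx x (tau x)).
  rewrite /Psi (D_comp _ (sC x) (sP _)) D_col_mx; [|exact: sm_id|exact: stau].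
  by rewrite D_id dtau -D_dirD// add_col_mx addr0 add0r.
have Tf x v : `|x - y0| < e -> T *m (jac f x *m v) = dd v Psi x.
  move=> xe; rewrite -D_jac// -D_mulmxl//.
  have -> : dd v Psi x = dd v (fun z => Psi z - y0) x by rewrite DB ?Dcst ?subr0//; exact: sm_cst.
  apply: D_eq; apply: (filterS (P := [set z | `|z - y0| < e])) => [z /PsiE ->|]; first by rewrite addrC addKr.
  by apply: open_nbhs_nbhs; split=> //; exact: open_normball.
have [r rp Hr2] : exists2 r : R, 0 < r & forall t : 'cV[R]_n, `|t| < r -> `|y0 + T *m t - y0| < e.
  have sT : sm (fun t : 'cV[R]_n => T *m t) 0 by apply: sm_mulmxl; exact: sm_id.
  have [e1 e10 He1] := (cont_normP _ _).1 (sm_cont sT) (e / 2) (divr_gt0 e0 (ltr0Sn R 1)).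
  exists e1 => // t te; have := He1 t; rewrite !subr0 mulmx0 subr0 => /(_ te) h.
  rewrite addrC addKr; apply: (le_lt_trans h).
  by rewrite ltr_pdivrMr// ltr_pMr// ltr1n.
exists e, r, f, T; split=> //.
- have y0d : `|y0 - y0| < d by rewrite subrr normr0.
  have t0d : `|0 : 'cV[R]_3| < d by rewrite normr0.
  rewrite /f /Psi tau0; have [_ _ h _ _] := HP y0 0 y0d t0d.
  by rewrite h// subrr mulmx0.
- move=> x xe; have [xd xr td] := He x xe; have [Dx ux uR] := Hr x xr.
  have [_ _ _ dK [dKw _ tB]] := HP x (tau x) xd td.
  have [_ PK _ _] := HK x xr.
  split=> //.
    apply: mulmx_ext => w; rewrite mul0mx -mulmxA.
    have -> : Xm X x *m w = K x *m (PS *m Xm X x *m w) by rewrite /K -[RHS]mulmxA -[PS *m Xm X x *m w]/((PS *m Xm X x) *m w) mulKmx.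
    move: (PS *m Xm X x *m w) => w'.
    rewrite -[LHS]mul1mx -PT1 -mulmxA Tf// dPsi dKw dK mulmxA PK mul1mx mulmxN subrr mulmx0.
    by [].
  move=> B bB; apply: form_ext => v w.
  have yr : `|Psi x - y0| < r0 by have [] := HP x (tau x) xd td.
  have [Dy uy _] := Hr _ yr.
  have BK A : B (Psi x) *m (K (Psi x) *m A) = 0.
    by have [_ _ BX _] := bB _ Dy; rewrite /K !mulmxA BX !mul0mx.
  have KB A : (K (Psi x) *m A)^T *m B (Psi x) = 0.
    have [_ _ _ XB] := bB _ Dy.
    by rewrite /K -mulmxA trmx_mul -mulmxA XB mulmx0.
  rewrite -(tB B) => [|y yr']; last by have [Dy' _ _] := Hr y yr'; have [sB _ _ _] := bB y Dy'; split=> //; have [_ _ _ h] := HK y yr'; exact: h.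
  rewrite pull_alg -PsiE// !Tf// !dPsi !dK trD mulmxDl KB addr0 mulmxDr -[_ *m (K _ *m _)]mulmxA BK mulmx0 addr0.
  by [].
move=> t tr; split; first exact: Hr2.
have te := Hr2 t tr; have [xd _ td] := He _ te.
have t0 : tau (y0 + T *m t) = 0 by rewrite /tau addrC addKr mulmxA ET mul0mx oppr0.
rewrite t0 in td; have [_ _ h _ _] := HP _ _ xd td.
by rewrite /f /Psi t0 h// addrC addKr mulmxA PT1 mul1mx.
Qed.

Lemma basic_gH : basic2 (gH G E).
Proof.
move=> x Dx; split; [exact: (sm_gH L Dx)|by move=> b; exact: (L_gH L Dx)|exact: (gH_Xm L Dx)|exact: (Xm_gH L Dx)].
Qed.

Lemma basic_om a : k != 0 -> (forall y, D y -> lii E y) -> basic2 (om k G P E a).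
Proof.
move=> k0 ii x Dx; have oE := omE L Dx a k0 (ii x Dx).
split; [exact: (sm_om L Dx)|by move=> b; exact: (L_om L Dx)| |].
  by have [c Pc] := P_Xm L Dx a; rewrite oE -mulmxA Pc mulmxA (gH_Xm L Dx) mul0mx.
by rewrite oE mulmxA (Xm_gH L Dx) mul0mx.
Qed.

Lemma gH_hor y : D y -> gH G E y = (hor E X y)^T *m G y *m hor E X y.
Proof.
move=> Dy; have h1 : gH G E y *m hor E X y = gH G E y.
  by rewrite horE mulmxBr mulmx1 mulmxA (gH_Xm L Dy) mul0mx subr0.
have h2 : (hor E X y)^T *m gH G E y = gH G E y.
  by apply: trmx_inj; rewrite trmx_mul trmxK (gH_sym L Dy).
transitivity ((hor E X y)^T *m (G y - \sum_a (E a y)^T *m E a y) *m hor E X y).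
  by rewrite -/(gH G E y) h2 h1.
move: (hor E X y) (E_hor L Dy) => h hE.
rewrite mulmxBr mulmxBl mulmx_sumr mulmx_suml [X in _ - X]big1 ?subr0// => a _.
by rewrite -!mulmxA hE !mulmx0.
Qed.

Lemma gH_posdef (T : 'M[R]_(m, n)) y : D y -> row_mx T (Xm X y) \in unitmx ->
  posdef (T^T *m gH G E y *m T).
Proof.
move=> Dy uy v v0; rewrite (gH_hor Dy).
have -> : v^T *m (T^T *m ((hor E X y)^T *m G y *m hor E X y) *m T) *m v =
  (hor E X y *m (T *m v))^T *m G y *m (hor E X y *m (T *m v)) by rewrite !trmx_mul !mulmxA.
apply: (l_pos L Dy).
apply: contra v0 => /eqP; rewrite horE mulmxBl mul1mx => /eqP.
rewrite subr_eq0 -[X in _ == X]mulmxA => /eqP h.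
have : row_mx T (Xm X y) *m col_mx v (- (Em E y *m (T *m v))) = 0.
  by rewrite mul_row_col mulmxN -h subrr.
move=> /(congr1 (mulmx (invmx (row_mx T (Xm X y))))); rewrite mulKmx// mulmx0 => /(congr1 usubmx).
by rewrite col_mxKu linear0 => ->.
Qed.

Section slice_algebra.
Variables (T : 'M[R]_(m, n)) (z : 'cV[R]_m).
Hypotheses (Dz : D z) (uz : row_mx T (Xm X z) \in unitmx).

Definition rho : 'M[R]_(n, m) := usubmx (invmx (row_mx T (Xm X z))).

Lemma rho_T : rho *m T = 1%:M /\ rho *m Xm X z = 0.
Proof.
have := mulVmx uz; rewrite -{1}[invmx _]vsubmxK mul_col_row.
by rewrite /rho scalar_mx_block => /eq_block_mx[-> -> _ _].
Qed.

Lemma T_rho : exists rho', T *m rho = 1%:M - Xm X z *m rho'.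
Proof.
have := mulmxV uz; rewrite -{1}[invmx _]vsubmxK mul_row_col -/rho => h.
by exists (dsubmx (invmx (row_mx T (Xm X z)))); rewrite -h addrK.
Qed.

Definition Jr a := rho *m P a z *m T.

Lemma Jr_mul a b : Jr a *m Jr b = rho *m (P a z *m P b z) *m T.
Proof.
have [_ rX] := rho_T; have [rho' TR] := T_rho; have [c Pc] := P_Xm L Dz a.
have -> : Jr a *m Jr b = rho *m P a z *m (T *m rho) *m P b z *m T by rewrite /Jr !mulmxA.
have -> : rho *m P a z *m (T *m rho) = rho *m P a z.
  by rewrite TR mulmxBr mulmx1 (mulmxA _ (Xm X z)) -(mulmxA rho) Pc (mulmxA rho) rX !mul0mx subr0.
by rewrite !mulmxA.
Qed.

Lemma rho_X a (w : 'rV[R]_m) : rho *m (X a z *m w) *m T = 0.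
Proof.
have <- : Xm X z *m delta_mx a 0 = X a z by apply/colP => i; rewrite -colE mxE mxE.
by have [_ rX] := rho_T; rewrite !mulmxA rX !mul0mx.
Qed.

Lemma Jr_sq a : Jr a *m Jr a = - 1%:M.
Proof.
by have [rT _] := rho_T; rewrite Jr_mul (l_P2 L a Dz) mulmxDr mulmxDl rho_X addr0 mulmxN mulmx1 mulNmx rT.
Qed.

Lemma Jr_quat a : Jr (a + 2) = Jr a *m Jr (a + 1) /\ Jr (a + 2) = - (Jr (a + 1) *m Jr a).
Proof.
have [h1 h2] := l_phi L a Dz; split.
  by rewrite {1}/Jr h1 Jr_mul mulmxBr mulmxBl rho_X subr0.
by rewrite {1}/Jr h2 Jr_mul mulmxDr mulmxDl rho_X addr0 mulmxN mulNmx.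
Qed.

Let gHTr : gH G E z *m (T *m rho) = gH G E z.
Proof. by have [rho' ->] := T_rho; rewrite mulmxBr mulmx1 mulmxA (gH_Xm L Dz) mul0mx subr0. Qed.

Lemma gH_Jr a : T^T *m gH G E z *m T *m Jr a = T^T *m (gH G E z *m P a z) *m T.
Proof.
have -> : T^T *m gH G E z *m T *m Jr a = T^T *m (gH G E z *m (T *m rho)) *m P a z *m T by rewrite /Jr !mulmxA.
by rewrite gHTr !mulmxA.
Qed.

Lemma Jr_her a : (Jr a)^T *m (T^T *m gH G E z *m T) *m Jr a = T^T *m gH G E z *m T.
Proof.
rewrite -mulmxA gH_Jr.
have -> : (Jr a)^T *m (T^T *m (gH G E z *m P a z) *m T) = T^T *m (P a z)^T *m (gH G E z *m (T *m rho))^T *m P a z *m T.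
  by rewrite /Jr !trmx_mul (gH_sym L Dz) !mulmxA.
by rewrite gHTr (gH_sym L Dz) -(mulmxA T^T) -(mulmxA T^T) (P_gH_P L Dz).
Qed.

End slice_algebra.

Let cancel_alg (A : 'M[R]_(n, m)) (T : 'M[R]_(m, n)) (H J : 'M[R]_n) (F g : 'M[R]_m) :
  g = A^T *m H *m A -> g *m F = A^T *m (H *m J) *m A -> (A *m T)^T *m (H *m (J *m A - A *m F)) = 0.
Proof.
move=> gE; rewrite gE => h; rewrite trmx_mul -mulmxA mulmxBr mulmxBr.
have -> : A^T *m (H *m (J *m A)) = A^T *m (H *m (A *m F)) by move: h; rewrite !mulmxA => <-.
by rewrite subrr mulmx0.
Qed.

Lemma transverse_hk y0 : D y0 -> k != 0 -> (forall y, D y -> lii E y) ->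
  exists (e r : R) (f : 'cV[R]_m -> 'cV[R]_n) (H : 'cV[R]_n -> 'M[R]_n) (J : 'I_3 -> 'cV[R]_n -> 'M[R]_n),
  [/\ 0 < e, 0 < r, f y0 = 0,
    forall x, `|x - y0| < e -> [/\ D x, sm f x, `|f x| < r & gH G E x = (jac f x)^T *m H (f x) *m jac f x] &
    forall t, `|t| < r -> [/\ [/\ sm H t, forall a, sm (J a) t, (H t)^T = H t & posdef (H t)],
      [/\ forall a, J a t *m J a t = - 1%:M, forall a, (J a t)^T *m H t *m J a t = H t &
        forall a, J (a + 2) t = J a t *m J (a + 1) t /\ J (a + 2) t = - (J (a + 1) t *m J a t)],
      forall a u v, tor (J a) t u v = 0 & forall a u v w, ext2 (fun z => H z *m J a z) t u v w = 0]].
Proof.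
move=> Dy0 k0 ii; have [e [r [f [T [e0 r0 fy0 He Hr]]]]] := transverse_flow Dy0.
pose sg (t : 'cV[R]_n) := y0 + T *m t.
pose H t := T^T *m gH G E (sg t) *m T; pose J a t := Jr T (sg t) a.
have sT t : sm (fun t : 'cV[R]_n => T *m t) t by apply: sm_mulmxl; exact: sm_id.
have ssg t : sm sg t by apply: smD; [exact: sm_cst|exact: sT].
have dsg u t : dd u sg t = T *m u.
  by rewrite DD ?Dcst ?add0r ?D_mulmxl ?D_id//; [exact: sm_id|exact: sm_cst].
have Hsg t : `|t| < r -> D (sg t) /\ row_mx T (Xm X (sg t)) \in unitmx.
  by move=> tr; have [te _] := Hr t tr; have [] := He _ te.
have sf0 : sm f y0 by have [|_ h _ _ _] := He y0; first by rewrite subrr normr0.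
have nr (t : 'cV[R]_n) : `|t| < r -> \forall z \near t, `|z| < r.
  move=> tr; apply/nbhs_normP; exists (r - `|t|); rewrite ?subr_gt0// => z zt.
  by have := ler_distD t z 0; rewrite !subr0 => h; apply: (le_lt_trans h); rewrite -ltrBrDr.
have HJ a t : `|t| < r -> H t *m J a t = T^T *m om k G P E a (sg t) *m T.
  by move=> /Hsg[Dt ut]; rewrite (omE L Dt a k0 (ii _ Dt)) /H /J (gH_Jr Dt ut).
have sH t : `|t| < r -> sm H t.
  move=> /Hsg[Dt _]; apply: sm_mulmxr; apply: sm_mulmxl.
  exact: sm_comp (ssg t) (sm_gH L Dt).
have sJ a t : `|t| < r -> sm (J a) t.
  move=> /Hsg[Dt ut].
  have sR : sm (fun z => row_mx T (Xm X z)) (sg t).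
    apply: (sm_ext (f := fun z => (col_mx T^T (Xm X z)^T)^T)).
      by move=> z; rewrite tr_col_mx !trmxK.
    by apply: sm_trmx; apply: sm_col_mx (sm_cst _ _) _; apply: sm_trmx; exact: (sm_Xm L Dt).
  have s1 : sm (fun z => rho T z *m P a z *m T) (sg t).
    apply: sm_mulmxr; apply: sm_mulmx; last exact: (l_smP L a Dt).
    by apply: sm_usubmx; exact: sm_invmx.
  exact: sm_comp (ssg t) s1.
have rel a t : `|t| < r -> \forall z \near sg t, J a (f z) *m jac f z = jac f z *m P a z.
  move=> tr; have [te ft] := Hr t tr; have [_ sft _ _ _] := He _ te.
  have nf : \forall z \near sg t, `|f z| < r.
    have := sm_cont sft; rewrite /prop_for /continuous_at ft => /(_ _ (nr t tr)); exact.
  have ne : \forall z \near sg t, `|z - y0| < e by apply: open_nbhs_nbhs; split; [exact: open_normball|].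
  apply: filterS2 nf ne => z fr ze; have [Dz sfz uz jX hB] := He z ze.
  have [Dw uw] := Hsg _ fr.
  have h1 := hB _ basic_gH; have h2 := hB _ (basic_om a k0 ii).
  rewrite -/(sg (f z)) -/(H (f z)) in h1; rewrite -/(sg (f z)) -HJ// (omE L Dz a k0 (ii _ Dz)) in h2.
  have pw : posdef (H (f z)) by exact: (gH_posdef Dw uw).
  have uH := posdef_unit pw.
  have uJT : jac f z *m T \in unitmx.
    have := posdef_unit (gH_posdef Dz uz).
    have -> : T^T *m gH G E z *m T = (jac f z *m T)^T *m (H (f z) *m (jac f z *m T)).
      by rewrite h1 trmx_mul !mulmxA.
    by rewrite !unitmx_mul => /andP[_ /andP[_]].
  have : (jac f z *m T)^T *m (H (f z) *m (J a (f z) *m jac f z - jac f z *m P a z)) = 0.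
    exact: cancel_alg h1 h2.
  move=> /(congr1 (mulmx (invmx (jac f z *m T)^T))); rewrite mulKmx ?unitmx_tr// mulmx0.
  move=> /(congr1 (mulmx (invmx (H (f z))))); rewrite mulKmx// mulmx0 => /eqP.
  by rewrite subr_eq0 => /eqP.
have [e1 [e10 He1]] : exists e1, 0 < e1 /\ forall x, `|x - y0| < e1 -> `|x - y0| < e /\ `|f x| < r.
  have [e1 e10 He1] := (cont_normP _ _).1 (sm_cont sf0) (r / 2) (divr_gt0 r0 (ltr0Sn R 1)).
  exists (Num.min e1 e); rewrite lt_min e10; split=> // x; rewrite lt_min => /andP[/He1 h ->]; split=> //.
  by move: h; rewrite fy0 subr0 => h; apply: (le_lt_trans h); rewrite ltr_pdivrMr// ltr_pMr// ltr1n.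
exists e1, r, f, H, J; split=> //.
  move=> x /He1[xe fr]; have [Dx sfx _ _ hB] := He x xe; split=> //.
  exact: hB _ basic_gH.
move=> t tr; have [Dt ut] := Hsg t tr; split.
- split=> //; [exact: sH|by move=> a; exact: sJ| |exact: (gH_posdef Dt ut)].
  by rewrite /H !trmx_mul trmxK (gH_sym L Dt) mulmxA.
- split=> a; [exact: (Jr_sq Dt ut)|exact: (Jr_her Dt ut)|exact: (Jr_quat Dt ut)].
- move=> a u v; have [te ft] := Hr t tr; have [_ sft utt jX hB] := He _ te.
  have [Z HZ] : exists Z, jac f (sg t) *m Z = 1%:M.
    have uJT : jac f (sg t) *m T = 1%:M.
      apply: mulmx_ext => w; rewrite mul1mx -mulmxA -[T *m w](dsg w t) -D_jac//.
      have sft' : sm f (sg t) by [].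
      rewrite -(D_comp w (ssg t) sft').
      have E1 : \forall z \near t, f (sg z) = id z by apply: filterS (nr t tr) => z /Hr[].
      by rewrite (D_eq w E1) D_id.
    by exists T.
  have sJf : sm (J a) (f (sg t)) by rewrite ft; exact: sJ.
  have := tor_related (Z *m u) (Z *m v) sft (l_smP L a Dt) sJf (rel a t tr).
  rewrite ft !(mulmxA _ Z) HZ !mul1mx => ->.
  have := l_tor L a (Z *m u) (Z *m v) Dt => /eqP; rewrite addr_eq0 => /eqP ->.
  have d : Xm X (sg t) *m delta_mx a 0 = X a (sg t) by apply/colP => i; rewrite -colE mxE mxE.
  by rewrite mulmxN -scalemxAr -d mulmxA jX mul0mx scaler0 oppr0.
move=> a u v w.
have sO := sm_om L Dt a.
have E1 : \forall z \near t, H z *m J a z = (fun z => T^T *m om k G P E a (sg z) *m T) z.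
  by apply: filterS (nr t tr) => z; exact: HJ.
have K b : dd b (fun z => H z *m J a z) t = T^T *m dd (T *m b) (om k G P E a) (sg t) *m T.
  have sOs := sm_comp (ssg t) sO.
  by rewrite (D_eq b E1) D_mulmxr ?D_mulmxl ?(D_comp b (ssg t) sO) ?dsg//; exact: sm_mulmxl.
have := om_closed L Dt a (T *m u) (T *m v) (T *m w).
by rewrite /ext2 !K !trmx_mul !mulmxA.
Qed.

End transverse.

(** * The map to the sphere *)

Section quaternion_matrices.
Context {R : realType}.

Definition Rq_table : seq (seq (seq R)) :=
  [:: [:: [:: 0; -1; 0; 0]; [:: 1; 0; 0; 0]; [:: 0; 0; 0; 1]; [:: 0; 0; -1; 0]];
      [:: [:: 0; 0; -1; 0]; [:: 0; 0; 0; -1]; [:: 1; 0; 0; 0]; [:: 0; 1; 0; 0]];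
      [:: [:: 0; 0; 0; -1]; [:: 0; 0; 1; 0]; [:: 0; -1; 0; 0]; [:: 1; 0; 0; 0]]].

(* Right multiplication by the quaternion units i, j, k. *)
Definition Rq (a : 'I_3) : 'M[R]_4 := \matrix_(i, j) nth 0 (nth [::] (nth [::] Rq_table a) i) j.

Lemma Rq_tr a : (Rq a)^T = - Rq a.
Proof.
apply/matrixP => i j; rewrite !mxE.
by move: a i j => [[|[|[|//]]] ia] [[|[|[|[|//]]]] ii] [[|[|[|[|//]]]] jj] /=; rewrite ?opprK ?oppr0.
Qed.

Lemma Rq_sq a : Rq a *m Rq a = - 1%:M.
Proof.
apply/matrixP => i j; rewrite !mxE !big_ord_recl big_ord0 !mxE.
by move: a i j => [[|[|[|//]]] ia] [[|[|[|[|//]]]] ii] [[|[|[|[|//]]]] jj] /=; rewrite ?mulr1n ?mulr0n; ring.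
Qed.

Lemma Rq_mul a : Rq (a + 1) *m Rq (a + 2) = - Rq a.
Proof.
apply/matrixP => i j; rewrite !mxE !big_ord_recl big_ord0 !mxE.
by move: a i j => [[|[|[|//]]] ia] [[|[|[|[|//]]]] ii] [[|[|[|[|//]]]] jj] /=; ring.
Qed.

Lemma Rq_mulC a : Rq (a + 2) *m Rq (a + 1) = Rq a.
Proof. by apply: trmx_inj; rewrite trmx_mul !Rq_tr mulNmx mulmxN opprK Rq_mul. Qed.

Lemma Rq_skew a (F : 'cV[R]_4) : F^T *m (Rq a *m F) = 0.
Proof.
have : F^T *m (Rq a *m F) = - (F^T *m (Rq a *m F)).
  by rewrite -[LHS]tr11 !trmx_mul trmxK Rq_tr mulmxN mulNmx mulmxA.
move: (F^T *m _) => t h; apply/matrixP => i j; move/matrixP/(_ i j): h.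
by rewrite !mxE; lra.
Qed.

Lemma Rq_dot a b (F : 'cV[R]_4) : (Rq a *m F)^T *m (Rq b *m F) = (a == b)%:R *: (F^T *m F).
Proof.
rewrite trmx_mul Rq_tr mulmxN mulNmx -mulmxA (mulmxA (Rq a)).
have n1 c : (c == c + 1 :> 'I_3) = false by apply/eqP => /(congr1 val); clear; move: c => [[|[|[|//]]] ia].
have n2 c : (c == c + 2 :> 'I_3) = false by apply/eqP => /(congr1 val); clear; move: c => [[|[|[|//]]] ia].
have [->|->|->] := I3_cases a b.
- by rewrite eqxx scale1r Rq_sq mulNmx mul1mx mulmxN opprK.
- rewrite n1 scale0r; have := Rq_mul (a + 2); rewrite I3_21 I3_22 => ->.
  by rewrite mulNmx mulmxN Rq_skew !oppr0.
rewrite n2 scale0r; have := Rq_mulC (a + 1); rewrite I3_12 I3_11 => ->.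
by rewrite Rq_skew oppr0.
Qed.

End quaternion_matrices.

Section sphere_map.
Context {R : realType} {m : nat}.
Variables (D : set 'cV[R]_m) (k : R) (G : 'cV[R]_m -> 'M[R]_m) (P : 'I_3 -> 'cV[R]_m -> 'M[R]_m)
    (E : 'I_3 -> 'cV[R]_m -> 'rV[R]_m) (X : 'I_3 -> 'cV[R]_m -> 'cV[R]_m).
Hypotheses (L : loc3 D k G P E X) (k0 : k != 0) (ii : forall y, D y -> lii E y).

Let Aa a (w : 'cV[R]_(m + 4)) : 'M[R]_(4, m) := Rq a *m dsubmx w *m E a (usubmx w).
Let A w := (k / 2) *: (Aa 0 w + Aa (0 + 1) w + Aa (0 + 2) w).
Let K w : 'M[R]_(m + 4, m) := col_mx 1%:M (A w).

Let su w : sm (fun w : 'cV[R]_(m + 4) => usubmx w) w := sm_usubmx (@sm_id R (m + 4) 1 w).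
Let sd w : sm (fun w : 'cV[R]_(m + 4) => dsubmx w) w := sm_dsubmx (@sm_id R (m + 4) 1 w).

Let sAa a w : D (usubmx w) -> sm (Aa a) w.
Proof.
move=> Dw; apply: sm_mulmx; first exact: sm_mulmxl.
exact: sm_comp (su w) (l_smE L a Dw).
Qed.

Let dAa a w z : D (usubmx w) -> dd z (Aa a) w =
  Rq a *m dsubmx z *m E a (usubmx w) + Rq a *m dsubmx w *m dd (usubmx z) (E a) (usubmx w).
Proof.
move=> Dw; have sE := l_smE L a Dw; have s1 := sm_comp (su w) sE.
rewrite /Aa (D_mulmx _ (sm_mulmxl _ (sd w)) s1) (D_mulmxl _ _ (sd w)) (D_comp _ (su w) sE).
by rewrite (D_usubmx _ (sm_id _)) (D_dsubmx _ (sm_id _)) D_id.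
Qed.

Let sA w : D (usubmx w) -> sm A w.
Proof. by move=> Dw; apply: smZ; apply: smD; [apply: smD|]; exact: sAa. Qed.

Let dA w z : D (usubmx w) -> dd z A w = (k / 2) *: (dd z (Aa 0) w + dd z (Aa (0 + 1)) w + dd z (Aa (0 + 2)) w).
Proof.
move=> Dw; have s a := sAa a Dw.
by rewrite DZ ?DD//; [exact: smD|apply: smD => //; exact: smD].
Qed.

Let e a (w : 'cV[R]_(m + 4)) (u : 'cV[R]_m) := (E a (usubmx w) *m u) 0 0.
Let r a (w : 'cV[R]_(m + 4)) := Rq a *m dsubmx w.

Let A_mul w u : A w *m u = (k / 2) *: (e 0 w u *: r 0 w + e (0 + 1) w u *: r (0 + 1) w + e (0 + 2) w u *: r (0 + 2) w).
Proof. by rewrite -scalemxAl !mulmxDl /Aa -!mulmxA !scal11 -!scalemxAr. Qed.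

Let comm_alg (c kk : R) (f r0 r1 r2 : 'cV[R]_4) (u0 u1 u2 v0 v1 v2 d0 d1 d2 d0' d1' d2' : R) : kk = 2 * c ->
  d0 = d0' - kk * (u1 * v2 - u2 * v1) -> d1 = d1' - kk * (u2 * v0 - u0 * v2) -> d2 = d2' - kk * (u0 * v1 - u1 * v0) ->
  c *: ((v0 *: (c *: (u0 *: - f + u1 *: - r2 + u2 *: r1)) + d0 *: r0)
    + (v1 *: (c *: (u0 *: r2 + u1 *: - f + u2 *: - r0)) + d1 *: r1)
    + (v2 *: (c *: (u0 *: - r1 + u1 *: r0 + u2 *: - f)) + d2 *: r2)) =
  c *: ((u0 *: (c *: (v0 *: - f + v1 *: - r2 + v2 *: r1)) + d0' *: r0)
    + (u1 *: (c *: (v0 *: r2 + v1 *: - f + v2 *: - r0)) + d1' *: r1)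
    + (u2 *: (c *: (v0 *: - r1 + v1 *: r0 + v2 *: - f)) + d2' *: r2)).
Proof.
move=> -> -> -> ->; apply/colP => i; rewrite !mxE; ring.
Qed.

Let RR w : [/\ forall a, Rq a *m r a w = - dsubmx w,
  [/\ Rq 0 *m r (0 + 1) w = - r (0 + 2) w, Rq 0 *m r (0 + 2) w = r (0 + 1) w & Rq (0 + 1) *m r 0 w = r (0 + 2) w] &
  [/\ Rq (0 + 1) *m r (0 + 2) w = - r 0 w, Rq (0 + 2) *m r 0 w = - r (0 + 1) w & Rq (0 + 2) *m r (0 + 1) w = r 0 w]].
Proof.
have h1 a : Rq (a + 1) *m r (a + 2) w = - r a w by rewrite /r mulmxA Rq_mul mulNmx.
have h2 a : Rq (a + 2) *m r (a + 1) w = r a w by rewrite /r mulmxA Rq_mulC.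
split.
- by move=> a; rewrite /r mulmxA Rq_sq mulNmx mul1mx.
- split; first by have := h1 (0 + 2); rewrite I3_21 I3_22.
    by have := h2 (0 + 1); rewrite I3_12 I3_11.
  by have := h2 (0 + 2); rewrite I3_22 I3_21.
split; first exact: h1.
  by have := h1 (0 + 1); rewrite I3_11 I3_12.
exact: h2.
Qed.

Let dAu w u v : D (usubmx w) -> let q a := (dd u (E a) (usubmx w) *m v) 0 0 in
  dd (K w *m u) A w *m v = (k / 2) *:
   ((e 0 w v *: ((k / 2) *: (e 0 w u *: - dsubmx w + e (0 + 1) w u *: - r (0 + 2) w + e (0 + 2) w u *: r (0 + 1) w)) + q 0 *: r 0 w)
  + (e (0 + 1) w v *: ((k / 2) *: (e 0 w u *: r (0 + 2) w + e (0 + 1) w u *: - dsubmx w + e (0 + 2) w u *: - r 0 w)) + q (0 + 1) *: r (0 + 1) w)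
  + (e (0 + 2) w v *: ((k / 2) *: (e 0 w u *: - r (0 + 1) w + e (0 + 1) w u *: r 0 w + e (0 + 2) w u *: - dsubmx w)) + q (0 + 2) *: r (0 + 2) w)).
Proof.
move=> Dw q; rewrite dA// -scalemxAl !mulmxDl; congr (_ *: _).
have H a : dd (K w *m u) (Aa a) w *m v = e a w v *: (Rq a *m (A w *m u)) + q a *: r a w.
  rewrite dAa// mulmxDl /K mul_col_mx mul1mx col_mxKu col_mxKd.
  by rewrite -[Rq a *m (A w *m u) *m _ *m v]mulmxA scal11 -[Rq a *m dsubmx w *m _ *m v]mulmxA scal11.
have [R0 [R1 R2 R3] [R4 R5 R6]] := RR w.
rewrite !H A_mul -!scalemxAr !mulmxDr -!scalemxAr !R0 R1 R2 R3 R4 R5 R6.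
by [].
Qed.

Let K_comm w u v : D (usubmx w) -> dd (K w *m u) K w *m v = dd (K w *m v) K w *m u.
Proof.
move=> Dw; have sAw := sA Dw.
have dK z (t : 'cV[R]_m) : dd z K w *m t = col_mx 0 (dd z A w *m t).
  by rewrite /K D_col_mx ?Dcst ?mul_col_mx ?mul0mx//; exact: sm_cst.
rewrite !dK; congr col_mx; rewrite !dAu//.
have q a : (dd u (E a) (usubmx w) *m v) 0 0 = (dd v (E a) (usubmx w) *m u) 0 0
   - k * (e (a + 1) w u * e (a + 2) w v - e (a + 2) w u * e (a + 1) w v).
  have := l_ii_ext L Dw (ii Dw) a u v; rewrite /ext1 [LHS]mxE [X in _ + X]mxE => h.
  by move/eqP: h; rewrite subr_eq mulNr addrC => /eqP.
apply: (comm_alg (kk := k)); first by field.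
- exact: q.
- by have := q (0 + 1); rewrite I3_11 I3_12.
- by have := q (0 + 2); rewrite I3_21 I3_22.
Qed.

Lemma sphere_map y0 : D y0 -> exists (e : R) (F : 'cV[R]_m -> 'cV[R]_4),
  [/\ 0 < e, F y0 = (2 / `|k|) *: delta_mx 0 0 &
  forall x, `|x - y0| < e -> [/\ sm F x, (k ^+ 2 / 4) *: ((F x)^T *m F x) = 1%:M &
    (jac F x)^T *m jac F x = \sum_a (E a x)^T *m E a x]].
Proof.
move=> Dy0; pose F0 : 'cV[R]_4 := (2 / `|k|) *: delta_mx 0 0; pose w0 := col_mx y0 F0.
have [r0 r00 Hr] := open_normP (l_open L) Dy0.
have HD w : `|w - w0| < r0 -> D (usubmx w).
  move=> wr; apply: Hr; apply: le_lt_trans wr.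
  by have := mx_norm_usub (w - w0); rewrite linearB /= col_mxKu.
have sK w : `|w - w0| < r0 -> sm K w.
  by move=> /HD Dw; apply: sm_col_mx (sm_cst _ _) (sA Dw).
pose PS : 'M[R]_(m, m + 4) := row_mx 1%:M 0.
have PK w : `|w - w0| < r0 -> PS *m K w = 1%:M.
  by move=> _; rewrite /PS /K mul_row_col mul1mx mul0mx addr0.
have [d [Phi [d0 sP HP]]] := comm_flow r00 sK PK (fun w u v wr => K_comm u v (HD w wr)).
have w00 : `|w0 - w0| < d by rewrite subrr normr0.
pose F x := dsubmx (Phi (col_mx w0 (x - y0))).
have sB x : sm (fun x : 'cV[R]_m => x - y0) x by apply: smB; [exact: sm_id|exact: sm_cst].
have sC x : sm (fun x : 'cV[R]_m => col_mx w0 (x - y0)) x by apply: sm_col_mx (sm_cst _ _) (sB x).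
have sPh x : sm (fun x => Phi (col_mx w0 (x - y0))) x by apply: sm_comp; [exact: sC|exact: sP].
have sF x : sm F x by apply: sm_dsubmx; exact: sPh.
have kk : k ^+ 2 / 4 * (2 / `|k|) ^+ 2 = 1.
  by rewrite expr_div_n real_normK ?num_real//; field.
exists d, F; split=> //.
  have t0 : `|(0 : 'cV[R]_m)| < d by rewrite normr0.
  have [_ _ /(_ erefl) h _ _] := HP w0 0 w00 t0.
  by rewrite /F subrr h col_mxKd.
move=> x xd; have [yr uP _ dt [_ inv _]] := HP w0 (x - y0) w00 xd.
set w := Phi _ in yr uP dt inv.
have ux : usubmx w = x.
  have pu (z : 'cV[R]_(m + 4)) : PS *m z = usubmx z by rewrite -[z]vsubmxK mul_row_col mul1mx mul0mx addr0 col_mxKu.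
  by move: uP; rewrite !pu col_mxKu addrC subrK.
have Dw := HD w yr.
have nF : (F x)^T *m F x = (2 / `|k|) ^+ 2 *: 1%:M.
  have := inv _ _ (fun w => (dsubmx w)^T *m dsubmx w); rewrite -/w.
  have -> : dsubmx w = F x by [].
  move=> -> => [|w' w'r].
    rewrite col_mxKd /F0 trZ -scalemxAl -scalemxAr scalerA -expr2 trmx_delta mul_delta_mx.
    by congr (_ *: _); apply/matrixP => i j; rewrite !mxE !ord1.
  have s1 := sm_trmx (sd w'); split; first exact: sm_mulmx.
  have Dw' := HD w' w'r.
  rewrite (D_mulmx _ s1 (sd w')) (D_trmx _ (sd w')) (D_dsubmx _ (sm_id _)) D_id.
  rewrite /K mul_col_mx col_mxKd A_mul.
  have S : (dsubmx w')^T *m ((k / 2) *: (e 0 w' (x - y0) *: r 0 w' + e (0 + 1) w' (x - y0) *: r (0 + 1) w' + e (0 + 2) w' (x - y0) *: r (0 + 2) w')) = 0.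
    by rewrite -scalemxAr !mulmxDr -!scalemxAr !Rq_skew !scaler0 !addr0 scaler0.
  by rewrite S -[X in X + _]trmxK trmx_mul trmxK S trmx0 addr0.
split=> //; first by rewrite nF scalerA kk scale1r.
have jF : jac F x = A w.
  apply: jac_uniq => // v; rewrite D_dsubmx// (D_comp _ (sC x) (sP _)) D_col_mx; [|exact: sm_cst|exact: sB].
  rewrite Dcst DB ?D_id ?Dcst ?subr0; [|exact: sm_id|exact: sm_cst].
  by rewrite dt -/w /K mul_col_mx col_mxKd.
rewrite jF (I3_sum _ 0) /A trZ -scalemxAl -scalemxAr scalerA !trD.
have AA a b : (Aa a w)^T *m Aa b w = ((a == b)%:R * (2 / `|k|) ^+ 2) *: ((E a x)^T *m E b x).
  rewrite /Aa ux trmx_mul mulmxA -[_ *m _ *m (Rq b *m _)]mulmxA Rq_dot nF scalerA.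
  by rewrite -scalemxAr mulmx1 -scalemxAl.
rewrite !mulmxDr !mulmxDl !AA !eqxx /= !mul0r !scale0r !addr0 !add0r !mul1r -!scalerDr scalerA.
by rewrite (_ : k / 2 * (k / 2) = k ^+ 2 / 4) ?kk ?scale1r//; field.
Qed.

End sphere_map.

(** * Condition (ii) implies (iv) *)

Lemma even_tripleP (a b c : 'I_3) : even_triple a b c -> b = a + 1 /\ c = a + 2.
Proof.
move=> [s es [ea eb ec]]; have inj : injective s by exact: perm_inj.
have ba : b != a by rewrite ea eb (inj_eq inj).
have ca : c != a by rewrite ea ec (inj_eq inj).
have cb : c != b by rewrite eb ec (inj_eq inj).
have [ab|ab|ab] := I3_cases a b; first by rewrite ab eqxx in ba.
  by have [ac|ac|ac] := I3_cases a c; [rewrite ac eqxx in ca|rewrite ac ab eqxx in cb|].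
have [ac|ac|ac] := I3_cases a c; [by rewrite ac eqxx in ca| |by rewrite ac ab eqxx in cb].
have [t et [ta tb tc]] := even_triple_succ a.
suff E : s = (tperm (1%R : 'I_3) (2%R : 'I_3) * t)%g by move: es; rewrite E odd_permM odd_tperm (negPf et).
apply/permP => i; rewrite permM.
have [->|->|->] := I3_cases 0 i; rewrite ?add0r.
- by rewrite tpermD// -ea.
- by rewrite tpermL -tc -eb.
- by rewrite tpermR -tb -ec.
Qed.

Lemma sm_norm_lt {R : realType} {m p q : nat} (h : 'cV[R]_m -> 'M[R]_(p, q)) x (d : R) :
  sm h x -> `|h x| < d -> \forall y \near x, `|h y| < d.
Proof.
move=> sh hd; have d2 : 0 < (d - `|h x|) / 2 by rewrite divr_gt0// subr_gt0.
have [r r0 Hr] := (cont_normP _ _).1 (sm_cont sh) _ d2.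
apply/nbhs_normP; exists r => // y /Hr yr.
have := ler_distD (h x) (h y) 0; rewrite !subr0 => h1; apply: (le_lt_trans h1).
by move: yr hd; move: (`|h y - h x|) (`|h x|) => u v; lra.
Qed.

Lemma inj_unitmx {F : fieldType} {m : nat} (A : 'M[F]_m) : (forall w : 'cV[F]_m, A *m w = 0 -> w = 0) -> A \in unitmx.
Proof.
move=> H; rewrite -unitmx_tr -row_free_unit -kermx_eq0; apply/rowV0P => v /sub_kermxP vA.
by apply: trmx_inj; rewrite trmx0; apply: H; rewrite -[LHS]trmxK trmx_mul trmxK vA trmx0.
Qed.

Section ball_hk.
Context {R : realType} {n : nat} (r : R) (r0 : 0 < r).
Variables (H : 'cV[R]_n -> 'M[R]_n) (J : 'I_3 -> 'cV[R]_n -> 'M[R]_n).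
Hypotheses (sH : forall t, `|t| < r -> sm H t) (sJ : forall a t, `|t| < r -> sm (J a) t)
  (HT : forall t, `|t| < r -> (H t)^T = H t) (pH : forall t, `|t| < r -> posdef (H t))
  (J2 : forall a t, `|t| < r -> J a t *m J a t = - 1%:M)
  (her : forall a t, `|t| < r -> (J a t)^T *m H t *m J a t = H t)
  (quat : forall a t, `|t| < r -> J (a + 2) t = J a t *m J (a + 1) t /\ J (a + 2) t = - (J (a + 1) t *m J a t))
  (tor0 : forall a t u v, `|t| < r -> tor (J a) t u v = 0)
  (cl : forall a t u v w, `|t| < r -> ext2 (fun z => H z *m J a z) t u v w = 0).

Let K := ball_manifold n r0.
Let b : chart R K n := ball_chart n r0.
Let gK : metric K := fun q => H (b q).
Let JK (a : 'I_3) : endofield K := fun q => J a (b q).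

Let bq (q : K) : `|b q| < r. Proof. exact: to_ball_lt. Qed.

Let nb (t : 'cV[R]_n) : `|t| < r -> \forall z \near t, `|z| < r.
Proof.
move=> tr; apply/nbhs_normP; exists (r - `|t|); rewrite ?subr_gt0// => z zt.
by have := ler_distD t z 0; rewrite !subr0 => h; apply: (le_lt_trans h); rewrite -ltrBrDr.
Qed.

Let lgE q : \forall z \near b q, lg b gK z = H z.
Proof.
apply: filterS (nb (bq q)) => z zr; rewrite /lg ball_Jt invmx1 trmx1 mul1mx mulmx1.
by rewrite /gK /= of_ballK.
Qed.

Let lJE a q : \forall z \near b q, lE b (JK a) z = J a z.
Proof.
apply: filterS (nb (bq q)) => z zr; rewrite /lE ball_Jt invmx1 mul1mx mulmx1.
by rewrite /JK /= of_ballK.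
Qed.

Let sg q : sm (lg b gK) (b q).
Proof. by apply: sm_eq (sH (bq q)); apply: filterS (lgE q) => z ->. Qed.
Let sE a q : sm (lE b (JK a)) (b q).
Proof. by apply: sm_eq (sJ a (bq q)); apply: filterS (lJE a q) => z ->. Qed.

Let ab : atlas b. Proof. by []. Qed.

Let rgK : riemannian gK.
Proof.
split=> [X Y sX sY|q|q v v0].
- apply/(smooth_funRP _ openT) => d q -> _ _.
  have s1 := sv_sm sX ab (I : chart_dom b q); have s2 := sv_sm sY ab (I : chart_dom b q).
  apply: sm_eq (near_inner gK X Y ab (I : chart_dom b q)) _.
  by apply: (sm_mxP _ _).1; apply: sm_mulmx => //; apply: sm_mulmx => //; exact: sm_trmx.
- by rewrite /gK HT.
- exact: pH.
Qed.

Let sJK a : smooth_endofield (JK a).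
Proof.
move=> X sX; apply/smooth_vfieldP => d q -> _.
have s1 := sv_sm sX ab (I : chart_dom b q).
apply: sm_ext (sm_mulmx (sE a q) s1) => y.
by rewrite lv_appE.
Qed.

Lemma ball_hyperKahler : hyperKahler gK JK.
Proof.
split=> //.
- by move=> a q; exact: J2.
- by move=> a q; exact: her.
- by move=> a b' c /even_tripleP[-> ->] q; exact: quat.
- move=> a X Y sX sY q.
  have := nij_chart ab (I : chart_dom b q) (sJK a) sX sY; rewrite ball_Jt mul1mx => ->.
  have := tor0 a (lv b X (b q)) (lv b Y (b q)) (bq q).
  by rewrite /tor -!(D_eq _ (lJE a q)) -(nbhs_singleton (lJE a q)).
- move=> a X Y Z sX sY sZ q; have i0 : chart_dom b q by [].
  have B0 := nbhs_singleton (lgE q); have B1 := nbhs_singleton (lJE a q).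
  rewrite (d2_chart ab i0 rgK (sJK a) _ (sv_sm sX ab i0) (sv_sm sY ab i0) (sv_sm sZ ab i0)); last first.
    rewrite /= B0 B1 trmx_mul HT// -[(J a _)^T *m _]mulmx1 -[1%:M]opprK -(J2 a (bq q)) mulmxN mulmxA.
    by rewrite her.
  have N : \forall z \near b q, lg b gK z *m lE b (JK a) z = (fun z => H z *m J a z) z.
    by apply: filterS2 (lgE q) (lJE a q) => z -> ->.
  have := cl a (lv b X (b q)) (lv b Y (b q)) (lv b Z (b q)) (bq q).
  by rewrite /ext2 -!(D_eq _ N) => ->; rewrite mxE mulr0.
Qed.

End ball_hk.

Section ii_iv.
Context {R : realType} {n : nat} {M : manifold R (n + 3)}.
Local Notation m := (n + 3)%N.
Variables (phi : 'I_3 -> endofield M) (xi : 'I_3 -> vfield M) (eta : 'I_3 -> oneform M) (g : metric M) (k : R).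
Hypotheses (tq : three_quasi_Sasakian phi xi eta g)
  (hk : forall a b d : 'I_3, even_triple a b d -> forall p : M, bracket (xi a) (xi b) p = k *: xi d p)
  (k0 : k != 0).

Let im (y : 'cV[R]_4) : 'cV[R]_3 := @dsubmx R 1 3 1 y.

Let im_re (y z : 'cV[R]_4) : im y = im z -> y 0 0 = z 0 0 -> y = z.
Proof.
move=> h1 h2; rewrite -[y](@vsubmxK R 1 3 1) -[z](@vsubmxK R 1 3 1); congr (@col_mx R 1 3 1).
  by apply: mx11_inj; rewrite !mxE; have -> : lshift 3 (0 : 'I_1) = 0 :> 'I_(1 + 3) by apply: val_inj.
exact: h1.
Qed.

Let sphere_re (y z : 'cV[R]_4) : (k ^+ 2 / 4) * \sum_i y i 0 ^+ 2 = 1 -> (k ^+ 2 / 4) * \sum_i z i 0 ^+ 2 = 1 ->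
  im y = im z -> 0 < y 0 0 -> 0 < z 0 0 -> y = z.
Proof.
move=> sy sz h y0 z0; apply: im_re => //.
have kk : k ^+ 2 / 4 != 0 by rewrite mulf_neq0 ?invr_eq0 ?pnatr_eq0// expf_neq0.
have : \sum_i y i 0 ^+ 2 = \sum_i z i 0 ^+ 2 by apply: (mulfI kk); rewrite sy sz.
rewrite !(big_ord_recl 3).
rewrite (eq_bigr (fun i => im y i 0 ^+ 2)) => [|i _]; last by rewrite mxE; congr (y _ _ ^+ 2); apply: val_inj.
rewrite [in RHS](eq_bigr (fun i => im z i 0 ^+ 2)) => [|i _]; last by rewrite mxE; congr (z _ _ ^+ 2); apply: val_inj.
by rewrite h => /addIr /eqP; rewrite eqrXn2 ?ltW// => /eqP.
Qed.

Lemma tq_ii_iv : tq_ii eta -> locally_hyperKahler_times_sphere g n (k ^+ 2 / 4).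
Proof.
move=> /(tq_iiP tq hk) ii p; have [ac cp] := chart_atP p; set c := chart_at p in ac cp.
have L := tq_loc3 tq hk ac; have Dp := in_img cp.
have iiD y : (c @` chart_dom c) y -> lii (fun a => le c (eta a)) y by move=> [q cq <-]; exact: ii.
have [e1 [r [f [H [J [e10 r0 fp Hf HH]]]]]] := transverse_hk L Dp k0 iiD.
have [e2 [F [e20 Fp HF]]] := sphere_map L k0 iiD Dp.
pose y0 := c p; rewrite -/y0 in fp Hf Fp HF Dp.
have imF0 : im (F y0) = 0.
  by apply/colP => i; rewrite Fp /im !mxE /= mulr0.
have Fp0 : 0 < F y0 0 0 by rewrite Fp !mxE eqxx mulr1 divr_gt0// normr_gt0.
have y0e1 : `|y0 - y0| < e1 by rewrite subrr normr0.
have y0e2 : `|y0 - y0| < e2 by rewrite subrr normr0.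
have sim (h : 'cV[R]_m -> 'cV[R]_4) x : sm h x -> sm (fun x => im (h x)) x.
  by move=> sh; exact: (@sm_dsubmx R _ 1 3 1).
have dim (h : 'cV[R]_m -> 'cV[R]_4) x v : sm h x -> dd v (fun x => im (h x)) x = im (dd v h x).
  by move=> sh; exact: (@D_dsubmx R _ 1 3 1).
pose Gm x := col_mx (f x) (im (F x)).
have sG x : `|x - y0| < e1 -> `|x - y0| < e2 -> sm Gm x.
  by move=> /Hf[_ sf _ _] /HF[sF _ _]; apply: sm_col_mx => //; exact: sim.
have isoG x : `|x - y0| < e1 -> `|x - y0| < e2 -> lg c g x = (jac f x)^T *m H (f x) *m jac f x + (jac F x)^T *m jac F x.
  by move=> /Hf[Dx _ _ hG] /HF[_ _ ->]; rewrite (gH_split (lg c g) (fun a => le c (eta a)) x) hG.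
have kk : k ^+ 2 / 4 != 0 by rewrite mulf_neq0 ?invr_eq0 ?pnatr_eq0// expf_neq0.
have uG : jac Gm y0 \in unitmx.
  have [Dy sf _ _] := Hf _ y0e1; have [sF _ _] := HF _ y0e2.
  apply: inj_unitmx => w; rewrite -D_jac; last exact: sG.
  rewrite D_col_mx//; last exact: sim.
  rewrite dim// => h0; have [h1 h2] := eq_col_mx (etrans h0 (esym (@col_mx0 R n 3 1))).
  have dF0 : dd w F y0 = 0.
    apply: im_re; first by rewrite h2; apply/colP => i; rewrite !mxE.
    have N : \forall z \near y0, (k ^+ 2 / 4) *: ((F z)^T *m F z) = (fun=> 1%:M : 'M[R]_1) z.
      apply: (filterS (P := [set z | `|z - y0| < e2])) => [z /HF[]//|].
      by apply: open_nbhs_nbhs; split; [exact: open_normball|].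
    have sFT := sm_trmx sF; have := D_eq w N; rewrite Dcst DZ; last exact: sm_mulmx.
    rewrite D_mulmx// D_trmx// => /eqP; rewrite scaler_eq0 (negPf kk) /= => /eqP /matrixP/(_ 0 0).
    rewrite [LHS]mxE [RHS]mxE Fp trZ -scalemxAl -scalemxAr [X in X + _]mxE [X in _ + X]mxE trmx_delta -rowE -colE !mxE.
    have c2 : 0 < 2 / `|k| by rewrite divr_gt0// normr_gt0.
    move: (2 / `|k|) c2 (dd w F y0 0 0) => t t0 d; rewrite -mulrDr => /eqP.
    by rewrite mulf_eq0 gt_eqF//= => /eqP; lra.
  apply/eqP; apply: contraT => w0; have := l_pos L Dy w0.
  rewrite isoG// mulmxDr mulmxDl -!mulmxA -!D_jac// h1 dF0 !mulmx0 addr0 mxE ltxx.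
  by [].
have [e3 e30 Re] : exists2 e3 : R, 0 < e3 & forall x, `|x - y0| < e3 -> 0 < F x 0 0.
  have [sF _ _] := HF _ y0e2; have sF0 := (sm_mxP _ _).1 sF 0 0.
  have d2 : 0 < F y0 0 0 / 2 by rewrite divr_gt0.
  have [e3 e30 He] := cont_realP (sm_cont sF0) d2; exists e3 => // x /He.
  by rewrite ler_distl; move: Fp0; move: (F y0 0 0) (F x 0 0) => u v ? /andP[? _]; lra.
have [e4 e40 He4] := open_normP (l_open L) Dp.
pose e := Num.min (Num.min e1 e2) (Num.min e3 e4).
have e0 : 0 < e by rewrite !lt_min e10 e20 e30.
have He x : `|x - y0| < e -> [/\ `|x - y0| < e1, `|x - y0| < e2, 0 < F x 0 0 & (c @` chart_dom c) x].
  by rewrite !lt_min => /andP[/andP[-> ->] /andP[/Re -> /He4]].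
have [r' [rho [/andP[r'0 r'e] rho0 inj surj]]] := local_inverse e0 (sG _ y0e1 y0e2) uG.
have Gp : Gm y0 = 0 by rewrite /Gm fp imF0 col_mx0.
pose rK := Num.min rho r.
have rK0 : 0 < rK by rewrite lt_min rho0.
have HK t (tr : `|t| < rK) : `|t| < r by move: tr; rewrite lt_min => /andP[].
pose K := ball_manifold n rK0; pose b : chart R K n := ball_chart n rK0.
pose gK : metric K := fun q => H (b q); pose JK (a : 'I_3) : endofield K := fun q => J a (b q).
have hkK : hyperKahler gK JK.
  apply: ball_hyperKahler.
  - by move=> t /HK/HH[[]].
  - by move=> a t /HK/HH[[_ sJ]]; move=> *; exact: sJ.
  - by move=> t /HK/HH[[]].
  - by move=> t /HK/HH[[]].
  - by move=> a t /HK/HH[_ [h _ _]]; move=> *; exact: h.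
  - by move=> a t /HK/HH[_ [_ h _]]; move=> *; exact: h.
  - by move=> a t /HK/HH[_ [_ _ h]]; move=> *; exact: h.
  - by move=> a t u v /HK/HH[_ _ h]; move=> *; exact: h.
  - by move=> a t u v w /HK/HH[_ _ _ h]; exact: h.
pose V x := [/\ `|x - y0| < r', `|f x| < rK & `|im (F x)| < rho].
pose U : set M := [set q | chart_dom c q /\ V (c q)].
have Ve x : V x -> `|x - y0| < e by move=> [h _ _]; exact: lt_trans h r'e.
have nV x : V x -> \forall z \near x, V z.
  move=> Vx; have [x1 x2 _ _] := He x (Ve x Vx); have [_ sf _ _] := Hf x x1; have [sF _ _] := HF x x2.
  have [v1 v2 v3] := Vx.
  have n1 : \forall z \near x, `|z - y0| < r' by apply: open_nbhs_nbhs; split=> //; exact: open_normball.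
  by apply: filterS3 n1 (sm_norm_lt sf v2) (sm_norm_lt (sim _ _ sF) v3) => z.
have oU : open U.
  rewrite openE => q [cq Vq]; apply: filterI; first exact: chart_dom_nbhs.
  exact: chart_fun_continuous cq _ (nV _ Vq).
pose F1 (q : M) : K := chart_inv b (f (c q)); pose F2 (q : M) := F (c q).
have bF1 q : U q -> b (F1 q) = f (c q).
  by move=> [_ [_ fr _]]; rewrite /F1 /= of_ballK.
have near_f q : U q -> \forall y \near c q, (b \o F1) (chart_inv c y) = f y.
  move=> Uq; have [cq _] := Uq; apply: filterS (near_chart cq (open_nbhs_nbhs (conj oU Uq))) => y [cy ey Uy].
  by apply: (etrans (bF1 _ Uy)); rewrite ey.
have near_F q : U q -> \forall y \near c q, F2 (chart_inv c y) = F y.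
  move=> Uq; have [cq _] := Uq; apply: filterS (near_dom cq) => y [_ ey].
  by rewrite /F2 ey.
have sfU q : U q -> sm f (c q) by move=> [_ Vq]; have [x1 _ _ _] := He _ (Ve _ Vq); have [] := Hf _ x1.
have sFU q : U q -> sm F (c q) by move=> [_ Vq]; have [_ x2 _ _] := He _ (Ve _ Vq); have [] := HF _ x2.
have sF1 : smooth_map U F1.
  have cF1 q : U q -> {for q, continuous F1}.
    move=> Uq; have [cq [_ fr _]] := Uq.
    have c2 : {for q, continuous (fun q => f (c q))}.
      by apply: (continuous_comp (chart_fun_continuous cq)); exact: sm_cont (sfU q Uq).
    by apply: (continuous_comp c2); exact: of_ball_continuous.
  split=> [q Uq|d ->]; first exact: cF1.
  rewrite (_ : U `&` F1 @^-1` chart_dom b = U); last by apply/seteqP; split=> q; [case|].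
  apply/(smooth_funP _ oU) => c' q ac' cq' Uq; have [cq _] := Uq.
  apply: (smf_change ac ac' cq cq').
  by apply: sm_eq (sfU q Uq); apply: filterS (near_f q Uq) => y <-.
have sF2 : smooth_fun U F2.
  apply/(smooth_funP _ oU) => c' q ac' cq' Uq; have [cq _] := Uq.
  apply: (smf_change ac ac' cq cq').
  by apply: sm_eq (sFU q Uq); apply: filterS (near_F q Uq) => y <-.
pose O : set 'cV[R]_4 := [set y : 'cV[R]_4 | 0 < y 0 0 /\ `|im y| < rho].
have sph x : V x -> (k ^+ 2 / 4) * \sum_i F x i 0 ^+ 2 = 1.
  move=> Vx; have [_ x2 _ _] := He x (Ve x Vx); have [_ + _] := HF x x2.
  move=> /matrixP/(_ 0 0); rewrite !mxE eqxx mulr1n => h; rewrite -[RHS]h; congr (_ * _).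
  by apply: eq_bigr => i _; rewrite mxE expr2.
exists U, K, gK, JK, setT, O, F1, F2; split=> //.
- split=> //; split=> //; split; rewrite ?subrr ?normr0// ?fp ?imF0 ?normr0//.
- split; first exact: openT.
  rewrite openE => y [y1 y2]; apply: filterI.
    have s0 := (sm_mxP _ _).1 (@sm_id R _ _ y) 0 0.
    have d2 : 0 < y 0 0 / 2 by rewrite divr_gt0.
    have [d d0 Hd] := cont_realP (sm_cont s0) d2; apply/nbhs_normP; exists d => // z /Hd.
    by rewrite /= ler_distl; move: y1; move: (y 0 0) (z 0 0) => u v ? /andP[? _]; lra.
  by apply: (sm_norm_lt (h := fun y => im y)) y2; apply: (@sm_dsubmx R _ 1 3 1); exact: sm_id.
- split=> //; split.
  + move=> q Uq; have [cq Vq] := Uq; split=> //; split; first exact: sph.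
    by have [_ _ Rq _] := He _ (Ve _ Vq); have [_ _ h] := Vq.
  + move=> q q' /set_mem[cq Vq] /set_mem[cq' Vq'] [h1 h2].
    have : Gm (c q) = Gm (c q').
      rewrite /Gm -(bF1 q) ?h1; last by split.
      by rewrite (bF1 q'); [rewrite -/(F2 q) h2|split].
    have [a1 _ _] := Vq; have [a2 _ _] := Vq'.
    by move=> /(inj _ _ a1 a2) /(congr1 (chart_inv c)); rewrite !chart_funK.
  + move=> [q y] [_ [sy [y1 y2]]] /=.
    have bq : `|b q| < rho by have := to_ball_lt rK0 (q : 'cV[R]_n); rewrite lt_min => /andP[].
    have [|x xr Gx] := surj (col_mx (b q) (im y)).
      rewrite Gp subr0; apply: (@le_lt_trans _ _ (Num.max `|b q| `|im y|)); last by rewrite gt_max bq.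
      by apply: mx_norm_col; rewrite le_max lexx ?orbT.
    have [fx Fx] := eq_col_mx Gx.
    have Vx : V x by split=> //; rewrite ?fx ?Fx//; exact: to_ball_lt.
    have [_ _ Rx [q' cq' eq']] := He x (Ve x Vx).
    exists q'; first by split=> //; rewrite eq'.
    congr pair; first by rewrite /F1 eq' fx /= to_ballK.
    by rewrite /F2 eq'; apply: sphere_re => //; exact: sph.
move=> q Uq u v; have [cq Vq] := Uq; have [x1 x2 _ _] := He _ (Ve _ Vq).
have T w : tangent_map F1 q w = jac f (c q) *m (Jt c q *m w).
  rewrite -D_jac; last exact: sfU.
  have := tangent_map_chart oU sF1 w Uq ac cq (d := b) erefl I; rewrite ball_Jt mul1mx => ->.
  by apply: D_eq; exact: near_f.
have T2 w : dfun F2 q w = jac F (c q) *m (Jt c q *m w).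
  have s2 : sm (F2 \o chart_inv c) (c q) by apply: sm_eq (sFU q Uq); apply: filterS (near_F q Uq) => y <-.
  rewrite (dfun_chart w ac cq s2) -D_jac; last exact: sFU.
  by apply: D_eq; exact: near_F.
have gE : g q = (Jt c q)^T *m lg c g (c q) *m Jt c q.
  have uJ := Jt_unit ac cq; rewrite lg_at// !mulmxA -trmx_mul mulVmx// trmx1 mul1mx mulmxKV//.
rewrite !T !T2 gE isoG// /gK bF1// mulmxDr mulmxDl mulmxDr mulmxDl [LHS]mxE.
by rewrite !trmx_mul !mulmxA.
Qed.

End ii_iv.

Theorem proposition5p3 (R : realType) (n l : nat) (hl : (l <= n)%N)
  (M : manifold R (4 * n + 3)%N)
  (phi : 'I_3 -> endofield M) (xi : 'I_3 -> vfield M)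
  (eta : 'I_3 -> oneform M) (g : metric M) (c : R)
  (hM : three_quasi_Sasakian_of_rank phi xi eta g (4 * l + 3)%N)
  (hc : forall a b d : 'I_3, even_triple a b d ->
          forall p : M, bracket (xi a) (xi b) p = c *: xi d p) :
  let i   := forall a : 'I_3, projectable phi xi eta a in
  let ii  := forall (a : 'I_3) (X Y : vfield M),
               horizontal_field eta X -> horizontal_field eta Y ->
               forall p : M, d1 (eta a) X Y p = 0 in
  let iii := integrable_distribution (4 * n)%N (horizontal_space eta) in
  let iv  := locally_hyperKahler_times_sphere g (4 * n)%N (c ^+ 2 / 4) in
  let v   := three_quasi_Sasakian_of_rank phi xi eta g 3 in
  [/\ i <-> ii, ii <-> iii, iii <-> iv & iv <-> v] /\
  ([\/ i, ii, iii | iv \/ v] ->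
     (forall X Y : vfield M, smooth_vfield X -> smooth_vfield Y -> forall p : M,
        ricci g X Y p =
        c ^+ 2 / 2 * (app1 (eta 0) X p * app1 (eta 0) Y p
                      + app1 (eta 1) X p * app1 (eta 1) Y p
                      + app1 (eta 2) X p * app1 (eta 2) Y p)) /\
     eta_Einstein eta g).
Proof.
move: hM => [tq rk] i ii iii iv v.
have i_ii : i <-> ii by exact: (tq_i_ii tq hc).
have ii_iii : ii -> iii by exact: (tq_ii_iii tq hc).
have iii_ii : iii -> ii by exact: (tq_iii_ii tq hc).
have ii_iv : ii -> iv by move=> h p; exact: (tq_ii_iv tq hc (tq_k_neq0 tq hc p rk h) h p).
have iv_ii : iv -> ii by exact: (tq_iv_ii tq hc erefl).
have ii_v : ii -> v by move=> h; split=> //; exact: (tq_ii_v tq hc rk h).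
have v_ii : v -> ii by move=> [_ rk3]; exact: (tq_v_ii tq hc rk3).
split; first by split; [|split|split|split]; auto.
move=> H; have hiv : iv.
  by apply: ii_iv; case: H => [/i_ii|//|/iii_ii|[/iv_ii|/v_ii]].
split=> [X Y sX sY p|]; last exact: (tq_iv_einstein tq hc erefl hiv).
by rewrite (tq_iv_ricci tq hc erefl hiv)// (I3_sum _ 0) !add0r.
Qed.
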